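(* Let $\mathcal{N}$ be a connected three-cell network with $k$ asymmetric inputs, and consider its annotated synchrony lattice, which is one of the seven types (a)–(g) described in the context. For a network eigenvalue $\mu$ with $\mathcal{V}_\mu(\mathcal{N})\ne\emptyset$ and generic $f\in\mathcal{V}_\mu(\mathcal{N})$, let $S(\mu)$ be the set of synchrony subspaces $\Delta$ for which $f^{\mathcal{N}}$ has a bifurcation branch with synchrony $\Delta$. Then, according to the lattice type: (a) $S(\upsilon)=\{\Delta_0,\mathbb{R}^3\}$ and $S(\mu)=\{\Delta_1\}$. (b) If Assumptions (A) hold (for $\Delta=\mathbb{R}^3$ and $\mu$), then $S(\upsilon)=\{\Delta_0\}$ and $S(\mu)=\{\Delta_1,\Delta_2,\Delta_3\}$. (c) If Condition (B) holds (for $\Delta=\mathbb{R}^3$ and $\mu$), then $S(\upsilon)=\{\Delta_0\}$ and $S(\mu)=\{\Delta_1,\mathbb{R}^3\}$. (d) $S(\upsilon)=\{\Delta_0\}$ and $S(\mu)=\{\mathbb{R}^3\}$. (e) $S(\upsilon)=\{\Delta_0\}$, $S(\mu_1)=\{\Delta_1\}$ and $S(\mu_2)=\{\Delta_2\}$. (f) $S(\upsilon)=\{\Delta_0\}$, $S(\mu_1)=\{\Delta_1\}$ and $S(\mu_2)=\{\mathbb{R}^3\}$. (g) $S(\upsilon)=\{\Delta_0\}$; when $\mu_1=\overline{\mu_2}$ and $\mu_2$ are nonreal, this is the only steady-state bifurcation condition; when $\mu_1,\mu_2$ are real and distinct, $S(\mu_1)=\{\mathbb{R}^3\}$ and $S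(\mu_2)=\{\mathbb{R}^3\}$.
   Context: **Networks and systems.** A three-cell network $\mathcal{N}$ with $k$ asymmetric inputs has cells $1,2,3$ and edges of $k$ types, each cell receiving exactly one edge of each type; its adjacency matrices $A_1,\dots,A_k$ have $(A_l)_{ij}=1$ if the type-$l$ edge ending at $i$ starts at $j$, and $0$ otherwise. Connected means there is an undirected path between any two cells. A smooth $f:\mathbb{R}\times\mathbb{R}^k\times\mathbb{R}\to\mathbb{R}$ defines $f^{\mathcal{N}}_i(x,\lambda)=f(x_i,x_{i_1},\dots,x_{i_k},\lambda)$, $i_j$ being the source of the type-$j$ edge ending at $i$. With $f_j$ the derivative of $f$ at the origin with respect to its $(j+1)$-th variable, the Jacobian at the origin is $J_f^{\mathcal{N}}=f_0\mathrm{Id}_3+\sum_{j=1}^kf_jA_j$. Network eigenvalues are the continuous functions of $(f_0,\dots,f_k)$ giving the distinct eigenvalues of $J_f^{\mathcal{N}}$ for generic $f$; $\upsilon=\sum_{j=0}^kf_j$ is the valency eigenvalue. **Synchrony.** A synchrony subspace is a polydiagonal (defined by equalities $x_i=x_j$) invariant under all $A_l$; $f^{\mathcal{N}}$ restricted to it is the system defined by $f$ on a quotient network. $\Delta_0=\{x_1=x_2=x_3\}$. The annotated synchrony lattice is the lattice of synchrony subspaces, each labelled by the network eigenvalues of its quotient (with multiplicity; a defective eigenvalue with algebraic multiplicity 2 and geometric multiplicity 1 is written once as $\mu^*$). The bottom is $\Delta_0$ (label $\upsilon$), the top is $\mathbb{R}^3$. The seven types (different symbols denote different eigenvalues; $\Delta_1,\Delta_2,\Delta_3$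 are two-dimensional): (a) one 2D subspace $\Delta_1$ labelled $\upsilon,\mu$; top $\upsilon,\upsilon,\mu$. (b) three 2D subspaces $\Delta_1,\Delta_2,\Delta_3$, each labelled $\upsilon,\mu$; top $\upsilon,\mu,\mu$, $\mu$ semisimple. (c) one 2D subspace $\Delta_1$ labelled $\upsilon,\mu$; top $\upsilon,\mu^*$. (d) no 2D subspace; top $\upsilon,\mu^*$. (e) two 2D subspaces $\Delta_1$ labelled $\upsilon,\mu_1$ and $\Delta_2$ labelled $\upsilon,\mu_2$; top $\upsilon,\mu_1,\mu_2$. (f) one 2D subspace $\Delta_1$ labelled $\upsilon,\mu_1$; top $\upsilon,\mu_1,\mu_2$. (g) no 2D subspace; top $\upsilon,\mu_1,\mu_2$. **Bifurcation problems.** $\mathcal{V}_\mu(\mathcal{N})$ is the set of $f$ with $\mu(f_0,\dots,f_k)=0$, $(f_0,\dots,f_k)\in\mathrm{int}(\mu^{-1}(\mathbb{R}))$ and $f(0,\lambda)=0$ for all $\lambda$. Generic $f$: $f$ satisfies a suitable finite number of non-trivial inequalities ($\neq$) on its derivatives at the origin (not involving $f_0$), not contradicting the bifurcation condition. A bifurcation branch of $f^{\mathcal{N}}$ is a function $b:R\to\mathbb{R}^3$, $b\not\equiv0$, with $f^{\mathcal{N}}(b(\lambda),\lambda)=0$, $R\subseteq\mathbb{R}$ a (nondegenerate) connected region containing $0$; bifurcation is local at the origin ($b$ continuous, $b(0)=0$, $R$ may be shrunk). It has synchrony $\Delta$ if $\Delta$ is the smallest synchrony subspace containing $b(R)$.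 **Assumptions (A)** (for $\mu$ semisimple of multiplicity $m$ on $\Delta$). Put $F=f^{\mathcal{N}}|_{\Delta\times\mathbb{R}}$, $J=D_xF(0,0)$; choose $v_1,\dots,v_m$ spanning $\ker J$, $v_1^*,\dots,v_m^*$ spanning $(\mathrm{range}\,J)^\perp$ with $\langle v_i^*,v_j\rangle=\delta_{ij}$; let $W(x,\lambda)$, with values in a complement of $\ker J$, solve $PF(\sum_jx_jv_j+W(x,\lambda),\lambda)=0$ near the origin, $P$ the orthogonal projection onto $\mathrm{range}\,J$; let $g_i(x,\lambda)=\langle v_i^*,F(\sum_jx_jv_j+W(x,\lambda),\lambda)\rangle$ (Lyapunov–Schmidt reduction) and $h=(h_1,\dots,h_m)$ the second-order Taylor expansion of $g$ at the origin. Assume: (1) $D_{(y,\lambda)}h(\tilde y,1)$ has rank $m$ for each $\tilde y\ne0$ with $h(\tilde y\lambda,\lambda)=0$; (2) the homogeneous quadratic polynomials $h_1,\dots,h_m$ in $(x,\lambda)$ do not share a common factor. **Condition (B)** (for $\mu$ with geometric multiplicity 1 and algebraic multiplicity 2 on $\Delta=\mathbb{R}^3$, with $\Delta_1$ the two-dimensional synchrony subspace). Write $J=J_f^{\mathcal{N}}$; take $v_1,v_2\in\ker(J^2)$ and $v_1^*,v_2^*\in(\mathrm{range}(J^2))^\perp$ with $v_1,v_1^*\in\Delta_1$, $Jv_2=v_1$, $\langle v_1^*,v_1\rangle=\langle v_2^*,v_2\rangle=1$, $\langle v_1^*,v_2^*\rangle=0$; let $P$ be the projection onto $\mathrm{range}(J^2)$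 with kernel $(\mathrm{range}(J^2))^\perp$ and $A_0=\mathrm{Id}$. The condition is: there are $p,q\in\{0,\dots,k\}$ with $\langle v_2^*,[A_p(v_2-(PJ)^{-1}Pv_1)]*[A_q(v_2-(PJ)^{-1}Pv_1)]\rangle\ne0$, where $*$ is the componentwise product and $(PJ)^{-1}$ is the inverse of $PJ$ on $\mathrm{range}(J^2)$. *)

(* Defs.v *)
From Stdlib Require List.
From HB Require Import structures.
From mathcomp Require Import all_boot all_order all_algebra complex.
(* The notations of mpoly clash with those of analysis. *)
From mathcomp Require Import -(notations) mpoly.
From mathcomp Require Import all_classical all_reals all_analysis.

Set Implicit Arguments.
Unset Strict Implicit.
Unset Printing Implicit Defensive.

Import Order.TTheory GRing.Theory Num.Theory.
Import numFieldNormedType.Exports.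

Local Open Scope classical_set_scope.
Local Open Scope ring_scope.
Local Open Scope complex_scope.

(* N l i is the cell at which the type-l edge ending at i starts. *)
Definition network (k n : nat) := 'I_k -> 'I_n -> 'I_n.

Definition connected_network k n (N : network k n) : Prop :=
  forall i j,
    connect (fun a b => [exists l, (N l a == b) || (N l b == a)]) i j.

(* Slot 0 of a cell is the cell itself and slot l + 1 its type-l input, so that
   the slots 0, ..., k are the first k + 1 arguments of f. *)
Definition slot k n (N : network k n) (p : 'I_k.+1) (i : 'I_n) : 'I_n :=
  if unlift ord0 p is Some l then N l i else i.

Section Calculus.
Variable R : realType.

Definition dot n (u v : 'cV[R]_n) : R := (u^T *m v) 0 0.

Definition pderiv d (W : normedModType R) (w : seq 'I_d) (g : 'rV[R]_d -> W)
    : 'rV[R]_d -> W :=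
  foldr (fun j (h : 'rV[R]_d -> W) => 'D_('e_j) h) g w.

Definition smooth_on d (W : normedModType R) (U : set 'rV[R]_d)
    (g : 'rV[R]_d -> W) : Prop :=
  forall (w : seq 'I_d) (z : 'rV[R]_d), U z -> differentiable (pderiv w g) z.

Definition evalp d (p : mpoly d R) (z : 'rV[R]_d) : R :=
  meval (fun a => z 0 a) p.

(* Outside the zero set of a nonzero polynomial. *)
Definition generic_point d (P : 'rV[R]_d -> Prop) : Prop :=
  exists2 p : mpoly d R, p != 0 & forall c, evalp p c != 0 -> P c.

Definition taylor2 d (g : 'rV[R]_d -> R) : mpoly d R :=
  mpolyC d (g 0)
  + \sum_(a < d) pderiv [:: a] g 0 *: mpolyX R (mnm1 a)
  + \sum_(a < d) \sum_(b < d)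
      (pderiv [:: a; b] g 0 / 2) *: (mpolyX R (mnm1 a) * mpolyX R (mnm1 b)).

Definition no_common_factor d m (h : 'I_m -> mpoly d R) : Prop :=
  forall q : mpoly d R, (forall i, exists r, h i = q * r) ->
    exists c, q = mpolyC d c.

Definition in_orthogonal n (U : {vspace 'cV[R]_n}) (y : 'cV[R]_n) : Prop :=
  forall x, x \in U -> dot y x = 0.

Definition orthogonal_projection n (P : 'M[R]_n) (U : {vspace 'cV[R]_n}) :
    Prop :=
  forall y : 'cV[R]_n, P *m y \in U /\ in_orthogonal U (y - P *m y).

Definition mxker n (A : 'M[R]_n) : {vspace 'cV[R]_n} :=
  lker (linfun (mulmx A : 'cV[R]_n -> 'cV[R]_n)).

Definition mxrange n (A : 'M[R]_n) : {vspace 'cV[R]_n} :=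
  limg (linfun (mulmx A : 'cV[R]_n -> 'cV[R]_n)).

End Calculus.

Section Network.
Variables (R : realType) (k n : nat).
Implicit Types (N : network k n) (D : {vspace 'cV[R]_n}).

Definition adjacency N (p : 'I_k.+1) : 'M[R]_n :=
  \matrix_(i, j) (slot N p i == j)%:R.

Definition jacobian N (c : 'rV[R]_k.+1) : 'M[R]_n :=
  \sum_(p < k.+1) c 0 p *: adjacency N p.

(* The k + 1 state arguments of f, followed by the parameter. *)
Definition response := 'rV[R]_(k.+1 + 1) -> R.

Definition admissible N (f : response) (x : 'cV[R]_n) (lambda : R) :
    'cV[R]_n :=
  \col_i f (row_mx (\row_p x (slot N p i) 0) lambda%:M).

Definition first_derivatives (f : response) : 'rV[R]_k.+1 :=
  \row_p pderiv [:: lshift 1 p] f 0.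

Definition polydiagonal D : Prop :=
  exists e : rel 'I_n, forall x,
    x \in D <-> forall i j, e i j -> x i 0 = x j 0.

Definition synchrony N D : Prop :=
  polydiagonal D /\
  forall (l : 'I_k) x, x \in D -> adjacency N (lift ord0 l) *m x \in D.

Definition quotient_network N D m (M : network k m) : Prop :=
  exists c : 'I_n -> 'I_m,
    [/\ forall a, exists i, c i = a,
        forall x, x \in D <-> forall i j, c i = c j -> x i 0 = x j 0
      & forall l i, M l (c i) = c (N l i)].

Definition eigenfunction := 'rV[R]_k.+1 -> R[i].

Definition valency : eigenfunction := fun c => (\sum_(p < k.+1) c 0 p)%:C.

Definition continuous_eigenfunction (mu : eigenfunction) : Prop :=
  continuous (fun c => complex.Re (mu c)) /\
  continuous (fun c => complex.Im (mu c)).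

Definition different (mus : seq eigenfunction) : Prop :=
  generic_point (fun c => uniq [seq mu c | mu <- mus]).

(* The Boolean marks a starred eigenvalue mu^*, which stands for two roots of
   the characteristic polynomial; an unstarred eigenvalue is repeated according
   to its multiplicity. *)
Definition annotation := seq (eigenfunction * bool).

Definition eigenvalue_annotation N (s : annotation) : Prop :=
  (forall e, List.In e s -> continuous_eigenfunction e.1) /\
  generic_point (fun c =>
    let J := map_mx (real_complex R) (jacobian N c) in
    char_poly J
      = \prod_(e <- s) ('X - (e.1 c)%:P) ^+ (if e.2 then 2 else 1) /\
    forall e, List.In e s ->
      mup (e.1 c) (char_poly J) = (\rank (eigenspace J^T (e.1 c)) + e.2)%N).

End Network.

Section Bifurcation.
Variables (R : realType) (k n : nat).
Implicit Types (N : network k n) (D : {vspace 'cV[R]_n}).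

Local Notation eigenfunction := (eigenfunction R k).
Local Notation annotation := (annotation R k).
Local Notation response := (response R k).
Local Notation valency := (@valency R k).

Definition annotated_synchrony_lattice N
    (L : seq ({vspace 'cV[R]_n} * annotation)) : Prop :=
  [/\ uniq (unzip1 L),
      forall D, synchrony N D <-> D \in unzip1 L
    & forall Ds, List.In Ds L ->
        exists (m : nat) (M : network k m),
          quotient_network N Ds.1 M /\ eigenvalue_annotation M Ds.2].

Definition bifurcation_problem (mu : eigenfunction) : set response :=
  [set f | [/\ smooth_on setT f,
               mu (first_derivatives f) = 0,
               [set c | complex.Im (mu c) = 0]° (first_derivatives f)
             & forall lambda : R, f (row_mx 0 lambda%:M) = 0]].

(* Finitely many inequalities p <> 0, with p polynomial in partial derivatives
   of f at the origin other than f_0; they are non-trivial on V, i.e. jointly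
   satisfiable there. *)
Definition generically (V : set response) (P : response -> Prop) : Prop :=
  exists (d : nat) (w : 'I_d -> seq 'I_(k.+1 + 1)) (ps : seq (mpoly d R)),
    let ineqs f :=
      forall p, p \in ps -> evalp p (\row_a pderiv (w a) f 0) != 0 in
    [/\ forall a, w a != [:: lshift 1 ord0],
        exists2 f, V f & ineqs f
      & forall f, V f -> ineqs f -> P f].

Definition region (I : set R) : Prop :=
  [/\ connected I, I 0 & exists2 lambda, I lambda & lambda != 0].

Definition bifurcation_branch N (f : response) (I : set R)
    (b : R -> 'cV[R]_n) : Prop :=
  [/\ region I, {within I, continuous b}, b 0 = 0,
      forall lambda, I lambda -> admissible N f (b lambda) lambda = 0
    & exists2 lambda, I lambda & b lambda != 0].

Definition smallest_synchrony N (S : set 'cV[R]_n) D : Prop :=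
  [/\ synchrony N D, forall x, S x -> x \in D
    & forall E, synchrony N E -> (forall x, S x -> x \in E) -> (D <= E)%VS].

(* Branches are local at the origin: shrinking the region, possibly to one side
   of 0, must leave a branch with the same synchrony.  Otherwise two half
   branches with different synchronies on the two sides of 0 could be glued
   into one continuous function with a larger synchrony. *)
Definition branch_with_synchrony N (f : response) D : Prop :=
  exists (I : set R) (b : R -> 'cV[R]_n),
    region I /\
    forall I', I' `<=` I -> region I' ->
      bifurcation_branch N f I' b /\ smallest_synchrony N (b @` I') D.

(* For generic f in the bifurcation problem of mu that satisfy C, the synchrony
   subspaces of the bifurcation branches are exactly those listed in Ds. *)
Definition generic_synchronies_if N (C : response -> Prop)
    (mu : eigenfunction) (Ds : seq {vspace 'cV[R]_n}) : Prop :=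
  bifurcation_problem mu !=set0 ->
  generically (bifurcation_problem mu)
    (fun f => C f -> forall D, branch_with_synchrony N f D <-> D \in Ds).

Definition generic_synchronies N := generic_synchronies_if N (fun=> True).

(* When mu1 and mu2 take conjugate nonreal values at f, a singular Jacobian or
   a bifurcation branch forces f into the bifurcation problem of the valency. *)
Definition only_valency_bifurcates N (mu1 mu2 : eigenfunction) : Prop :=
  forall f : response,
    smooth_on setT f ->
    (forall lambda : R, f (row_mx 0 lambda%:M) = 0) ->
    let c := first_derivatives f in
    mu1 c = conjc (mu2 c) -> complex.Im (mu2 c) != 0 ->
    \det (jacobian N c) = 0 \/ (exists D, branch_with_synchrony N f D) ->
    bifurcation_problem valency f.

(* Lyapunov-Schmidt reduction on the whole space: v and vs are the v_i and
   v_i^*, U is the complement of ker J in which W takes its values, and the last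
   coordinate of z is the parameter lambda. *)
Definition assumptions_A N (m : nat) (f : response) : Prop :=
  let J := jacobian N (first_derivatives f) in
  exists (v vs : m.-tuple 'cV[R]_n) (P : 'M[R]_n) (U : {vspace 'cV[R]_n})
         (W : 'rV[R]_(m + 1) -> 'cV[R]_n),
    let F (z : 'rV[R]_(m + 1)) := admissible N f
      (\sum_(j < m) z 0 (lshift 1 j) *: tnth v j + W z) (z 0 (rshift m 0)) in
    let h i := taylor2 (fun z => dot (tnth vs i) (F z)) in
    [/\ basis_of (mxker J) v,
        (forall y, y \in <<vs>>%VS <-> in_orthogonal (mxrange J) y) /\
        (forall i j, dot (tnth vs i) (tnth v j) = (i == j)%:R),
        orthogonal_projection P (mxrange J),
        [/\ (mxker J + U)%VS = fullv, (mxker J :&: U)%VS = 0%VS, W 0 = 0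
          & exists2 O : set 'rV[R]_(m + 1), open_nbhs (0 : 'rV[R]_(m + 1)) O &
              smooth_on O W /\
              forall z, O z -> W z \in U /\ P *m F z = 0]
      & (forall y : 'rV[R]_m, y != 0 ->
           (forall (lambda : R) i,
              evalp (h i) (row_mx (lambda *: y) lambda%:M) = 0) ->
           \rank (\matrix_(i < m, a < m + 1)
                    evalp (mderiv a (h i)) (row_mx y 1%:M)) = m) /\
        no_common_factor h].

(* w1 and w2 are v_1^* and v_2^*, and Q is the inverse of P J on the range of
   J^2. *)
Definition condition_B N (D1 : {vspace 'cV[R]_n}) (f : response) : Prop :=
  let J := jacobian N (first_derivatives f) in
  let J2 := J *m J in
  exists (v1 v2 w1 w2 : 'cV[R]_n) (P Q : 'M[R]_n),
    let u : 'cV[R]_n := v2 - Q *m (P *m v1) in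
    [/\ [/\ v1 \in mxker J2, v2 \in mxker J2, in_orthogonal (mxrange J2) w1
          & in_orthogonal (mxrange J2) w2],
        [/\ v1 \in D1, w1 \in D1 & J *m v2 = v1],
        [/\ dot w1 v1 = 1, dot w2 v2 = 1 & dot w1 w2 = 0],
        orthogonal_projection P (mxrange J2) /\
        (forall x, x \in mxrange J2 ->
           [/\ Q *m x \in mxrange J2, P *m (J *m (Q *m x)) = x
             & Q *m (P *m (J *m x)) = x])
      & exists p q : 'I_k.+1,
          dot w2 (map2_mx *%R (adjacency R N p *m u)
                                (adjacency R N q *m u)) != 0].

End Bifurcation.

Section LatticeTypes.
Variables (R : realType) (k : nat).
Implicit Types (N : network k 3) (D : {vspace 'cV[R]_3}).
Implicit Types mu : eigenfunction R k.

Definition diagonal_space : {vspace 'cV[R]_3} := <[const_mx 1]>%VS.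
Definition full_space : {vspace 'cV[R]_3} := fullv.

Definition plain mu : eigenfunction R k * bool := (mu, false).
Definition star mu : eigenfunction R k * bool := (mu, true).

Local Notation valency := (@valency R k).
Local Notation ups := (plain valency).

Definition type_a N D1 mu : Prop :=
  different [:: valency; mu] /\
  annotated_synchrony_lattice N
    [:: (diagonal_space, [:: ups]);
        (D1, [:: ups; plain mu]);
        (full_space, [:: ups; ups; plain mu])].

Definition type_b N D1 D2 D3 mu : Prop :=
  different [:: valency; mu] /\
  annotated_synchrony_lattice N
    [:: (diagonal_space, [:: ups]);
        (D1, [:: ups; plain mu]);
        (D2, [:: ups; plain mu]);
        (D3, [:: ups; plain mu]);
        (full_space, [:: ups; plain mu; plain mu])].

Definition type_c N D1 mu : Prop :=
  different [:: valency; mu] /\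
  annotated_synchrony_lattice N
    [:: (diagonal_space, [:: ups]);
        (D1, [:: ups; plain mu]);
        (full_space, [:: ups; star mu])].

Definition type_d N mu : Prop :=
  different [:: valency; mu] /\
  annotated_synchrony_lattice N
    [:: (diagonal_space, [:: ups]);
        (full_space, [:: ups; star mu])].

Definition type_e N D1 D2 mu1 mu2 : Prop :=
  different [:: valency; mu1; mu2] /\
  annotated_synchrony_lattice N
    [:: (diagonal_space, [:: ups]);
        (D1, [:: ups; plain mu1]);
        (D2, [:: ups; plain mu2]);
        (full_space, [:: ups; plain mu1; plain mu2])].

Definition type_f N D1 mu1 mu2 : Prop :=
  different [:: valency; mu1; mu2] /\
  annotated_synchrony_lattice N
    [:: (diagonal_space, [:: ups]);
        (D1, [:: ups; plain mu1]);
        (full_space, [:: ups; plain mu1; plain mu2])].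

Definition type_g N mu1 mu2 : Prop :=
  different [:: valency; mu1; mu2] /\
  annotated_synchrony_lattice N
    [:: (diagonal_space, [:: ups]);
        (full_space, [:: ups; plain mu1; plain mu2])].

End LatticeTypes.

(* Main.v *)
(* Let t and d be the trace and the determinant of the map that the Jacobian
   induces modulo the diagonal.  The eigenvalues other than the valency are the
   roots of X^2 - t X + d.  A synchronous pair of cells makes them linear in
   (f_0, ..., f_k), so that the number of synchronous pairs (3, 2, 1 or 0) leads
   to the types (b), (e), (a) or (c) or (f), and (g).  Without synchronous pairs
   t^2 - 4 d does not vanish identically, hence type (d) does not occur.

   Strict differentiability confines the zeros near the origin to the synchrony
   spaces on which a critical eigenvalue lives.  Branches are found by blowing
   up: after a rescaling of the state by powers of s, with lambda = +- s^m, the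
   equations have a nondegenerate zero at s = 0, which a contraction uniform in s
   continues.  At a simple eigenvalue the branch is transcritical when the
   quadratic coefficient of the reduced equation is nonzero and a pitchfork when
   it vanishes but the cubic coefficient does not; (a) and (c) have rescalings of
   their own.  In (b) the network equations say that f(u + x_i v) = 0 for each
   cell i, with the same u and v, and Rolle's theorem forces two cells to agree.

   The required inequalities are polynomial in the derivatives of order at most
   three.  The bifurcation condition eliminates f_0: it is linear in f_0, or
   quadratic, and then one takes the product over both roots.  Cubic polynomials
   f show that the resulting inequalities are not contradictory. *)
Require Import Defs.
From HB Require Import structures.
From mathcomp Require Import all_boot all_order all_algebra complex.
From mathcomp Require Import -(notations) mpoly.
From mathcomp Require Import all_classical all_reals all_analysis.
From mathcomp Require Import ring lra.

Import Defs.

Set Implicit Arguments.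
Unset Strict Implicit.
Unset Printing Implicit Defensive.

Import Order.TTheory GRing.Theory Num.Theory.
Import numFieldNormedType.Exports.

Local Open Scope classical_set_scope.
Local Open Scope ring_scope.

(** * Taylor remainders *)

Arguments pderiv : simpl never.

Section Calculus.
Variable R : realType.
Implicit Types (d : nat).

(** The rescaled equations contain quotients by powers of s and make sense only for s > 0. Instead
    of an implicit function theorem at s = 0, the contraction uses strict differentiability in the
    state at one point, uniformly in small s. This notion passes to sums and products, a factor s
    kills both value and derivative, and Taylor remainders enter only through Lipschitz bounds; so a
    rescaling has to be checked at leading order only. The inequalities must not mention f_0,
    whereas the natural nondegeneracy coefficients do. All coefficients are therefore written
    without division, with adjugates in place of inverses, so that they are polynomials in the jet.
    When f_0 solves a quadratic equation, one witness has to be nondegenerate at both roots, since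
    both share the inequalities in the other derivatives. Existence and exclusion are separate
    matters. Branches are built in a quotient that carries the critical eigenvalue and are lifted.
    Exclusion compares the equations of two cells, whose difference is controlled by the difference
    of their inputs and not merely by the size of the state. *)

Lemma mx_norm_coord m n (A : 'M[R]_(m, n)) i j : `|A i j| <= `|A|.
Proof.
rewrite [leRHS]/Num.norm /= mx_normrE.
exact: (@le_bigmax _ _ _ 0 (fun ij : (ordinal m * ordinal n)%type => `|A ij.1 ij.2|) (i, j)).
Qed.

Lemma mx_norm_le m n (A : 'M[R]_(m, n)) (C : R) :
  0 <= C -> (forall i j, `|A i j| <= C) -> `|A| <= C.
Proof.
move=> C0 H; rewrite [leLHS]/Num.norm /= mx_normrE.
by apply/bigmax_leP; split => // -[i j] _; exact: H.
Qed.

Lemma derive_coord d (g : 'rV[R]_d -> R) (z v : 'rV[R]_d) :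
  differentiable g z -> 'D_v g z = \sum_a v 0 a * 'D_('e_a) g z.
Proof.
move=> dg; rewrite deriveE// {1}(row_sum_delta v) linear_sum.
by apply: eq_bigr => a _; rewrite linearZ/= deriveE.
Qed.

Lemma is_derive_line d (g : 'rV[R]_d -> R) (z v : 'rV[R]_d) (t : R) :
  differentiable g (z + t *: v) ->
  is_derive t 1 (fun t => g (z + t *: v)) ('D_v g (z + t *: v)).
Proof.
move=> dg.
have h : is_diff t (fun t : R => z + t *: v) (fun t => t *: v).
  by apply: is_diff_eq; rewrite add0r.
case: (is_diff_comp h (differentiableP dg)) => dH vH.
apply: DeriveDef; first exact/derivable1_diffP.
by rewrite deriveE// vH /= scale1r deriveE.
Qed.

(** The segment between the two points stays in the ball by convexity, so the one-dimensional mean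
    value theorem along it meets the derivative bound. *)
Lemma mean_value d (g : 'rV[R]_d -> R) (z0 z z' : 'rV[R]_d) (rho B : R) :
  (forall u, differentiable g u) ->
  (forall u v, `|u - z0| <= rho -> `|'D_v g u| <= B * `|v|) ->
  `|z - z0| <= rho -> `|z' - z0| <= rho ->
  `|g z - g z'| <= B * `|z - z'|.
Proof.
move=> dg hB hz hz'.
pose h t := g (z' + t *: (z - z')).
have dh (t : R) : is_derive t 1 h ('D_(z - z') g (z' + t *: (z - z'))).
  exact: is_derive_line.
have [|c c01] := @MVT _ h _ 0 1 ltr01 (fun x _ => dh x).
  apply: continuous_subspaceT => x.
  by apply: differentiable_continuous; apply/derivable1_diffP; case: (dh x).
rewrite /h scale1r scale0r addr0 (addrC z') subrK => ->.
rewrite subr0 mulr1; apply: hB.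
have -> : z' + c *: (z - z') - z0 = (1 - c) *: (z' - z0) + c *: (z - z0).
  by apply/rowP => i; rewrite !mxE; ring.
apply: le_trans (ler_normD _ _) _; rewrite !normrZ.
move: c01; rewrite in_itv /= => /andP[c0 c1].
have c10 : 0 <= 1 - c by rewrite subr_ge0 ltW.
rewrite (ger0_norm c10) (gtr0_norm c0).
have := ler_wpM2l (ltW c0) hz.
have := ler_wpM2l c10 hz'; lra.
Qed.

Lemma smooth_differentiable d (g : 'rV[R]_d -> R) w z :
  smooth_on setT g -> differentiable (pderiv w g) z.
Proof. by move=> sg; exact: sg. Qed.

Lemma smooth_pderiv d (g : 'rV[R]_d -> R) w :
  smooth_on setT g -> smooth_on setT (pderiv w g).
Proof.
by move=> sg w' z _; have := sg (w' ++ w) z I; rewrite /pderiv foldr_cat.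
Qed.

Lemma smooth_cvg d (g : 'rV[R]_d -> R) w (z0 : 'rV[R]_d) (e : R) :
  smooth_on setT g -> 0 < e ->
  exists2 rho : R, 0 < rho &
    forall u, `|u - z0| <= rho -> `|pderiv w g u - pderiv w g z0| <= e.
Proof.
move=> sg e0.
have /differentiable_continuous cg := smooth_differentiable w z0 sg.
have /cvgrPdist_le /(_ e e0) := cg.
rewrite -nbhs_nearE => /nbhs_closedballP[rho hrho].
exists rho%:num => // u hu; rewrite distrC.
apply: hrho; rewrite closed_ballE //= /closed_ball_ /=.
by rewrite distrC.
Qed.

Lemma is_derive_coord d (z v : 'rV[R]_d) (b : 'I_d) :
  is_derive z v (fun z : 'rV[R]_d => z 0 b) (v 0 b).
Proof.
apply: DeriveDef; first exact/diff_derivable/differentiable_coord.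
apply: lim_near_cst => //.
near=> h; rewrite /= !mxE addrK scalerA mulVf ?scale1r//.
by near: h; exact: nbhs_dnbhs_neq.
Unshelve. all: by end_near. Qed.

Definition jet1 d (g : 'rV[R]_d -> R) (z : 'rV[R]_d) : R :=
  \sum_a z 0 a * pderiv [:: a] g 0.
Definition jet2 d (g : 'rV[R]_d -> R) (z z' : 'rV[R]_d) : R :=
  \sum_a \sum_b z 0 a * z' 0 b * pderiv [:: a; b] g 0.
Definition jet3 d (g : 'rV[R]_d -> R) (z z' z'' : 'rV[R]_d) : R :=
  \sum_a \sum_b \sum_c z 0 a * z' 0 b * z'' 0 c * pderiv [:: a; b; c] g 0.

Lemma is_derive_fsum d n (h : 'I_n -> 'rV[R]_d -> R) (z v : 'rV[R]_d)
    (dh : 'I_n -> R) :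
  (forall i, is_derive z v (h i) (dh i)) ->
  is_derive z v (fun z => \sum_i h i z) (\sum_i dh i).
Proof.
move=> H; have -> : (fun z => \sum_i h i z) = \sum_i h i.
  by apply/funext => u; rewrite fct_sumE.
exact: is_derive_sum.
Qed.

Lemma is_derive_fmul d (f g : 'rV[R]_d -> R) (z v : 'rV[R]_d) (df dg : R) :
  is_derive z v f df -> is_derive z v g dg ->
  is_derive z v (fun z => f z * g z) (f z * dg + g z * df).
Proof. exact: is_deriveM. Qed.

Lemma is_derive_jet1 d (g : 'rV[R]_d -> R) (z v : 'rV[R]_d) :
  is_derive z v (jet1 g) (jet1 g v).
Proof.
apply: is_derive_fsum => a.
have := is_derive_fmul (is_derive_coord z v a) (is_derive_cst (pderiv [:: a] g 0) z v).
by rewrite /= mulr0 add0r mulrC.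
Qed.

Lemma is_derive_jet2 d (g : 'rV[R]_d -> R) (z v : 'rV[R]_d) :
  is_derive z v (fun z => jet2 g z z) (jet2 g v z + jet2 g z v).
Proof.
rewrite /jet2 -big_split; apply: is_derive_fsum => a.
rewrite -big_split; apply: is_derive_fsum => b.
have h := is_derive_fmul (is_derive_coord z v a) (is_derive_coord z v b).
have := is_derive_fmul h (is_derive_cst (pderiv [:: a; b] g 0) z v).
by rewrite /=; congr is_derive; ring.
Qed.

Lemma is_derive_jet3 d (g : 'rV[R]_d -> R) (z v : 'rV[R]_d) :
  is_derive z v (fun z => jet3 g z z z)
    (jet3 g v z z + jet3 g z v z + jet3 g z z v).
Proof.
rewrite /jet3 -!big_split; apply: is_derive_fsum => a.
rewrite -!big_split; apply: is_derive_fsum => b.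
rewrite -!big_split; apply: is_derive_fsum => c.
have h := is_derive_fmul (is_derive_coord z v a) (is_derive_coord z v b).
have h' := is_derive_fmul h (is_derive_coord z v c).
have := is_derive_fmul h' (is_derive_cst (pderiv [:: a; b; c] g 0) z v).
by rewrite /=; congr is_derive; ring.
Qed.

Lemma differentiable_fsum d n (h : 'I_n -> 'rV[R]_d -> R) (z : 'rV[R]_d) :
  (forall i, differentiable (h i) z) -> differentiable (fun z => \sum_i h i z) z.
Proof.
move=> H; have -> : (fun z => \sum_i h i z) = \sum_i h i.
  by apply/funext => u; rewrite fct_sumE.
exact: differentiable_sum.
Qed.

Lemma differentiable_fmul d (f g : 'rV[R]_d -> R) (z : 'rV[R]_d) :
  differentiable f z -> differentiable g z -> differentiable (fun z => f z * g z) z.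
Proof. exact: differentiableM. Qed.

Lemma differentiable_jets d (g : 'rV[R]_d -> R) (z : 'rV[R]_d) :
  [/\ differentiable (jet1 g) z, differentiable (fun z => jet2 g z z) z
    & differentiable (fun z => jet3 g z z z) z].
Proof.
split; repeat (apply: differentiable_fsum => ?);
  repeat (apply: differentiable_fmul); try exact: differentiable_coord;
  exact: differentiable_cst.
Qed.

Lemma sum_norm_le d (v : 'rV[R]_d) (F : 'I_d -> R) (B : R) :
  (forall a, `|F a| <= B) -> `|\sum_a v 0 a * F a| <= d%:R * B * `|v|.
Proof.
move=> H; apply: le_trans (ler_norm_sum _ _ _) _.
have -> : d%:R * B * `|v| = \sum_(a < d) `|v| * B.
  by rewrite sumr_const card_ord -mulr_natl; ring.
by apply: ler_sum => a _; rewrite normrM ler_pM//; exact: mx_norm_coord.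
Qed.

Lemma common_radius n (P : 'I_n -> R -> Prop) :
  (forall i r r', 0 < r' <= r -> P i r -> P i r') ->
  (forall i, exists2 r, 0 < r & P i r) -> exists2 r, 0 < r & forall i, P i r.
Proof.
move=> hP /(_ _)/cid2-/all_sig2[r r0 Pr].
exists (\big[Order.min/1]_i r i).
  by apply: lt_bigmin => // i _; exact: r0.
move=> i; apply: hP (Pr i); apply/andP; split; last exact: bigmin_le.
by apply: lt_bigmin => // j _; exact: r0.
Qed.

(** Subtracting the linearization at [z0] leaves a function whose gradient is small near [z0] by
    continuity of the partial derivatives. The mean value bound then controls increments between any
    two nearby points; the contraction and the comparison of two cells both need this two-point
    form. *)
Lemma strict_diff d (g : 'rV[R]_d -> R) (z0 : 'rV[R]_d) (e : R) :
  smooth_on setT g -> 0 < e ->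
  exists2 rho : R, 0 < rho &
    forall z z', `|z - z0| <= rho -> `|z' - z0| <= rho ->
      `|g z - g z' - \sum_a (z - z') 0 a * pderiv [:: a] g z0|
        <= e * `|z - z'|.
Proof.
move=> sg e0.
have dg z : differentiable g z := smooth_differentiable [::] z sg.
(* The [d] partial errors must add up to at most [e]; the successor avoids a division by 0 when [d]
   is 0. *)
have e1 : 0 < e / d.+1%:R by rewrite divr_gt0// ltr0Sn.
have [rho rho0 H] := @common_radius d (fun a rho => forall u, `|u - z0| <= rho ->
    `|pderiv [:: a] g u - pderiv [:: a] g z0| <= e / d.+1%:R)
  (fun a r r' rr' H u hu => H u (le_trans hu (proj2 (andP rr'))))
  (fun a => smooth_cvg [:: a] z0 sg e1).
exists rho => // z z' hz hz'.
pose c a := pderiv [:: a] g z0.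
pose h u := g u - \sum_a u 0 a * c a.
have dl u v : is_derive u v (fun u : 'rV[R]_d => \sum_a u 0 a * c a) (\sum_a v 0 a * c a).
  apply: is_derive_fsum => a.
  have := is_derive_fmul (is_derive_coord u v a) (is_derive_cst (c a) u v).
  by rewrite /= mulr0 add0r mulrC.
have -> : g z - g z' - \sum_a (z - z') 0 a * c a = h z - h z'.
  suff -> : \sum_a (z - z') 0 a * c a = \sum_a z 0 a * c a - \sum_a z' 0 a * c a.
    by rewrite /h; ring.
  by rewrite -sumrB; apply: eq_bigr => a _; rewrite !mxE mulrBl.
have dh u : differentiable h u.
  apply: differentiableB; first exact: dg.
  apply: differentiable_fsum => a; apply: differentiable_fmul.
    exact: differentiable_coord.
  exact: differentiable_cst.
apply: (mean_value dh _ hz hz') => u v hu.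
have dgu : is_derive u v g (\sum_a v 0 a * pderiv [:: a] g u).
  by apply: DeriveDef; [exact: diff_derivable|rewrite derive_coord].
have -> : 'D_v h u = \sum_a v 0 a * (pderiv [:: a] g u - c a).
  have hh := is_deriveB dgu (dl u v).
  rewrite (_ : h = g - (fun u : 'rV[R]_d => \sum_a u 0 a * c a))// derive_val.
  by rewrite -sumrB; apply: eq_bigr => a _; rewrite mulrBr.
apply: le_trans (sum_norm_le _ (fun a => H a u hu)) _.
apply: ler_wpM2r => //; rewrite mulrCA ler_piMr ?(ltW e0)//.
by rewrite ler_pdivrMr ?ltr0Sn// mul1r ler_nat.
Qed.

(** The second difference [D] is symmetric in the two directions. By the mean value theorem in one
    direction and strict differentiability of the first partial derivative in the other, it equals
    s^2 times the mixed derivative up to o(s^2), for either order of differentiation. *)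
Lemma schwarz d (g : 'rV[R]_d -> R) (a b : 'I_d) :
  smooth_on setT g -> pderiv [:: a; b] g = pderiv [:: b; a] g.
Proof.
move=> sg.
pose ev (s : R) (c : 'I_d) : 'rV[R]_d := s *: 'e_c.
pose D z s a b := g (z + ev s a + ev s b) - g (z + ev s a) - g (z + ev s b) + g z.
have nev s c : `|ev s c| <= `|s|.
  apply: mx_norm_le => // i j; rewrite !mxE normrM ler_piMr//.
  by case: (_ && _); rewrite /= ?normr1 ?normr0.
have key z p q (e : R) : 0 < e -> exists2 r, 0 < r & forall s, 0 < s <= r ->
    `|D z s p q - s ^+ 2 * pderiv [:: q; p] g z| <= e * s ^+ 2.
  move=> e0.
  have [r r0 H] := strict_diff z (smooth_pderiv [:: p] sg) e0.
  exists (r / 2) => [|s /andP[s0 sr]]; first by rewrite divr_gt0.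
  pose h (t : R) := g (z + ev s q + t *: 'e_p) - g (z + t *: 'e_p).
  pose dh (t : R) := pderiv [:: p] g (z + ev s q + t *: 'e_p) -
                     pderiv [:: p] g (z + t *: 'e_p).
  have dgz u : differentiable g u := smooth_differentiable [::] u sg.
  have Dh (t : R) : is_derive t 1 h (dh t).
    by apply: is_deriveB; apply: is_derive_line.
  have [|c /[!in_itv]/= /andP[c0 cs]] := @MVT _ h _ 0 s s0 (fun x _ => Dh x).
    apply: continuous_subspaceT => x.
    by apply: differentiable_continuous; apply/derivable1_diffP; case: (Dh x).
  rewrite subr0 /h !scale0r !addr0 => hs.
  have -> : D z s p q = dh c * s.
    rewrite -hs /D /ev (addrAC z (s *: 'e_p)); ring.
  have nc : `|z + c *: 'e_p - z| <= r.
    rewrite addrC addKr (le_trans (nev c p))// gtr0_norm//; lra.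
  have nc2 : `|z + ev s q + c *: 'e_p - z| <= r.
    rewrite addrC addrA addKr (le_trans (ler_normD _ _))//.
    rewrite (le_trans (lerD (nev s q) (nev c p)))// !gtr0_norm//; lra.
  have := H _ _ nc2 nc.
  have -> : z + ev s q + c *: 'e_p - (z + c *: 'e_p) = ev s q.
    by apply/rowP => i; rewrite !mxE; ring.
  rewrite (bigD1 q)//= big1 ?addr0 => [|j jq]; last first.
    by rewrite !mxE (negbTE jq) andbF mulr0 mul0r.
  rewrite !mxE !eqxx mulr1 => hh.
  have -> : dh c * s - s ^+ 2 * pderiv [:: q; p] g z =
            (dh c - s * pderiv [:: q; p] g z) * s by ring.
  rewrite normrM (gtr0_norm s0) expr2 mulrA ler_wpM2r ?(ltW s0)//.
  by apply: le_trans hh _; rewrite ler_wpM2l ?(ltW e0)// (le_trans (nev _ _))// gtr0_norm.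
apply/funext => z; apply/eqP; rewrite -subr_eq0 -normr_le0.
apply/ler_addgt0Pr => e e0; rewrite add0r.
have e2 : 0 < e / 2 by rewrite divr_gt0.
have [r1 r10 H1] := key z b a _ e2.
have [r2 r20 H2] := key z a b _ e2.
pose s := Order.min r1 r2.
have s0 : 0 < s by rewrite lt_min r10.
have := H1 s; rewrite s0 ge_min lexx => /(_ isT) h1.
have := H2 s; rewrite s0 ge_min lexx orbT => /(_ isT) h2.
have Dsym : D z s b a = D z s a b by rewrite /D (addrAC z (ev s b)); ring.
have s20 : 0 < s ^+ 2 by rewrite exprn_gt0.
rewrite -(ler_pM2r s20) -[X in _ * X](ger0_norm (ltW s20)) -normrM.
have aux (p q x y : R) : (p - q) * y = (x - y * q) - (x - y * p) by ring.
rewrite Dsym in h1; rewrite (aux _ _ (D z s a b)).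
apply: le_trans (ler_normB _ _) _.
by apply: le_trans (lerD h2 h1) _; rewrite -mulrDl -splitr.
Qed.

Definition rem0 d (g : 'rV[R]_d -> R) z := g z - g 0.
Definition rem1 d (g : 'rV[R]_d -> R) z := rem0 g z - jet1 g z.
Definition rem2 d (g : 'rV[R]_d -> R) z := rem1 g z - 2^-1 * jet2 g z z.
Definition rem3 d (g : 'rV[R]_d -> R) z := rem2 g z - 6^-1 * jet3 g z z z.

Lemma derive_smooth d (g : 'rV[R]_d -> R) (u v : 'rV[R]_d) :
  smooth_on setT g ->
  is_derive u v g (\sum_a v 0 a * pderiv [:: a] g u).
Proof.
move=> sg; have dg := smooth_differentiable [::] u sg.
by apply: DeriveDef; [exact: diff_derivable|rewrite derive_coord].
Qed.

Lemma derive_rem0 d (g : 'rV[R]_d -> R) (u v : 'rV[R]_d) :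
  smooth_on setT g ->
  is_derive u v (rem0 g) (\sum_a v 0 a * pderiv [:: a] g u).
Proof.
move=> sg; rewrite -[X in is_derive _ _ _ X]subr0.
by apply: is_deriveB; exact: derive_smooth.
Qed.

Lemma derive_rem1 d (g : 'rV[R]_d -> R) (u v : 'rV[R]_d) :
  smooth_on setT g ->
  is_derive u v (rem1 g) (\sum_a v 0 a * rem0 (pderiv [:: a] g) u).
Proof.
move=> sg; have := is_deriveB (derive_rem0 u v sg) (is_derive_jet1 g u v).
by congr is_derive; rewrite /jet1 -sumrB; apply: eq_bigr => a _; rewrite mulrBr.
Qed.

Lemma jet2C d (g : 'rV[R]_d -> R) (u v : 'rV[R]_d) :
  smooth_on setT g -> jet2 g u v = jet2 g v u.
Proof.
move=> sg; rewrite /jet2 exchange_big/=; apply: eq_bigr => a _.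
by apply: eq_bigr => b _; rewrite (schwarz b a sg) [u 0 b * _]mulrC.
Qed.

Lemma jet2_pderiv d (g : 'rV[R]_d -> R) (u v : 'rV[R]_d) :
  smooth_on setT g ->
  jet2 g v u = \sum_a v 0 a * jet1 (pderiv [:: a] g) u.
Proof.
move=> sg; rewrite /jet2; apply: eq_bigr => a _; rewrite /jet1 mulr_sumr.
by apply: eq_bigr => b _; rewrite mulrA (schwarz a b sg).
Qed.

Lemma derive_rem2 d (g : 'rV[R]_d -> R) (u v : 'rV[R]_d) :
  smooth_on setT g ->
  is_derive u v (rem2 g) (\sum_a v 0 a * rem1 (pderiv [:: a] g) u).
Proof.
move=> sg; have := is_deriveB (derive_rem1 u v sg)
  (is_deriveZ 2^-1 (is_derive_jet2 g u v)).
congr is_derive; rewrite (jet2C u v sg) (jet2_pderiv _ _ sg).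
have -> (x : R) : 2^-1 *: (x + x) = x by rewrite /GRing.scale/=; field.
rewrite -sumrB.
by apply: eq_bigr => a _; rewrite -mulrBr.
Qed.

Lemma pderiv3 d (g : 'rV[R]_d -> R) (a b c : 'I_d) : smooth_on setT g ->
  pderiv [:: a; b; c] g = pderiv [:: b; a; c] g /\
  pderiv [:: a; b; c] g = pderiv [:: a; c; b] g.
Proof.
move=> sg; split; first exact: (schwarz a b (smooth_pderiv [:: c] sg)).
rewrite -[LHS]/(pderiv [:: a] (pderiv [:: b; c] g)).
by rewrite -[RHS]/(pderiv [:: a] (pderiv [:: c; b] g)) (schwarz b c sg).
Qed.

Lemma jet3C12 d (g : 'rV[R]_d -> R) (u v w : 'rV[R]_d) :
  smooth_on setT g -> jet3 g u v w = jet3 g v u w.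
Proof.
move=> sg; rewrite /jet3 exchange_big/=; apply: eq_bigr => a _.
apply: eq_bigr => b _; apply: eq_bigr => c _.
by rewrite (pderiv3 b a c sg).1 [u 0 b * _]mulrC.
Qed.

Lemma jet3C23 d (g : 'rV[R]_d -> R) (u v w : 'rV[R]_d) :
  smooth_on setT g -> jet3 g u v w = jet3 g u w v.
Proof.
move=> sg; rewrite /jet3; apply: eq_bigr => a _.
rewrite exchange_big/=; apply: eq_bigr => b _; apply: eq_bigr => c _.
by rewrite (pderiv3 a c b sg).2; congr (_ * _); rewrite mulrAC.
Qed.

Lemma jet3_pderiv d (g : 'rV[R]_d -> R) (u v w : 'rV[R]_d) :
  smooth_on setT g ->
  jet3 g v u w = \sum_a v 0 a * jet2 (pderiv [:: a] g) u w.
Proof.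
move=> sg; rewrite /jet3; apply: eq_bigr => a _; rewrite /jet2 mulr_sumr.
apply: eq_bigr => b _; rewrite mulr_sumr; apply: eq_bigr => c _.
by rewrite !mulrA (pderiv3 a b c sg).1 (pderiv3 b a c sg).2.
Qed.

Lemma derive_rem3 d (g : 'rV[R]_d -> R) (u v : 'rV[R]_d) :
  smooth_on setT g ->
  is_derive u v (rem3 g) (\sum_a v 0 a * rem2 (pderiv [:: a] g) u).
Proof.
move=> sg; have := is_deriveB (derive_rem2 u v sg)
  (is_deriveZ 6^-1 (is_derive_jet3 g u v)).
congr is_derive.
rewrite (jet3C23 u u v sg) (jet3C12 u v u sg) (jet3_pderiv _ _ _ sg).
have -> (x : R) : 6^-1 *: (x + x + x) = 2^-1 * x.
  by rewrite /GRing.scale/=; field.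
rewrite mulr_sumr -sumrB.
by apply: eq_bigr => a _; rewrite mulrCA -mulrBr.
Qed.

Definition small_order d (m : nat) (r : 'rV[R]_d -> R) : Prop :=
  exists (C rho : R), [/\ 0 <= C, 0 < rho &
    forall u, `|u| <= rho -> `|r u| <= C * `|u| ^+ m].

(* The derivative of the Taylor remainder of order m + 1 involves the Taylor
   remainders of order m of the partial derivatives. *)
Lemma small_order_deriv d m (r : 'rV[R]_d -> R) (r' : 'I_d -> 'rV[R]_d -> R) :
  (forall u v, is_derive u v r (\sum_a v 0 a * r' a u)) ->
  (forall u, differentiable r u) ->
  (forall a, small_order m (r' a)) -> r 0 = 0 ->
  small_order m.+1 r /\
  exists (C rho : R), [/\ 0 <= C, 0 < rho &
    forall M z z', `|z| <= M -> `|z'| <= M -> M <= rho ->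
      `|r z - r z'| <= C * M ^+ m * `|z - z'|].
Proof.
move=> dr ddr sr r0.
have [C [rho [C0 rho0 H]]] : exists (C rho : R), [/\ 0 <= C, 0 < rho &
    forall a u, `|u| <= rho -> `|r' a u| <= C * `|u| ^+ m].
  have /all_sig[C HC] : forall a, {C : R | exists2 rho, 0 < rho &
       0 <= C /\ forall u, `|u| <= rho -> `|r' a u| <= C * `|u| ^+ m}.
    by move=> a; apply: cid; case: (sr a) => C [rho [C0 rho0 H]]; exists C, rho.
  have [|rho rho0 H] := @common_radius d (fun a rho => 0 <= C a /\
      forall u, `|u| <= rho -> `|r' a u| <= C a * `|u| ^+ m) _ HC.
    move=> a p q /andP[_ qp] [Ca0 H]; split => // u hu.
    exact: H (le_trans hu qp).
  have C0 : 0 <= \sum_a C a by apply: sumr_ge0 => a _; case: (H a).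
  exists (\sum_a C a), rho; split=> // a u hu.
  case: (H a) => _ /(_ u hu)/le_trans; apply; rewrite ler_wpM2r ?exprn_ge0//.
  by rewrite (bigD1 a)//= lerDl sumr_ge0// => b _; case: (H b).
have key M z z' : `|z| <= M -> `|z'| <= M -> M <= rho ->
      `|r z - r z'| <= (d%:R * C) * M ^+ m * `|z - z'|.
  move=> hz hz' hM; have M0 : 0 <= M := le_trans (normr_ge0 z) hz.
  apply: (@mean_value _ r 0 _ _ M) => //; rewrite ?subr0// => u v.
  rewrite subr0 => hu; have /@derive_val -> := dr u v.
  rewrite -(mulrA d%:R); apply: sum_norm_le => a.
  have := H a u (le_trans hu hM) => /le_trans; apply.
  by rewrite ler_wpM2l// lerXn2r// nnegrE.
split; exists (d%:R * C), rho; split => //; try by rewrite mulr_ge0.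
move=> u hu; have := key `|u| u 0 (lexx _).
by rewrite normr0 normr_ge0 r0 !subr0 exprSr mulrA; apply.
Qed.

Lemma differentiable_rems d (g : 'rV[R]_d -> R) (u : 'rV[R]_d) :
  smooth_on setT g ->
  [/\ differentiable (rem0 g) u, differentiable (rem1 g) u,
      differentiable (rem2 g) u & differentiable (rem3 g) u].
Proof.
move=> sg; have [d1 d2 d3] := differentiable_jets g u.
have h0 : differentiable (rem0 g) u.
  apply: differentiableB; first exact: (smooth_differentiable [::]).
  exact: differentiable_cst.
have h1 : differentiable (rem1 g) u by exact: differentiableB.
have h2 : differentiable (rem2 g) u.
  by apply: differentiableB => //; exact: differentiableZ.
by split=> //; apply: differentiableB => //; exact: differentiableZ.
Qed.

Lemma jets0 d (g : 'rV[R]_d -> R) :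
  [/\ jet1 g 0 = 0, forall v, jet2 g 0 v = 0 & forall v w, jet3 g 0 v w = 0].
Proof.
split; first by rewrite /jet1 big1// => a _; rewrite mxE mul0r.
  move=> v; rewrite /jet2 big1// => a _; rewrite big1// => b _.
  by rewrite mxE !mul0r.
move=> v w; rewrite /jet3 big1// => a _; rewrite big1// => b _; rewrite big1// => c _.
by rewrite mxE !mul0r.
Qed.

Lemma small_order_bounded d (g : 'rV[R]_d -> R) w :
  smooth_on setT g -> small_order 0 (pderiv w g).
Proof.
move=> sg; have [rho rho0 H] := smooth_cvg w 0 sg ltr01.
exists (`|pderiv w g 0| + 1), rho; split=> // u hu; rewrite expr0 mulr1 -[pderiv w g u](subrK (pderiv w g 0)) addrC.
by apply: le_trans (ler_normD _ _) _; rewrite lerD2l H// subr0.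
Qed.

Lemma taylor_remainders d (g : 'rV[R]_d -> R) : smooth_on setT g ->
  [/\ small_order 1 (rem0 g), small_order 2 (rem1 g), small_order 3 (rem2 g)
    & small_order 4 (rem3 g)].
Proof.
have h0 f : smooth_on setT f -> small_order 1 (@rem0 d f).
  move=> sf; apply: (@small_order_deriv d 0 _ (fun a => pderiv [:: a] f) _ _ _ _).1.
  - by move=> u v; exact: derive_rem0.
  - by move=> u; case: (differentiable_rems u sf).
  - by move=> a; exact: small_order_bounded.
  - by rewrite /rem0 subrr.
have h1 f : smooth_on setT f -> small_order 2 (@rem1 d f).
  move=> sf; apply: (@small_order_deriv d 1 _ (fun a => rem0 (pderiv [:: a] f)) _ _ _ _).1.
  - by move=> u v; exact: derive_rem1.
  - by move=> u; case: (differentiable_rems u sf).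
  - by move=> a; apply: h0; exact: smooth_pderiv.
  - by case: (jets0 f) => e _ _; rewrite /rem1 e /rem0 !subrr.
have h2 f : smooth_on setT f -> small_order 3 (@rem2 d f).
  move=> sf; apply: (@small_order_deriv d 2 _ (fun a => rem1 (pderiv [:: a] f)) _ _ _ _).1.
  - by move=> u v; exact: derive_rem2.
  - by move=> u; case: (differentiable_rems u sf).
  - by move=> a; apply: h1; exact: smooth_pderiv.
  - by case: (jets0 f) => e e2 _; rewrite /rem2 e2 /rem1 e /rem0 mulr0 !subrr.
move=> sg; split; [exact: h0|exact: h1|exact: h2|].
apply: (@small_order_deriv d 3 _ (fun a => rem2 (pderiv [:: a] g)) _ _ _ _).1.
- by move=> u v; exact: derive_rem3.
- by move=> u; case: (differentiable_rems u sg).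
- by move=> a; apply: h2; exact: smooth_pderiv.
- by case: (jets0 g) => e e2 e3; rewrite /rem3 e3 /rem2 e2 /rem1 e /rem0 !mulr0 !subrr.
Qed.

Definition lipschitz_order d (m : nat) (r : 'rV[R]_d -> R) : Prop :=
  r 0 = 0 /\
  exists (C rho : R), [/\ 0 <= C, 0 < rho &
    forall M z z', `|z| <= M -> `|z'| <= M -> M <= rho ->
      `|r z - r z'| <= C * M ^+ m * `|z - z'|].

Lemma taylor_lipschitz d (g : 'rV[R]_d -> R) : smooth_on setT g ->
  [/\ lipschitz_order 1 (rem1 g), lipschitz_order 2 (rem2 g)
    & lipschitz_order 3 (rem3 g)].
Proof.
move=> sg; case: (jets0 g) => e1 e2 e3.
have z1 : rem1 g 0 = 0 by rewrite /rem1 e1 /rem0 !subrr.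
have z2 : rem2 g 0 = 0 by rewrite /rem2 e2 z1 mulr0 subrr.
have z3 : rem3 g 0 = 0 by rewrite /rem3 e3 z2 mulr0 subrr.
split; split => //.
- apply: (@small_order_deriv d 1 _ (fun a => rem0 (pderiv [:: a] g)) _ _ _ _).2 => //.
  + by move=> u v; exact: derive_rem1.
  + by move=> u; case: (differentiable_rems u sg).
  + by move=> a; case: (taylor_remainders (smooth_pderiv [:: a] sg)).
- apply: (@small_order_deriv d 2 _ (fun a => rem1 (pderiv [:: a] g)) _ _ _ _).2 => //.
  + by move=> u v; exact: derive_rem2.
  + by move=> u; case: (differentiable_rems u sg).
  + by move=> a; case: (taylor_remainders (smooth_pderiv [:: a] sg)).
- apply: (@small_order_deriv d 3 _ (fun a => rem2 (pderiv [:: a] g)) _ _ _ _).2 => //.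
  + by move=> u v; exact: derive_rem3.
  + by move=> u; case: (differentiable_rems u sg).
  + by move=> a; case: (taylor_remainders (smooth_pderiv [:: a] sg)).
Qed.

End Calculus.

(** * Contractions uniform in a parameter *)

HB.instance Definition _ (R : realType) m n := Complete.on 'M[R]_(m, n).

Section UniformStrictDifferentiability.
Variables (R : realType) (n : nat) (z0 : 'cV[R]_n).
Implicit Types (E F : 'cV[R]_n -> R -> R) (l : 'rV[R]_n).

(** [e] and [l] play the role of the value and the state derivative at [(z0, 0)]. Nothing is asked
    at s = 0, because the functions of interest contain divisions by powers of s. *)
Definition sdiff E (e : R) l : Prop :=
  forall eps : R, 0 < eps -> exists2 rho : R, 0 < rho &
    forall z z' s, `|z - z0| <= rho -> `|z' - z0| <= rho -> 0 < s <= rho ->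
      `|E z s - e| <= eps /\
      `|E z s - E z' s - (l *m (z - z')) 0 0| <= eps * `|z - z'|.

Definition sdiffable E : Prop := exists e l, sdiff E e l.

Lemma mulmx_norm m p q (A : 'M[R]_(m, p)) (B : 'M[R]_(p, q)) :
  `|A *m B| <= p%:R * `|A| * `|B|.
Proof.
apply: mx_norm_le => [|i j]; first by rewrite !mulr_ge0.
rewrite mxE; apply: le_trans (ler_norm_sum _ _ _) _.
have -> : p%:R * `|A| * `|B| = \sum_(a < p) `|A| * `|B|.
  by rewrite sumr_const card_ord -mulr_natl; ring.
by apply: ler_sum => a _; rewrite normrM ler_pM//; exact: mx_norm_coord.
Qed.

Lemma row_apply_norm l (z : 'cV[R]_n) : `|(l *m z) 0 0| <= n%:R * `|l| * `|z|.
Proof. exact: le_trans (mx_norm_coord _ _ _) (mulmx_norm _ _). Qed.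

Lemma sdiff_const c : sdiff (fun _ _ => c) c 0.
Proof.
move=> eps e0; exists 1 => // z z' s _ _ _.
by rewrite !subrr mul0mx mxE subr0 normr0 (ltW e0) mulr_ge0// ltW.
Qed.

Lemma sdiff_time : sdiff (fun _ s => s) 0 0.
Proof.
move=> eps e0; exists eps => // z z' s _ _ /andP[s0 se].
by rewrite !subrr mul0mx mxE !subr0 normr0 gtr0_norm// se mulr_ge0// ltW.
Qed.

Lemma sdiff_coord i : sdiff (fun z _ => z i 0) (z0 i 0) 'e_i.
Proof.
move=> eps e0; exists eps => // z z' s hz _ _; split.
  have := mx_norm_coord (z - z0) i 0; rewrite !mxE => /le_trans; exact.
have -> : (('e_i : 'rV[R]_n) *m (z - z')) 0 0 = z i 0 - z' i 0.
  by rewrite -rowE !mxE.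
by rewrite subrr normr0 mulr_ge0// ltW.
Qed.

Lemma sdiff_add E F e f l l' :
  sdiff E e l -> sdiff F f l' -> sdiff (fun z s => E z s + F z s) (e + f) (l + l').
Proof.
move=> hE hF eps e0; have e2 : 0 < eps / 2 by rewrite divr_gt0.
have [r r0 H] := hE _ e2; have [q q0 K] := hF _ e2.
exists (Order.min r q) => [|z z' s]; first by rewrite lt_min r0.
rewrite !le_min => /andP[a1 a2] /andP[b1 b2] /andP[s0 /andP[c1 c2]].
have [|h1 h2] := H z z' s a1 b1; first by rewrite s0.
have [|k1 k2] := K z z' s a2 b2; first by rewrite s0.
split.
  rewrite opprD addrACA (le_trans (ler_normD _ _))// (le_trans (lerD h1 k1))//.
  by rewrite -splitr.
rewrite mulmxDl mxE.
have -> : E z s + F z s - (E z' s + F z' s) -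
    ((l *m (z - z')) 0 0 + (l' *m (z - z')) 0 0) =
  (E z s - E z' s - (l *m (z - z')) 0 0) +
  (F z s - F z' s - (l' *m (z - z')) 0 0) by ring.
by rewrite (le_trans (ler_normD _ _))// (le_trans (lerD h2 k2))// -mulrDl -splitr.
Qed.

Lemma sdiff_mul E F e f l l' :
  sdiff E e l -> sdiff F f l' ->
  sdiff (fun z s => E z s * F z s) (e * f) (e *: l' + f *: l).
Proof.
move=> hE hF eps e0.
(* [B] bounds the factors, their limits and their derivatives at once; each of the four error terms
   below then costs at most a quarter of the allowance. *)
pose B := `|e| + `|f| + 1 + n%:R * `|l| + n%:R * `|l'|.
have p1 : 0 <= n%:R * `|l| by rewrite mulr_ge0.
have p2 : 0 <= n%:R * `|l'| by rewrite mulr_ge0.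
have pe := normr_ge0 e; have pf := normr_ge0 f.
have [B1 Be Bf] : [/\ 1 <= B, `|e| + 1 <= B & `|f| + 1 <= B] by rewrite /B; split; lra.
have [Bl Bl'] : n%:R * `|l| <= B /\ n%:R * `|l'| <= B by rewrite /B; split; lra.
have nB (c x dd : R) : dd <= 1 -> `|x - c| <= dd -> `|c| + 1 <= B -> `|x| <= B.
  move=> h1 h2; apply: le_trans; rewrite -[x](subrK c) addrC.
  by apply: le_trans (ler_normD _ _) _; rewrite lerD2l (le_trans h2).
have hB1 : `|e| <= B by apply: le_trans Be; rewrite lerDl ler01.
have B0 : 0 < B by apply: lt_le_trans B1.
pose d := Order.min 1 (eps / (4 * B)).
have d0 : 0 < d by rewrite lt_min ltr01 divr_gt0// mulr_gt0.
have d1 : d <= 1 by rewrite ge_min lexx.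
have dB : d * B <= eps / 4.
  have : d <= eps / (4 * B) by rewrite ge_min lexx orbT.
  by rewrite -(ler_pM2r B0) => /le_trans; apply; rewrite invfM mulrA mulfVK ?gt_eqF.
have [r r0 H] := hE _ d0; have [q q0 K] := hF _ d0.
exists (Order.min r q) => [|z z' s]; first by rewrite lt_min r0.
rewrite !le_min => /andP[a1 a2] /andP[b1 b2] /andP[s0 /andP[c1 c2]].
have [|h1 h2] := H z z' s a1 b1; first by rewrite s0.
have [|k1 k2] := K z z' s a2 b2; first by rewrite s0.
have [|h1' _] := H z' z s b1 a1; first by rewrite s0.
have hF1 : `|F z s| <= B by exact: (nB f _ d).
have hE1 : `|E z' s| <= B by exact: (nB e _ d).
split.
  have -> : E z s * F z s - e * f = (E z s - e) * F z s + e * (F z s - f) by ring.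
  rewrite (le_trans (ler_normD _ _))// !normrM.
  have := ler_pM (normr_ge0 _) (normr_ge0 _) h1 hF1.
  have := ler_pM (normr_ge0 _) (normr_ge0 _) hB1 k1.
  rewrite (mulrC B); lra.
set L := (l *m (z - z')) 0 0; set L' := (l' *m (z - z')) 0 0; set D := `|z - z'|.
have -> : ((e *: l' + f *: l) *m (z - z')) 0 0 = e * L' + f * L.
  by rewrite mulmxDl -!scalemxAl mxE; congr (_ + _); rewrite mxE.
have -> : E z s * F z s - E z' s * F z' s - (e * L' + f * L) =
   (E z s - E z' s - L) * F z s + (F z s - f) * L +
   E z' s * (F z s - F z' s - L') + (E z' s - e) * L' by ring.
have D0 : 0 <= D := normr_ge0 _.
have hL : `|L| <= B * D.
  by apply: le_trans (row_apply_norm _ _) _; rewrite ler_wpM2r.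
have hL' : `|L'| <= B * D.
  by apply: le_trans (row_apply_norm _ _) _; rewrite ler_wpM2r.
rewrite (le_trans (ler_normD _ _))//.
have -> : eps * D = 3 * (eps / 4 * D) + eps / 4 * D by field.
have dBD : d * B * D <= eps / 4 * D by rewrite ler_wpM2r.
apply: lerD.
  rewrite (le_trans (ler_normD _ _))//.
  have -> : 3 * (eps / 4 * D) = eps / 4 * D + eps / 4 * D + eps / 4 * D by ring.
  apply: lerD; first rewrite (le_trans (ler_normD _ _))//; first apply: lerD.
  - rewrite normrM; apply: le_trans (ler_pM (normr_ge0 _) (normr_ge0 _) h2 hF1) _.
    by rewrite mulrAC.
  - rewrite normrM; apply: le_trans (ler_pM (normr_ge0 _) (normr_ge0 _) k1 hL) _.
    by rewrite mulrA.
  - rewrite normrM; apply: le_trans (ler_pM (normr_ge0 _) (normr_ge0 _) hE1 k2) _.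
    by rewrite mulrA (mulrC B).
rewrite normrM; apply: le_trans (ler_pM (normr_ge0 _) (normr_ge0 _) h1' hL') _.
by rewrite mulrA.
Qed.

Lemma sdiff_eq E F e f l l' : sdiff E e l -> (forall z s, 0 < s -> F z s = E z s) ->
  f = e -> l' = l -> sdiff F f l'.
Proof.
move=> hE FE -> -> eps e0; have [r r0 H] := hE _ e0; exists r => // z z' s hz hz' hs.
by case/andP: (hs) => s0 _; rewrite !FE//; exact: H.
Qed.

Lemma sdiffable_const c : sdiffable (fun _ _ => c).
Proof. by exists c, 0; exact: sdiff_const. Qed.
Lemma sdiffable_time : sdiffable (fun _ s => s).
Proof. by exists 0, 0; exact: sdiff_time. Qed.
Lemma sdiffable_coord i : sdiffable (fun z _ => z i 0).
Proof. by exists (z0 i 0), 'e_i; exact: sdiff_coord. Qed.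
Lemma sdiffable_add E F :
  sdiffable E -> sdiffable F -> sdiffable (fun z s => E z s + F z s).
Proof. by move=> [e [l H]] [f [l' K]]; exists (e + f), (l + l'); exact: sdiff_add. Qed.
Lemma sdiffable_mul E F :
  sdiffable E -> sdiffable F -> sdiffable (fun z s => E z s * F z s).
Proof.
by move=> [e [l H]] [f [l' K]]; exists (e * f), (e *: l' + f *: l); exact: sdiff_mul.
Qed.
Lemma sdiffable_opp E : sdiffable E -> sdiffable (fun z s => - E z s).
Proof.
move=> h; have := sdiffable_mul (sdiffable_const (-1)) h.
by congr sdiffable; apply/funext => z; apply/funext => s; rewrite mulN1r.
Qed.
Lemma sdiffable_exp E m : sdiffable E -> sdiffable (fun z s => E z s ^+ m).
Proof.
move=> h; elim: m => [|m IH]; first exact: sdiffable_const.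
have := sdiffable_mul h IH.
by congr sdiffable; apply/funext => z; apply/funext => s; rewrite exprS.
Qed.
Lemma sdiffable_sum (I : Type) (r : seq I) (P : pred I) (E : I -> 'cV[R]_n -> R -> R) :
  (forall i, sdiffable (E i)) ->
  sdiffable (fun z s => \sum_(i <- r | P i) E i z s).
Proof.
move=> h; elim: r => [|i r IH].
  have := sdiffable_const 0.
  by congr sdiffable; apply/funext => z; apply/funext => s; rewrite big_nil.
have [Pi|Pi] := boolP (P i).
  have := sdiffable_add (h i) IH.
  by congr sdiffable; apply/funext => z; apply/funext => s; rewrite big_cons Pi.
move: IH; congr sdiffable; apply/funext => z; apply/funext => s.
by rewrite big_cons (negbTE Pi).
Qed.

(** This is what discards the higher order terms of a rescaled equation: of the cofactor of s only
    differentiability has to be known. *)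
Lemma sdiff_time_mul E : sdiffable E -> sdiff (fun z s => s * E z s) 0 0.
Proof.
move=> [e [l h]]; apply: (sdiff_eq (sdiff_mul sdiff_time h)) => //.
  by rewrite mul0r.
by rewrite scale0r scaler0 addr0.
Qed.

Lemma sdiffable_bounded E : sdiffable E -> exists K rho : R,
  [/\ 0 <= K, 0 < rho & forall z z' s, `|z - z0| <= rho -> `|z' - z0| <= rho ->
     0 < s <= rho -> `|E z s| <= K /\ `|E z s - E z' s| <= K * `|z - z'|].
Proof.
move=> [e [l h]]; have [rho rho0 H] := h 1 ltr01.
have p0 : 0 <= n%:R * `|l| by rewrite mulr_ge0.
have pe := normr_ge0 e.
exists (1 + `|e| + n%:R * `|l|), rho; split=> // z z' s hz hz' hs; have [h1 h2] := H z z' s hz hz' hs; split.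
  by rewrite -[E z s](subrK e) (le_trans (ler_normD _ _))//; lra.
rewrite -[E z s - _](subrK ((l *m (z - z')) 0 0)) (le_trans (ler_normD _ _))//.
have h3 := row_apply_norm l (z - z'); have h4 := mulr_ge0 pe (normr_ge0 (z - z')).
rewrite !mulrDl; apply: le_trans (lerD h2 h3) _.
by rewrite mul1r -addrA lerD2l lerDr.
Qed.

(** The remainder has order m + 1 and its argument has size s^(j+1), so the quotient and its
    Lipschitz constant in z are O(s^(j+1)). Exponents other than 1 serve rescalings in which all
    arguments of f are of order s^2. *)
Lemma sdiff_remainder_pow d m j (r : 'rV[R]_d -> R)
    (Y : 'cV[R]_n -> R -> 'rV[R]_d) :
  lipschitz_order m r -> (forall a, sdiffable (fun z s => Y z s 0 a)) ->
  sdiff (fun z s => r (s ^+ j.+1 *: Y z s) / (s ^+ j.+1) ^+ m) 0 0.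
Proof.
move=> [r0 [C [rho [C0 rho0 H]]]] hZ eps e0; pose Z a z s := Y z s 0 a.
have rowE z s t : s *: Y z t = \row_a (s * Z a z t) by apply/rowP => a; rewrite !mxE.
have /all_sig[K HK] : forall a, {K : R | exists2 rho, 0 < rho &
     0 <= K /\ forall z z' s, `|z - z0| <= rho -> `|z' - z0| <= rho ->
     0 < s <= rho -> `|Z a z s| <= K /\ `|Z a z s - Z a z' s| <= K * `|z - z'|}.
  by move=> a; apply: cid; have [K [q [? ? ?]]] := sdiffable_bounded (hZ a); exists K, q.
have [|q q0 Hq] := @common_radius R d (fun a rho => 0 <= K a /\
    forall z z' s, `|z - z0| <= rho -> `|z' - z0| <= rho ->
     0 < s <= rho -> `|Z a z s| <= K a /\ `|Z a z s - Z a z' s| <= K a * `|z - z'|) _ HK.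
  move=> a x y /andP[_ yx] [Ka h]; split=> // z z' s hz hz' /andP[s0 sy].
  by apply: h; rewrite ?s0 ?(le_trans _ yx).
pose B := 1 + \sum_a K a.
have B1 : 1 <= B by rewrite lerDl sumr_ge0// => a _; case: (Hq a).
have B0 : 0 < B by apply: lt_le_trans B1.
have KB a : K a <= B.
  rewrite /B (bigD1 a)//= addrCA lerDl addr_ge0// sumr_ge0// => b _.
  by case: (Hq b).
have K0 a : 0 <= K a by case: (Hq a).
pose M := C * B ^+ m.+1.
have M0 : 0 <= M by rewrite mulr_ge0// exprn_ge0// ltW.
(* In turn, these radii keep the bounds on [Y] valid, the argument inside the domain of the
   remainder estimate, powers of the parameter at most 1, and the final error below [eps]. *)
pose q' := Order.min q (Order.min (rho / B) (Order.min 1 (eps / (M + 1)))).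
have q'0 : 0 < q' by rewrite !lt_min q0 !divr_gt0//= ?ltr01// ltr_wpDl.
exists q' => // z z' t hz hz' /andP[t0 tq'].
have t1 : t <= 1 by apply: le_trans tq' _; rewrite !ge_min lexx !orbT.
have htq : 0 < t <= q by rewrite t0; apply: le_trans tq' _; rewrite ge_min lexx.
have s0 : 0 < t ^+ j.+1 by rewrite exprn_gt0.
have sq' : t ^+ j.+1 <= q'.
  by apply: le_trans tq'; rewrite exprS ler_piMr ?(ltW t0)// exprn_ile1// ltW.
move: (t ^+ j.+1) s0 sq' => s s0 sq'.
have sq : s <= q by apply: le_trans sq' _; rewrite ge_min lexx.
have sr : s * B <= rho.
  by rewrite -ler_pdivlMr//; apply: le_trans sq' _; rewrite !ge_min lexx orbT.
have s1 : s <= 1 by apply: le_trans sq' _; rewrite !ge_min lexx !orbT.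
have se : s * (M + 1) <= eps.
  rewrite -ler_pdivlMr ?ltr_wpDl//; apply: le_trans sq' _.
  by rewrite !ge_min lexx !orbT.
have hzq : `|z - z0| <= q by apply: le_trans hz _; rewrite ge_min lexx.
have hzq' : `|z' - z0| <= q by apply: le_trans hz' _; rewrite ge_min lexx.
pose w z := \row_a (s * Z a z t).
have nw u : `|u - z0| <= q -> `|w u| <= s * B.
  move=> hu; apply: mx_norm_le => [|i a]; first by rewrite mulr_ge0// ltW.
  rewrite mxE normrM gtr0_norm// ler_pM2l// (le_trans _ (KB a))//.
  by case: ((Hq a).2 u u t hu hu htq).
have dw : `|w z - w z'| <= s * B * `|z - z'|.
  apply: mx_norm_le => [|i a]; first by rewrite !mulr_ge0// ltW.
  rewrite !mxE -mulrBr normrM gtr0_norm// -mulrA ler_pM2l//.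
  by case: ((Hq a).2 z z' t hzq hzq' htq) => _ /le_trans; apply; rewrite ler_wpM2r.
have sm0 : 0 < s ^+ m by rewrite exprn_gt0.
have e1 : C * (s * B) ^+ m * (s * B) = s ^+ m * (s * M).
  by rewrite /M exprMn exprS; ring.
have sM : s * M <= eps by apply: le_trans se; rewrite ler_pM2l// lerDl.
rewrite mul0mx mxE !subr0 !rowE -/(w z) -/(w z'); split.
  rewrite normrM normfV (gtr0_norm sm0) ler_pdivrMr//.
  have := H (s * B) (w z) 0 (nw z hzq); rewrite normr0 r0 !subr0.
  rewrite mulr_ge0 ?(ltW s0) ?(ltW B0)// => /(_ isT sr)/le_trans; apply.
  apply: (@le_trans _ _ (C * (s * B) ^+ m * (s * B))).
    by rewrite ler_wpM2l ?nw// mulr_ge0// exprn_ge0// mulr_ge0// ltW.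
  by rewrite e1 mulrC ler_wpM2r// ltW.
rewrite -mulrBl normrM normfV (gtr0_norm sm0) ler_pdivrMr//.
apply: le_trans (H _ _ _ (nw z hzq) (nw z' hzq') sr) _.
apply: (@le_trans _ _ (C * (s * B) ^+ m * (s * B * `|z - z'|))).
  by rewrite ler_wpM2l// mulr_ge0// exprn_ge0// mulr_ge0// ltW.
rewrite mulrA e1 -mulrA mulrC ler_wpM2r ?(ltW sm0)//.
by rewrite ler_wpM2r.
Qed.

Lemma sdiff_remainder d m (r : 'rV[R]_d -> R) (Y : 'cV[R]_n -> R -> 'rV[R]_d) :
  lipschitz_order m r -> (forall a, sdiffable (fun z s => Y z s 0 a)) ->
  sdiff (fun z s => r (s *: Y z s) / s ^+ m) 0 0.
Proof. exact: (@sdiff_remainder_pow d m 0). Qed.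

(* Newton's method with a frozen derivative: the maps
   z |-> z - A^-1 G(z, s) are contractions of a ball around z0, uniformly in
   s. *)
Lemma zero_branch (A : 'M[R]_n) (G : 'I_n -> 'cV[R]_n -> R -> R) :
  A \in unitmx -> (forall i, sdiff (G i) 0 (row i A)) ->
  (forall i z s, 0 < s -> {for s, continuous (G i z)}) ->
  exists (dlt : R) (z : R -> 'cV[R]_n), [/\ 0 < dlt,
    forall s, 0 < s <= dlt -> forall i, G i (z s) s = 0,
    forall eps, 0 < eps -> exists2 dlt', 0 < dlt' &
      forall s, 0 < s <= dlt' -> `|z s - z0| <= eps
  & forall s eps, 0 < s <= dlt -> 0 < eps -> exists2 eta, 0 < eta &
      forall s', 0 < s' <= dlt -> `|s - s'| < eta -> `|z s - z s'| <= eps].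
Proof.
move=> uA hG cG.
pose B := n%:R * `|invmx A| + 1.
have B1 : 1 <= B by rewrite lerDr mulr_ge0.
have B0 : 0 < B by apply: lt_le_trans B1.
pose Gv z s := \col_i G i z s.
pose T z s := z - invmx A *m Gv z s.
have nA (h : 'cV[R]_n) : `|invmx A *m h| <= B * `|h|.
  apply: le_trans (mulmx_norm _ _) _; rewrite ler_wpM2r// /B lerDl//.
have radius (e : R) : 0 < e -> exists2 rho : R, 0 < rho &
    forall i z z' s, `|z - z0| <= rho -> `|z' - z0| <= rho -> 0 < s <= rho ->
      `|G i z s| <= e /\
      `|G i z s - G i z' s - (row i A *m (z - z')) 0 0| <= e * `|z - z'|.
  move=> e0; apply: (@common_radius R n (fun i rho => forall z z' s,
     `|z - z0| <= rho -> `|z' - z0| <= rho -> 0 < s <= rho ->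
      `|G i z s| <= e /\
      `|G i z s - G i z' s - (row i A *m (z - z')) 0 0| <= e * `|z - z'|)).
    move=> i x y /andP[_ yx] H z z' s hz hz' /andP[s0 sy].
    by apply: H; rewrite ?s0 ?(le_trans _ yx).
  move=> i; have [r r0 H] := hG i _ e0; exists r => // z z' s hz hz' hs.
  by have := H z z' s hz hz' hs; rewrite subr0.
(* Since [B] bounds the inverse of [A], this tolerance makes each [T ^~ s] a contraction with factor
   1/2. *)
have e0 : 0 < (2 * B)^-1 by rewrite invr_gt0 mulr_gt0.
have [rho rho0 H] := radius _ e0.
have contr z z' s : `|z - z0| <= rho -> `|z' - z0| <= rho -> 0 < s <= rho ->
    `|T z s - T z' s| <= 2^-1 * `|z - z'|.
  move=> hz hz' hs.
  have -> : T z s - T z' s = invmx A *m (A *m (z - z') - (Gv z s - Gv z' s)).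
    rewrite mulmxBr mulKmx// mulmxBr /T.
    by apply/colP => i; rewrite !mxE; ring.
  apply: le_trans (nA _) _; rewrite -(ler_pM2l (_ : 0 < B^-1)) ?invr_gt0//.
  rewrite mulKf ?gt_eqF// mulrA -invfM (mulrC B).
  apply: mx_norm_le => [|i j]; first by rewrite mulr_ge0// ltW// (mulrC 2).
  have [_] := H i z z' s hz hz' hs; rewrite !ord1.
  have -> : (A *m (z - z') - (Gv z s - Gv z' s)) i 0 =
     - (G i z s - G i z' s - (row i A *m (z - z')) 0 0); last by rewrite normrN.
  by rewrite -row_mul ![in LHS]mxE ![in RHS]mxE; ring.
have small e : 0 < e -> exists2 q, 0 < q & forall s, 0 < s <= q -> `|T z0 s - z0| <= e.
  move=> he; have eB : 0 < e / B by rewrite divr_gt0.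
  have [q q0 K] := radius _ eB; exists q => // s hs.
  have -> : T z0 s - z0 = - (invmx A *m Gv z0 s) by rewrite /T addrC addKr.
  rewrite normrN (le_trans (nA _))// mulrC -ler_pdivlMr//.
  apply: mx_norm_le => [|i j]; first exact: ltW.
  by rewrite mxE; case: (K i z0 z0 s); rewrite ?subrr ?normr0// ltW.
(* The centre of the ball moves by at most half the radius and the contraction uses the other half,
   so the ball is mapped into itself. *)
have r2 : 0 < rho / 2 by rewrite divr_gt0.
have [q q0 hq] := small _ r2.
pose dlt := Order.min rho q.
have d0 : 0 < dlt by rewrite lt_min rho0.
pose U : set 'cV[R]_n := closed_ball_ Num.norm z0 rho.
have UP z : U z <-> `|z - z0| <= rho by rewrite /U /closed_ball_/= distrC.
have ex s : 0 < s <= dlt -> exists2 z, `|z - z0| <= rho & z = T z s.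
  rewrite le_min => /andP[s0 /andP[sr sq]].
  have hs : 0 < s <= rho by rewrite s0.
  have hU : {homo (T ^~ s) : x / U x >-> U x}.
    move=> z /UP hz; apply/UP.
    have -> : T z s - z0 = (T z s - T z0 s) + (T z0 s - z0) by rewrite addrA subrK.
    rewrite (le_trans (ler_normD _ _))// [leRHS]splitr lerD//; last first.
      by apply: hq; rewrite s0.
    apply: le_trans (contr _ _ _ hz _ hs) _; first by rewrite subrr normr0 ltW.
    by rewrite mulrC ler_pM2r.
  have [|||z Uz hz] := @banach_fixed_point R 'cV[R]_n U (mkfun_fun hU).
  - exists (2^-1)%:nng; split; first by rewrite /= invf_lt1// ltr1n.
    by move=> [x y] /= [/UP hx /UP hy]; exact: contr.
  - exact: closed_closed_ball_.
  - by exists z0; apply/UP; rewrite subrr normr0 ltW.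
  by exists z; [apply/UP|].
have /choice[z hz] : forall s : R, exists z : 'cV[R]_n,
    0 < s <= dlt -> `|z - z0| <= rho /\ z = T z s.
  move=> s; have [/ex[w h1 h2]|] := boolP (0 < s <= dlt); first by exists w.
  by exists z0.
exists dlt, z; split=> //.
- move=> s hs i; have [_ h] := hz s hs.
  have : invmx A *m Gv (z s) s = 0.
    have : z s - T (z s) s = 0 by rewrite -h subrr.
    by rewrite /T opprB addrC subrK.
  move/(congr1 (mulmx A)); rewrite mulKVmx// mulmx0 => /matrixP/(_ i 0).
  by rewrite !mxE.
- move=> eps eps0; have e2 : 0 < eps / 2 by rewrite divr_gt0.
  have [q' q'0 hq'] := small _ e2; exists (Order.min dlt q') => [|s].
    by rewrite lt_min d0.
  rewrite le_min => /andP[s0 /andP[sd sq]].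
  have [|h1 h2] := hz s; first by rewrite s0.
  have hs : 0 < s <= rho by rewrite s0 (le_trans sd)// ge_min lexx.
  have : `|T z0 s - z0| <= eps / 2 by apply: hq'; rewrite s0.
  have := contr (z s) z0 s h1 _ hs; rewrite subrr normr0 ltW// -h2 => /(_ isT) c1 c2.
  have := ler_normD (z s - T z0 s) (T z0 s - z0); rewrite addrA subrK.
  have -> : eps = 2 * (eps / 2) by field.
  lra.
(* Continuity in s: the fixed point for s is almost fixed at a nearby parameter, and the factor 1/2
   turns this defect into a bound on the distance of the two fixed points. *)
- move=> s eps hs eps0; have [h1 h2] := hz s hs.
  have eB : 0 < eps / (2 * B) by rewrite divr_gt0// mulr_gt0.
  have s0 : 0 < s by case/andP: hs.
  have [eta eta0 heta] : exists2 eta : R, 0 < eta & forall i t, `|s - t| < eta ->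
      `|G i (z s) s - G i (z s) t| <= eps / (2 * B).
    apply: (@common_radius R n (fun i eta => forall t, `|s - t| < eta ->
      `|G i (z s) s - G i (z s) t| <= eps / (2 * B))).
      by move=> i x y /andP[_ yx] K t ht; apply: K; apply: lt_le_trans yx.
    move=> i; have /cvgrPdist_le/(_ _ eB) := cG i (z s) s s0.
    rewrite -nbhs_nearE => /nbhs_ballP[eta eta0 K]; exists eta => //.
  exists eta => // t ht st; have [k1 k2] := hz t ht.
  have t0 : 0 < t <= rho.
    by case/andP: ht => -> /=; rewrite le_min => /andP[].
  have := contr _ _ _ h1 k1 t0; rewrite -k2 => c1.
  have c2 : `|z s - T (z s) t| <= eps / 2.
    have -> : z s - T (z s) t = invmx A *m (Gv (z s) t - Gv (z s) s).
      by rewrite {1}h2 mulmxBr /T; apply/colP => k; rewrite !mxE; ring.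
    rewrite (le_trans (nA _))// mulrC -ler_pdivlMr// -mulrA -invfM.
    apply: mx_norm_le => [|i j]; first exact: ltW.
    by rewrite !mxE distrC; exact: heta.
  have := ler_normD (z s - T (z s) t) (T (z s) t - z t); rewrite addrA subrK.
  lra.
Qed.

End UniformStrictDifferentiability.

(** * Branches at a simple eigenvalue *)

Section Families.
Variables (R : realType) (n : nat) (z0 : 'cV[R]_n).

Definition sdiffable_row d (Y : 'cV[R]_n -> R -> 'rV[R]_d) : Prop :=
  forall a, sdiffable z0 (fun z s => Y z s 0 a).

Lemma sdiffable_row_const d (u : 'rV[R]_d) : sdiffable_row (fun _ _ => u).
Proof. by move=> a; exact: sdiffable_const. Qed.

Lemma sdiffable_row_add d (Y W : 'cV[R]_n -> R -> 'rV[R]_d) :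
  sdiffable_row Y -> sdiffable_row W -> sdiffable_row (fun z s => Y z s + W z s).
Proof.
move=> hY hW a; have := sdiffable_add (hY a) (hW a).
by congr sdiffable; apply/funext => z; apply/funext => s; rewrite mxE.
Qed.

Lemma sdiffable_row_scale d E (Y : 'cV[R]_n -> R -> 'rV[R]_d) :
  sdiffable z0 E -> sdiffable_row Y -> sdiffable_row (fun z s => E z s *: Y z s).
Proof.
move=> hE hY a; have := sdiffable_mul hE (hY a).
by congr sdiffable; apply/funext => z; apply/funext => s; rewrite mxE.
Qed.

Lemma sdiffable_row_coord d i (v : 'rV[R]_d) : sdiffable_row (fun z _ => z i 0 *: v).
Proof. by apply: sdiffable_row_scale; [exact: sdiffable_coord|exact: sdiffable_row_const]. Qed.

Lemma sdiffable_jet2 d (g : 'rV[R]_d -> R) Y W :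
  sdiffable_row Y -> sdiffable_row W ->
  sdiffable z0 (fun z s => jet2 g (Y z s) (W z s)).
Proof.
move=> hY hW; apply: sdiffable_sum => a; apply: sdiffable_sum => b.
apply: sdiffable_mul; last exact: sdiffable_const.
exact: sdiffable_mul.
Qed.

Lemma sdiffable_jet3 d (g : 'rV[R]_d -> R) Y W X :
  sdiffable_row Y -> sdiffable_row W -> sdiffable_row X ->
  sdiffable z0 (fun z s => jet3 g (Y z s) (W z s) (X z s)).
Proof.
move=> hY hW hX; apply: sdiffable_sum => a; apply: sdiffable_sum => b.
apply: sdiffable_sum => c.
apply: sdiffable_mul; last exact: sdiffable_const.
by apply: sdiffable_mul => //; exact: sdiffable_mul.
Qed.

Lemma sdiff_row (l : 'rV[R]_n) :
  sdiff z0 (fun z _ => (l *m z) 0 0) ((l *m z0) 0 0) l.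
Proof.
move=> eps e0; pose C := n%:R * `|l| + 1.
have C0 : 0 < C by rewrite ltr_wpDl// mulr_ge0.
exists (eps / C) => [|z z' s hz _ _]; first by rewrite divr_gt0.
have e (u v : 'cV[R]_n) : (l *m u) 0 0 - (l *m v) 0 0 = (l *m (u - v)) 0 0.
  by rewrite mulmxBr [RHS]mxE [X in _ = _ + X]mxE.
split; last by rewrite e subrr normr0 mulr_ge0// ltW.
rewrite e.
apply: le_trans (row_apply_norm _ _) _.
rewrite ler_pdivlMr// mulrC in hz; apply: le_trans hz.
by rewrite ler_wpM2r// lerDl.
Qed.

End Families.

Section Multilinear.
Variables (R : realType) (d : nat) (g : 'rV[R]_d -> R).
Implicit Types (u v w : 'rV[R]_d) (a : R).

Lemma jet1D u v : jet1 g (u + v) = jet1 g u + jet1 g v.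
Proof.
by rewrite /jet1 -big_split; apply: eq_bigr => a _; rewrite mxE mulrDl.
Qed.
Lemma jet1Z a u : jet1 g (a *: u) = a * jet1 g u.
Proof.
by rewrite /jet1 mulr_sumr; apply: eq_bigr => b _; rewrite mxE mulrA.
Qed.
Lemma jet2Dl u v w : jet2 g (u + v) w = jet2 g u w + jet2 g v w.
Proof.
rewrite /jet2 -big_split; apply: eq_bigr => a _; rewrite -big_split.
by apply: eq_bigr => b _; rewrite mxE !mulrDl.
Qed.
Lemma jet2Dr u v w : jet2 g w (u + v) = jet2 g w u + jet2 g w v.
Proof.
rewrite /jet2 -big_split; apply: eq_bigr => a _; rewrite -big_split.
by apply: eq_bigr => b _; rewrite mxE mulrDr !mulrDl.
Qed.
Lemma jet2Zl a u w : jet2 g (a *: u) w = a * jet2 g u w.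
Proof.
rewrite /jet2 mulr_sumr; apply: eq_bigr => b _; rewrite mulr_sumr.
by apply: eq_bigr => c _; rewrite mxE !mulrA.
Qed.
Lemma jet2Zr a u w : jet2 g w (a *: u) = a * jet2 g w u.
Proof.
rewrite /jet2 mulr_sumr; apply: eq_bigr => b _; rewrite mulr_sumr.
by apply: eq_bigr => c _; rewrite mxE; ring.
Qed.
Lemma jet3D1 u v w x : jet3 g (u + v) w x = jet3 g u w x + jet3 g v w x.
Proof.
rewrite /jet3 -big_split; apply: eq_bigr => a _; rewrite -big_split.
apply: eq_bigr => b _; rewrite -big_split; apply: eq_bigr => c _.
by rewrite mxE /=; ring.
Qed.
Lemma jet3D2 u v w x : jet3 g w (u + v) x = jet3 g w u x + jet3 g w v x.
Proof.
rewrite /jet3 -big_split; apply: eq_bigr => a _; rewrite -big_split.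
apply: eq_bigr => b _; rewrite -big_split; apply: eq_bigr => c _.
by rewrite mxE /=; ring.
Qed.
Lemma jet3D3 u v w x : jet3 g w x (u + v) = jet3 g w x u + jet3 g w x v.
Proof.
rewrite /jet3 -big_split; apply: eq_bigr => a _; rewrite -big_split.
apply: eq_bigr => b _; rewrite -big_split; apply: eq_bigr => c _.
by rewrite mxE /=; ring.
Qed.
Lemma jet3Z1 a u w x : jet3 g (a *: u) w x = a * jet3 g u w x.
Proof.
rewrite /jet3 mulr_sumr; apply: eq_bigr => b _; rewrite mulr_sumr.
apply: eq_bigr => c _; rewrite mulr_sumr; apply: eq_bigr => e _.
by rewrite mxE; ring.
Qed.
Lemma jet3Z2 a u w x : jet3 g w (a *: u) x = a * jet3 g w u x.
Proof.
rewrite /jet3 mulr_sumr; apply: eq_bigr => b _; rewrite mulr_sumr.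
apply: eq_bigr => c _; rewrite mulr_sumr; apply: eq_bigr => e _.
by rewrite mxE; ring.
Qed.
Lemma jet3Z3 a u w x : jet3 g w x (a *: u) = a * jet3 g w x u.
Proof.
rewrite /jet3 mulr_sumr; apply: eq_bigr => b _; rewrite mulr_sumr.
apply: eq_bigr => c _; rewrite mulr_sumr; apply: eq_bigr => e _.
by rewrite mxE; ring.
Qed.

Lemma jet2_square u v a b : jet2 g (a *: u + b *: v) (a *: u + b *: v) =
  a ^+ 2 * jet2 g u u + a * b * (jet2 g u v + jet2 g v u) + b ^+ 2 * jet2 g v v.
Proof. by rewrite jet2Dl !jet2Dr !jet2Zl !jet2Zr; ring. Qed.

(** The cofactor of [a] stays unexpanded: in the rescaled equations [a] is s, and only the term free
    of s has to be explicit. *)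
Lemma jet3_perturb u v a : jet3 g (u + a *: v) (u + a *: v) (u + a *: v) =
  jet3 g u u u + a * (jet3 g v (u + a *: v) (u + a *: v)
    + jet3 g u v (u + a *: v) + jet3 g u u v).
Proof.
have h1 w x : jet3 g (u + a *: v) w x = jet3 g u w x + a * jet3 g v w x.
  by rewrite jet3D1 jet3Z1.
have h2 w x : jet3 g w (u + a *: v) x = jet3 g w u x + a * jet3 g w v x.
  by rewrite jet3D2 jet3Z2.
have h3 w x : jet3 g w x (u + a *: v) = jet3 g w x u + a * jet3 g w x v.
  by rewrite jet3D3 jet3Z3.
by rewrite h1 [jet3 g u _ _]h2 [jet3 g u u _]h3; ring.
Qed.

Lemma rem1E u : g u = g 0 + jet1 g u + rem1 g u.
Proof. by rewrite /rem1 /rem0; ring. Qed.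
Lemma rem2E u : g u = g 0 + jet1 g u + 2^-1 * jet2 g u u + rem2 g u.
Proof. by rewrite /rem2 /rem1 /rem0; ring. Qed.
Lemma rem3E u : g u = g 0 + jet1 g u + 2^-1 * jet2 g u u
  + 6^-1 * jet3 g u u u + rem3 g u.
Proof. by rewrite /rem3 /rem2 /rem1 /rem0; ring. Qed.

End Multilinear.

Section Branches.
Variables (R : realType) (k : nat) (f : response R k).
Hypothesis sf : smooth_on setT f.
Hypothesis f0 : forall l : R, f (row_mx 0 l%:M) = 0.

Definition zrow n (N : network k n) (x : 'cV[R]_n) (l : R) (i : 'I_n) :
    'rV[R]_(k.+1 + 1) :=
  row_mx (\row_p x (slot N p i) 0) l%:M.

Definition erow : 'rV[R]_(k.+1 + 1) := row_mx 0 1%:M.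

Lemma zrowD n (N : network k n) x y l m i :
  zrow N (x + y) (l + m) i = zrow N x l i + zrow N y m i.
Proof.
rewrite /zrow add_row_mx raddfD /=; congr row_mx.
by apply/rowP => p; rewrite !mxE.
Qed.

Lemma zrowZ n (N : network k n) a x l i :
  zrow N (a *: x) (a * l) i = a *: zrow N x l i.
Proof.
rewrite /zrow scale_row_mx scale_scalar_mx; congr row_mx.
by apply/rowP => p; rewrite !mxE.
Qed.

Lemma zrow0 n (N : network k n) l i : zrow N 0 l i = l *: erow.
Proof.
rewrite /zrow /erow scale_row_mx scaler0 scale_scalar_mx mulr1; congr row_mx.
by apply/rowP => p; rewrite !mxE.
Qed.

Lemma zrow_split n (N : network k n) x l i :
  zrow N x l i = zrow N x 0 i + l *: erow.
Proof. by rewrite -(zrow0 N l i) -zrowD addr0 add0r. Qed.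

Lemma zrowD0 n (N : network k n) x y i :
  zrow N (x + y) 0 i = zrow N x 0 i + zrow N y 0 i.
Proof. by rewrite -[X in zrow N (_ + _) X i]addr0 zrowD. Qed.

Lemma zrowZ0 n (N : network k n) a x i :
  zrow N (a *: x) 0 i = a *: zrow N x 0 i.
Proof. by rewrite -[X in zrow N (_ *: _) X i](mulr0 a) zrowZ. Qed.

Lemma zrow_l n (N : network k n) x l i p :
  zrow N x l i 0 (lshift 1 p) = x (slot N p i) 0.
Proof. by rewrite /zrow row_mxEl mxE. Qed.

Lemma zrow_r n (N : network k n) x l i j : zrow N x l i 0 (rshift k.+1 j) = l.
Proof. by rewrite /zrow row_mxEr mxE !ord1 eqxx. Qed.

Lemma erow_delta : erow = 'e_(rshift k.+1 0).
Proof.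
apply/rowP => a; rewrite [RHS]mxE eqxx /=; case: (split_ordP a) => j ->.
  by rewrite row_mxEl mxE eq_lrshift.
by rewrite row_mxEr mxE !ord1 !eqxx.
Qed.

Lemma admissibleE n (N : network k n) x l i :
  admissible N f x l i 0 = f (zrow N x l i).
Proof. by rewrite mxE. Qed.

Lemma f00 : f 0 = 0.
Proof. by have := f0 0; rewrite raddf0 row_mx0. Qed.

Lemma erow_lambda l : l *: erow = row_mx 0 l%:M.
Proof. by rewrite /erow scale_row_mx scaler0 scale_scalar_mx mulr1. Qed.

(** f vanishes along the whole line of trivial solutions, so its expansion has no pure powers of the
    parameter; the first term that involves the parameter is the mixed second derivative. *)
Lemma pderiv_lambda (l : R) : pderiv [:: rshift k.+1 0] f (l *: erow) = 0.
Proof.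
have := derive_val (is_derive := is_derive_line (z := 0) (v := erow) (t := l)
   (smooth_differentiable [::] _ sf)).
rewrite add0r /pderiv /= -erow_delta => <-.
rewrite (_ : (fun t => f (0 + t *: erow)) = cst 0) ?derive_cst//.
by apply/funext => t; rewrite add0r erow_lambda f0.
Qed.

Lemma pderiv_lambda2 : pderiv [:: rshift k.+1 0; rshift k.+1 0] f 0 = 0.
Proof.
have := derive_val (is_derive := is_derive_line (z := 0) (v := erow) (t := 0)
   (smooth_differentiable [::] _ (smooth_pderiv [:: rshift k.+1 0] sf))).
rewrite scale0r addr0.
rewrite -[LHS in _ -> LHS = _]/('D_('e_(rshift k.+1 0)) (pderiv [:: rshift k.+1 0] f) 0).
rewrite -erow_delta => <-.
rewrite (_ : (fun t => _) = cst 0) ?derive_cst//.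
by apply/funext => t; rewrite add0r; exact: pderiv_lambda.
Qed.

Lemma erowE a : erow 0 a = (a == rshift k.+1 0)%:R.
Proof. by rewrite erow_delta mxE eqxx. Qed.

Lemma jet1_erow : jet1 f erow = 0.
Proof.
rewrite /jet1 (bigD1 (rshift k.+1 0))//= big1 ?addr0 => [|a /negbTE an].
  by have := pderiv_lambda 0; rewrite scale0r => ->; rewrite mulr0.
by rewrite erowE an mul0r.
Qed.

Lemma jet2_erow : jet2 f erow erow = 0.
Proof.
rewrite /jet2 (bigD1 (rshift k.+1 0))//= [X in _ + X]big1 => [|a /negbTE an].
  rewrite addr0 (bigD1 (rshift k.+1 0))//= big1 => [|a /negbTE an].
    by rewrite pderiv_lambda2 mulr0 addr0.
  by rewrite [erow 0 a]erowE an mulr0 mul0r.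
by rewrite big1// => b _; rewrite erowE an !mul0r.
Qed.

Lemma jet1_zrow n (N : network k n) (v : 'cV[R]_n) i :
  jet1 f (zrow N v 0 i) = (jacobian N (first_derivatives f) *m v) i 0.
Proof.
rewrite /jet1 big_split_ord /= big_ord1 zrow_r mul0r addr0 mxE /jacobian.
transitivity (\sum_(p < k.+1) \sum_j
   (pderiv [:: lshift 1 p] f 0 * (slot N p i == j)%:R) * v j 0).
  apply: eq_bigr => p _; rewrite (bigD1 (slot N p i))//= eqxx mulr1 mulrC zrow_l.
  by rewrite big1 ?addr0// => j ji; rewrite eq_sym (negbTE ji) mulr0 mul0r.
rewrite exchange_big; apply: eq_bigr => j _; rewrite summxE mulr_suml.
by apply: eq_bigr => p _; rewrite !mxE.
Qed.

Definition lin_lambda n (N : network k n) (v : 'cV[R]_n) : 'cV[R]_n :=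
  \col_i jet2 f (zrow N v 0 i) erow.
Definition quad n (N : network k n) (v w : 'cV[R]_n) : 'cV[R]_n :=
  \col_i jet2 f (zrow N v 0 i) (zrow N w 0 i).
Definition cubic n (N : network k n) (v : 'cV[R]_n) : 'cV[R]_n :=
  \col_i jet3 f (zrow N v 0 i) (zrow N v 0 i) (zrow N v 0 i).

Definition half_line (e dlt : R) : set R := [set l | 0 <= e * l <= dlt].

(** The sign [e] selects the side of 0, since a pitchfork exists on one side only. The property [P]
    of the nonzero part of the branch later identifies its synchrony. *)
Definition half_branch n (N : network k n) (e dlt : R) (b : R -> 'cV[R]_n)
    (P : 'cV[R]_n -> Prop) : Prop :=
  [/\ e ^+ 2 = 1, 0 < dlt,
      {within half_line e dlt, continuous b},
      b 0 = 0 /\ (forall l, half_line e dlt l -> admissible N f (b l) l = 0)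
    & forall l, half_line e dlt l -> l != 0 -> P (b l)].

Lemma continuous_row d (Y : R -> 'rV[R]_d) (s : R) :
  (forall a, {for s, continuous (fun s => Y s 0 a)}) -> {for s, continuous Y}.
Proof.
move=> h; apply/cvgrPdist_le => e e0.
have [r r0 H] : exists2 r : R, 0 < r & forall a t, `|s - t| < r ->
    `|Y s 0 a - Y t 0 a| <= e.
  apply: (@common_radius R d (fun a r => forall t, `|s - t| < r ->
    `|Y s 0 a - Y t 0 a| <= e)).
    by move=> a x y /andP[_ yx] K t ht; apply: K; apply: lt_le_trans yx.
  move=> a; have /cvgrPdist_le/(_ _ e0) := h a.
  by rewrite -nbhs_nearE => /nbhs_ballP[eta eta0 K]; exists eta => // t ht; apply: K.
rewrite -nbhs_nearE; apply/nbhs_ballP; exists r => // t ht.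
apply: mx_norm_le => [|i j]; first exact: ltW.
by rewrite !mxE ord1; apply: H.
Qed.

Lemma continuous_response (Y : R -> 'rV[R]_(k.+1 + 1)) (s : R) :
  (forall a, {for s, continuous (fun s => Y s 0 a)}) ->
  {for s, continuous (f \o Y)}.
Proof.
move=> /continuous_row h; apply: continuous_comp => //.
by apply: differentiable_continuous; exact: (smooth_differentiable [::]).
Qed.

(* From the blown up variables to a branch over a half line: the state is
   X (z, s) with parameter lambda = e * s ^ m, and sg is the inverse of
   s |-> s ^ m. *)
Lemma half_branch_of_zeros n q (N : network k n) (e : R) (m : nat) (sg : R -> R)
    (z0 : 'cV[R]_q) (A : 'M[R]_q) (G : 'I_q -> 'cV[R]_q -> R -> R)
    (X : 'cV[R]_q -> R -> 'cV[R]_n) (P : 'cV[R]_n -> Prop) :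
  e ^+ 2 = 1 -> continuous sg -> sg 0 = 0 ->
  (forall x, 0 < x -> 0 < sg x /\ sg x ^+ m = x) ->
  A \in unitmx -> (forall i, sdiff z0 (G i) 0 (row i A)) ->
  (forall i z s, 0 < s -> {for s, continuous (G i z)}) ->
  (forall i, sdiff z0 (fun z s => X z s i 0) 0 0) ->
  (forall i z s, 0 < s -> {for s, continuous (fun s => X z s i 0)}) ->
  (forall z s, 0 < s -> (forall i, G i z s = 0) ->
     admissible N f (X z s) (e * s ^+ m) = 0) ->
  (exists2 r, 0 < r & forall z s, `|z - z0| <= r -> 0 < s <= r -> P (X z s)) ->
  exists dlt b, half_branch N e dlt b P.
Proof.
move=> e2 csg sg0 hsg uA hG cG hX cX GX [rP rP0 hP].
have [dlt [z [d0 zG z_lim z_cont]]] := zero_branch uA hG cG.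
have [d1 d10 hd1] := z_lim _ rP0.
have [rX rX0 hrX] : exists2 r : R, 0 < r & forall i z z' s, `|z - z0| <= r ->
    `|z' - z0| <= r -> 0 < s <= r -> `|X z s i 0 - X z' s i 0| <= `|z - z'|.
  apply: (@common_radius R n (fun i r => forall z z' s, `|z - z0| <= r ->
    `|z' - z0| <= r -> 0 < s <= r -> `|X z s i 0 - X z' s i 0| <= `|z - z'|)).
    move=> i x y /andP[_ yx] K u u' s hu hu' /andP[s0 hs].
    by apply: K; rewrite ?s0 ?(le_trans _ yx).
  move=> i; have [r r0 H] := hX i _ ltr01; exists r => // u u' s hu hu' hs.
  by have [_] := H u u' s hu hu' hs; rewrite mul0mx mxE subr0 mul1r.
have [d2 d20 hd2] := z_lim _ rX0.
pose s1 := Order.min (Order.min dlt d1) (Order.min (Order.min d2 rP) rX).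
have s10 : 0 < s1 by rewrite !lt_min d0 d10 d20 rP0.
have good s : 0 < s <= s1 -> [/\ 0 < s <= dlt, 0 < s <= d1, 0 < s <= d2,
    0 < s <= rP & 0 < s <= rX].
  rewrite !le_min => /andP[s0 /andP[/andP[h1 h2] /andP[/andP[h3 h4] h5]]].
  by rewrite !s0.
have [del del0 hdel] : exists2 del : R, 0 < del & forall x, 0 < x <= del -> 0 < sg x <= s1.
  have /cvgrPdist_le/(_ _ s10) := csg 0.
  rewrite -nbhs_nearE => /nbhs_ballP[r r0 K]; exists (r / 2); first by rewrite divr_gt0.
  move=> x /andP[x0 xr]; have [sx _] := hsg x x0; rewrite sx /=.
  have := K x; rewrite sg0 /= sub0r normrN gtr0_norm//; apply.
  rewrite -ball_normE /= sub0r normrN gtr0_norm//; lra.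
have ee : e * e = 1 by rewrite -expr2.
have el0 l : e * l = 0 -> l = 0 by move=> h; rewrite -[l]mul1r -ee -mulrA h mulr0.
pose x s := X (z s) s.
(* The rescaled solution is meaningful for s > 0 only, so the value at parameter 0 is prescribed and
   continuity there is proved separately. *)
pose b l := if l == 0 then 0 else x (sg (e * l)).
have hl l : half_line e del l -> l != 0 -> 0 < sg (e * l) <= s1.
  move=> /andP[h1 h2] l0; apply: hdel; rewrite h2 andbT lt_neqAle h1 andbT eq_sym.
  by apply: contra l0 => /eqP/el0 ->.
have small eps : 0 < eps -> exists2 t, 0 < t & forall s, 0 < s <= t -> `|x s| <= eps.
  move=> eps0; have [r r0 H] : exists2 r : R, 0 < r & forall i z s, `|z - z0| <= r ->
     0 < s <= r -> `|X z s i 0| <= eps.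
    apply: (@common_radius R n (fun i r => forall z s, `|z - z0| <= r ->
       0 < s <= r -> `|X z s i 0| <= eps)).
      move=> i y y' /andP[_ yx] K u s hu /andP[s0 hs].
      by apply: K; rewrite ?s0 ?(le_trans _ yx).
    move=> i; have [r r0 H] := hX i _ eps0; exists r => // u s hu hs.
    by have [+ _] := H u u s hu hu hs; rewrite subr0.
  have [t t0 ht] := z_lim _ r0; exists (Order.min t r) => [|s]; first by rewrite lt_min t0.
  rewrite le_min => /andP[s0 /andP[st sr]].
  apply: mx_norm_le => [|i j]; first exact: ltW.
  by rewrite ord1; apply: H; rewrite ?s0//; apply: ht; rewrite s0.
exists del, b; split => //.
- apply/subspace_continuousP => l hll.
  apply/cvgrPdist_le => eps eps0.
  have [->|l0] := eqVneq l 0.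
    have [t t0 ht] := small _ eps0.
    have /cvgrPdist_le/(_ _ t0) := csg 0; rewrite sg0.
    rewrite -nbhs_nearE => /nbhs_ballP[r r0 K].
    rewrite /within/= -nbhs_nearE; apply/nbhs_ballP; exists r => // l' hl' hhl'.
    change (`|b 0 - b l'| <= eps).
    rewrite /b eqxx sub0r normrN; have [_|l'0] := eqVneq l' 0; first by rewrite normr0 ltW.
    apply: ht; have /andP[sp _] := hl _ hhl' l'0; rewrite sp /=.
    have := K (e * l'); rewrite sub0r normrN gtr0_norm//; apply.
    have ne : `|e| = 1 by apply/eqP; rewrite -sqrp_eq1// -normrX e2 normr1.
    move: hl'; rewrite -!ball_normE /ball_ /= !sub0r !normrN normrM ne mul1r//.
  have hs := hl _ hll l0; have [g1 g2 g3 g4 g5] := good _ hs.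
  set s := sg (e * l) in hs g1 g2 g3 g4 g5.
  have e20 : 0 < eps / 2 by rewrite divr_gt0.
  have [eta eta0 heta] := z_cont s _ g1 e20.
  have [nu nu0 hnu] : exists2 nu : R, 0 < nu & forall i t, `|s - t| < nu ->
      `|X (z s) s i 0 - X (z s) t i 0| <= eps / 2.
    apply: (@common_radius R n (fun i nu => forall t, `|s - t| < nu ->
      `|X (z s) s i 0 - X (z s) t i 0| <= eps / 2)).
      by move=> i y y' /andP[_ yx] K t ht; apply: K; apply: lt_le_trans yx.
    have s0 : 0 < s by case/andP: hs.
    move=> i; have /cvgrPdist_le/(_ _ e20) := cX i (z s) s s0.
    by rewrite -nbhs_nearE => /nbhs_ballP[nu nu0 K]; exists nu => // t ht; apply: K.
  pose rr := Order.min eta nu / 2.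
  have rr0 : 0 < rr by rewrite divr_gt0// lt_min eta0.
  have /cvgrPdist_le/(_ _ rr0) : {for l, continuous (fun l => sg (e * l))}.
    apply: (@continuous_comp _ _ _ (fun l => e * l) sg); last exact: csg.
    exact: mulrl_continuous.
  rewrite -nbhs_nearE => /nbhs_ballP[r r0 K].
  (* The second radius keeps the compared parameter away from 0, where [b] is given by the other
     case. *)
  rewrite /within/= -nbhs_nearE; apply/nbhs_ballP; exists (Order.min r `|l|).
    by rewrite /= lt_min r0 normr_gt0.
  move=> l' hl' hhl'.
  have l'0 : l' != 0.
    apply/eqP => l'0; move: hl'; rewrite l'0 -ball_normE/ball_/= subr0.
    by rewrite lt_min ltxx andbF.
  have hl'r : ball l r l'.
    by move: hl'; rewrite -!ball_normE /ball_/= lt_min => /andP[].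
  have hs' := hl _ hhl' l'0; have [k1 k2 k3 k4 k5] := good _ hs'.
  set t := sg (e * l') in hs' k1 k2 k3 k4 k5.
  have st : `|s - t| <= rr := K _ hl'r.
  have st' : `|s - t| < Order.min eta nu.
    apply: le_lt_trans st _; rewrite /rr ltr_pdivrMr// ltr_pMr ?ltr1n//.
    by rewrite lt_min eta0.
  move: st'; rewrite lt_min => /andP[st1 st2].
  change (`|b l - b l'| <= eps).
  rewrite /b (negbTE l0) (negbTE l'0) -/s -/t /x.
  apply: mx_norm_le => [|i j]; first exact: ltW.
  rewrite ord1 !mxE.
  have -> : X (z s) s i 0 - X (z t) t i 0 = (X (z s) s i 0 - X (z s) t i 0) +
     (X (z s) t i 0 - X (z t) t i 0) by rewrite addrA subrK.
  rewrite (le_trans (ler_normD _ _))// [leRHS]splitr lerD ?hnu//.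
  apply: le_trans (heta _ k1 st1).
  by apply: hrX => //; apply: hd2.
- split; first by rewrite /b eqxx.
  move=> l hll; rewrite /b; have [->|l0] := eqVneq l 0.
    by apply/colP => i; rewrite admissibleE mxE zrow0 scale0r f00.
  have hs := hl _ hll l0; have [g1 _ _ _ _] := good _ hs.
  have [_ hm] : 0 < sg (e * l) /\ sg (e * l) ^+ m = e * l.
    apply: hsg; case/andP: hll => h1 h2; rewrite lt_neqAle h1 andbT eq_sym.
    by apply: contra l0 => /eqP/el0 ->.
  suff : admissible N f (x (sg (e * l))) (e * sg (e * l) ^+ m) = 0.
    by rewrite hm mulrA ee mul1r.
  by apply: GX; [case/andP: hs|exact: zG].
- move=> l hll l0; rewrite /b (negbTE l0).
  have hs := hl _ hll l0; have [g1 g2 _ g4 _] := good _ hs.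
  by apply: hP => //; apply: hd1.
Qed.

Lemma unitmx_inj n (A : 'M[R]_n) :
  (forall h : 'cV[R]_n, A *m h = 0 -> h = 0) -> A \in unitmx.
Proof.
move=> hA; rewrite -unitmx_tr -row_free_unit -kermx_eq0.
apply/eqP/row_matrixP => i; rewrite row0.
have /(congr1 trmx) : row i (kermx A^T) *m A^T = 0 by rewrite -row_mul mulmx_ker row0.
rewrite trmx_mul trmxK trmx0 => /hA /(congr1 trmx).
by rewrite trmxK trmx0.
Qed.

Lemma sdiff_neq0 q (z0 : 'cV[R]_q) E e l : sdiff z0 E e l -> e != 0 ->
  exists2 r, 0 < r & forall z s, `|z - z0| <= r -> 0 < s <= r -> E z s != 0.
Proof.
move=> h e0; have e2 : 0 < `|e| / 2 by rewrite divr_gt0// normr_gt0.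
have [r r0 H] := h _ e2; exists r => // z s hz hs.
have [+ _] := H z z s hz hz hs; apply: contraTneq => ->.
by rewrite sub0r normrN -ltNge ltr_pdivrMr// ltr_pMr ?normr_gt0// ltr1n.
Qed.

Lemma cont_add (g h : R -> R) s :
  {for s, continuous g} -> {for s, continuous h} ->
  {for s, continuous (fun s => g s + h s)}.
Proof. exact: continuousD. Qed.
Lemma cont_mul (g h : R -> R) s :
  {for s, continuous g} -> {for s, continuous h} ->
  {for s, continuous (fun s => g s * h s)}.
Proof. exact: continuousM. Qed.
Lemma cont_cst (c s : R) : {for s, continuous (fun _ : R => c)}.
Proof. exact: cst_continuous. Qed.
Lemma cont_id (s : R) : {for s, continuous (fun s : R => s)}.
Proof. exact: cvg_id. Qed.
Lemma cont_pow (g : R -> R) m s :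
  {for s, continuous g} -> {for s, continuous (fun s => g s ^+ m)}.
Proof.
move=> h; elim: m => [|m IH]; first exact: cont_cst.
have := cont_mul h IH.
by rewrite (_ : (fun s => _) = (fun s => g s ^+ m.+1))//; apply/funext => t; rewrite exprS.
Qed.
Lemma cont_invpow m s : 0 < s -> {for s, continuous (fun s : R => (s ^+ m)^-1)}.
Proof.
move=> s0; apply: continuousV; first by rewrite expf_neq0// gt_eqF.
exact: (@cont_pow (fun s => s) m s (@cont_id s)).
Qed.

Lemma cont_zrow n (N : network k n) (X : R -> 'cV[R]_n) (l : R -> R) i s :
  (forall i, {for s, continuous (fun s => X s i 0)}) -> {for s, continuous l} ->
  {for s, continuous (fun s => f (zrow N (X s) (l s) i))}.
Proof.
move=> hX hl; apply: (@continuous_response (fun s => zrow N (X s) (l s) i)) => a.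
case: (split_ordP a) => p ->.
  rewrite (_ : (fun s => _) = (fun s => X s (slot N p i) 0)) ?hX//.
  by apply/funext => t; rewrite zrow_l.
rewrite (_ : (fun s => _) = l) ?hl//.
by apply/funext => t; rewrite zrow_r.
Qed.

Lemma sdiffable_zrow n q (z0 : 'cV[R]_q) (N : network k n) i
    (X : 'cV[R]_q -> R -> 'cV[R]_n) (l : 'cV[R]_q -> R -> R) :
  (forall j, sdiffable z0 (fun z s => X z s j 0)) -> sdiffable z0 l ->
  sdiffable_row z0 (fun z s => zrow N (X z s) (l z s) i).
Proof.
move=> hX hl a; case: (split_ordP a) => p ->.
  have := hX (slot N p i); congr sdiffable.
  by apply/funext => z; apply/funext => s; rewrite zrow_l.
move: hl; congr sdiffable.
by apply/funext => z; apply/funext => s; rewrite zrow_r.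
Qed.

Section SimpleEigenvalue.
Variables (n : nat) (N : network k n) (v : 'cV[R]_n) (w : 'rV[R]_n).
Let J := jacobian N (first_derivatives f).
Hypotheses (Jv : J *m v = 0) (wJ : w *m J = 0) (wv : (w *m v) 0 0 = 1).
Hypothesis kerJ : forall h : 'cV[R]_n, J *m h = 0 -> (w *m h) 0 0 = 0 -> h = 0.
Let T1 := (w *m lin_lambda N v) 0 0.
Hypothesis T10 : T1 != 0.

Let wD (a b : 'cV[R]_n) : (w *m (a + b)) 0 0 = (w *m a) 0 0 + (w *m b) 0 0.
Proof. by rewrite mulmxDr mxE. Qed.
Let wZ (c : R) (a : 'cV[R]_n) : (w *m (c *: a)) 0 0 = c * (w *m a) 0 0.
Proof. by rewrite -scalemxAr mxE. Qed.
Let wJh (h : 'cV[R]_n) : (w *m (J *m h)) 0 0 = 0.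
Proof. by rewrite mulmxA wJ mul0mx mxE. Qed.
Let mul_rank1 (u h : 'cV[R]_n) : u *m w *m h = (w *m h) 0 0 *: u.
Proof.
by rewrite -mulmxA {1}[w *m h]mx11_scalar mul_mx_scalar.
Qed.

Lemma rank1_perturbation_unit (u : 'cV[R]_n) :
  (w *m u) 0 0 != 0 -> J + u *m w \in unitmx.
Proof.
move=> wu; apply: unitmx_inj => h; rewrite mulmxDl mul_rank1 => e.
have : (w *m (J *m h + (w *m h) 0 0 *: u)) 0 0 = 0 by rewrite e mulmx0 mxE.
rewrite wD wZ wJh add0r => /eqP; rewrite mulf_eq0 (negbTE wu) orbF => /eqP h0.
by apply: kerJ => //; move: e; rewrite h0 scale0r addr0.
Qed.

(** The Fredholm alternative: the inverse of the bordered matrix gives the solution, and applying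
    [w] shows that the border contributes nothing. *)
Lemma range_solve (u : 'cV[R]_n) : (w *m u) 0 0 = 0 ->
  exists2 r : 'cV[R]_n, J *m r = u & (w *m r) 0 0 = 0.
Proof.
move=> wu; have uA : J + v *m w \in unitmx.
  by apply: rank1_perturbation_unit; rewrite wv oner_eq0.
exists (invmx (J + v *m w) *m u).
  have e := mulKVmx uA u; rewrite mulmxDl mul_rank1 in e.
  have : (w *m (J *m (invmx (J + v *m w) *m u) +
      (w *m (invmx (J + v *m w) *m u)) 0 0 *: v)) 0 0 = 0 by rewrite e.
  rewrite wD wZ wJh add0r wv mulr1 => h0.
  by move: e; rewrite h0 scale0r addr0.
have e := mulKVmx uA u; rewrite mulmxDl mul_rank1 in e.
have : (w *m (J *m (invmx (J + v *m w) *m u) +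
      (w *m (invmx (J + v *m w) *m u)) 0 0 *: v)) 0 0 = 0 by rewrite e.
by rewrite wD wZ wJh add0r wv mulr1.
Qed.

Let y (z : 'cV[R]_n) : R := (w *m z) 0 0.

(** Ansatz x = s (y v + s r) with parameter s. At order s^2 the equation is J r + y^2 Q / 2 + y L =
    0, whose solvability condition y (T2 y / 2 + T1) = 0 has the nonzero root [y0]. The unknown z
    stores y as its component along [w] and r as the rest. *)
Lemma transcritical_branch :
  (w *m quad N v v) 0 0 != 0 ->
  exists dlt b, half_branch N 1 dlt b (fun x => x != 0).
Proof.
set T2 := (w *m quad N v v) 0 0 => T20.
pose Q := quad N v v; pose L := lin_lambda N v.
pose y0 := - 2 * T1 / T2.
have y00 : y0 != 0 by rewrite !mulf_neq0 ?invr_eq0 ?oppr_eq0 ?pnatr_eq0.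
pose u := - (2^-1 * y0 ^+ 2 *: Q + y0 *: L).
have wu : (w *m u) 0 0 = 0.
  rewrite /u mulmxN mxE wD !wZ -/T1 -/T2; apply/eqP; rewrite oppr_eq0; apply/eqP.
  by rewrite /y0; field.
have [r0 Jr0 wr0] := range_solve wu.
pose z0 := y0 *: v + r0.
have yz0 : y z0 = y0 by rewrite /y wD wZ wv mulr1 wr0 addr0.
have Jz0 : J *m z0 = u by rewrite mulmxDr -scalemxAr Jv scaler0 add0r.
(* The derivative of the order s^2 equation in z; the component of its border under [w] is y0 T2 +
   T1 = - T1. *)
pose A := J + (y0 *: Q + L) *m w.
have uA : A \in unitmx.
  apply: rank1_perturbation_unit; rewrite wD wZ -/T1 -/T2.
  have -> : y0 * T2 + T1 = - T1 by rewrite /y0; field.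
  by rewrite oppr_eq0.
pose X (z : 'cV[R]_n) (s : R) := s *: (y z *: v + s *: (z - y z *: v)).
pose G i z s := f (zrow N (X z s) s i) / s ^+ 2.
have sy : sdiff z0 (fun z _ => y z) y0 w by rewrite -yz0; exact: sdiff_row.
have sby : sdiffable z0 (fun z _ => y z) by exists y0, w.
have sbX j : sdiffable z0 (fun z s => (y z *: v + s *: (z - y z *: v)) j 0).
  have := sdiffable_add (sdiffable_mul sby (sdiffable_const z0 (v j 0)))
    (sdiffable_mul (sdiffable_time z0) (sdiffable_add (sdiffable_coord z0 j)
       (sdiffable_opp (sdiffable_mul sby (sdiffable_const z0 (v j 0)))))).
  by congr sdiffable; apply/funext => z; apply/funext => s; rewrite !mxE.
have cX j z s : 0 < s -> {for s, continuous (fun s => X z s j 0)}.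
  move=> s0; rewrite (_ : (fun s => _) = (fun s => s * (y z * v j 0 + s * (z j 0 - y z * v j 0)))).
    apply: cont_mul; first exact: cont_id.
    apply: cont_add; first exact: cont_cst.
    by apply: cont_mul; [exact: cont_id|exact: cont_cst].
  by apply/funext => t; rewrite !mxE.
apply: (@half_branch_of_zeros n n N 1 1 id z0 A G X) => //.
- by rewrite expr1n.
- by move=> x; exact: cvg_id.
- move=> i.
  pose P z := y z *: zrow N v 0 i + erow.
  pose W z := zrow N (z - y z *: v) 0 i.
  have zE z s : zrow N (X z s) s i = s *: (P z + s *: W z).
    rewrite zrow_split /X !(zrowZ0, zrowD0 N (y z *: v), zrowD0 N (s *: _)) /P -/(W z).
    move: (erow) (W z) (zrow N v 0 i) => a c b.
    by apply/rowP => j; rewrite !mxE; ring.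
  have sP : sdiffable_row z0 (fun z _ => P z).
    apply: sdiffable_row_add; last exact: sdiffable_row_const.
    by apply: sdiffable_row_scale => //; exact: sdiffable_row_const.
  have sW : sdiffable_row z0 (fun z _ => W z).
    apply: sdiffable_zrow; last exact: sdiffable_const.
    move=> j; have := sdiffable_add (sdiffable_coord z0 j)
       (sdiffable_opp (sdiffable_mul sby (sdiffable_const z0 (v j 0)))).
    by congr sdiffable; apply/funext => z; apply/funext => s; rewrite !mxE.
  have sZ : sdiffable_row z0 (fun z s => P z + s *: W z).
    apply: sdiffable_row_add => //; apply: sdiffable_row_scale => //.
    exact: sdiffable_time.
  have [_ l2 _] := taylor_lipschitz sf.
  have sR := sdiff_remainder l2 sZ.
  have sS : sdiffable z0 (fun z s =>
      2^-1 * (jet2 f (W z) (P z + s *: W z) + jet2 f (P z) (W z))).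
    by apply: sdiffable_mul; [exact: sdiffable_const|apply: sdiffable_add; exact: sdiffable_jet2].
  have hh := sdiff_add (sdiff_add (sdiff_add (sdiff_row z0 (row i J))
     (sdiff_add (sdiff_mul (sdiff_const z0 (2^-1 * Q i 0)) (sdiff_mul sy sy))
        (sdiff_mul (sdiff_const z0 (L i 0)) sy)))
     (sdiff_time_mul sS)) sR.
  apply: (sdiff_eq hh).
  + move=> z s s0; have sn : s != 0 by rewrite gt_eqF.
    rewrite /G zE {1}(rem2E f) f00 jet1Z jet2Zl jet2Zr.
    rewrite jet1D jet1Z /P jet1D jet1Z jet1_zrow Jv mxE mulr0 add0r jet1_erow.
    rewrite add0r jet1_zrow mulmxBr -scalemxAr Jv scaler0 subr0 -row_mul mxE -/(P z).
    rewrite jet2Dl jet2Dr (jet2Zl f s (W z)) (jet2Zr f s (W z) (P z)).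
    rewrite {1 2}/P !jet2Dl !jet2Dr !jet2Zl !jet2Zr jet2_erow.
    rewrite (jet2C (erow) _ sf) /Q /L !mxE.
    by field.
  + by rewrite -row_mul mxE Jz0 /u !mxE; field.
  + by apply/rowP => j; rewrite !mxE big_ord1 !mxE; field.
- by move=> i z s s0; apply: cont_mul; [apply: cont_zrow; [move=> j; exact: cX|exact: cont_id]|exact: cont_invpow].
- move=> i; have := sdiff_time_mul (sbX i).
  by congr sdiff; apply/funext => z; apply/funext => s; rewrite [in RHS]mxE.
- move=> z s s0 hG; rewrite mul1r expr1; apply/colP => i; rewrite admissibleE mxE.
  by have := hG i => /eqP; rewrite /G mulf_eq0 invr_eq0 expf_eq0/= (gt_eqF s0) orbF => /eqP.
- have [r rr0 H] := sdiff_neq0 sy y00; exists r => // z s hz hs.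
  apply: contraNneq (H z s hz hs) => X0.
  have s0 : s != 0 by case/andP: hs => /gt_eqF ->.
  have : (w *m X z s) 0 0 = 0 by rewrite X0 mulmx0 mxE.
  have -> : (w *m X z s) 0 0 = s * y z.
    by rewrite /X wZ wD !wZ -scaleNr wD wZ wv mulr1 mulr1 subrr mulr0 addr0.
  by move/eqP; rewrite mulf_eq0 (negbTE s0).
Qed.

(** [W2] solves the order s^2 equation, which forces the quadratic coefficient to be 0. The ansatz x
    = s y v + s^2 y^2 W2 + s^3 r with parameter e s^2 leaves J r + y^3 C + e y L = 0 at order s^3,
    with solvability condition y (K y^2 + e T1) = 0. *)
Lemma pitchfork_branch (W2 : 'cV[R]_n) :
  J *m W2 = - 2^-1 *: quad N v v ->
  (w *m (quad N v W2 + 6^-1 *: cubic N v)) 0 0 != 0 ->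
  exists e dlt b, half_branch N e dlt b (fun x => x != 0).
Proof.
move=> JW2; set C := quad N v W2 + _ => K0; set K := (w *m C) 0 0 in K0.
pose L := lin_lambda N v; pose Q := quad N v v.
(* The side of 0 on which y^2 = - e T1 / K is positive. *)
pose e : R := - Num.sg (T1 / K).
have TK0 : T1 / K != 0 by rewrite mulf_neq0// invr_eq0.
have e2 : e ^+ 2 = 1 by rewrite sqrrN sqr_sg TK0.
pose y0 := Num.sqrt `|T1 / K|.
have y00 : y0 != 0 by rewrite gt_eqF// sqrtr_gt0 normr_gt0.
have y02 : y0 ^+ 2 * K = - e * T1.
  have aux (a b c : R) : c != 0 -> a * (b / c) * c = a * b by move=> ?; field.
  by rewrite sqr_sqrtr// opprK normrEsg; exact: aux.
pose u := - (y0 ^+ 3 *: C + (e * y0) *: L).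
have wu : (w *m u) 0 0 = 0.
  rewrite /u mulmxN mxE wD !wZ -/T1 -/K exprSr.
  have -> : y0 ^+ 2 * y0 * K = y0 ^+ 2 * K * y0 by ring.
  by rewrite y02; ring.
have [r0 Jr0 wr0] := range_solve wu.
pose z0 := y0 *: v + r0.
have yz0 : y z0 = y0 by rewrite /y wD wZ wv mulr1 wr0 addr0.
have Jz0 : J *m z0 = u by rewrite mulmxDr -scalemxAr Jv scaler0 add0r.
pose A := J + ((3 * y0 ^+ 2) *: C + e *: L) *m w.
have uA : A \in unitmx.
  apply: rank1_perturbation_unit; rewrite wD !wZ -/T1 -/K -mulrA y02.
  have -> : 3 * (- e * T1) + e * T1 = - (2 * (e * T1)) by ring.
  by rewrite oppr_eq0 !mulf_neq0 ?pnatr_eq0// oppr_eq0 sgr_eq0.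
pose X (z : 'cV[R]_n) (s : R) :=
  s *: (y z *: v + s *: (y z ^+ 2 *: W2 + s *: (z - y z *: v))).
pose G i z s := f (zrow N (X z s) (e * s ^+ 2) i) / s ^+ 3.
have sy : sdiff z0 (fun z _ => y z) y0 w by rewrite -yz0; exact: sdiff_row.
have sby : sdiffable z0 (fun z _ => y z) by exists y0, w.
have sbr j : sdiffable z0 (fun z s => (z - y z *: v) j 0).
  have := sdiffable_add (sdiffable_coord z0 j)
       (sdiffable_opp (sdiffable_mul sby (sdiffable_const z0 (v j 0)))).
  by congr sdiffable; apply/funext => z; apply/funext => s; rewrite !mxE.
have sbX j : sdiffable z0 (fun z s =>
    (y z *: v + s *: (y z ^+ 2 *: W2 + s *: (z - y z *: v))) j 0).
  have := sdiffable_add (sdiffable_mul sby (sdiffable_const z0 (v j 0)))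
    (sdiffable_mul (sdiffable_time z0) (sdiffable_add
      (sdiffable_mul (sdiffable_mul sby sby) (sdiffable_const z0 (W2 j 0)))
      (sdiffable_mul (sdiffable_time z0) (sbr j)))).
  by congr sdiffable; apply/funext => z; apply/funext => s; rewrite !mxE.
have cX j z s : 0 < s -> {for s, continuous (fun s => X z s j 0)}.
  move=> s0; rewrite (_ : (fun s => _) = (fun s => s * (y z * v j 0 +
      s * (y z ^+ 2 * W2 j 0 + s * (z j 0 - y z * v j 0))))).
    apply: cont_mul; first exact: cont_id.
    apply: cont_add; first exact: cont_cst.
    apply: cont_mul; first exact: cont_id.
    apply: cont_add; first exact: cont_cst.
    by apply: cont_mul; [exact: cont_id|exact: cont_cst].
  by apply/funext => t; rewrite !mxE.
exists e.
apply: (@half_branch_of_zeros n n N e 2 Num.sqrt z0 A G X) => //.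
- exact: sqrt_continuous.
- exact: sqrtr0.
- by move=> x x0; rewrite sqrtr_gt0 x0 sqr_sqrtr// ltW.
- move=> i.
  pose Z1 := zrow N v 0 i; pose B := zrow N W2 0 i.
  pose D z := y z ^+ 2 *: B + e *: erow.
  have QE : Q i 0 = jet2 f Z1 Z1 by rewrite mxE.
  have LE : L i 0 = jet2 f Z1 erow by rewrite mxE.
  have CE : C i 0 = jet2 f Z1 B + 6^-1 * jet3 f Z1 Z1 Z1.
    by rewrite /C mxE; congr (_ + _); rewrite mxE; [|congr (_ * _); rewrite mxE].
  pose W z := zrow N (z - y z *: v) 0 i.
  have zE z s : zrow N (X z s) (e * s ^+ 2) i =
      s *: (y z *: Z1 + s *: (D z + s *: W z)).
    rewrite zrow_split /X !(zrowZ0, zrowD0) /D /W /Z1 /B zrowD0.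
    move: (erow) (zrow N (- _) 0 i) (zrow N z 0 i) (zrow N v 0 i) (zrow N W2 0 i).
    move=> a c c' b1 b2.
    by apply/rowP => j; rewrite !mxE; ring.
  have sD : sdiffable_row z0 (fun z _ => D z).
    apply: sdiffable_row_add; last exact: sdiffable_row_const.
    by apply: sdiffable_row_scale; [exact: sdiffable_exp|exact: sdiffable_row_const].
  have sW : sdiffable_row z0 (fun z _ => W z).
    by apply: sdiffable_zrow => //; exact: sdiffable_const.
  pose V z s := D z + s *: W z.
  have sV : sdiffable_row z0 V.
    by apply: sdiffable_row_add => //; apply: sdiffable_row_scale => //; exact: sdiffable_time.
  have sP : sdiffable_row z0 (fun z _ => y z *: Z1).
    by apply: sdiffable_row_scale => //; exact: sdiffable_row_const.
  have sZ : sdiffable_row z0 (fun z s => y z *: Z1 + s *: V z s).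
    by apply: sdiffable_row_add => //; apply: sdiffable_row_scale => //; exact: sdiffable_time.
  have [_ _ l3] := taylor_lipschitz sf.
  have sR := sdiff_remainder l3 sZ.
  have sS2 : sdiffable z0 (fun z s =>
      y z * jet2 f Z1 (W z) + 2^-1 * jet2 f (V z s) (V z s)).
    apply: sdiffable_add; apply: sdiffable_mul => //; try exact: sdiffable_const;
      apply: sdiffable_jet2 => //; exact: sdiffable_row_const.
  pose S3 z s := 6^-1 * (jet3 f (V z s) (y z *: Z1 + s *: V z s) (y z *: Z1 + s *: V z s)
    + jet3 f (y z *: Z1) (V z s) (y z *: Z1 + s *: V z s)
    + jet3 f (y z *: Z1) (y z *: Z1) (V z s)).
  have sS3 : sdiffable z0 S3.
    apply: sdiffable_mul; first exact: sdiffable_const.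
    by apply: sdiffable_add; [apply: sdiffable_add|]; apply: sdiffable_jet3.
  have sS := sdiffable_add sS2 sS3.
  have hh := sdiff_add (sdiff_add (sdiff_add (sdiff_row z0 (row i J))
     (sdiff_add (sdiff_mul (sdiff_const z0 (C i 0)) (sdiff_mul sy (sdiff_mul sy sy)))
        (sdiff_mul (sdiff_const z0 (e * L i 0)) sy)))
     (sdiff_time_mul sS)) sR.
  apply: (sdiff_eq hh).
  + move=> z s s0; have sn : s != 0 by rewrite gt_eqF.
    rewrite /G zE -/(V z s) {1}(rem3E f) f00 jet1Z jet2Zl jet2Zr jet3Z1 jet3Z2 jet3Z3.
    have -> : jet3 f (y z *: Z1 + s *: V z s) (y z *: Z1 + s *: V z s)
        (y z *: Z1 + s *: V z s) = y z ^+ 3 * jet3 f Z1 Z1 Z1 + s * (6 * S3 z s).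
      rewrite /S3 mulrA divff ?pnatr_eq0// mul1r.
      rewrite jet3_perturb.
      have -> : jet3 f (y z *: Z1) (y z *: Z1) (y z *: Z1) =
          y z ^+ 3 * jet3 f Z1 Z1 Z1 by rewrite jet3Z1 jet3Z2 jet3Z3; ring.
      by [].
    rewrite jet1D !jet1Z jet1_zrow Jv mxE mulr0 add0r /V jet1D jet1Z -/(V z s).
    rewrite {1}/D jet1D !jet1Z jet1_erow mulr0 addr0 jet1_zrow JW2.
    rewrite jet1_zrow mulmxBr -scalemxAr Jv scaler0 subr0 -row_mul mxE.
    rewrite [row i _ 0 0]mxE.
    have -> : jet2 f (y z *: Z1 + s *: V z s) (y z *: Z1 + s *: V z s) =
       y z ^+ 2 * Q i 0 + 2 * s * (y z * (y z ^+ 2 * jet2 f Z1 B + e * L i 0)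
         + s * (y z * jet2 f Z1 (W z))) + s ^+ 2 * jet2 f (V z s) (V z s).
      rewrite jet2_square (jet2C (V z s) Z1 sf).
      have -> : jet2 f Z1 (V z s) =
          y z ^+ 2 * jet2 f Z1 B + e * L i 0 + s * jet2 f Z1 (W z).
        by rewrite /V /D !jet2Dr !jet2Zr LE.
      by rewrite QE; ring.
    rewrite -/Q -/J CE; move: (rem3 f _) (S3 z s) ((J *m z) i 0) => r t j.
    by field.
  + by rewrite -row_mul [row i _ 0 0]mxE Jz0 /u !mxE; ring.
  + by apply/rowP => j; rewrite !mxE big_ord1 !mxE; ring.
- by move=> i z s s0; apply: cont_mul; [apply: cont_zrow; [move=> j; exact: cX|
    apply: cont_mul; [exact: cont_cst|exact: (@cont_pow id 2 s (@cont_id s))]]|exact: cont_invpow].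
- move=> i; have := sdiff_time_mul (sbX i).
  by congr sdiff; apply/funext => z; apply/funext => s; rewrite [in RHS]mxE.
- move=> z s s0 hG; apply/colP => i; rewrite admissibleE mxE.
  by have := hG i => /eqP; rewrite /G mulf_eq0 invr_eq0 expf_eq0/= (gt_eqF s0) orbF => /eqP.
- have sw : sdiff z0 (fun z s => y z + s * (y z ^+ 2 * y W2)) (y0 + 0) (w + 0).
    apply: sdiff_add => //; apply: sdiff_time_mul; apply: sdiffable_mul.
      exact: sdiffable_exp.
    exact: sdiffable_const.
  rewrite addr0 in sw.
  have [r rr0 H] := sdiff_neq0 sw y00; exists r => // z s hz hs.
  apply: contraNneq (H z s hz hs) => X0.
  have s0 : s != 0 by case/andP: hs => /gt_eqF ->.
  have : (w *m X z s) 0 0 = 0 by rewrite X0 mulmx0 mxE.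
  rewrite /X wZ wD !wZ wD !wZ wv mulr1.
  have -> : (w *m (z - y z *: v)) 0 0 = 0.
    by rewrite -scaleNr wD wZ wv mulr1 subrr.
  rewrite mulr0 addr0 -/(y W2).
  by move/eqP; rewrite mulf_eq0 (negbTE s0).
Qed.

End SimpleEigenvalue.

End Branches.

(** * Branches of feedforward and chain networks *)

Section ThreeCells.
Variables (R : realType) (k : nat) (f : response R k).
Hypothesis sf : smooth_on setT f.
Hypothesis f0 : forall l : R, f (row_mx 0 l%:M) = 0.
Variables (N : network k 3) (a b c : 'I_3).
Hypotheses (ab : a != b) (ac : a != c) (bc : b != c).
Hypothesis abc : forall i : 'I_3, [\/ i = a, i = b | i = c].

Definition case3 (T : Type) (x y z : T) (i : 'I_3) : T :=
  if i == a then x else if i == b then y else z.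

Lemma case3E T (x y z : T) :
  [/\ case3 x y z a = x, case3 x y z b = y & case3 x y z c = z].
Proof.
have ba : (b == a) = false by rewrite eq_sym (negbTE ab).
have ca : (c == a) = false by rewrite eq_sym (negbTE ac).
have cb : (c == b) = false by rewrite eq_sym (negbTE bc).
by rewrite /case3 !eqxx ba ca cb.
Qed.

Lemma sum3 (g : 'I_3 -> R) : \sum_i g i = g a + g b + g c.
Proof.
rewrite (bigD1 a)//= (bigD1 b) 1?eq_sym//= (bigD1 c); last by rewrite eq_sym ac eq_sym bc.
rewrite big1 => [|i /andP[/andP[ia ib] ic]]; first by rewrite /= addr0 addrA.
by case: (abc i) => e; rewrite e eqxx in ia ib ic.
Qed.

Lemma half_branch3 (e : R) (m : nat) (sg : R -> R) (z0 : 'cV[R]_3)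
    (g1 g2 g3 : 'cV[R]_3 -> R -> R) (l1 l2 l3 : 'rV[R]_3)
    (X1 X2 X3 : 'cV[R]_3 -> R -> R) (P : 'cV[R]_3 -> Prop) :
  e ^+ 2 = 1 -> continuous sg -> sg 0 = 0 ->
  (forall x, 0 < x -> 0 < sg x /\ sg x ^+ m = x) ->
  (forall h : 'cV[R]_3, (l1 *m h) 0 0 = 0 -> (l2 *m h) 0 0 = 0 ->
      (l3 *m h) 0 0 = 0 -> h = 0) ->
  sdiff z0 g1 0 l1 -> sdiff z0 g2 0 l2 -> sdiff z0 g3 0 l3 ->
  (forall z s, 0 < s -> [/\ {for s, continuous (g1 z)},
     {for s, continuous (g2 z)} & {for s, continuous (g3 z)}]) ->
  sdiff z0 X1 0 0 -> sdiff z0 X2 0 0 -> sdiff z0 X3 0 0 ->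
  (forall z s, 0 < s -> [/\ {for s, continuous (X1 z)},
     {for s, continuous (X2 z)} & {for s, continuous (X3 z)}]) ->
  (forall z s, 0 < s -> g1 z s = 0 -> g2 z s = 0 -> g3 z s = 0 ->
     forall x : 'cV[R]_3, x a 0 = X1 z s -> x b 0 = X2 z s -> x c 0 = X3 z s ->
     [/\ f (zrow N x (e * s ^+ m) a) = 0, f (zrow N x (e * s ^+ m) b) = 0
       & f (zrow N x (e * s ^+ m) c) = 0]) ->
  (exists2 r, 0 < r & forall z s, `|z - z0| <= r -> 0 < s <= r ->
     forall x : 'cV[R]_3, x a 0 = X1 z s -> x b 0 = X2 z s -> x c 0 = X3 z s -> P x) ->
  exists dlt br, half_branch f N e dlt br P.
Proof.
move=> e2 csg sg0 hsg linj h1 h2 h3 cg hX1 hX2 hX3 cX zero [r r0 hP].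
pose G i := case3 g1 g2 g3 i.
pose X z s : 'cV[R]_3 := \col_i case3 (X1 z s) (X2 z s) (X3 z s) i.
pose A : 'M[R]_3 := \matrix_i case3 l1 l2 l3 i.
have XE z s : [/\ X z s a 0 = X1 z s, X z s b 0 = X2 z s & X z s c 0 = X3 z s].
  by case: (case3E (X1 z s) (X2 z s) (X3 z s)) => ea eb ec; rewrite !mxE ea eb ec.
have [Ga Gb Gc] := case3E g1 g2 g3; have [la lb lc] := case3E l1 l2 l3.
apply: (half_branch_of_zeros f0 (A := A) (G := G) (X := X) (z0 := z0) (m := m)
  (sg := sg) (e := e)) => //.
- apply: unitmx_inj => h Ah.
  have row0' i : (row i A *m h) 0 0 = 0.
    by rewrite -row_mul Ah mxE mxE.
  apply: linj; [move: (row0' a)|move: (row0' b)|move: (row0' c)];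
    by rewrite rowK ?la ?lb ?lc.
- by move=> i; rewrite rowK; case: (abc i) => ->; rewrite /G ?Ga ?Gb ?Gc ?la ?lb ?lc.
- move=> i z s /(cg z)[c1 c2 c3].
  by case: (abc i) => ->; rewrite /G ?Ga ?Gb ?Gc.
- move=> i; case: (abc i) => ->; [move: hX1|move: hX2|move: hX3]; congr sdiff;
    by apply/funext => z; apply/funext => s; case: (XE z s).
- move=> i z s /(cX z)[c1 c2 c3].
  have ext (g h : R -> R) : (forall t, g t = h t) ->
      {for s, continuous h} -> {for s, continuous g} by move=> /funext ->.
  by case: (abc i) => ->; [apply: ext c1|apply: ext c2|apply: ext c3] => t;
    case: (XE z t).
- move=> z s s0 hG; have [ea eb ec] := XE z s.
  have [|||za zb zc] := zero z s s0 _ _ _ _ ea eb ec.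
  + by move: (hG a); rewrite /G Ga.
  + by move: (hG b); rewrite /G Gb.
  + by move: (hG c); rewrite /G Gc.
  by apply/colP => i; rewrite admissibleE mxE; case: (abc i) => ->.
- exists r => // z s hz hs; have [ea eb ec] := XE z s.
  exact: hP ea eb ec.
Qed.

Definition cont_row d (Y : R -> 'rV[R]_d) (s : R) : Prop :=
  forall a, {for s, continuous (fun s => Y s 0 a)}.

Lemma cont_row_const d (u : 'rV[R]_d) s : cont_row (fun=> u) s.
Proof. by move=> j; exact: cont_cst. Qed.
Lemma cont_row_add d (Y W : R -> 'rV[R]_d) s :
  cont_row Y s -> cont_row W s -> cont_row (fun s => Y s + W s) s.
Proof.
move=> hY hW j; rewrite (_ : (fun s => _) = fun s => Y s 0 j + W s 0 j).
  exact: cont_add (hY j) (hW j).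
by apply/funext => t; rewrite mxE.
Qed.
Lemma cont_row_scale d (g : R -> R) (Y : R -> 'rV[R]_d) s :
  {for s, continuous g} -> cont_row Y s -> cont_row (fun s => g s *: Y s) s.
Proof.
move=> hg hY j; rewrite (_ : (fun s => _) = fun s => g s * Y s 0 j).
  exact: cont_mul hg (hY j).
by apply/funext => t; rewrite mxE.
Qed.
Lemma cont_row_response (Y : R -> 'rV[R]_(k.+1 + 1)) s :
  cont_row Y s -> {for s, continuous (fun s => f (Y s))}.
Proof. exact: (continuous_response sf). Qed.

Local Notation e_ := (erow R k).
Let je := jet1_erow sf f0.
Let jee := jet2_erow sf f0.
Let f00' : f 0 = 0 := f00 f0.

Lemma row_delta (i : 'I_3) (h : 'cV[R]_3) : (('e_i : 'rV[R]_3) *m h) 0 0 = h i 0.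
Proof. by rewrite -rowE mxE. Qed.

Lemma row_mulD (l l' : 'rV[R]_3) (h : 'cV[R]_3) :
  ((l + l') *m h) 0 0 = (l *m h) 0 0 + (l' *m h) 0 0.
Proof. by rewrite mulmxDl mxE. Qed.

Lemma row_mulZ x (l : 'rV[R]_3) (h : 'cV[R]_3) :
  ((x *: l) *m h) 0 0 = x * (l *m h) 0 0.
Proof. by rewrite -scalemxAl mxE. Qed.

Lemma cont_quotient (Y : R -> 'rV[R]_(k.+1 + 1)) m s : 0 < s ->
  cont_row Y s -> {for s, continuous (fun s => f (Y s) / s ^+ m)}.
Proof.
move=> s0 hY; apply: (@cont_mul _ (fun s => f (Y s)) (fun s => (s ^+ m)^-1)).
  exact: cont_row_response.
exact: cont_invpow.
Qed.

Lemma cont_row_time d (Y : R -> 'rV[R]_d) s :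
  cont_row Y s -> cont_row (fun s => s *: Y s) s.
Proof. by apply: (@cont_row_scale d id); exact: cont_id. Qed.

Lemma cont_time (x s : R) : {for s, continuous (fun s : R => s * x)}.
Proof. exact: (@cont_mul R id (fun=> x) s (@cont_id R s) (@cont_cst R x s)). Qed.

(** Cells [a] and [b] obey the same scalar equation, which undergoes a transcritical bifurcation.
    Giving the nontrivial solution to [a] and the trivial one to [b] breaks their synchrony; cell
    [c] is driven by both and can follow because its own eigenvalue [mu] is not 0. *)
Lemma feedforward_branch (u eta ka kb : 'rV[R]_(k.+1 + 1)) :
  (forall x l, zrow N x l a = x a 0 *: u + l *: e_) ->
  (forall x l, zrow N x l b = x b 0 *: u + l *: e_) ->
  (forall x l, zrow N x l c = x c 0 *: eta + x a 0 *: ka + x b 0 *: kb + l *: e_) ->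
  jet1 f u = 0 -> jet2 f u u != 0 -> jet2 f u e_ != 0 -> jet1 f eta != 0 ->
  exists dlt br, half_branch f N 1 dlt br (fun x => x a 0 != x b 0).
Proof.
move=> za zb zc fu; set T2 := jet2 f u u; set T1 := jet2 f u e_; set mu := jet1 f eta.
move=> T20 T10 mu0.
pose y1 := - 2 * T1 / T2; pose y3 := - (y1 * jet1 f ka) / mu.
have y10 : y1 != 0 by rewrite !mulf_neq0 ?invr_eq0 ?oppr_eq0 ?pnatr_eq0.
pose z0 : 'cV[R]_3 := \col_i case3 y1 0 y3 i.
have [e1 e2 e3] := case3E y1 0 y3.
have [z0a z0b z0c] : [/\ z0 a 0 = y1, z0 b 0 = 0 & z0 c 0 = y3] by rewrite !mxE.
have [_ l2 _] := taylor_lipschitz sf; have [l1 _ _] := taylor_lipschitz sf.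
have quadratic i : sdiff z0 (fun z s => f (s *: (z i 0 *: u + e_)) / s ^+ 2)
    (2^-1 * T2 * (z0 i 0 * z0 i 0) + T1 * z0 i 0) ((T2 * z0 i 0 + T1) *: 'e_i).
  have sZ : sdiffable_row z0 (fun z s => z i 0 *: u + e_).
    apply: sdiffable_row_add; last exact: sdiffable_row_const.
    by apply: sdiffable_row_scale; [exact: sdiffable_coord|exact: sdiffable_row_const].
  have hh := sdiff_add (sdiff_add
     (sdiff_mul (sdiff_const z0 (2^-1 * T2)) (sdiff_mul (sdiff_coord z0 i) (sdiff_coord z0 i)))
     (sdiff_mul (sdiff_const z0 T1) (sdiff_coord z0 i))) (sdiff_remainder l2 sZ).
  apply: (sdiff_eq hh); last 2 first.
  - by rewrite addr0.
  - by apply/rowP => j; rewrite !mxE; field.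
  move=> z s s0; have sn : s != 0 by rewrite gt_eqF.
  rewrite {1}(rem2E f) f00' !jet1Z jet1D jet1Z fu je jet2Zl jet2Zr.
  rewrite -{1 2}[e_]scale1r jet2_square jee (jet2C e_ u sf) -/T1 -/T2.
  by field.
have third : sdiff z0 (fun z s =>
    f (s *: (z c 0 *: eta + z a 0 *: ka + z b 0 *: kb + e_)) / s ^+ 1)
    0 (mu *: 'e_c + jet1 f ka *: 'e_a + jet1 f kb *: 'e_b).
  have sZ : sdiffable_row z0 (fun z s => z c 0 *: eta + z a 0 *: ka + z b 0 *: kb + e_).
    apply: sdiffable_row_add; last exact: sdiffable_row_const.
    apply: sdiffable_row_add; last exact: sdiffable_row_coord.
    by apply: sdiffable_row_add; exact: sdiffable_row_coord.
  have hh := sdiff_add (sdiff_add (sdiff_add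
     (sdiff_mul (sdiff_const z0 mu) (sdiff_coord z0 c))
     (sdiff_mul (sdiff_const z0 (jet1 f ka)) (sdiff_coord z0 a)))
     (sdiff_mul (sdiff_const z0 (jet1 f kb)) (sdiff_coord z0 b))) (sdiff_remainder l1 sZ).
  apply: (sdiff_eq hh); last 2 first.
  - by rewrite z0a z0b z0c /y3; field.
  - by apply/rowP => j; rewrite !mxE; ring.
  move=> z s s0; have sn : s != 0 by rewrite gt_eqF.
  rewrite {1}(rem1E f) f00' !jet1Z !jet1D !jet1Z je -/mu.
  by field.
have sc i : sdiff z0 (fun z s => s * z i 0) 0 0.
  by apply: sdiff_time_mul; exact: sdiffable_coord.
apply: (half_branch3 (m := 1) (sg := id) (z0 := z0)
  (g1 := fun z s => f (s *: (z a 0 *: u + e_)) / s ^+ 2)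
  (g2 := fun z s => f (s *: (z b 0 *: u + e_)) / s ^+ 2)
  (g3 := fun z s => f (s *: (z c 0 *: eta + z a 0 *: ka + z b 0 *: kb + e_)) / s ^+ 1)
  (l1 := (T2 * y1 + T1) *: 'e_a) (l2 := T1 *: 'e_b)
  (l3 := mu *: 'e_c + jet1 f ka *: 'e_a + jet1 f kb *: 'e_b)
  (X1 := fun z s => s * z a 0) (X2 := fun z s => s * z b 0)
  (X3 := fun z s => s * z c 0)) => //.
- by rewrite expr1n.
- by move=> x; exact: cvg_id.
- move=> h; rewrite !(row_mulD, row_mulZ) !row_delta => /eqP.
  have -> : T2 * y1 + T1 = - T1 by rewrite /y1; field.
  rewrite mulf_eq0 oppr_eq0 (negbTE T10) /= => /eqP ha /eqP.
  rewrite mulf_eq0 (negbTE T10) /= => /eqP hb.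
  rewrite ha hb !mulr0 !addr0 => /eqP; rewrite mulf_eq0 (negbTE mu0) /= => /eqP hc.
  by apply/colP => i; rewrite mxE; case: (abc i) => ->.
- apply: (sdiff_eq (quadratic a)) => //; rewrite z0a // /y1; field.
  by rewrite T20.
- by apply: (sdiff_eq (quadratic b)) => //; rewrite z0b; [ring|rewrite mulr0 add0r].
- by move=> z s s0; split; apply: cont_quotient => //; apply: cont_row_time;
    exact: cont_row_const.
- by move=> z s s0; split; exact: cont_time.
- move=> z s s0 h1 h2 h3 x xa xb xc; rewrite mul1r expr1.
  have nz (r : R) m : r / s ^+ m = 0 -> r = 0.
    by move/eqP; rewrite mulf_eq0 invr_eq0 expf_eq0 (gt_eqF s0) andbF orbF => /eqP.
  rewrite za zb zc xa xb xc; split.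
  + by rewrite -(nz _ _ h1) -scalerA -scalerDr.
  + by rewrite -(nz _ _ h2) -scalerA -scalerDr.
  + by rewrite -(nz _ _ h3) -!scalerA -!scalerDr.
- have hd := sdiff_add (sdiff_coord z0 a) (sdiff_mul (sdiff_const z0 (-1)) (sdiff_coord z0 b)).
  have [|r r0 H] := sdiff_neq0 hd; first by rewrite z0a z0b mulr0 addr0.
  exists r => // z s hz hs x xa xb _; rewrite xa xb; have s0 : s != 0 by case/andP: hs => /gt_eqF ->.
  have := H z s hz hs; rewrite mulN1r subr_eq0.
  by apply: contra => /eqP/(mulfI s0) ->.
Qed.

(** * Branches of chain networks at a defective eigenvalue *)

Section ChainNetwork.
Variables u eta chi kb kc : 'rV[R]_(k.+1 + 1).
Hypothesis za : forall x l, zrow N x l a =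
  x a 0 *: u + (x b 0 - x a 0) *: kb + (x c 0 - x a 0) *: kc + l *: e_.
Hypothesis zb : forall x l, zrow N x l b = zrow N x l a + (x b 0 - x a 0) *: eta.
Hypothesis zc : forall x l, zrow N x l c =
  zrow N x l a + (x c 0 - x a 0) *: eta + (x b 0 - x a 0) *: chi.
Let ups := jet1 f u.
Let nu := jet1 f chi.
Let mu1 := jet2 f e_ eta.
Let phi := jet2 f eta eta.
Hypotheses (feta : jet1 f eta = 0) (ups0 : ups != 0) (nu0 : nu != 0)
  (mu10 : mu1 != 0) (phi0 : phi != 0).

Lemma jet2_diff v w : jet2 f (v + w) (v + w) - jet2 f v v =
  2 * jet2 f v w + jet2 f w w.
Proof. by rewrite jet2Dl !jet2Dr (jet2C w v sf); ring. Qed.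

(** Write x_a = s X, x_c - x_a = s T and x_b - x_a = s^2 D, with parameter s. The leading equations
    are ups X + m3 T = 0 for cell a, D (qu X + qc T + mu1) = 0 for b minus a (order s^3), and nu D +
    phi T^2 / 2 + T (qu X + qc T + mu1) = 0 for c minus a (order s^2). A nonzero D makes the bracket
    vanish; this fixes T and X, and then D. *)
Lemma chain_branch_open :
  jet2 f kc eta * ups - jet1 f kc * jet2 f u eta != 0 ->
  exists dlt br, half_branch f N 1 dlt br (fun x => x a 0 != x b 0).
Proof.
set m3 := jet1 f kc; set qu := jet2 f u eta; set qc := jet2 f kc eta => H0.
pose T0 := - mu1 * ups / (qc * ups - m3 * qu).
pose X0 := - m3 * T0 / ups; pose D0 := - phi * T0 ^+ 2 / (2 * nu).
have T00 : T0 != 0 by rewrite !mulf_neq0 ?invr_eq0 ?oppr_eq0.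
have D00 : D0 != 0.
  by rewrite !mulf_neq0 ?invr_eq0 ?oppr_eq0 ?expf_neq0 ?mulf_neq0 ?pnatr_eq0.
have bracket : X0 * qu + T0 * qc + mu1 = 0.
  by rewrite /X0 /T0; field; rewrite H0 ups0.
pose z0 : 'cV[R]_3 := \col_i case3 X0 D0 T0 i.
have [e1 e2 e3] := case3E X0 D0 T0.
have [z0a z0b z0c] : [/\ z0 a 0 = X0, z0 b 0 = D0 & z0 c 0 = T0] by rewrite !mxE.
have [l1 l2 l3] := taylor_lipschitz sf.
pose p (z : 'cV[R]_3) := z a 0 *: u + z c 0 *: kc + e_.
pose ya (z : 'cV[R]_3) s := p z + s *: (z b 0 *: kb).
pose w (z : 'cV[R]_3) s := z c 0 *: eta + s *: (z b 0 *: chi).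
pose yb (z : 'cV[R]_3) s := ya z s + s *: (z b 0 *: eta).
pose yc (z : 'cV[R]_3) s := ya z s + w z s.
have sp : sdiffable_row z0 (fun z _ => p z).
  rewrite /p; apply: sdiffable_row_add; last exact: sdiffable_row_const.
  by apply: sdiffable_row_add; exact: sdiffable_row_coord.
have scale v : sdiffable_row z0 (fun z s => z b 0 *: v).
  by apply: sdiffable_row_scale; [exact: sdiffable_coord|exact: sdiffable_row_const].
have stime Y : sdiffable_row z0 Y -> sdiffable_row z0 (fun z s => s *: Y z s).
  by apply: sdiffable_row_scale; exact: sdiffable_time.
have sya : sdiffable_row z0 ya by apply: sdiffable_row_add => //; exact: stime.
have sw : sdiffable_row z0 w.
  apply: sdiffable_row_add; last exact: stime.
  by apply: sdiffable_row_scale; [exact: sdiffable_coord|exact: sdiffable_row_const].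
have syb : sdiffable_row z0 yb by apply: sdiffable_row_add => //; exact: stime.
have syc : sdiffable_row z0 yc by apply: sdiffable_row_add.
pose g1 (z : 'cV[R]_3) s := f (s *: ya z s) / s ^+ 1.
pose g2 (z : 'cV[R]_3) s := f (s *: yb z s) / s ^+ 3 - f (s *: ya z s) / s ^+ 3.
pose g3 (z : 'cV[R]_3) s := f (s *: yc z s) / s ^+ 2 - f (s *: ya z s) / s ^+ 2.
have sq z : jet2 f (p z) eta = z a 0 * qu + z c 0 * qc + mu1.
  by rewrite /p !jet2Dl !jet2Zl.
have sbr : sdiff z0 (fun z _ => z a 0 * qu + z c 0 * qc + mu1) 0
    (qu *: 'e_a + qc *: 'e_c).
  have hh := sdiff_add (sdiff_add
     (sdiff_mul (sdiff_coord z0 a) (sdiff_const z0 qu))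
     (sdiff_mul (sdiff_coord z0 c) (sdiff_const z0 qc))) (sdiff_const z0 mu1).
  apply: (sdiff_eq hh) => //; first by rewrite z0a z0c bracket.
  by rewrite !scaler0 !add0r addr0.
have h1 : sdiff z0 g1 0 (ups *: 'e_a + m3 *: 'e_c).
  have hh := sdiff_add (sdiff_add (sdiff_add
     (sdiff_mul (sdiff_const z0 ups) (sdiff_coord z0 a))
     (sdiff_mul (sdiff_const z0 m3) (sdiff_coord z0 c)))
     (sdiff_time_mul (sdiffable_mul (sdiffable_const z0 (jet1 f kb))
         (sdiffable_coord z0 b)))) (sdiff_remainder l1 sya).
  apply: (sdiff_eq hh).
  - move=> z s s0; have sn : s != 0 by rewrite gt_eqF.
    rewrite /g1 {1}(rem1E f) f00' jet1Z {1}/ya /p !jet1D !jet1Z je -/ups -/m3.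
    by field.
  - by rewrite z0a z0c /X0; field.
  - by rewrite !scaler0 !addr0.
have h3 : sdiff z0 g3 0
    (nu *: 'e_b + (phi * T0) *: 'e_c + T0 *: (qu *: 'e_a + qc *: 'e_c)).
  pose S z s := jet2 f (p z) (z b 0 *: chi) + jet2 f (z b 0 *: kb) (w z s) +
    z c 0 * jet2 f eta (z b 0 *: chi) +
    2^-1 * (s * jet2 f (z b 0 *: chi) (z b 0 *: chi)).
  have sS : sdiffable z0 S.
    apply: sdiffable_add; [apply: sdiffable_add; [apply: sdiffable_add|]|].
    - exact: sdiffable_jet2.
    - exact: sdiffable_jet2.
    - apply: sdiffable_mul; first exact: sdiffable_coord.
      by apply: sdiffable_jet2 => //; exact: sdiffable_row_const.
    - apply: sdiffable_mul; first exact: sdiffable_const.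
      by apply: sdiffable_mul; [exact: sdiffable_time|exact: sdiffable_jet2].
  have hh := sdiff_add (sdiff_add (sdiff_add (sdiff_add
      (sdiff_mul (sdiff_const z0 nu) (sdiff_coord z0 b))
      (sdiff_mul (sdiff_const z0 (2^-1 * phi)) (sdiff_mul (sdiff_coord z0 c) (sdiff_coord z0 c))))
      (sdiff_mul (sdiff_coord z0 c) sbr))
      (sdiff_time_mul sS))
      (sdiff_add (sdiff_remainder l2 syc)
        (sdiff_mul (sdiff_const z0 (-1)) (sdiff_remainder l2 sya))).
  apply: (sdiff_eq hh).
  - move=> z s s0; have sn : s != 0 by rewrite gt_eqF.
    have e : f (s *: yc z s) - f (s *: ya z s) = s * jet1 f (w z s) +
       s ^+ 2 * (jet2 f (ya z s) (w z s) + 2^-1 * jet2 f (w z s) (w z s)) +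
       (rem2 f (s *: yc z s) - rem2 f (s *: ya z s)).
      rewrite {1}(rem2E f (s *: yc z s)) {1}(rem2E f (s *: ya z s)) !jet1Z !jet2Zl !jet2Zr.
      rewrite /yc jet1D; have := jet2_diff (ya z s) (w z s).
      move: (jet2 f (ya z s + _) _) (jet2 f (ya z s) (ya z s)) => q1 q2 hq.
      have -> : q1 = q2 + (2 * jet2 f (ya z s) (w z s) + jet2 f (w z s) (w z s)).
        by rewrite -hq; ring.
      by field.
    have e1' : jet1 f (w z s) = s * (z b 0 * nu).
      by rewrite /w jet1D !jet1Z feta mulr0 add0r.
    have e2' : jet2 f (ya z s) (w z s) = z c 0 * (z a 0 * qu + z c 0 * qc + mu1) +
        s * (jet2 f (p z) (z b 0 *: chi) + jet2 f (z b 0 *: kb) (w z s)).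
      rewrite /ya jet2Dl (jet2Zl f s) {1}/w jet2Dr (jet2Zr f (z c 0)) (jet2Zr f s) sq.
      by ring.
    have e3' : jet2 f (w z s) (w z s) = z c 0 ^+ 2 * phi +
        s * (2 * (z c 0 * jet2 f eta (z b 0 *: chi)) + s * jet2 f (z b 0 *: chi) (z b 0 *: chi)).
      rewrite /w jet2_square (jet2C (z b 0 *: chi) eta sf) -/phi; ring.
    rewrite /g3 -mulrBl e e1' e2' e3' /S -/(w z s).
    move: (rem2 f (s *: yc z s)) (rem2 f (s *: ya z s)) => r1 r2.
    by field.
  - rewrite z0b z0c /D0; field.
    by rewrite nu0.
  - by rewrite z0c; apply/rowP => j; rewrite !mxE; field.
have h2 : sdiff z0 g2 0 (D0 *: (qu *: 'e_a + qc *: 'e_c)).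
  pose v (z : 'cV[R]_3) := z b 0 *: eta.
  pose S3 z s := 6^-1 * (jet3 f (v z) (yb z s) (yb z s) +
     jet3 f (ya z s) (v z) (yb z s) + jet3 f (ya z s) (ya z s) (v z)).
  pose S (z : 'cV[R]_3) s := z b 0 * (z b 0 * jet2 f kb eta) + 2^-1 * (phi * z b 0 ^+ 2) + S3 z s.
  have sv : sdiffable_row z0 (fun z _ => v z) by exact: scale.
  have sS : sdiffable z0 S.
    apply: sdiffable_add; first apply: sdiffable_add.
    - apply: sdiffable_mul; first exact: sdiffable_coord.
      by apply: sdiffable_mul; [exact: sdiffable_coord|exact: sdiffable_const].
    - apply: sdiffable_mul; first exact: sdiffable_const.
      apply: sdiffable_mul; first exact: sdiffable_const.
      exact: sdiffable_exp (sdiffable_coord z0 b).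
    - apply: sdiffable_mul; first exact: sdiffable_const.
      by apply: sdiffable_add; [apply: sdiffable_add|]; apply: sdiffable_jet3.
  have hh := sdiff_add (sdiff_add (sdiff_mul (sdiff_coord z0 b) sbr)
      (sdiff_time_mul sS)) (sdiff_add (sdiff_remainder l3 syb)
        (sdiff_mul (sdiff_const z0 (-1)) (sdiff_remainder l3 sya))).
  apply: (sdiff_eq hh).
  - move=> z s s0; have sn : s != 0 by rewrite gt_eqF.
    have e3' : jet3 f (yb z s) (yb z s) (yb z s) =
       jet3 f (ya z s) (ya z s) (ya z s) + s * (6 * S3 z s).
      rewrite /yb jet3_perturb -/(yb z s) -/(v z); congr (_ + s * _).
      by rewrite /S3 -/(yb z s) mulrA divff ?pnatr_eq0// mul1r.
    have e2' : jet2 f (yb z s) (yb z s) = jet2 f (ya z s) (ya z s) +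
       (2 * s * z b 0 * jet2 f (ya z s) eta + s ^+ 2 * (phi * z b 0 ^+ 2)).
      have := jet2_diff (ya z s) (s *: (z b 0 *: eta)).
      rewrite -/(yb z s) !jet2Zl !jet2Zr -/phi.
      move: (jet2 f (yb z s) _) (jet2 f (ya z s) (ya z s)) => q1 q2 hq.
      have -> : q1 = q2 + (q1 - q2) by ring.
      by rewrite hq; ring.
    have e1' : jet1 f (yb z s) = jet1 f (ya z s).
      by rewrite /yb jet1D !jet1Z feta !mulr0 addr0.
    have e4' : jet2 f (ya z s) eta = z a 0 * qu + z c 0 * qc + mu1 + s * (z b 0 * jet2 f kb eta).
      by rewrite /ya jet2Dl !jet2Zl sq.
    have -> : g2 z s = (f (s *: yb z s) - f (s *: ya z s)) / s ^+ 3 by rewrite /g2 mulrBl.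
    rewrite {1}(rem3E f (s *: yb z s)) {1}(rem3E f (s *: ya z s)) f00' !jet1Z !jet2Zl !jet2Zr.
    rewrite !jet3Z1 !jet3Z2 !jet3Z3 e1' e2' e3' e4' /S.
    move: (rem3 f (s *: yb z s)) (rem3 f (s *: ya z s)) (jet3 _ _ _ _) (jet2 f (ya z s) _).
    move=> r1 r2 r3 r4; move: (S3 z s) (jet1 f _) => r5 r6.
    by field.
  - by rewrite !mulr0 !addr0.
  - by rewrite z0b; apply/rowP => j; rewrite !mxE; ring.
apply: (half_branch3 (m := 1) (sg := id) (z0 := z0) (g1 := g1) (g2 := g2) (g3 := g3)
  (X1 := fun z s => s * z a 0) (X2 := fun z s => s * (z a 0 + s * z b 0))
  (X3 := fun z s => s * (z a 0 + z c 0)) _ _ _ _ _ h1 h2 h3) => //.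
- by rewrite expr1n.
- by move=> x; exact: cvg_id.
- move=> h; rewrite !(row_mulD, row_mulZ) !row_delta => k1 k2 k3.
  have k2' : qu * h a 0 + qc * h c 0 = 0.
    by move/eqP: k2; rewrite mulf_eq0 (negbTE D00) => /eqP.
  have hc : h c 0 = 0.
    have : (qc * ups - m3 * qu) * h c 0 = 0.
      have -> : (qc * ups - m3 * qu) * h c 0 = ups * (qu * h a 0 + qc * h c 0) -
        qu * (ups * h a 0 + m3 * h c 0) by ring.
      by rewrite k1 k2' !mulr0 subrr.
    by move/eqP; rewrite mulf_eq0 (negbTE H0) => /eqP.
  have ha : h a 0 = 0.
    by move/eqP: k1; rewrite hc mulr0 addr0 mulf_eq0 (negbTE ups0) => /eqP.
  have hb : h b 0 = 0.
    by move/eqP: k3; rewrite hc ha !mulr0 !addr0 mulr0 addr0 mulf_eq0 (negbTE nu0) => /eqP.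
  by apply/colP => i; rewrite mxE; case: (abc i) => ->.
- move=> z s s0.
  have ca : cont_row (ya z) s.
    by apply: cont_row_add; [exact: cont_row_const|apply: cont_row_time; exact: cont_row_const].
  have cb : cont_row (yb z) s.
    by apply: cont_row_add => //; apply: cont_row_time; exact: cont_row_const.
  have cc : cont_row (yc z) s.
    apply: cont_row_add => //; apply: cont_row_add; first exact: cont_row_const.
    by apply: cont_row_time; exact: cont_row_const.
  split.
  + by apply: cont_quotient => //; exact: cont_row_time.
  + by apply: continuousB; apply: cont_quotient => //; exact: cont_row_time.
  + by apply: continuousB; apply: cont_quotient => //; exact: cont_row_time.
- by apply: sdiff_time_mul; exact: sdiffable_coord.
- apply: sdiff_time_mul; apply: sdiffable_add; first exact: sdiffable_coord.
  by apply: sdiffable_mul; [exact: sdiffable_time|exact: sdiffable_coord].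
- by apply: sdiff_time_mul; apply: sdiffable_add; exact: sdiffable_coord.
- move=> z s s0; split; [exact: cont_time| |exact: cont_time].
  apply: (@cont_mul R id (fun s => z a 0 + s * z b 0)); first exact: cont_id.
  by apply: (@cont_add R (fun=> z a 0)); [exact: cont_cst|exact: cont_time].
- move=> z s s0 k1 k2 k3 x xa xb xc; rewrite mul1r expr1.
  have nz (r : R) m : r / s ^+ m = 0 -> r = 0.
    by move/eqP; rewrite mulf_eq0 invr_eq0 expf_eq0 (gt_eqF s0) andbF orbF => /eqP.
  have ea : zrow N x s a = s *: ya z s.
    rewrite za xa xb xc /ya /p; move: (e_) => e0.
    by apply/rowP => j; rewrite !mxE; ring.
  have eb : zrow N x s b = s *: yb z s.
    by rewrite zb ea xa xb /yb; apply/rowP => j; rewrite !mxE; ring.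
  have ec : zrow N x s c = s *: yc z s.
    by rewrite zc ea xa xb xc /yc /w; apply/rowP => j; rewrite !mxE; ring.
  have fa := nz _ _ k1.
  rewrite ea eb ec; split => //.
    by move: k2; rewrite /g2 fa mul0r subr0 => /nz.
  by move: k3; rewrite /g3 fa mul0r subr0 => /nz.
- have [|r r0 H] := sdiff_neq0 (sdiff_coord z0 b); first by rewrite z0b.
  exists r => // z s hz hs x xa xb _; have s0 : s != 0 by case/andP: hs => /gt_eqF ->.
  rewrite xa xb mulrDr -subr_eq0 opprD addrA subrr sub0r oppr_eq0.
  by rewrite !mulf_neq0//; exact: H hz hs.
Qed.

(** Cell c no longer acts on cell a, and the scales change: x_a = s^2 X, x_b - x_a = s^2 D, x_c -
    x_a = s T, with parameter e s^2. The leading equations are ups X + m2 D = 0, D (qu X + (qb + phi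
    / 2) D + e mu1) = 0 and nu D + phi T^2 / 2 = 0. The first two give X and D, and the sign of T^2
    in the third selects e. *)
Lemma chain_branch_closed : kc = 0 ->
  (jet2 f kb eta + 2^-1 * phi) * ups - jet1 f kb * jet2 f u eta != 0 ->
  exists e dlt br, half_branch f N e dlt br (fun x => x a 0 != x b 0).
Proof.
move=> kc0; set m2 := jet1 f kb; set qu := jet2 f u eta; set qb := jet2 f kb eta.
set H := _ - _ => H0.
(* For e = 1 the leading equations give T^2 = 2 t; taking for e the sign of t replaces t by its
   absolute value. *)
pose t := nu * mu1 * ups / (H * phi).
have t0 : t != 0 by rewrite !mulf_neq0 ?invr_eq0 ?mulf_neq0.
pose e : R := Num.sg t.
have e2 : e ^+ 2 = 1 by rewrite sqr_sg t0.
have e0 : e != 0 by rewrite sgr_eq0.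
pose D0 := - e * mu1 * ups / H.
pose X0 := - m2 * D0 / ups; pose T0 := Num.sqrt (2 * `|t|).
have T00 : T0 != 0 by rewrite gt_eqF// sqrtr_gt0 mulr_gt0// normr_gt0.
have T02 : T0 ^+ 2 * phi = - 2 * nu * D0.
  rewrite sqr_sqrtr ?mulr_ge0// normrEsg -/e /t /D0; field.
  by rewrite phi0 H0.
have D00 : D0 != 0 by rewrite !mulf_neq0 ?invr_eq0 ?oppr_eq0.
have bracket : X0 * qu + D0 * (qb + 2^-1 * phi) + e * mu1 = 0.
  rewrite /X0 /D0 /H; field; rewrite ups0 andbT.
  by apply: contra H0; rewrite /H => /eqP h; apply/eqP; lra.
pose z0 : 'cV[R]_3 := \col_i case3 X0 D0 T0 i.
have [e1 e3 e4] := case3E X0 D0 T0.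
have [z0a z0b z0c] : [/\ z0 a 0 = X0, z0 b 0 = D0 & z0 c 0 = T0] by rewrite !mxE.
have [_ l2 _] := taylor_lipschitz sf.
pose ya (z : 'cV[R]_3) (s : R) := z a 0 *: u + z b 0 *: kb + e *: e_.
pose yb (z : 'cV[R]_3) (s : R) := ya z s + z b 0 *: eta.
pose w (z : 'cV[R]_3) (s : R) := ya z s + z b 0 *: chi.
pose yc (z : 'cV[R]_3) (s : R) := z c 0 *: eta + s *: w z s.
have scale i v : sdiffable_row z0 (fun z s => z i 0 *: v).
  by apply: sdiffable_row_scale; [exact: sdiffable_coord|exact: sdiffable_row_const].
have sya : sdiffable_row z0 ya.
  by apply: sdiffable_row_add; [exact: sdiffable_row_add|exact: sdiffable_row_const].
have syb : sdiffable_row z0 yb by exact: sdiffable_row_add.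
have sw : sdiffable_row z0 w by exact: sdiffable_row_add.
have stime Y : sdiffable_row z0 Y -> sdiffable_row z0 (fun z s => s *: Y z s).
  by apply: sdiffable_row_scale; exact: sdiffable_time.
have syc : sdiffable_row z0 yc by apply: sdiffable_row_add => //; exact: stime.
have stya := stime _ _ sya.
pose g1 (z : 'cV[R]_3) s := f (s *: (s *: ya z s)) / s ^+ 2.
pose g2 (z : 'cV[R]_3) s := f (s ^+ 2 *: yb z s) / (s ^+ 2) ^+ 2
  - f (s ^+ 2 *: ya z s) / (s ^+ 2) ^+ 2.
pose g3 (z : 'cV[R]_3) s := f (s *: yc z s) / s ^+ 2 - f (s *: (s *: ya z s)) / s ^+ 2.
have h1 : sdiff z0 g1 0 (ups *: 'e_a + m2 *: 'e_b).
  pose S z s := 2^-1 * (s * jet2 f (ya z s) (ya z s)).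
  have sS : sdiffable z0 S.
    apply: sdiffable_mul; first exact: sdiffable_const.
    by apply: sdiffable_mul; [exact: sdiffable_time|exact: sdiffable_jet2].
  have hh := sdiff_add (sdiff_add (sdiff_add
     (sdiff_mul (sdiff_const z0 ups) (sdiff_coord z0 a))
     (sdiff_mul (sdiff_const z0 m2) (sdiff_coord z0 b)))
     (sdiff_time_mul sS)) (sdiff_remainder l2 stya).
  apply: (sdiff_eq hh).
  - move=> z s s0; have sn : s != 0 by rewrite gt_eqF.
    rewrite /g1 {1}(rem2E f) f00' !jet1Z !jet2Zl !jet2Zr /S.
    rewrite {1}/ya !jet1D !jet1Z je -/ups -/m2.
    move: (rem2 f _) (jet2 _ _ _) => r1 r2.
    by field.
  - by rewrite z0a z0b /X0; field.
  - by rewrite !scaler0 !addr0.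
have h3 : sdiff z0 g3 0 (nu *: 'e_b + (phi * T0) *: 'e_c).
  pose S (z : 'cV[R]_3) s := z c 0 * jet2 f eta (w z s) + 2^-1 * (s * jet2 f (w z s) (w z s))
    - 2^-1 * (s * jet2 f (ya z s) (ya z s)).
  have sS : sdiffable z0 S.
    apply: sdiffable_add; first apply: sdiffable_add.
    - apply: sdiffable_mul; first exact: sdiffable_coord.
      by apply: sdiffable_jet2 => //; exact: sdiffable_row_const.
    - apply: sdiffable_mul; first exact: sdiffable_const.
      by apply: sdiffable_mul; [exact: sdiffable_time|exact: sdiffable_jet2].
    - apply: sdiffable_opp; apply: sdiffable_mul; first exact: sdiffable_const.
      by apply: sdiffable_mul; [exact: sdiffable_time|exact: sdiffable_jet2].
  have hh := sdiff_add (sdiff_add (sdiff_add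
      (sdiff_mul (sdiff_const z0 nu) (sdiff_coord z0 b))
      (sdiff_mul (sdiff_const z0 (2^-1 * phi)) (sdiff_mul (sdiff_coord z0 c) (sdiff_coord z0 c))))
      (sdiff_time_mul sS))
      (sdiff_add (sdiff_remainder l2 syc)
        (sdiff_mul (sdiff_const z0 (-1)) (sdiff_remainder l2 stya))).
  apply: (sdiff_eq hh).
  - move=> z s s0; have sn : s != 0 by rewrite gt_eqF.
    have ec1 : jet1 f (yc z s) = s * (jet1 f (ya z s) + z b 0 * nu).
      by rewrite /yc /w !(jet1D, jet1Z) feta mulr0 add0r.
    have ec2 : jet2 f (yc z s) (yc z s) = z c 0 ^+ 2 * phi +
        2 * s * (z c 0 * jet2 f eta (w z s)) + s ^+ 2 * jet2 f (w z s) (w z s).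
      by rewrite /yc jet2_square (jet2C (w z s) eta sf) -/phi; ring.
    rewrite /g3 {1}(rem2E f (s *: yc z s)) {1}(rem2E f (s *: (s *: ya z s))) f00'.
    rewrite !jet1Z !jet2Zl !jet2Zr ec1 ec2 /S.
    move: (rem2 f (s *: yc z s)) (rem2 f (s *: (s *: ya z s))) => r1 r2.
    move: (jet1 f (ya z s)) (jet2 f (ya z s) _) (jet2 f (w z s) _) (jet2 f eta (w z s)).
    move=> r3 r4 r5 r6.
    by field.
  - rewrite z0b z0c; have := T02; rewrite expr2 => h.
    have -> : 2^-1 * phi * (T0 * T0) = 2^-1 * (T0 * T0 * phi) by ring.
    by rewrite h; field.
  - by rewrite z0c; apply/rowP => j; rewrite !mxE; field.
have h2 : sdiff z0 g2 0 (D0 *: (qu *: 'e_a + (qb + 2^-1 * phi) *: 'e_b)).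
  have sbr : sdiff z0 (fun z _ => z a 0 * qu + z b 0 * (qb + 2^-1 * phi) + e * mu1) 0
      (qu *: 'e_a + (qb + 2^-1 * phi) *: 'e_b).
    have hh := sdiff_add (sdiff_add
       (sdiff_mul (sdiff_coord z0 a) (sdiff_const z0 qu))
       (sdiff_mul (sdiff_coord z0 b) (sdiff_const z0 (qb + 2^-1 * phi))))
       (sdiff_const z0 (e * mu1)).
    apply: (sdiff_eq hh) => //; first by rewrite z0a z0b bracket.
    by rewrite !scaler0 !add0r addr0.
  have hh := sdiff_add (sdiff_mul (sdiff_coord z0 b) sbr)
      (sdiff_add (sdiff_remainder_pow 1 l2 syb)
        (sdiff_mul (sdiff_const z0 (-1)) (sdiff_remainder_pow 1 l2 sya))).
  apply: (sdiff_eq hh).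
  - move=> z s s0; have sn : s != 0 by rewrite gt_eqF.
    have e2' : jet2 f (yb z s) (yb z s) = jet2 f (ya z s) (ya z s) +
       (2 * z b 0 * jet2 f (ya z s) eta + phi * z b 0 ^+ 2).
      have := jet2_diff (ya z s) (z b 0 *: eta).
      rewrite -/(yb z s) !jet2Zl !jet2Zr -/phi.
      move: (jet2 f (yb z s) _) (jet2 f (ya z s) (ya z s)) => q1 q2 hq.
      have -> : q1 = q2 + (q1 - q2) by ring.
      by rewrite hq; ring.
    have e1' : jet1 f (yb z s) = jet1 f (ya z s).
      by rewrite /yb jet1D !jet1Z feta !mulr0 addr0.
    have e4' : jet2 f (ya z s) eta = z a 0 * qu + z b 0 * qb + e * mu1.
      by rewrite /ya !jet2Dl !jet2Zl.
    rewrite /g2 {1}(rem2E f (s ^+ 2 *: yb z s)) {1}(rem2E f (s ^+ 2 *: ya z s)) f00'.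
    rewrite !jet1Z !jet2Zl !jet2Zr e1' e2' e4'.
    move: (rem2 f (s ^+ 2 *: yb z s)) (rem2 f (s ^+ 2 *: ya z s)) => r1 r2.
    move: (jet2 f (ya z s) _) (jet1 f _) => r3 r4.
    by field.
  - by rewrite !mulr0 !addr0.
  - by rewrite z0b; apply/rowP => j; rewrite !mxE; ring.
exists e.
apply: (half_branch3 (m := 2) (sg := Num.sqrt) (z0 := z0) (g1 := g1) (g2 := g2) (g3 := g3)
  (X1 := fun z s => s * (s * z a 0)) (X2 := fun z s => s * (s * (z a 0 + z b 0)))
  (X3 := fun z s => s * (s * z a 0 + z c 0)) _ _ _ _ _ h1 h2 h3) => //.
- exact: sqrt_continuous.
- exact: sqrtr0.
- by move=> x x0; rewrite sqrtr_gt0 x0 sqr_sqrtr// ltW.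
- move=> h; rewrite !(row_mulD, row_mulZ) !row_delta => k1 k2 k3.
  have k2' : qu * h a 0 + (qb + 2^-1 * phi) * h b 0 = 0.
    by move/eqP: k2; rewrite mulf_eq0 (negbTE D00) => /eqP.
  have hb : h b 0 = 0.
    have : H * h b 0 = 0.
      have -> : H * h b 0 = ups * (qu * h a 0 + (qb + 2^-1 * phi) * h b 0) -
        qu * (ups * h a 0 + m2 * h b 0) by rewrite /H; ring.
      by rewrite k1 k2' !mulr0 subrr.
    by move/eqP; rewrite mulf_eq0 (negbTE H0) => /eqP.
  have ha : h a 0 = 0.
    by move/eqP: k1; rewrite hb mulr0 addr0 mulf_eq0 (negbTE ups0) => /eqP.
  have hc : h c 0 = 0.
    by move/eqP: k3; rewrite hb mulr0 add0r !mulf_eq0 (negbTE phi0) (negbTE T00) => /eqP.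
  by apply/colP => i; rewrite mxE; case: (abc i) => ->.
- move=> z s s0.
  have ca : cont_row (ya z) s by exact: cont_row_const.
  have cb : cont_row (yb z) s by exact: (@cont_row_const _ (yb z 0) s).
  have cw : cont_row (w z) s by exact: (@cont_row_const _ (w z 0) s).
  have cc : cont_row (yc z) s.
    by apply: cont_row_add; [exact: cont_row_const|exact: cont_row_time].
  have c2 : {for s, continuous (fun s : R => s ^+ 2)}.
    exact: (@cont_pow R id 2 s (@cont_id R s)).
  have cpow (Y : R -> 'rV[R]_(k.+1 + 1)) : cont_row Y s ->
      {for s, continuous (fun s : R => f (s ^+ 2 *: Y s) / (s ^+ 2) ^+ 2)}.
    move=> hY; apply: (@cont_mul R (fun s : R => f (s ^+ 2 *: Y s)) (fun s : R => ((s ^+ 2) ^+ 2)^-1)).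
      by apply: cont_row_response; apply: (@cont_row_scale _ (fun s => s ^+ 2)).
    apply: continuousV; first by rewrite !expf_neq0// gt_eqF.
    exact: (@cont_pow R (fun s => s ^+ 2) 2 s c2).
  split.
  + by apply: cont_quotient => //; do 2 apply: cont_row_time.
  + by apply: continuousB; exact: cpow.
  + apply: continuousB.
      by apply: (cont_quotient (Y := fun s => s *: yc z s)) => //; exact: cont_row_time.
    apply: (cont_quotient (Y := fun s => s *: (s *: ya z s))) => //.
    by apply: (cont_row_time (Y := fun s => s *: ya z s)); exact: cont_row_time.
- by apply: sdiff_time_mul; apply: sdiffable_mul; [exact: sdiffable_time|exact: sdiffable_coord].
- apply: sdiff_time_mul; apply: sdiffable_mul; first exact: sdiffable_time.
  by apply: sdiffable_add; exact: sdiffable_coord.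
- apply: sdiff_time_mul; apply: sdiffable_add; last exact: sdiffable_coord.
  by apply: sdiffable_mul; [exact: sdiffable_time|exact: sdiffable_coord].
- have ct2 (x s : R) : {for s, continuous (fun s : R => s * (s * x))}.
    by apply: (@cont_mul R id (fun s => s * x)); [exact: cont_id|exact: cont_time].
  move=> z s s0; split; [exact: ct2|exact: ct2|].
  apply: (@cont_mul R id (fun s => s * z a 0 + z c 0)); first exact: cont_id.
  by apply: (@cont_add R _ (fun=> z c 0)); [exact: cont_time|exact: cont_cst].
- move=> z s s0 k1 k2 k3 x xa xb xc.
  have nz (r : R) m : r / s ^+ m = 0 -> r = 0.
    by move/eqP; rewrite mulf_eq0 invr_eq0 expf_eq0 (gt_eqF s0) andbF orbF => /eqP.
  have ea : zrow N x (e * s ^+ 2) a = s ^+ 2 *: ya z s.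
    rewrite za xa xb xc /ya kc0; move: (e_) => e0'.
    by apply/rowP => j; rewrite !mxE; ring.
  have ea' : s ^+ 2 *: ya z s = s *: (s *: ya z s) by rewrite scalerA expr2.
  have eb : zrow N x (e * s ^+ 2) b = s ^+ 2 *: yb z s.
    by rewrite zb ea xa xb /yb; apply/rowP => j; rewrite !mxE; ring.
  have ec : zrow N x (e * s ^+ 2) c = s *: yc z s.
    by rewrite zc ea xa xb xc /yc /w; apply/rowP => j; rewrite !mxE; ring.
  have fa := nz _ _ k1.
  rewrite ec eb ea; split.
  + by rewrite ea'.
  + move: k2; rewrite /g2 ea' fa mul0r subr0 -exprM; exact: nz.
  + by move: k3; rewrite /g3 fa mul0r subr0 => /nz.
- have [|r r0 Hr] := sdiff_neq0 (sdiff_coord z0 b); first by rewrite z0b.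
  exists r => // z s hz hs x xa xb _; have s0 : s != 0 by case/andP: hs => /gt_eqF ->.
  rewrite xa xb -subr_eq0 -!mulrBr opprD addrA subrr sub0r.
  by rewrite !mulf_neq0 ?oppr_eq0//; exact: Hr hz hs.
Qed.

End ChainNetwork.

End ThreeCells.

(** * Localization of the zeros *)

(* The trace and the determinant of the map that a matrix with constant row
   sums induces on the quotient of the state space by the diagonal. *)
Definition reduced_trace (K : comPzRingType) (a b c : 'I_3) (J : 'M[K]_3) : K :=
  (J b b - J a b) + (J c c - J a c).
Definition reduced_det (K : comPzRingType) (a b c : 'I_3) (J : 'M[K]_3) : K :=
  (J b b - J a b) * (J c c - J a c) - (J b c - J a c) * (J c b - J a b).

Section LocalZeros.
Variables (R : realType) (k : nat) (f : response R k).
Hypothesis sf : smooth_on setT f.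
Hypothesis f0 : forall l : R, f (row_mx 0 l%:M) = 0.

Definition derivatives_at (l : R) : 'rV[R]_k.+1 :=
  \row_p pderiv [:: lshift 1 p] f (l *: erow R k).

Lemma derivatives_at0 : derivatives_at 0 = first_derivatives f.
Proof. by apply/rowP => p; rewrite !mxE scale0r. Qed.

Lemma linear_part n (N : network k n) l0 (x : 'cV[R]_n) i :
  \sum_a zrow N x 0 i 0 a * pderiv [:: a] f (l0 *: erow R k) =
  (jacobian N (derivatives_at l0) *m x) i 0.
Proof.
rewrite big_split_ord /= big_ord1 zrow_r mul0r addr0 mxE /jacobian.
transitivity (\sum_(p < k.+1) \sum_j
   (pderiv [:: lshift 1 p] f (l0 *: erow R k) * (slot N p i == j)%:R) * x j 0).
  apply: eq_bigr => p _; rewrite (bigD1 (slot N p i))//= eqxx mulr1 mulrC zrow_l.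
  by rewrite big1 ?addr0// => j ji; rewrite eq_sym (negbTE ji) mulr0 mul0r.
rewrite exchange_big; apply: eq_bigr => j _; rewrite summxE mulr_suml.
by apply: eq_bigr => p _; rewrite !mxE.
Qed.

Lemma jacobian_row_sum n (N : network k n) (e : 'rV[R]_k.+1) i :
  \sum_j jacobian N e i j = \sum_p e 0 p.
Proof.
under eq_bigr do rewrite summxE.
rewrite exchange_big; apply: eq_bigr => p _.
rewrite (bigD1 (slot N p i))//= !mxE eqxx mulr1 big1 ?addr0// => j ji.
by rewrite !mxE eq_sym (negbTE ji) mulr0.
Qed.

Lemma zrow_norm n (N : network k n) (x : 'cV[R]_n) l i M : 0 <= M ->
  (forall j, `|x j 0| <= M) -> `|l| <= M -> `|zrow N x l i| <= M.
Proof.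
move=> M0 hx hl; apply: mx_norm_le => // a b; rewrite ord1.
by case: (split_ordP b) => p ->; rewrite ?zrow_l ?zrow_r.
Qed.

Lemma zrow_sub_erow n (N : network k n) (x : 'cV[R]_n) l l0 i :
  zrow N x l i - l0 *: erow R k = zrow N x (l - l0) i.
Proof.
rewrite zrow_split [RHS]zrow_split -addrA; congr (_ + _).
by rewrite -scalerBl.
Qed.

Lemma zrow_diff_l n (N : network k n) (x : 'cV[R]_n) l i j p :
  (zrow N x l i - zrow N x l j) 0 (lshift 1 p) = x (slot N p i) 0 - x (slot N p j) 0.
Proof. by rewrite -(zrow_l N x l) -(zrow_l N x l) [LHS]mxE [X in _ + X]mxE. Qed.

Lemma zrow_diff_r n (N : network k n) (x : 'cV[R]_n) l i j q :
  (zrow N x l i - zrow N x l j) 0 (rshift k.+1 q) = 0.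
Proof. by rewrite [LHS]mxE [X in _ + X]mxE !zrow_r subrr. Qed.

(** In the first bound the error is proportional to the difference of the inputs of the two cells
    and not to the size of x. This lets a nonzero eigenvalue force two cells to agree exactly. *)
Lemma compare_cells n (N : network k n) (l0 eps : R) : 0 < eps ->
  exists2 r : R, 0 < r & forall (x : 'cV[R]_n) l i j, `|x| <= r -> `|l - l0| <= r ->
    (`|f (zrow N x l i) - f (zrow N x l j) -
      \sum_p (x (slot N p i) 0 - x (slot N p j) 0) * derivatives_at l0 0 p|
     <= eps * `|zrow N x l i - zrow N x l j|)
    /\ `|f (zrow N x l i) - (jacobian N (derivatives_at l0) *m x) i 0| <= eps * `|x|.
Proof.
move=> e0; have [r r0 H] := strict_diff (l0 *: erow R k) sf e0.
exists r => // x l i j hx hl.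
have near0 (y : 'cV[R]_n) q : `|y| <= r -> `|zrow N y l q - l0 *: erow R k| <= r.
  move=> hy; rewrite zrow_sub_erow; apply: zrow_norm => //; first exact: ltW.
  by move=> s; apply: le_trans (mx_norm_coord _ _ _) hy.
split.
  have := H _ _ (near0 x i hx) (near0 x j hx).
  rewrite big_split_ord /= big_ord1 zrow_diff_r mul0r addr0.
  under eq_bigr do rewrite zrow_diff_l.
  by under [in X in _ -> X]eq_bigr do rewrite mxE.
have n0 : `|0 : 'cV[R]_n| <= r by rewrite normr0 ltW.
have := H _ _ (near0 x i hx) (near0 0 i n0).
rewrite (zrow0 N l) erow_lambda f0 subr0 zrow_split -erow_lambda addrK linear_part.
move/le_trans; apply; rewrite ler_wpM2l ?(ltW e0)//.
by apply: zrow_norm => [//|q|]; rewrite ?normr0//; exact: mx_norm_coord.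
Qed.

(** At a zero the linear part equals the error, and the inverse Jacobian turns this into a bound of
    the norm of x by half of itself. *)
Lemma isolated_zero n (N : network k n) (l0 : R) :
  \det (jacobian N (derivatives_at l0)) != 0 ->
  exists2 r : R, 0 < r & forall (x : 'cV[R]_n) l, `|x| <= r -> `|l - l0| <= r ->
    admissible N f x l = 0 -> x = 0.
Proof.
set J := jacobian _ _ => detJ.
have uJ : J \in unitmx by rewrite unitmxE unitfE.
pose B := n%:R * `|invmx J| + 1.
have B0 : 0 < B by rewrite ltr_wpDl// mulr_ge0.
have e0 : 0 < (2 * B)^-1 by rewrite invr_gt0 mulr_gt0.
have [r r0 H] := compare_cells N l0 e0; exists r => // x l hx hl Fx.
apply/eqP; rewrite -normr_le0.
have hJ : `|J *m x| <= (2 * B)^-1 * `|x|.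
  apply: mx_norm_le => [|i j]; first by rewrite mulr_ge0// ltW.
  have [_] := H x l i i hx hl; rewrite ord1 -admissibleE Fx mxE sub0r normrN//.
have : `|x| <= B * ((2 * B)^-1 * `|x|).
  rewrite -{1}(mulKmx uJ x); apply: le_trans (mulmx_norm _ _) _.
  by apply: ler_pM => //; rewrite ?mulr_ge0// lerDl.
have -> : B * ((2 * B)^-1 * `|x|) = `|x| / 2.
  by move: (`|x|) => q; field; rewrite gt_eqF.
by have := normr_ge0 x; lra.
Qed.

Section Pair.
Variables (n : nat) (N : network k n) (i j : 'I_n).
Hypothesis ij : i != j.

(* The eigenvalue contributed by the slot p on the quotient of the state space
   by the equality of the cells i and j. *)
Definition transverse (p : 'I_k.+1) : R :=
  (slot N p i == i)%:R - (slot N p j == i)%:R.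

(** The balanced colouring condition for the partition whose only nontrivial class is the pair. *)
Definition sync_pair : Prop := forall l, N l i = N l j \/
  (N l i = i /\ N l j = j) \/ (N l i = j /\ N l j = i).

Lemma sync_pair_slot p (x : 'cV[R]_n) : sync_pair ->
  x (slot N p i) 0 - x (slot N p j) 0 = transverse p * (x i 0 - x j 0).
Proof.
move=> sp; rewrite /transverse /slot; case: unliftP => [l _|_]; last first.
  by rewrite eqxx [j == i]eq_sym (negbTE ij) subr0 mul1r.
case: (sp l) => [->|[[-> ->]|[-> ->]]]; first by rewrite !subrr mul0r.
  by rewrite eqxx [j == i]eq_sym (negbTE ij) subr0 mul1r.
by rewrite eqxx [j == i]eq_sym (negbTE ij) sub0r mulN1r opprB.
Qed.

(** All inputs of the two cells differ by multiples of x_i - x_j, so the comparison of the cells is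
    a scalar inequality in this difference, whose leading coefficient is the transverse
    eigenvalue. *)
Lemma pair_zero : sync_pair ->
  \sum_p transverse p * first_derivatives f 0 p != 0 ->
  exists2 r : R, 0 < r & forall (x : 'cV[R]_n) l, `|x| <= r -> `|l| <= r ->
    admissible N f x l = 0 -> x i 0 = x j 0.
Proof.
move=> sp; set s := \sum_p _ => s0.
have e0 : 0 < `|s| / 2 by rewrite divr_gt0// normr_gt0.
have [r r0 H] := compare_cells N 0 e0; exists r => // x l hx hl Fx.
have hl0 : `|l - 0| <= r by rewrite subr0.
have [+ _] := H x l i j hx hl0.
rewrite -!admissibleE Fx !mxE subrr sub0r normrN derivatives_at0.
have -> : \sum_p (x (slot N p i) 0 - x (slot N p j) 0) * first_derivatives f 0 p
   = s * (x i 0 - x j 0).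
  by rewrite mulr_suml; apply: eq_bigr => p _; rewrite sync_pair_slot//; ring.
have hz : `|zrow N x l i - zrow N x l j| <= `|x i 0 - x j 0|.
  apply: mx_norm_le => // a b; rewrite ord1.
  case: (split_ordP b) => p ->; rewrite ?zrow_diff_l ?zrow_diff_r; last by rewrite normr0.
  rewrite sync_pair_slot// normrM ler_piMl// /transverse.
  by do 2 case: eqP => _ /=; rewrite ?subrr ?subr0 ?sub0r ?normrN ?normr0 ?normr1.
move=> hh; have := le_trans hh (ler_wpM2l (ltW e0) hz); rewrite normrM => h3.
apply/eqP; rewrite -subr_eq0 -normr_le0.
have : `|s| / 2 * `|x i 0 - x j 0| <= 0.
  by move: h3; move: (`|x i 0 - x j 0|) (`|s|) => p q; lra.
by rewrite pmulr_rle0.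
Qed.

End Pair.

Lemma norm_pairs (p q r' t : R) : `|t| + `|q| <= 1 + `|p| + `|t| + `|q| + `|r'| /\
  `|p| + `|r'| <= 1 + `|p| + `|t| + `|q| + `|r'|.
Proof.
have [h1 h2] := (normr_ge0 p, normr_ge0 q); have [h3 h4] := (normr_ge0 r', normr_ge0 t).
by split; lra.
Qed.

Section Diagonal.
Variables (N : network k 3) (a b c : 'I_3).
Hypotheses (ab : a != b) (ac : a != c) (bc : b != c).
Hypothesis abc : forall i : 'I_3, [\/ i = a, i = b | i = c].

(** The deviations of cells b and c from cell a solve a linear system of size two up to errors
    proportional to the deviations themselves; Cramer's rule bounds them by a fraction of
    themselves. *)
Lemma diagonal_zero : reduced_det a b c (jacobian N (first_derivatives f)) != 0 ->
  exists2 r : R, 0 < r & forall (x : 'cV[R]_3) l, `|x| <= r -> `|l| <= r ->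
    admissible N f x l = 0 -> x a 0 = x b 0 /\ x a 0 = x c 0.
Proof.
set J := jacobian _ _; set d := reduced_det _ _ _ _ => d0.
pose B := 1 + `|J b b - J a b| + `|J c c - J a c| + `|J b c - J a c| + `|J c b - J a b|.
have B1 : 1 <= B by rewrite /B -!addrA lerDl !addr_ge0.
have B0 : 0 < B by apply: lt_le_trans B1.
(* Two cells differ by at most 2 m, so each residual is at most |d| m / (4 B); Cramer's rule with
   coefficients bounded by B then gives |d| m <= |d| m / 4. *)
have e0 : 0 < `|d| / (8 * B) by rewrite divr_gt0 ?normr_gt0// mulr_gt0.
have [r r0 H] := compare_cells N 0 e0; exists r => // x l hx hl Fx.
have hl0 : `|l - 0| <= r by rewrite subr0.
pose u := x b 0 - x a 0; pose v := x c 0 - x a 0.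
pose m := Order.max `|u| `|v|.
have m0 : 0 <= m by rewrite le_max normr_ge0.
have um : `|u| <= m by rewrite le_max lexx.
have vm : `|v| <= m by rewrite le_max lexx orbT.
have xd i j : `|x i 0 - x j 0| <= 2 * m.
  have hh q : `|x q 0 - x a 0| <= m.
    by case: (abc q) => ->; rewrite ?subrr ?normr0.
  have -> : x i 0 - x j 0 = (x i 0 - x a 0) - (x j 0 - x a 0) by ring.
  apply: le_trans (ler_normB _ _) _; have := hh i; have := hh j; lra.
have key i : `|(J i b - J a b) * u + (J i c - J a c) * v| <= `|d| / (8 * B) * (2 * m).
  have [+ _] := H x l i a hx hl0.
  rewrite -!admissibleE Fx !mxE subrr sub0r normrN derivatives_at0 => h.
  have -> : (J i b - J a b) * u + (J i c - J a c) * v =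
      \sum_p (x (slot N p i) 0 - x (slot N p a) 0) * first_derivatives f 0 p.
    have hJ q : (J *m x) q 0 = \sum_p x (slot N p q) 0 * first_derivatives f 0 p.
      rewrite /J -derivatives_at0 -linear_part big_split_ord /= big_ord1 zrow_r mul0r addr0.
      by apply: eq_bigr => p _; rewrite zrow_l [in RHS]mxE.
    under [RHS]eq_bigr do rewrite mulrBl.
    rewrite sumrB -!hJ !mxE !(sum3 ab ac bc abc).
    have hs q : J q a = (\sum_p first_derivatives f 0 p) - J q b - J q c.
      by rewrite -(jacobian_row_sum N _ q) (sum3 ab ac bc abc) -/J; ring.
    by rewrite !hs /u /v; ring.
  apply: le_trans h _; rewrite ler_wpM2l ?(ltW e0)//.
  apply: mx_norm_le => [|a' b']; first by rewrite mulr_ge0.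
  rewrite ord1; case: (split_ordP b') => p ->; rewrite ?zrow_diff_l ?zrow_diff_r//.
  by rewrite normr0 mulr_ge0.
have kb := key b; have kc := key c.
have he : `|d| * m <= `|d| * m / 2.
  set E := `|d| / (8 * B) * (2 * m) in kb kc.
  have hB : B * E * 2 = `|d| * m / 2.
    have aux w B' : B' != 0 -> B' * (w / (8 * B') * (2 * m)) * 2 = w * m / 2.
      by move=> ?; field.
    by rewrite aux// gt_eqF.
  have E0 : 0 <= E by apply: le_trans kb.
  have bound p q e1 e2 : `|p| + `|q| <= B -> `|e1| <= E -> `|e2| <= E ->
      `|p * e1 - q * e2| <= B * E.
    move=> pq h1 h2; apply: le_trans (ler_normB _ _) _; rewrite !normrM.
    apply: le_trans (ler_wpM2r E0 pq); rewrite mulrDl.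
    by rewrite lerD// ler_wpM2l.
  have [B1' B2'] := norm_pairs (J b b - J a b) (J b c - J a c) (J c b - J a b) (J c c - J a c).
  have hu := bound _ _ _ _ B1' kb kc; have hv := bound _ _ _ _ B2' kc kb.
  have eu : `|d| * `|u| <= B * E.
    rewrite -normrM; apply: le_trans hu; rewrite le_eqVlt; apply/orP; left.
    by apply/eqP; congr (`|_|); rewrite /d /reduced_det; ring.
  have ev : `|d| * `|v| <= B * E.
    rewrite -normrM; apply: le_trans hv; rewrite le_eqVlt; apply/orP; left.
    by apply/eqP; congr (`|_|); rewrite /d /reduced_det; ring.
  have BE : 0 <= B * E by rewrite mulr_ge0// ltW.
  have : `|d| * m <= B * E by rewrite /m; case: (leP `|u| `|v|) => _.
  by rewrite -hB => /le_trans; apply; rewrite mulr2n mulrDr !mulr1 lerDl.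
have dm : `|d| * m <= 0.
  by move: he; rewrite {1}[`|d| * m]splitr gerDl pmulr_lle0// invr_gt0.
have {dm} : m <= 0 by move: dm; rewrite pmulr_rle0// normr_gt0.
move=> m1; split; apply/eqP; rewrite -subr_eq0 -normr_le0 distrC.
  exact: le_trans um m1.
exact: le_trans vm m1.
Qed.

End Diagonal.

Section Branches.
Variables (n : nat) (N : network k n).
Implicit Types (D E : {vspace 'cV[R]_n}).

Definition near_zeros (P : 'cV[R]_n -> Prop) : Prop :=
  exists2 r : R, 0 < r & forall x l, `|x| <= r -> `|l| <= r ->
    admissible N f x l = 0 -> P x.

Lemma near_zeros_and P Q : near_zeros P -> near_zeros Q ->
  near_zeros (fun x => P x /\ Q x).
Proof.
move=> [r r0 h] [q q0 g]; exists (Order.min r q); first by rewrite lt_min r0.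
by move=> x l; rewrite !le_min => /andP[? ?] /andP[? ?] F0; split; [exact: (h x l)|exact: (g x l)].
Qed.

Lemma near_zeros_imp (P Q : 'cV[R]_n -> Prop) : (forall x, P x -> Q x) ->
  near_zeros P -> near_zeros Q.
Proof. by move=> h [r r0 g]; exists r => // x l hx hl /(g x l hx hl)/h. Qed.

Lemma unit_cases (e : R) : e ^+ 2 = 1 -> e = 1 \/ e = -1.
Proof.
by move=> /eqP; rewrite -subr_eq0 subr_sqr_1 mulf_eq0 subr_eq0 addr_eq0 => /orP[]/eqP; [left|right].
Qed.

Lemma unit_norm (e : R) : e ^+ 2 = 1 -> `|e| = 1.
Proof. by move=> /unit_cases[]->; rewrite ?normrN1 ?normr1. Qed.

Lemma half_line_small (e dlt l : R) : e ^+ 2 = 1 -> half_line e dlt l -> `|l| <= dlt.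
Proof.
move=> e2; rewrite /half_line /= => /andP[x1].
by rewrite -[e * l]ger0_norm// normrM (unit_norm e2) mul1r.
Qed.

Lemma half_line_region (e dlt : R) : e ^+ 2 = 1 -> 0 < dlt -> region (half_line e dlt).
Proof.
move=> e2 d0; have e0 : e != 0 by apply: contraPneq e2 => ->; rewrite expr0n /=; lra.
split.
- apply/connected_intervalP => x y; rewrite /half_line /= => /andP[x1 x2] /andP[y1 y2].
  move=> z /andP[xz zy]; case: (unit_cases e2) => e1; move: x1 x2 y1 y2; rewrite e1 ?mul1r ?mulN1r => *; apply/andP; split; lra.
- by rewrite /half_line /= mulr0 lexx ltW.
- exists (e * dlt); last by rewrite mulf_neq0// gt_eqF.
  by rewrite /half_line /= mulrA -expr2 e2 mul1r lexx ltW.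
Qed.

Lemma within_small (I : set R) (b : R -> 'cV[R]_n) (r : R) : 0 < r ->
  {within I, continuous b} -> I 0 -> b 0 = 0 ->
  exists2 q : R, 0 < q & forall l, I l -> `|l| <= q -> `|b l| <= r.
Proof.
move=> r0 cb I0 b0.
have := cb 0; rewrite /continuous_at => /cvgrPdist_le /(_ r r0).
rewrite -[from_subspace I b 0]/(b 0) b0 => H.
have {H} : \forall t \near within I (nbhs (0 : R)), `|0 - b t| <= r.
  by move: H; rewrite /nbhs/= nbhs_subspace_in.
rewrite /within /= => /nbhs_ballP[q /= q0 hq]; exists (q / 2); first by rewrite divr_gt0.
move=> l Il lq; rewrite -normrN -sub0r; apply: hq => //.
by rewrite /ball /= sub0r normrN; apply: le_lt_trans lq _; lra.
Qed.

(** The region contains a nonzero parameter, hence an interval from 0 towards it. Shrinking to a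
    short piece of this interval makes states and parameters small, and the synchrony survives by
    the definition of [branch_with_synchrony]. *)
Lemma branch_localize D (r : R) : 0 < r -> branch_with_synchrony N f D ->
  exists e dlt b, [/\ e ^+ 2 = 1, 0 < dlt <= r /\ {within half_line e dlt, continuous b},
    b 0 = 0 /\ forall l, half_line e dlt l -> `|b l| <= r /\ admissible N f (b l) l = 0,
    smallest_synchrony N (b @` half_line e dlt) D
    & exists2 l, half_line e dlt l & b l != 0].
Proof.
move=> r0 [I [b [regI HI]]].
have [[rI cb b0 zb [l1 Il1 bl1]] _] := HI I (@subset_refl _ I) regI.
have [q q0 hq] := within_small r0 cb (let: And3 _ i _ := regI in i) b0.
case: regI => [/connected_intervalP iI I0 [l Il l0]].
pose e := Num.sg l; have e2 : e ^+ 2 = 1 by rewrite sqr_sg l0.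
pose dlt := Order.min (Order.min r q) `|l|.
have d0 : 0 < dlt by rewrite !lt_min r0 q0 normr_gt0.
have sub : half_line e dlt `<=` I.
  move=> x; rewrite /half_line /= => /andP[x1]; rewrite le_min => /andP[_ x2].
  have : (0 <= x <= l) || (l <= x <= 0).
    move: x1 x2; rewrite /e; case: (sgrP l) => [e'|p|p]; first by rewrite e' eqxx in l0.
      by rewrite mul1r => -> ->.
    by rewrite mulN1r => ? ?; apply/orP; right; apply/andP; split; lra.
  by case/orP; [exact: iI|exact: iI].
have [[_ cb' _ zb' nb'] sD] := HI _ sub (half_line_region e2 d0).
exists e, dlt, b; split=> //.
- by split=> //; rewrite d0 /dlt !ge_min lexx.
- split=> // x hx; split; last exact: zb'.
  apply: hq; first exact: sub.
  move: hx; rewrite /half_line /= le_min => /andP[x1 /andP[+ _]].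
  rewrite le_min => /andP[_]; rewrite -[e * x]ger0_norm// normrM.
  by rewrite normr_sg l0 mul1r.
Qed.

Lemma branch_below D E : branch_with_synchrony N f D -> synchrony N E ->
  near_zeros (fun x => x \in D -> x \in E) -> (D <= E)%VS.
Proof.
move=> bD sE [r r0 h]; have [e [dlt [b [e2 [d0 cb] [b0 zb] [_ inD min] _]]]] := branch_localize r0 bD.
apply: min => // _ [l hl <-]; have [h1 h2] := zb l hl; apply: (h _ l) => //; last by apply: inD; exists l.
by apply: le_trans (half_line_small e2 hl) _; case/andP: d0.
Qed.

(** A branch is nonzero on every subregion, however close to 0, so it cannot stay in a space in
    which 0 is the only nearby zero. *)
Lemma branch_not_below D E : branch_with_synchrony N f D ->
  near_zeros (fun x => x \in E -> x = 0) -> ~~ (D <= E)%VS.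
Proof.
move=> bD [r r0 h]; apply/negP => DE.
have [e [dlt [b [e2 [d0 cb] [b0 zb] [_ inD _] [l hl /eqP bl]]]]] := branch_localize r0 bD.
have [h1 h2] := zb l hl; apply: bl; apply: (h _ l) => //; last first.
  by apply: (subvP DE); apply: inD; exists l.
by apply: le_trans (half_line_small e2 hl) _; case/andP: d0.
Qed.

(** Every subregion contains a nonzero parameter, and the state at a single such parameter already
    determines the smallest synchrony space; shrinking therefore loses nothing. *)
Lemma half_branch_synchrony D (e dlt : R) b P : half_branch f N e dlt b P ->
  synchrony N D ->
  near_zeros (fun x => P x -> [/\ x != 0, x \in D &
    forall E, synchrony N E -> x \in E -> (D <= E)%VS]) ->
  branch_with_synchrony N f D.
Proof.
move=> [e2 d0 cb [b0 zb] Pb] sD [r r0 near].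
have [_ I0 _] := half_line_region e2 d0.
have [q q0 hq] := within_small r0 cb I0 b0.
pose dl := Order.min dlt (Order.min q r).
have dl0 : 0 < dl by rewrite !lt_min d0 q0 r0.
exists (half_line e dl), b; split; first exact: half_line_region.
move=> I' I'sub [cI' I'0 [l I'l l0]].
have sub : half_line e dl `<=` half_line e dlt.
  by move=> x; rewrite /half_line /= => /andP[->]; rewrite le_min => /andP[-> _].
have key x : I' x -> x != 0 -> [/\ b x != 0, b x \in D &
    forall E, synchrony N E -> b x \in E -> (D <= E)%VS].
  move=> I'x x0; have hx := sub _ (I'sub _ I'x).
  have xq : `|x| <= q /\ `|x| <= r.
    by have := half_line_small e2 (I'sub _ I'x); rewrite !le_min => /and3P[].
  by apply: (near _ x); [apply: hq; tauto|tauto|exact: zb|exact: Pb].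
split.
  split=> //; first by split=> //; exists l.
  - by apply: continuous_subspaceW cb; apply: subset_trans I'sub sub.
  - by move=> x /I'sub/sub; exact: zb.
  - by exists l => //; have [] := key l I'l l0.
split=> //.
  move=> _ [x I'x <-]; have [->|x0] := eqVneq x 0; first by rewrite b0 mem0v.
  by have [] := key x I'x x0.
by move=> E sE hE; have [_ _] := key l I'l l0; apply=> //; apply: hE; exists l.
Qed.

End Branches.

(** * Lifting zeros and branches from quotient networks *)

Section Quotient.
Variables (n m : nat) (N : network k n) (M : network k m) (cc : 'I_n -> 'I_m).
Hypothesis ccN : forall l i, M l (cc i) = cc (N l i).

Definition inflate (x : 'cV[R]_m) : 'cV[R]_n := \col_i x (cc i) 0.

Lemma inflate_zrow x l i : zrow N (inflate x) l i = zrow M x l (cc i).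
Proof.
congr row_mx; apply/rowP => p; rewrite !mxE; congr (x _ 0).
by rewrite /slot; case: unliftP => [q _|_]//; rewrite ccN.
Qed.

Lemma inflate_admissible x l : admissible N f (inflate x) l = inflate (admissible M f x l).
Proof. by apply/colP => i; rewrite [RHS]mxE !admissibleE inflate_zrow. Qed.

Lemma inflate0 : inflate 0 = 0.
Proof. by apply/colP => i; rewrite !mxE. Qed.

Lemma inflate_norm x : `|inflate x| <= `|x|.
Proof. by apply: mx_norm_le => // i j; rewrite ord1 mxE; exact: mx_norm_coord. Qed.

Lemma inflate_sub x y : inflate (x - y) = inflate x - inflate y.
Proof. by apply/colP => i; rewrite !mxE. Qed.

Lemma inflate_branch e dlt b P : half_branch f M e dlt b P ->
  half_branch f N e dlt (inflate \o b) (fun x => exists2 y, x = inflate y & P y).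
Proof.
move=> [e2 d0 cb [b0 zb] Pb]; split=> //.
- have cl : continuous inflate.
    move=> x; apply/(@cvgrPdist_le _ _ _ (nbhs x)) => eps eps0.
    have /cvgrPdist_le/(_ eps eps0) : (fun y : 'cV[R]_m => y) @ x --> x by exact: cvg_id.
    by apply: filterS => y; apply: le_trans; rewrite -inflate_sub; exact: inflate_norm.
  by move=> x; exact: (cvg_comp _ _ (cb x) (cl (b x))).
- split=> [|l hl /=]; first by rewrite /= b0 inflate0.
  by rewrite inflate_admissible zb// inflate0.
- by move=> l hl l0; exists (b l) => //; exact: Pb.
Qed.

Hypothesis cc_surj : forall a, exists i, cc i = a.

Lemma inflate_inj x y : inflate x = inflate y -> x = y.
Proof.
move=> xy; apply/colP => a; have [i <-] := cc_surj a.
by have /colP/(_ i) := xy; rewrite !mxE.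
Qed.

Lemma inflateP (x : 'cV[R]_n) : (forall i j, cc i = cc j -> x i 0 = x j 0) ->
  exists2 y, x = inflate y & `|y| <= `|x|.
Proof.
move=> xc; have [s hs] := choice cc_surj.
exists (\col_a x (s a) 0); first by apply/colP => i; rewrite !mxE; apply: xc; rewrite hs.
by apply: mx_norm_le => // i j; rewrite ord1 mxE; exact: mx_norm_coord.
Qed.

Lemma quotient_zero (D : {vspace 'cV[R]_n}) :
  (forall x, x \in D <-> forall i j, cc i = cc j -> x i 0 = x j 0) ->
  \det (jacobian M (first_derivatives f)) != 0 ->
  near_zeros N (fun x => x \in D -> x = 0).
Proof.
move=> DE; rewrite -derivatives_at0 => /isolated_zero[r r0 H].
exists r => // x l hx hl Fx /DE/inflateP[y xy yx]; rewrite xy.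
rewrite (H y l) ?inflate0//; first exact: le_trans hx.
  by rewrite subr0.
by apply: inflate_inj; rewrite -inflate_admissible -xy Fx inflate0.
Qed.

End Quotient.

(** * Networks whose input maps are identities or constants *)

Section Homogeneous.
Variables (N : network k 3).
Hypothesis id_or_const : forall p, (forall i, slot N p i = i) \/
  (forall i j, slot N p i = slot N p j).

(** Only identity inputs tell the cells apart, so the arguments of f at the three cells lie on one
    line with this direction. *)
Definition fixed_slots : 'rV[R]_(k.+1 + 1) :=
  row_mx (\row_p [forall i, slot N p i == i]%:R) 0.

Lemma homogeneous_zrow (x : 'cV[R]_3) l i j :
  zrow N x l i = zrow N x l j + (x i 0 - x j 0) *: fixed_slots.
Proof.
apply/rowP => b; rewrite [RHS]mxE [X in _ + X]mxE.
case: (split_ordP b) => p ->; rewrite ?zrow_l ?zrow_r; last first.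
  by rewrite row_mxEr mxE mulr0 addr0.
rewrite row_mxEl mxE; case: (id_or_const p) => [h|h].
  have -> : [forall i, slot N p i == i] by apply/forallP => q; rewrite h.
  by rewrite !h mulr1 addrC subrK.
rewrite (h i j); case: forallP => [hp|_]; last by rewrite mulr0 addr0.
by have := h 0 1; rewrite !(eqP (hp _)).
Qed.

Definition curvature (z : 'rV[R]_(k.+1 + 1)) : R :=
  \sum_p fixed_slots 0 p * \sum_q fixed_slots 0 q * pderiv [:: q; p] f z.

Lemma curvature_near : jet2 f fixed_slots fixed_slots != 0 ->
  exists2 r : R, 0 < r & forall z, `|z| <= r -> curvature z != 0.
Proof.
have -> : jet2 f fixed_slots fixed_slots = curvature 0.
  rewrite /jet2 exchange_big; apply: eq_bigr => a _; rewrite mulr_sumr.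
  by apply: eq_bigr => b _; rewrite mulrA [fixed_slots 0 b * _]mulrC.
move=> q0; have dc : differentiable curvature 0.
  apply: differentiable_fsum => a; apply: differentiable_fmul; first exact: differentiable_cst.
  apply: differentiable_fsum => b; apply: differentiable_fmul; first exact: differentiable_cst.
  exact: sf.
have /differentiable_continuous cc := dc.
move/(@cvgrPdist_lt _ _ _ (nbhs (0 : 'rV[R]_(k.+1 + 1)))): cc.
have n0 : 0 < `|curvature 0| by rewrite normr_gt0.
move=> /(_ _ n0) /nbhs_ballP[q /= q1 hq]; exists (q / 2); first by rewrite divr_gt0.
move=> z hz; apply: contraTneq (hq z _) => [->|]; first by rewrite subr0 ltxx.
rewrite -ball_normE /= sub0r normrN; apply: le_lt_trans hz _; lra.
Qed.

Lemma derive_line_pderiv w (z : 'rV[R]_(k.+1 + 1)) (t : R) :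
  is_derive t 1 (fun t => pderiv w f (z + t *: fixed_slots))
    (\sum_q fixed_slots 0 q * pderiv (q :: w) f (z + t *: fixed_slots)).
Proof.
have := is_derive_line (z := z) (v := fixed_slots) (t := t) (smooth_differentiable w (z + t *: fixed_slots) sf).
by rewrite derive_coord //; exact: sf.
Qed.

Lemma three_zeros (z : 'rV[R]_(k.+1 + 1)) (y1 y2 y3 : R) : y1 < y2 -> y2 < y3 ->
  f (z + y1 *: fixed_slots) = 0 -> f (z + y2 *: fixed_slots) = 0 ->
  f (z + y3 *: fixed_slots) = 0 ->
  exists2 y, y1 <= y <= y3 & curvature (z + y *: fixed_slots) = 0.
Proof.
move=> y12 y23 f1 f2 f3.
pose g t := f (z + t *: fixed_slots).
pose g1 t := \sum_q fixed_slots 0 q * pderiv [:: q] f (z + t *: fixed_slots).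
have dg (t : R) : is_derive t (1 : R) g (g1 t) by exact: (derive_line_pderiv [::]).
have dg1 (t : R) : is_derive t (1 : R) g1 (curvature (z + t *: fixed_slots)).
  pose G u := \sum_q fixed_slots 0 q * pderiv [:: q] f u.
  have dG u : is_derive u fixed_slots G (curvature u).
    apply: is_derive_fsum => q.
    have dq : is_derive u fixed_slots (pderiv [:: q] f)
        (\sum_q0 fixed_slots 0 q0 * pderiv [:: q0; q] f u).
      apply: DeriveDef; first by apply: diff_derivable; exact: smooth_differentiable.
      by rewrite derive_coord//; exact: smooth_differentiable.
    have := is_derive_fmul (is_derive_cst (fixed_slots 0 q) u fixed_slots) dq.
    by rewrite mulr0 addr0.
  have := is_derive_line (z := z) (v := fixed_slots) (t := t) (g := G).
  have -> : 'D_fixed_slots G (z + t *: fixed_slots) = curvature (z + t *: fixed_slots).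
    by have := dG (z + t *: fixed_slots) => dG'; exact: derive_val.
  apply; apply: differentiable_fsum => q; apply: differentiable_fmul.
    exact: differentiable_cst.
  exact: smooth_differentiable.
have cont h h' : (forall t : R, is_derive t (1 : R) h (h' t : R)) -> continuous h.
  move=> dh t; apply: differentiable_continuous; apply/derivable1_diffP.
  exact: (@ex_derive _ _ _ _ _ _ _ (dh t)).
have rolle h h' x y : (forall t : R, is_derive t (1 : R) h (h' t : R)) -> x < y -> h x = h y ->
    exists2 c, x < c < y & h' c = 0.
  move=> dh xy hxy.
  have [||c cxy hc] := Rolle xy _ _ hxy.
  - by move=> t _; exact: (@ex_derive _ _ _ _ _ _ _ (dh t)).
  - exact: continuous_subspaceT (cont h h' dh).
  exists c; first by move: cxy; rewrite in_itv.
  have e1 := @derive_val _ _ _ _ _ _ _ hc; have e2 := @derive_val _ _ _ _ _ _ _ (dh c).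
  by rewrite -e1 e2.
have [c1 /andP[a1 b1] z1] := rolle g g1 _ _ dg y12 (etrans f1 (esym f2)).
have [c2 /andP[a2 b2] z2] := rolle g g1 _ _ dg y23 (etrans f2 (esym f3)).
have [c /andP[a3 b3] z3] := rolle _ _ c1 c2 dg1 (lt_trans b1 a2) (etrans z1 (esym z2)).
exists c => //; apply/andP; split; lra.
Qed.

(** Three distinct states would be three zeros of f on one short line, and the second derivative
    along the line would vanish close to the origin. *)
Lemma two_cells_agree : jet2 f fixed_slots fixed_slots != 0 ->
  near_zeros N (fun x => [\/ x 0 0 = x 1 0, x 0 0 = x 2 0 | x 1 0 = x 2 0]).
Proof.
(* The base point has norm at most r / 5 and the offsets along the line are at most 2 r / 5, so the
   segment stays in the ball of radius r. *)
move=> /curvature_near[r r0 H]; exists (r / 5); first by rewrite divr_gt0.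
move=> x l hx hl Fx.
have fz i : f (zrow N x l 0 + (x i 0 - x 0 0) *: fixed_slots) = 0.
  by rewrite -homogeneous_zrow -admissibleE Fx mxE.
have hs : `|fixed_slots| <= 1.
  apply: mx_norm_le => // i j; rewrite ord1 /fixed_slots.
  case: (split_ordP j) => p ->; rewrite ?row_mxEl ?row_mxEr mxE ?normr0//.
  by case: [forall _, _]; rewrite ?normr1 ?normr0.
have small i j y : x i 0 - x 0 0 <= y <= x j 0 - x 0 0 ->
    curvature (zrow N x l 0 + y *: fixed_slots) != 0.
  move=> /andP[y1 y2]; apply: H; apply: le_trans (ler_normD _ _) _.
  have h1 : `|zrow N x l 0| <= r / 5.
    by apply: zrow_norm => //; [rewrite divr_ge0// ltW|move=> q; apply: le_trans (mx_norm_coord _ _ _) hx].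
  have h2 q : `|x q 0| <= r / 5 by apply: le_trans (mx_norm_coord _ _ _) hx.
  have h3 : `|y| <= 2 * (r / 5).
    have := (h2 0, h2 i, h2 j); rewrite !ler_norml => -[[/andP[? ?] /andP[? ?]] /andP[? ?]].
    by apply/andP; split; lra.
  have h4 : `|y *: fixed_slots| <= 2 * (r / 5).
    by rewrite normrZ -[X in _ <= X]mulr1; apply: ler_pM.
  by apply: le_trans (lerD h1 h4) _; lra.
have chain i j q : x i 0 < x j 0 -> x j 0 < x q 0 -> False.
  move=> ij jq; have [||y hy cy] := @three_zeros (zrow N x l 0)
      (x i 0 - x 0 0) (x j 0 - x 0 0) (x q 0 - x 0 0) _ _ (fz i) (fz j) (fz q).
  - by rewrite ltrD2r.
  - by rewrite ltrD2r.
  by have := small i q y hy; rewrite cy eqxx.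
case: (ltgtP (x 0 0) (x 1 0)) => [a01|a10|e01]; last by constructor 1.
  case: (ltgtP (x 1 0) (x 2 0)) => [a12|a21|e12]; [by case: (chain 0 1 2)| |by constructor 3].
  by case: (ltgtP (x 0 0) (x 2 0)) => [a02|a20|e02]; [case: (chain 0 2 1)|case: (chain 2 0 1)|constructor 2].
case: (ltgtP (x 1 0) (x 2 0)) => [a12|a21|e12]; [ |by case: (chain 2 1 0)|by constructor 3].
by case: (ltgtP (x 0 0) (x 2 0)) => [a02|a20|e02]; [case: (chain 1 0 2)|case: (chain 1 2 0)|constructor 2].
Qed.

Lemma locally_constant (T : Type) (A : set R) (h : R -> T) : connected A ->
  (forall s, A s -> exists2 r : R, 0 < r & forall t, A t -> `|s - t| < r -> h t = h s) ->
  forall s t, A s -> A t -> h t = h s.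
Proof.
move=> cA loc s t As At.
pose B := [set u | A u /\ h u = h s].
have BE : B = A.
  apply: cA.
  - by exists s.
  - exists [set u | A u -> h u = h s]^°; first exact: open_interior.
    apply/seteqP; split=> [u [Au hu]|u [Au /interior_subset hu]]; last by split => //; exact: hu.
    split=> //; have [r r0 H] := loc u Au; apply/nbhs_ballP; exists r => // z uz Az.
    by rewrite (H z Az uz).
  - exists (~` [set u | A u -> h u <> h s]^°).
      by apply: open_closedC; exact: open_interior.
    apply/seteqP; split=> [u [Au hu]|u [Au nu]]; first by split=> // /interior_subset/(_ Au).
    split=> //; apply: contrapT => hu; apply: nu.
    have [r r0 H] := loc u Au; apply/nbhs_ballP; exists r => // z uz Az.
    by rewrite (H z Az uz).
by have [] : B t by rewrite BE.
Qed.

Lemma half_line_convex (e dlt x y z : R) : e ^+ 2 = 1 -> 0 < e * x -> e * x <= dlt ->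
  0 < e * y -> e * y <= dlt -> x <= z -> z <= y -> 0 < e * z <= dlt.
Proof.
by move=> /unit_cases[] ->; rewrite ?mul1r ?mulN1r => *; apply/andP; split; lra.
Qed.

Lemma no_common_neighbour (x y w : R) : x != y ->
  `|x - w| <= `|x - y| / 4 -> `|y - w| <= `|x - y| / 4 -> False.
Proof.
rewrite -subr_eq0 -normr_gt0 => d0 h1; rewrite distrC => h2.
have := ler_distD w x y; lra.
Qed.

(* Away from the origin a branch has no zero, so the pair of cells that agree
   cannot change along it. *)
Lemma homogeneous_branch D : jet2 f fixed_slots fixed_slots != 0 ->
  (exists2 r : R, 0 < r & forall l, 0 < `|l| <= r ->
     \det (jacobian N (derivatives_at l)) != 0) ->
  near_zeros N (fun x => x 0 0 = x 1 0 -> x 0 0 = x 2 0 -> x = 0) ->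
  branch_with_synchrony N f D ->
  exists i j : 'I_3, i != j /\ forall E, synchrony N E ->
    (forall x, x \in E <-> x i 0 = x j 0) -> (D <= E)%VS.
Proof.
move=> curv [rd rd0 detJ] diag bD.
have [r r0 near] := near_zeros_and (two_cells_agree curv) diag.
have near1 x l (hx : `|x| <= r) (hl : `|l| <= r) F0 := (near x l hx hl F0).1.
have near2 x l (hx : `|x| <= r) (hl : `|l| <= r) F0 := (near x l hx hl F0).2.
pose r1 := Order.min (r / 2) (rd / 2).
have r10 : 0 < r1 by rewrite lt_min !divr_gt0.
have [e [dlt [b [e2 [/andP[d0 d1] cb] [b0 zb] [_ inD min] [l1 hl1 bl1]]]]] := branch_localize r10 bD.
move: d1; rewrite le_min => /andP[dr drd].
have hsmall l : half_line e dlt l -> [/\ `|b l| <= r, `|l| <= r & `|l| <= rd].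
  move=> hl; have := half_line_small e2 hl; have [+ _] := zb l hl.
  rewrite le_min => /andP[h1 _] h2; have half (x : R) : 0 < x -> x / 2 <= x.
    by move=> x0; rewrite ler_pdivrMr// ler_peMr ?ler1n// ltW.
  by split; [exact: le_trans h1 (half _ r0)|exact: le_trans h2 (le_trans dr (half _ r0))
    |exact: le_trans h2 (le_trans drd (half _ rd0))].
pose A := [set l : R | 0 < e * l <= dlt].
have AH l : A l -> half_line e dlt l by rewrite /A /half_line /= => /andP[/ltW-> ->].
have cA : connected A.
  apply/connected_intervalP => x y; rewrite /A /= => /andP[x1 x2] /andP[y1 y2] z /andP[xz zy].
  exact: (half_line_convex e2 x1 x2 y1 y2 xz zy).
(* The three equalities are followed together: once this pattern is locally constant on the
   connected set [A], the pair of equal cells is the same along the whole branch. *)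
pose h l := (b l 0 0 == b l 1 0, b l 0 0 == b l 2 0, b l 1 0 == b l 2 0).
have hloc s : A s -> exists2 q : R, 0 < q & forall t, A t -> `|s - t| < q -> h t = h s.
  move=> As; have s0 : s != 0.
    by apply: contraPneq As => ->; rewrite /A /= mulr0 ltxx.
  have [h1 h2 h3] := hsmall s (AH s As).
  have Js : \det (jacobian N (derivatives_at s)) != 0 by apply: detJ; rewrite normr_gt0 s0.
  have [q1 q10 iso] := isolated_zero Js.
  have cont (eps : R) : 0 < eps -> exists2 q, 0 < q & forall t, A t -> `|s - t| < q -> `|b s - b t| <= eps.
    move=> eps0; have := cb s.
    rewrite /continuous_at => /cvgrPdist_le /(_ eps eps0).
    rewrite -[from_subspace _ b s]/(b s) => H.
    have {H} : \forall t \near within (half_line e dlt) (nbhs s), `|b s - b t| <= eps.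
      by move: H; rewrite /nbhs/= nbhs_subspace_in//; exact: AH.
    rewrite /within /= => /nbhs_ballP[q /= q0 hq]; exists q => // t At st.
    by apply: hq => //; exact: AH.
  have agree t : A t -> [\/ b t 0 0 = b t 1 0, b t 0 0 = b t 2 0 | b t 1 0 = b t 2 0].
    move=> /AH At; have [k1 k2 _] := hsmall t At; have [_ k3] := zb t At.
    exact: (near1 _ t).
  have zero t : A t -> b t 0 0 = b t 1 0 -> b t 0 0 = b t 2 0 -> b t = 0.
    move=> /AH At; have [k1 k2 _] := hsmall t At; have [_ k3] := zb t At.
    exact: (near2 _ t).
  (* The branch may return to 0 at a nonzero parameter s. The Jacobian is regular there, so the
     branch stays at 0 nearby and the pattern does not change. *)
  have [bs|/eqP bs] := eqVneq (b s) 0.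
    have [q2 q20 c2] := cont q1 q10; exists (Order.min q1 q2); first by rewrite lt_min q10.
    move=> t At; rewrite lt_min => /andP[st1 st2].
    suff bt : b t = 0 by rewrite /h bt bs.
    apply: (iso _ t); last by have [] := zb t (AH t At).
      by have := c2 t At st2; rewrite bs sub0r normrN.
    by rewrite distrC ltW.
  (* Inequalities between cells persist by continuity. As some pair of cells always agrees, the
     remaining equality persists too. *)
  have stay i j : b s i 0 != b s j 0 -> exists2 q, 0 < q & forall t, A t -> `|s - t| < q -> b t i 0 != b t j 0.
    move=> ij; have e0 : 0 < `|b s i 0 - b s j 0| / 4 by rewrite divr_gt0// normr_gt0 subr_eq0.
    have [q q0 c] := cont _ e0; exists q => // t At st.
    apply: contraTneq isT => tij; have hb u := le_trans (mx_norm_coord (b s - b t) u 0) (c t At st).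
    have := hb i; have := hb j; rewrite !mxE tij => k1 k2.
    by have := no_common_neighbour ij k2 k1.
  have := agree s As.
  have fin i j u : b s i 0 = b s j 0 -> b s i 0 != b s u 0 -> b s j 0 != b s u 0 ->
    exists2 q, 0 < q & forall t, A t -> `|s - t| < q -> b t i 0 != b t u 0 /\ b t j 0 != b t u 0.
    move=> _ iu ju; have [q q0 c] := stay i u iu; have [q' q'0 c'] := stay j u ju.
    exists (Order.min q q'); first by rewrite lt_min q0.
    by move=> t At; rewrite lt_min => /andP[? ?]; split; [exact: c|exact: c'].
  have [s01|s01] := eqVneq (b s 0 0) (b s 1 0).
    have s02 : b s 0 0 != b s 2 0 by apply/eqP => s02; apply: bs; exact: zero.
    have s12 : b s 1 0 != b s 2 0 by rewrite -s01.
    have [q q0 c] := fin 0 1 2 s01 s02 s12; move=> _; exists q => // t At st.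
    have [t02 t12] := c t At st; rewrite /h (negbTE t02) (negbTE t12) (negbTE s02) (negbTE s12) s01 eqxx.
    by case: (agree t At) => [->|/eqP|/eqP]; rewrite ?eqxx// ?(negbTE t02) ?(negbTE t12).
  have [s02|s02] := eqVneq (b s 0 0) (b s 2 0).
    have s12 : b s 2 0 != b s 1 0 by rewrite -s02.
    have [q q0 c] := fin 0 2 1 s02 s01 s12; move=> _; exists q => // t At st.
    have [t01 t21] := c t At st; rewrite /h (negbTE t01) eq_sym.
    rewrite (negbTE s01) s02 eqxx [b s 1 0 == _]eq_sym (negbTE s12) [b t 1 0 == _]eq_sym (negbTE t21).
    by case: (agree t At) => [/eqP|->|/esym/eqP]; rewrite ?eqxx// ?(negbTE t01) ?(negbTE t21).
  case=> [/eqP|/eqP|s12]; rewrite ?(negbTE s01) ?(negbTE s02)//.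
  have s10 : b s 1 0 != b s 0 0 by rewrite eq_sym.
  have s20 : b s 2 0 != b s 0 0 by rewrite eq_sym.
  have [q q0 c] := fin 1 2 0 s12 s10 s20; exists q => // t At st.
  have [t10 t20] := c t At st; rewrite /h (negbTE s01) (negbTE s02) s12 eqxx.
  rewrite [b t 0 0 == _]eq_sym (negbTE t10) [b t 0 0 == _]eq_sym (negbTE t20).
  by case: (agree t At) => [/esym/eqP|/esym/eqP|->]; rewrite ?eqxx// ?(negbTE t10) ?(negbTE t20).
have Al1 : A l1.
  move: hl1; rewrite /half_line /A /= => /andP[x1 ->]; rewrite andbT lt_def x1 andbT.
  rewrite mulf_neq0//; first by apply: contraPneq e2 => ->; rewrite expr0n /=; lra.
  by apply: contraNneq bl1 => ->; rewrite b0.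
have hc l : A l -> h l = h l1 by apply: locally_constant => //.
have concl i j : i != j -> (forall l, A l -> b l i 0 = b l j 0) ->
  exists i j : 'I_3, i != j /\ forall E, synchrony N E ->
    (forall x, x \in E <-> x i 0 = x j 0) -> (D <= E)%VS.
  move=> ij H; exists i, j; split=> // E sE EE; apply: min => // _ [l hl <-]; apply/EE.
  have [->|l0] := eqVneq l 0; first by rewrite b0 !mxE.
  apply: H; move: hl; rewrite /half_line /A /= => /andP[x1 ->]; rewrite andbT lt_def x1 andbT.
  by rewrite mulf_neq0//; apply: contraPneq e2 => ->; rewrite expr0n /=; lra.
have [] : [\/ b l1 0 0 = b l1 1 0, b l1 0 0 = b l1 2 0 | b l1 1 0 = b l1 2 0].
  have [k1 k2 _] := hsmall l1 hl1; have [_ k3] := zb l1 hl1.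
  exact: (near1 _ l1).
- move=> e1; apply: (concl 0 1) => // l Al.
  by have /(congr1 (fun u => u.1.1)) /= := hc l Al; rewrite e1 eqxx => /eqP.
- move=> e1; apply: (concl 0 2) => // l Al.
  by have /(congr1 (fun u => u.1.2)) /= := hc l Al; rewrite e1 eqxx => /eqP.
- move=> e1; apply: (concl 1 2) => // l Al.
  by have /(congr1 (fun u => u.2)) /= := hc l Al; rewrite e1 eqxx => /eqP.
Qed.

End Homogeneous.

End LocalZeros.

(** * Polynomial conditions on the derivatives *)

Section PolynomialValues.
Variables (R : realType).

(** Among [size q] distinct points one is not a root, because a nonzero polynomial has fewer roots
    than its size. *)
Lemma poly_small_nonroot (q : {poly R}) (e : R) : q != 0 -> 0 < e ->
  exists2 s, 0 < s < e & q.[s] != 0.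
Proof.
move=> q0 e0; pose rs := [seq e / (i.+2)%:R | i <- iota 0 (size q)].
have urs : uniq rs.
  rewrite map_inj_uniq ?iota_uniq// => i j /(mulfI (lt0r_neq0 e0))/invr_inj/eqP.
  by rewrite eqr_nat => /eqP[].
have : ~~ all (root q) rs.
  apply/negP => ars; have := max_poly_roots q0 ars urs.
  by rewrite size_map size_iota ltnn.
case/allPn => s /mapP[i _ ->] nr; exists (e / i.+2%:R) => //.
by rewrite divr_gt0//= ltr_pdivrMr// ltr_pMr// ltr1n.
Qed.

Lemma evalpD d (p q : mpoly d R) z : evalp (p + q) z = evalp p z + evalp q z.
Proof. exact: mevalD. Qed.
Lemma evalpM d (p q : mpoly d R) z : evalp (p * q) z = evalp p z * evalp q z.
Proof. exact: mevalM. Qed.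
Lemma evalpC d c (z : 'rV[R]_d) : evalp (mpolyC d c) z = c.
Proof. exact: mevalC. Qed.
Lemma evalpX d i (z : 'rV[R]_d) : evalp (mpolyX R (mnm1 i)) z = z 0 i.
Proof. exact: mevalXU. Qed.
Lemma evalpZ d c (p : mpoly d R) z : evalp (c *: p) z = c * evalp p z.
Proof. exact: mevalZ. Qed.

Lemma evalp_closed d (P : ('rV[R]_d -> R) -> Prop) :
  (forall c, P (fun=> c)) -> (forall i, P (fun z => z 0 i)) ->
  (forall f g, P f -> P g -> P (fun z => f z + g z)) ->
  (forall f g, P f -> P g -> P (fun z => f z * g z)) ->
  forall p, P (evalp p).
Proof.
move=> PC PX PD PM p.
have Pexp i n : P (fun z => z 0 i ^+ n).
  elim: n => [|n ih]; first exact: PC.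
  by under eq_fun do rewrite exprS; exact: (PM).
have Pmon (m : multinom d) : P (fun z => \prod_(i < d) z 0 i ^+ m i).
  elim: (index_enum _) => [|i s ih]; first by under eq_fun do rewrite big_nil; exact: PC.
  by under eq_fun do rewrite big_cons; exact: PM.
have -> : evalp p = fun z => \sum_(m <- msupp p) mcoeff m p * \prod_(i < d) z 0 i ^+ m i.
  by apply/funext => z; rewrite /evalp mevalE.
elim: (msupp p) => [|m s ih]; first by under eq_fun do rewrite big_nil; exact: PC.
by under eq_fun do rewrite big_cons; apply: PD => //; apply: PM.
Qed.

Lemma evalp_line d (p : mpoly d R) (y z : 'rV[R]_d) :
  exists q : {poly R}, forall s, evalp p (y + s *: z) = q.[s].
Proof.
apply: (evalp_closed (P := fun f => exists q : {poly R}, forall s, f (y + s *: z) = q.[s])).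
- by move=> c; exists c%:P => s; rewrite hornerC.
- move=> i; exists ((z 0 i)%:P * 'X + (y 0 i)%:P) => s.
  by rewrite !hornerE !mxE addrC mulrC.
- by move=> f g [q fq] [r gr]; exists (q + r) => s; rewrite hornerD fq gr.
- by move=> f g [q fq] [r gr]; exists (q * r) => s; rewrite hornerM fq gr.
Qed.

Lemma is_derive_evalp d (p : mpoly d R) (z v : 'rV[R]_d) :
  is_derive z v (evalp p) (\sum_a v 0 a * evalp (mderiv a p) z).
Proof.
move: p; have step (P : mpoly d R -> Prop) : (forall c, P (mpolyC d c)) ->
    (forall i, P (mpolyX R (mnm1 i))) -> (forall p q, P p -> P q -> P (p + q)) ->
    (forall p q, P p -> P q -> P (p * q)) -> forall p, P p.
  move=> PC PX PD PM p; rewrite (mpolyE p).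
  elim: (msupp p) => [|m s ih]; first by rewrite big_nil -(mpolyC0 d R); exact: PC.
  rewrite big_cons; apply: PD => //; rewrite -mul_mpolyC; apply: (PM); first exact: PC.
  rewrite mpolyXE_id; elim: (index_enum _) => [|i t iht].
    by rewrite big_nil -(mpolyC1 d R); exact: PC.
  rewrite big_cons; apply: (PM) => //; elim: (m i) => [|n ihn].
    by rewrite expr0 -(mpolyC1 d R); exact: PC.
  by rewrite exprS; apply: PM.
apply: step => [c|i|p q dp dq|p q dp dq].
- have -> : evalp (mpolyC d c) = cst c by apply/funext => u; rewrite evalpC.
  rewrite big1 => [|a _]; first exact: is_derive_cst.
  by rewrite mderivC /evalp meval0 mulr0.
- have -> : evalp (mpolyX R (mnm1 i)) = fun u => u 0 i by apply/funext => u; rewrite evalpX.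
  have -> : \sum_a v 0 a * evalp (mderiv a (mpolyX R (mnm1 i))) z = v 0 i.
    rewrite (bigD1 i)//= big1 ?addr0 => [|a ai].
      have mm : mnm_sub (mnm1 i) (mnm1 i) = mnm0 by apply/mnmP => j; rewrite mnmBE mnm0E subnn.
      by rewrite mderivX mnm1E eqxx scale1r mm mpolyX0 /evalp meval1 mulr1.
    by rewrite mderivX mnm1E eq_sym (negbTE ai) scale0r /evalp meval0 mulr0.
  exact: is_derive_coord.
- have -> : evalp (p + q) = evalp p + evalp q by apply/funext => u; rewrite evalpD.
  under eq_bigr do rewrite mderivD evalpD mulrDr.
  by rewrite big_split; exact: is_deriveD.
- have -> : evalp (p * q) = fun u => evalp p u * evalp q u by apply/funext => u; rewrite evalpM.
  have := is_derive_fmul dp dq; congr is_derive.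
  rewrite !mulr_sumr -big_split; apply: eq_bigr => a _.
  by rewrite mderivM evalpD !evalpM /=; ring.
Qed.

Lemma pderiv_evalp d w (p : mpoly d R) : pderiv w (evalp p) = evalp (foldr (@mderiv d R) p w).
Proof.
elim: w p => //= a w ih p.
rewrite -[pderiv (a :: w) _]/(fun z => 'D_('e_a) (pderiv w (evalp p)) z) ih.
apply/funext => z; have h := is_derive_evalp (foldr (@mderiv d R) p w) z 'e_a.
rewrite (derive_val (is_derive := h)) (bigD1 a)//= big1 ?addr0 => [|b ba].
  by rewrite mxE !eqxx mul1r.
by rewrite mxE (negbTE ba) andbF mul0r.
Qed.

Lemma smooth_evalp d (p : mpoly d R) : smooth_on setT (evalp p).
Proof.
move=> w z _; rewrite pderiv_evalp; move: (foldr _ _ _) => {p} p.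
apply: (evalp_closed (P := fun f => differentiable f z)).
- by move=> c; exact: differentiable_cst.
- by move=> i; exact: differentiable_coord.
- by move=> f g df dg; exact: differentiableD.
- by move=> f g df dg; exact: differentiable_fmul.
Qed.

Lemma multinom_neq0 d (m : multinom d) : m != mnm0 -> exists i, m i != 0%N.
Proof.
move=> m0; apply/existsP; apply: contraNT m0 => /existsPn H.
by apply/eqP/mnmP => i; rewrite mnm0E; apply/eqP; rewrite -[_ == _]negbK.
Qed.

Lemma evalp_at0 d (p : mpoly d R) : evalp p 0 = mcoeff mnm0 p.
Proof.
have zero m : m != mnm0 -> mcoeff m p * \prod_(i < d) (0 : 'rV[R]_d) 0 i ^+ m i = 0.
  move=> /multinom_neq0[i mi]; rewrite (bigD1 i)//= mxE expr0n (negbTE mi) mul0r mulr0//.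
rewrite /evalp mevalE.
have [p0|p0] := boolP (mnm0 \in msupp p); last first.
  rewrite (memN_msupp_eq0 p0) big1_seq// => m /andP[_ mp]; apply: zero.
  by apply: contraNneq p0 => <-.
rewrite (bigD1_seq mnm0)//= ?msupp_uniq// big1 ?mulr1 ?big1_seq ?addr0//.
  by move=> m /andP[m0 _]; exact: zero.
by move=> i _; rewrite mnm0E expr0.
Qed.

(** The coefficients are recovered from derivatives at 0 by induction on the degree of the monomial;
    the integer factors that arise cancel in characteristic 0. *)
Lemma evalp_eq0 d (p : mpoly d R) : (forall z, evalp p z = 0) -> p = 0.
Proof.
move=> pz; apply/mpolyP => m; rewrite mcoeff0.
move: {2}(mdeg m) (erefl (mdeg m)) => n; elim: n p pz m => [|n ih] p pz m dm.
  have -> : m = mnm0 by apply/eqP; rewrite -mdeg_eq0 dm.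
  by rewrite -evalp_at0 pz.
have [|i mi] := @multinom_neq0 d m; first by rewrite -mdeg_eq0 dm.
have mU : m = mnm_add (mnm_sub m (mnm1 i)) (mnm1 i) by rewrite submK// lep1mP.
have dpz z : evalp (mderiv i p) z = 0.
  have h := is_derive_evalp p z 'e_i.
  have := derive_val (is_derive := h); rewrite (bigD1 i)//= big1 ?addr0 => [|b bi]; last first.
    by rewrite mxE (negbTE bi) andbF mul0r.
  rewrite mxE !eqxx mul1r => <-.
  by rewrite (_ : evalp p = cst 0) ?derive_cst//; apply/funext.
have := ih _ dpz (mnm_sub m (mnm1 i)); rewrite mcoeff_deriv -mU => H.
have : mcoeff m p *+ (mnm_sub m (mnm1 i) i).+1 = 0.
  by apply: H; apply/eqP; rewrite -eqSS -dm {2}mU mdegD mdeg1 addn1.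
by move/eqP; rewrite mulrn_eq0 => /orP[//|/eqP].
Qed.

(** On the line from z to a point where p does not vanish, p is a nonzero polynomial in one variable
    and has nonroots arbitrarily close to z. *)
Lemma evalp_nonzero_near d (p : mpoly d R) (z : 'rV[R]_d) (e : R) : p != 0 -> 0 < e ->
  exists2 y, `|y - z| < e & evalp p y != 0.
Proof.
move=> p0 e0.
have [x px] : exists x, evalp p x != 0.
  apply: contrapT => H; move/eqP: p0; apply; apply: evalp_eq0 => x.
  by apply/eqP/negPn/negP => px; apply: H; exists x.
have [q hq] := evalp_line p z (x - z).
have q0 : q != 0.
  apply: contraNneq px => q0; have := hq 1; rewrite scale1r addrC subrK q0 => ->.
  by rewrite horner0.
have b0 : 0 < `|x - z| + 1 by rewrite ltr_wpDl.
have [s /andP[s0 se] qs] := poly_small_nonroot q0 (divr_gt0 e0 b0).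
exists (z + s *: (x - z)); last by rewrite hq.
rewrite addrC addKr normrZ gtr0_norm//.
move: se; rewrite ltr_pdivlMr//; apply: le_lt_trans.
by apply: ler_wpM2l; [exact: ltW|rewrite lerDl].
Qed.

End PolynomialValues.

(** * Polynomials in the jet and the elimination of f_0 *)

Section JetPolynomials.
Variables (R : realType) (k : nat).
Local Notation response := (response R k).
Local Notation dim := (k.+1 + 1)%N.

Definition jet_count := #|{: 3.-bseq 'I_dim}|.
Definition jet_word (a : 'I_jet_count) : seq 'I_dim := (enum_val a : 3.-bseq 'I_dim).

Definition f0_word : seq 'I_dim := [:: lshift 1 ord0].
(** The slot of f_0 is filled with the empty word, that is with the value f 0, so that jets with and
    without f_0 have the same number of variables. *)
Definition free_word (a : 'I_jet_count) : seq 'I_dim :=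
  if jet_word a == f0_word then [::] else jet_word a.

Lemma jet_word_onto w : (size w <= 3)%N -> exists a, jet_word a = w.
Proof.
move=> sw; exists (enum_rank (Bseq sw : 3.-bseq 'I_dim)).
by rewrite /jet_word enum_rankK.
Qed.

Lemma free_word_onto w : (size w <= 3)%N -> w != f0_word -> exists a, free_word a = w.
Proof. by move=> /jet_word_onto[a <-] h; exists a; rewrite /free_word (negbTE h). Qed.

Lemma free_wordN a : free_word a != f0_word.
Proof. by rewrite /free_word; case: ifPn. Qed.

Lemma free_word_size a : (size (free_word a) <= 3)%N.
Proof. by rewrite /free_word /jet_word; case: ifP => // _; exact: size_bseq. Qed.

Definition jet_poly (W : 'I_jet_count -> seq 'I_dim) (Phi : response -> R) : Prop :=
  exists p : mpoly jet_count R,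
    forall f, Phi f = evalp p (\row_a pderiv (W a) f 0).

Section Closure.
Variable W : 'I_jet_count -> seq 'I_dim.
Local Notation jp := (jet_poly W).

Lemma jp_const c : jp (fun=> c).
Proof. by exists (mpolyC _ c) => f; rewrite evalpC. Qed.

Lemma jp_add A B : jp A -> jp B -> jp (fun f => A f + B f).
Proof. by move=> [p hp] [q hq]; exists (p + q) => f; rewrite evalpD hp hq. Qed.

Lemma jp_mul A B : jp A -> jp B -> jp (fun f => A f * B f).
Proof. by move=> [p hp] [q hq]; exists (p * q) => f; rewrite evalpM hp hq. Qed.

Lemma jp_opp A : jp A -> jp (fun f => - A f).
Proof.
by move=> /(jp_mul (jp_const (-1)))[p hp]; exists p => f; rewrite -hp mulN1r.
Qed.

Lemma jp_sub A B : jp A -> jp B -> jp (fun f => A f - B f).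
Proof. by move=> hA hB; apply: jp_add => //; exact: jp_opp. Qed.

Lemma jp_exp A n : jp A -> jp (fun f => A f ^+ n).
Proof.
move=> hA; elim: n => [|n ih]; first by under eq_fun do rewrite expr0; exact: jp_const.
by under eq_fun do rewrite exprS; exact: jp_mul.
Qed.

Lemma jp_sum (I : finType) (A : I -> response -> R) :
  (forall i, jp (A i)) -> jp (fun f => \sum_i A i f).
Proof.
move=> hA; elim: (index_enum _) => [|i s ih].
  by under eq_fun do rewrite big_nil; exact: jp_const.
by under eq_fun do rewrite big_cons; exact: jp_add.
Qed.

Lemma jp_word w : (exists a, W a = w) -> jp (fun f => pderiv w f 0).
Proof.
by move=> [a <-]; exists (mpolyX R (mnm1 a)) => f; rewrite evalpX mxE.
Qed.

End Closure.

Lemma jp_der w : (size w <= 3)%N -> jet_poly jet_word (fun f => pderiv w f 0).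
Proof. by move=> /jet_word_onto/jp_word. Qed.

Lemma jp_first p : jet_poly jet_word (fun f => first_derivatives f 0 p).
Proof. by under eq_fun do rewrite mxE; exact: jp_der. Qed.

Lemma free_first p : p != ord0 -> jet_poly free_word (fun f => first_derivatives f 0 p).
Proof.
move=> p0; under eq_fun do rewrite mxE; apply: jp_word; apply: free_word_onto => //.
by apply: contraNneq p0 => -[] p0; apply/eqP/val_inj.
Qed.

Section Vectors.
Implicit Types (X Y Z : response -> 'rV[R]_dim).

Lemma jp_jet1 Y : (forall a, jet_poly jet_word (fun f => Y f 0 a)) ->
  jet_poly jet_word (fun f => jet1 f (Y f)).
Proof. by move=> hY; apply: jp_sum => a; apply: jp_mul => //; exact: jp_der. Qed.

Lemma jp_jet2 Y Z : (forall a, jet_poly jet_word (fun f => Y f 0 a)) ->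
  (forall a, jet_poly jet_word (fun f => Z f 0 a)) ->
  jet_poly jet_word (fun f => jet2 f (Y f) (Z f)).
Proof.
move=> hY hZ; apply: jp_sum => a; apply: jp_sum => b.
by apply: jp_mul; [exact: jp_mul|exact: jp_der].
Qed.

Lemma jp_jet3 X Y Z : (forall a, jet_poly jet_word (fun f => X f 0 a)) ->
  (forall a, jet_poly jet_word (fun f => Y f 0 a)) ->
  (forall a, jet_poly jet_word (fun f => Z f 0 a)) ->
  jet_poly jet_word (fun f => jet3 f (X f) (Y f) (Z f)).
Proof.
move=> hX hY hZ; apply: jp_sum => a; apply: jp_sum => b; apply: jp_sum => c.
by apply: jp_mul; [apply: jp_mul => //; exact: jp_mul|exact: jp_der].
Qed.

Variables (n : nat) (N : network k n).

Lemma jp_zrow (x : response -> 'cV[R]_n) i :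
  (forall j, jet_poly jet_word (fun f => x f j 0)) ->
  forall a, jet_poly jet_word (fun f => zrow N (x f) 0 i 0 a).
Proof.
move=> hx a; case: (split_ordP a) => p ->.
  by under eq_fun do rewrite zrow_l; exact: hx.
by under eq_fun do rewrite zrow_r; exact: jp_const.
Qed.

Lemma jp_jacobian i j :
  jet_poly jet_word (fun f => jacobian N (first_derivatives f) i j).
Proof.
rewrite /jacobian; under eq_fun do rewrite summxE.
apply: jp_sum => p; under eq_fun do rewrite mxE.
by apply: jp_mul; [exact: jp_first|exact: jp_const].
Qed.

End Vectors.

(* The equation [f0 ^ 2 + t f0 + d = 0] eliminates the higher powers of f0. *)
Lemma jp_eliminate (t d Phi : response -> R) :
  jet_poly free_word t -> jet_poly free_word d -> jet_poly jet_word Phi ->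
  exists al be : response -> R,
    [/\ jet_poly free_word al, jet_poly free_word be &
      forall f : response, pderiv f0_word f 0 ^+ 2 + t f * pderiv f0_word f 0 + d f = 0 ->
        Phi f = al f + be f * pderiv f0_word f 0].
Proof.
move=> ht hd [p hp].
pose P (Psi : 'rV[R]_jet_count -> R) := exists al be : response -> R,
    [/\ jet_poly free_word al, jet_poly free_word be &
      forall f : response, pderiv f0_word f 0 ^+ 2 + t f * pderiv f0_word f 0 + d f = 0 ->
        Psi (\row_a pderiv (jet_word a) f 0) = al f + be f * pderiv f0_word f 0].
suff [al [be [h1 h2 h3]]] : P (evalp p) by exists al, be; split=> // f hf; rewrite hp h3.
apply: evalp_closed.
- move=> c; exists (fun=> c), (fun=> 0); split=> [||f _]; try exact: jp_const.
  by rewrite mul0r addr0.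
- move=> a; have [wa|wa] := eqVneq (jet_word a) f0_word.
    exists (fun=> 0), (fun=> 1); split=> [||f _]; try exact: jp_const.
    by rewrite mxE wa mul1r add0r.
  exists (fun f => pderiv (jet_word a) f 0), (fun=> 0); split=> [||f _].
  - by apply: jp_word; exists a; rewrite /free_word (negbTE wa).
  - exact: jp_const.
  - by rewrite mxE mul0r addr0.
- move=> A B [a1 [b1 [ha1 hb1 h1]]] [a2 [b2 [ha2 hb2 h2]]].
  exists (fun f => a1 f + a2 f), (fun f => b1 f + b2 f); split; [exact: jp_add|exact: jp_add|].
  by move=> f hf; rewrite h1// h2//; ring.
- move=> A B [a1 [b1 [ha1 hb1 h1]]] [a2 [b2 [ha2 hb2 h2]]].
  exists (fun f => a1 f * a2 f - b1 f * b2 f * d f).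
  exists (fun f => a1 f * b2 f + b1 f * a2 f - b1 f * b2 f * t f); split.
  - by apply: jp_sub; [exact: jp_mul|do 2 apply: jp_mul => //].
  - by apply: jp_sub; [apply: jp_add; exact: jp_mul|do 2 apply: jp_mul => //].
  move=> f hf; rewrite h1// h2//.
  move: (a1 f) (a2 f) (b1 f) (b2 f) (pderiv f0_word f 0) (t f) (d f) hf => x1 x2 y1 y2 c u v hf.
  transitivity (x1 * x2 + (x1 * y2 + y1 * x2) * c + y1 * y2 * c ^+ 2); first by ring.
  by have -> : c ^+ 2 = - (u * c + v); [move: hf; move: (c ^+ 2) (u * c) => X Y; lra|ring].
Qed.

(* The norm eliminates f0: it is the product of the values of Phi at both roots
   of the equation of f0. *)
Lemma generic_by_norm (V : set response) (P : response -> Prop) (t d Phi : response -> R) :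
  jet_poly free_word t -> jet_poly free_word d -> jet_poly jet_word Phi ->
  (forall f, V f -> pderiv f0_word f 0 ^+ 2 + t f * pderiv f0_word f 0 + d f = 0) ->
  (exists f g, [/\ V f, Phi f != 0, Phi g != 0,
      pderiv f0_word g 0 = - t f - pderiv f0_word f 0
    & forall w, (size w <= 3)%N -> w != f0_word -> pderiv w g 0 = pderiv w f 0]) ->
  (forall f, V f -> Phi f != 0 -> P f) ->
  generically V P.
Proof.
move=> ht hd hPhi VQ [f [g [Vf Pf Pg g0 gf]]] HP.
have [al [be [ha hb hab]]] := jp_eliminate ht hd hPhi.
have free_gf A : jet_poly free_word A -> A g = A f.
  move=> [p hp]; rewrite !hp; congr evalp; apply/rowP => a; rewrite !mxE gf//.
    exact: free_word_size.
  exact: free_wordN.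
have [q hq] : jet_poly free_word (fun f => al f ^+ 2 - al f * be f * t f + be f ^+ 2 * d f).
  apply: jp_add; last by apply: jp_mul => //; exact: jp_exp.
  by apply: jp_sub; [exact: jp_exp|do 2 apply: jp_mul => //].
(* If h is one root of the quadratic equation, the other root is - t - h. *)
have norm h y : h ^+ 2 + t y * h + d y = 0 -> al y ^+ 2 - al y * be y * t y + be y ^+ 2 * d y =
    (al y + be y * h) * (al y + be y * (- t y - h)).
  move=> hy; have -> : d y = - (h ^+ 2 + t y * h) by move: hy; move: (h ^+ 2) (t y * h) => X Y; lra.
  by ring.
exists jet_count, free_word, [:: q]; split.
- exact: free_wordN.
- exists f => // p; rewrite inE => /eqP->; rewrite -hq (norm _ _ (VQ f Vf)) mulf_neq0//.
    by rewrite -hab// VQ.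
  (* [g] has the free derivatives of [f] and the other root as its f_0, so the second factor of the
     norm at [f] is [Phi g]. *)
  rewrite -g0 -(free_gf al)// -(free_gf be)// -hab// g0 (free_gf t)// (free_gf d)//.
  have := VQ f Vf; move: (pderiv _ f 0) (t f) (d f) => x u v <-; ring.
- move=> h Vh /(_ q); rewrite inE eqxx => /(_ isT); rewrite -hq (norm _ _ (VQ h Vh)) => hn.
  apply: HP => //; rewrite hab; last exact: VQ.
  by apply: contraNneq hn => ->; rewrite mul0r.
Qed.

Definition mix (s : R) (f g : response) : response := fun z => f z + s * (g z - f z).

Lemma pderiv_mix s f g w : smooth_on setT f -> smooth_on setT g ->
  pderiv w (mix s f g) = mix s (pderiv w f) (pderiv w g).
Proof.
move=> sf sg; elim: w => // a w ih.
apply/funext => z; rewrite -[pderiv (a :: w) _ z]/('D_('e_a) (pderiv w (mix s f g)) z) ih.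
have df : derivable (pderiv w f) z 'e_a by apply: diff_derivable; exact: smooth_differentiable.
have dg : derivable (pderiv w g) z 'e_a by apply: diff_derivable; exact: smooth_differentiable.
have -> : mix s (pderiv w f) (pderiv w g) = pderiv w f + s *: (pderiv w g - pderiv w f).
  by apply/funext.
have hf := DeriveDef df erefl; have hg := DeriveDef dg erefl.
exact: (derive_val (is_derive := is_deriveD hf (is_deriveZ s (is_deriveB hg hf)))).
Qed.

Lemma smooth_mix s f g : smooth_on setT f -> smooth_on setT g -> smooth_on setT (mix s f g).
Proof.
move=> sf sg w z _; rewrite pderiv_mix//.
apply: differentiableD; first exact: smooth_differentiable.
apply: differentiableZ; apply: differentiableB; exact: smooth_differentiable.
Qed.

Lemma jp_mix Phi f g : jet_poly jet_word Phi -> smooth_on setT f -> smooth_on setT g ->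
  exists q : {poly R}, forall s, Phi (mix s f g) = q.[s].
Proof.
move=> [p hp] sf sg.
pose J f := \row_a pderiv (jet_word a) f 0 : 'rV[R]_jet_count.
have [q hq] := evalp_line p (J f) (J g - J f); exists q => s.
by rewrite hp -hq; congr evalp; apply/rowP => a; rewrite !mxE pderiv_mix.
Qed.

Lemma mix0 f g : mix 0 f g = f.
Proof. by apply/funext => z; rewrite /mix mul0r addr0. Qed.

Lemma mix1 f g : mix 1 f g = g.
Proof. by apply/funext => z; rewrite /mix mul1r addrC subrK. Qed.

(** Along the line through the two witnesses both expressions are nonzero polynomials in s, and so
    is their product. In an affine family, conditions that can be met separately can hence be met
    jointly. *)
Lemma mix_both Phi Psi f g : jet_poly jet_word Phi -> jet_poly jet_word Psi ->
  smooth_on setT f -> smooth_on setT g -> Phi f != 0 -> Psi g != 0 ->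
  exists2 s, Phi (mix s f g) != 0 & Psi (mix s f g) != 0.
Proof.
move=> hPhi hPsi sf sg Pf Pg.
have [q hq] := jp_mix hPhi sf sg; have [r hr] := jp_mix hPsi sf sg.
have q0 : q != 0 by apply: contraNneq Pf => q0; rewrite -(mix0 f g) hq q0 horner0.
have r0 : r != 0 by apply: contraNneq Pg => r0; rewrite -(mix1 f g) hr r0 horner0.
have [s _] := poly_small_nonroot (mulf_neq0 q0 r0) (@ltr01 R).
by rewrite hornerM mulf_eq0 negb_or -hq -hr => /andP[? ?]; exists s.
Qed.

(* A condition that holds outside the zero set of a polynomial in the
   derivatives of order at most three, f0 included. *)
Definition condition (V : set response) (P : response -> Prop) : Prop :=
  exists Phi, [/\ jet_poly jet_word Phi, exists2 f, V f & Phi f != 0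
    & forall f, V f -> Phi f != 0 -> P f].

Definition convex_problem (V : set response) : Prop :=
  (forall f, V f -> smooth_on setT f) /\
  (forall f g s, V f -> V g -> V (mix s f g)).

Lemma condition_and V P Q : convex_problem V -> condition V P -> condition V Q ->
  condition V (fun f => P f /\ Q f).
Proof.
move=> [Vs Vm] [A [hA [f Vf Af] AP]] [B [hB [g Vg Bg] BQ]].
have [s As Bs] := mix_both hA hB (Vs f Vf) (Vs g Vg) Af Bg.
exists (fun f => A f * B f); split; first exact: jp_mul.
  by exists (mix s f g); [exact: Vm|exact: mulf_neq0].
by move=> h Vh; rewrite mulf_eq0 negb_or => /andP[Ah Bh]; split; [exact: AP|exact: BQ].
Qed.

Lemma condition_imp V P Q : (forall f, V f -> P f -> Q f) -> condition V P -> condition V Q.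
Proof. by move=> PQ [A [hA ne AP]]; exists A; split=> // f Vf Af; apply: PQ => //; exact: AP. Qed.

(** The linear equation is squared, which makes f_0 a double root; a witness is then its own partner
    at the other root. *)
Lemma generic_linear (V : set response) (l : response -> R) P :
  jet_poly free_word l -> (forall f, V f -> pderiv f0_word f 0 = l f) ->
  condition V P -> generically V P.
Proof.
move=> hl Vl [A [hA [f Vf Af] AP]].
apply: (generic_by_norm (t := fun f => - (2 * l f)) (d := fun f => l f ^+ 2) (Phi := A)) => //.
- by apply: jp_opp; apply: jp_mul => //; exact: jp_const.
- exact: jp_exp.
- by move=> g Vg; rewrite (Vl g Vg); ring.
- by exists f, f; split=> //; rewrite (Vl f Vf); ring.
Qed.

End JetPolynomials.

(** * Explicit cubic response functions *)

Section Witness.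
Variables (R : realType) (k : nat).
Local Notation dim := (k.+1 + 1)%N.
Implicit Types (c h : 'rV[R]_k.+1) (g tau : R) (u z : 'rV[R]_dim).

Definition linf u : mpoly dim R := \sum_a u 0 a *: mpolyX R (mnm1 a).

Lemma evalp_linf u z : evalp (linf u) z = \sum_a u 0 a * z 0 a.
Proof.
rewrite /evalp /linf raddf_sum; apply: eq_bigr => a _.
by transitivity (u 0 a * evalp (mpolyX R (mnm1 a)) z); [exact: evalpZ|rewrite evalpX].
Qed.

Lemma mderiv_linf u a : mderiv a (linf u) = mpolyC dim (u 0 a).
Proof.
have mm i : mnm_sub (mnm1 i) (mnm1 i) = @mnm0 dim by apply/mnmP => j; rewrite mnmBE mnm0E subnn.
rewrite /linf raddf_sum (bigD1 a)//= big1 ?addr0 => [|b ba].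
  by rewrite mderivZ mderivX mnm1E eqxx scale1r mm mpolyX0 -mul_mpolyC mulr1.
by rewrite mderivZ mderivX mnm1E (negbTE ba) scale0r scaler0.
Qed.

Definition e0 : 'rV[R]_dim := 'e_(lshift 1 ord0).

(** The summands prescribe the first derivatives, make [lin_lambda] the identity whatever [c] is,
    add a quadratic term in the own state of the cell, and add the cube of a free linear form [h] of
    all inputs. Each of them vanishes on the trivial solutions. *)
Definition witness_poly c h g tau : mpoly dim R :=
  linf (row_mx c 0) + linf (erow R k) * linf e0 + (g / 2) *: (linf e0 * linf e0)
  + (tau / 6) *: (linf (row_mx h 0) * linf (row_mx h 0) * linf (row_mx h 0)).

Definition witness c h g tau : response R k := evalp (witness_poly c h g tau).

Lemma smooth_witness c h g tau : smooth_on setT (witness c h g tau).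
Proof. exact: smooth_evalp. Qed.

Lemma state_linf c (l : R) : evalp (linf (row_mx c 0)) (row_mx 0 l%:M) = 0.
Proof.
rewrite evalp_linf big_split_ord /= !big1 ?addr0// => p _.
  by rewrite row_mxEr mxE mul0r.
by rewrite [row_mx 0 _ _ _]row_mxEl [X in _ * X]mxE mulr0.
Qed.

Lemma e0E : e0 = row_mx 'e_ord0 0.
Proof.
apply/rowP => a; case: (split_ordP a) => p ->; rewrite ?row_mxEl ?row_mxEr !mxE.
  by rewrite (inj_eq (@lshift_inj _ _)).
by rewrite eq_rlshift andbF.
Qed.

Lemma witness_trivial c h g tau (l : R) : witness c h g tau (row_mx 0 l%:M) = 0.
Proof.
by rewrite /witness /witness_poly !(evalpD, evalpM, evalpZ) e0E !state_linf !(mulr0, addr0).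
Qed.

Lemma linf0 u : evalp (linf u) 0 = 0.
Proof. by rewrite evalp_linf big1// => a _; rewrite mxE mulr0. Qed.

Lemma witness_der1 c h g tau a : pderiv [:: a] (witness c h g tau) 0 = row_mx c 0 0 a.
Proof.
rewrite pderiv_evalp /= !(mderivD, mderivM, mderivZ, mderiv_linf).
by rewrite !(evalpD, evalpM, evalpZ, evalpC, linf0); ring.
Qed.

Lemma evalp0 z : evalp (0 : mpoly dim R) z = 0.
Proof. exact: meval0. Qed.

Lemma witness_der2 c h g tau a b : pderiv [:: a; b] (witness c h g tau) 0 =
  erow R k 0 a * e0 0 b + erow R k 0 b * e0 0 a + g * (e0 0 a * e0 0 b).
Proof.
rewrite pderiv_evalp /= !(mderivD, mderivM, mderivZ, mderiv_linf, mderivC).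
by rewrite !(evalpD, evalpM, evalpZ, evalpC, linf0, evalp0); field.
Qed.

Lemma witness_der3 c h g tau a b d : pderiv [:: a; b; d] (witness c h g tau) 0 =
  tau * (row_mx h 0 0 a * row_mx h 0 0 b * row_mx h 0 0 d).
Proof.
rewrite pderiv_evalp /= !(mderivD, mderivM, mderivZ, mderiv_linf, mderivC, mderiv0).
by rewrite !(evalpD, evalpM, evalpZ, evalpC, linf0, evalp0); field.
Qed.

Lemma witness_first c h g tau : first_derivatives (witness c h g tau) = c.
Proof. by apply/rowP => p; rewrite mxE witness_der1 row_mxEl. Qed.

(** Changing the first coordinate of [c] alone changes only f_0; this supplies the partner at the
    other root that the norm argument asks for. *)
Lemma witness_free c c' h g tau w : (forall p, p != ord0 -> c 0 p = c' 0 p) ->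
  (size w <= 3)%N -> w != f0_word k ->
  pderiv w (witness c h g tau) 0 = pderiv w (witness c' h g tau) 0.
Proof.
move=> cc'; case: w => [|a w]; last case: w => [|b w]; last case: w => [|d w]; last case: w => [|e w].
- move=> _ _; have z0 : 0 = row_mx 0 (0 : R)%:M :> 'rV[R]_dim.
    by rewrite -[LHS]row_mx0; congr row_mx; apply/matrixP => i j; rewrite !mxE mul0rn.
  by rewrite /pderiv /= z0 !witness_trivial.
- move=> _ w0; rewrite !witness_der1; case: (split_ordP a) w0 => p -> w0.
    by rewrite !row_mxEl; apply: cc'; apply: contraNneq w0 => ->.
  by rewrite !row_mxEr.
- by move=> _ _; rewrite !witness_der2.
- by move=> _ _; rewrite !witness_der3.
- by move=> /= sw; exfalso; move: sw; rewrite !ltnS ltn0.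
Qed.

Lemma dot_erow z : \sum_a z 0 a * erow R k 0 a = z 0 (rshift k.+1 0).
Proof.
rewrite (bigD1 (rshift k.+1 0))//= erowE eqxx mulr1 big1 ?addr0// => b /negbTE bn.
by rewrite erowE bn mulr0.
Qed.

Lemma dot_e0 z : \sum_a z 0 a * e0 0 a = z 0 (lshift 1 ord0).
Proof.
rewrite (bigD1 (lshift 1 ord0))//= mxE !eqxx mulr1 big1 ?addr0// => b /negbTE bn.
by rewrite mxE bn mulr0.
Qed.

Lemma witness_jet2 c h g tau z z' : jet2 (witness c h g tau) z z' =
  z 0 (rshift k.+1 0) * z' 0 (lshift 1 ord0) + z 0 (lshift 1 ord0) * z' 0 (rshift k.+1 0)
  + g * (z 0 (lshift 1 ord0) * z' 0 (lshift 1 ord0)).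
Proof.
rewrite -!dot_erow -!dot_e0 !big_distrlr /= mulr_sumr -!big_split; apply: eq_bigr => a _.
rewrite mulr_sumr -!big_split; apply: eq_bigr => b _; rewrite witness_der2 /=.
by move: (erow R k) e0 => u v; ring.
Qed.

Lemma witness_jet3 c h g tau z : jet3 (witness c h g tau) z z z =
  tau * (\sum_p z 0 (lshift 1 p) * h 0 p) ^+ 3.
Proof.
have -> : \sum_p z 0 (lshift 1 p) * h 0 p = \sum_a z 0 a * row_mx h 0 0 a.
  rewrite [RHS]big_split_ord /= big_ord1 row_mxEr mxE mulr0 addr0.
  by apply: eq_bigr => p _; rewrite row_mxEl.
rewrite exprS expr2 big_distrlr /= big_distrlr /= mulr_sumr; apply: eq_bigr => a _.
rewrite mulr_sumr exchange_big; apply: eq_bigr => b _.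
rewrite mulr_sumr mulr_sumr; apply: eq_bigr => d _; rewrite witness_der3.
by move: (row_mx h 0) => u; ring.
Qed.

Lemma witness_problem mu c h g tau : mu c = 0 ->
  [set c | complex.Im (mu c) = 0]° c -> bifurcation_problem mu (witness c h g tau).
Proof.
move=> mu0 ic; split; rewrite ?witness_first//; first exact: smooth_witness.
exact: witness_trivial.
Qed.

End Witness.

(** * Nondegeneracy at a simple eigenvalue *)

Section SimpleBranch.
Lemma cube_inj (R : realType) (x y : R) : x ^+ 3 = y ^+ 3 -> x = y.
Proof.
move=> h; apply/eqP; rewrite -subr_eq0; apply: contraPT h => xy h.
have : (x - y) * (x ^+ 2 + x * y + y ^+ 2) = 0 by rewrite -(subrr (y ^+ 3)) -{1}h; ring.
move/eqP; rewrite mulf_eq0 (negbTE xy) => /eqP z.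
have sq : (x + y / 2) ^+ 2 + 3 / 4 * y ^+ 2 = 0 by rewrite -z; field.
have y0 : y ^+ 2 = 0 by have := sqr_ge0 y; have := sqr_ge0 (x + y / 2); lra.
have /eqP := z; rewrite y0; move/eqP: y0; rewrite sqrf_eq0 => /eqP y0.
by rewrite y0 mulr0 !addr0 sqrf_eq0 => /eqP x0; move: xy; rewrite x0 y0 subrr eqxx.
Qed.

Variables (R : realType) (k : nat).

Section Value.
Variables (n : nat) (N : network k n).

(* The vanishing of T1 is that of the crossing speed of the eigenvalue, and T2
   and K are the quadratic and cubic coefficients of the reduced equation. *)
Definition branch_value (f : response R k) (v : 'cV[R]_n) (w : 'rV[R]_n)
    (S : 'cV[R]_n -> 'cV[R]_n) (kappa : R) : R :=
  (w *m lin_lambda f N v) 0 0 *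
  ((w *m quad f N v v) 0 0 ^+ 2 +
   (w *m ((kappa / 6) *: cubic f N v - 2^-1 *: quad f N v (S (quad f N v v)))) 0 0 ^+ 2).

Lemma jp_branch_value (v : response R k -> 'cV[R]_n) (w : response R k -> 'rV[R]_n)
    (S : response R k -> 'cV[R]_n -> 'cV[R]_n) (kappa : response R k -> R) :
  (forall i, jet_poly (@jet_word k) (fun f => v f i 0)) ->
  (forall i, jet_poly (@jet_word k) (fun f => w f 0 i)) ->
  (forall Y : response R k -> 'cV[R]_n, (forall i, jet_poly (@jet_word k) (fun f => Y f i 0)) ->
     forall i, jet_poly (@jet_word k) (fun f => S f (Y f) i 0)) ->
  jet_poly (@jet_word k) kappa ->
  jet_poly (@jet_word k) (fun f => branch_value f (v f) (w f) (S f) (kappa f)).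
Proof.
move=> hv hw hS hk.
have dot (Y : response R k -> 'cV[R]_n) : (forall i, jet_poly (@jet_word k) (fun f => Y f i 0)) ->
    jet_poly (@jet_word k) (fun f => (w f *m Y f) 0 0).
  by move=> hY; under eq_fun do rewrite mxE; apply: jp_sum => i; exact: jp_mul.
have hq (Y Z : response R k -> 'cV[R]_n) : (forall i, jet_poly (@jet_word k) (fun f => Y f i 0)) ->
    (forall i, jet_poly (@jet_word k) (fun f => Z f i 0)) ->
    forall i, jet_poly (@jet_word k) (fun f => quad f N (Y f) (Z f) i 0).
  by move=> hY hZ i; under eq_fun do rewrite mxE; apply: jp_jet2 => a; exact: jp_zrow.
apply: jp_mul.
  apply: dot => i; under eq_fun do rewrite mxE; apply: jp_jet2 => a; first exact: jp_zrow.
  exact: jp_const.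
apply: jp_add; apply: jp_exp; apply: dot; first exact: hq.
move=> i.
have -> : (fun f => ((kappa f / 6) *: cubic f N (v f) -
      2^-1 *: quad f N (v f) (S f (quad f N (v f) (v f)))) i 0) =
    (fun f => kappa f / 6 * cubic f N (v f) i 0 -
      2^-1 * quad f N (v f) (S f (quad f N (v f) (v f))) i 0).
  by apply/funext => f; rewrite !mxE.
apply: jp_sub; apply: jp_mul; try exact: jp_const.
- by apply: jp_mul => //; exact: jp_const.
- by under eq_fun do rewrite mxE; apply: jp_jet3 => a; exact: jp_zrow.
- by apply: (hq _ (fun f => S f (quad f N (v f) (v f)))) => //; apply: hS; exact: hq.
Qed.

(** [S] inverts J on its range up to the factor [kappa], so that no division enters [branch_value].
    The sum of squares covers both cases: a nonzero T2 gives a transcritical branch, and otherwise a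
    nonzero K gives a pitchfork. The left null vector is normalized here only, outside the
    polynomial condition. *)
Lemma simple_branch (f : response R k) (v : 'cV[R]_n) (w : 'rV[R]_n) S (kappa : R) :
  smooth_on setT f -> (forall l : R, f (row_mx 0 l%:M) = 0) ->
  let J := jacobian N (first_derivatives f) in
  J *m v = 0 -> w *m J = 0 -> (w *m v) 0 0 != 0 ->
  (forall h : 'cV[R]_n, J *m h = 0 -> (w *m h) 0 0 = 0 -> h = 0) ->
  kappa != 0 ->
  (forall y, (w *m y) 0 0 = 0 -> J *m S y = kappa *: y) ->
  branch_value f v w S kappa != 0 ->
  exists e dlt b, half_branch f N e dlt b (fun x => x != 0).
Proof.
move=> sf f0 J Jv wJ wv kerJ k0 JS; rewrite mulf_eq0 negb_or => /andP[T10 TK].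
set th := (w *m v) 0 0 in wv.
have th1 (y : 'cV[R]_n) : (th^-1 *: w *m y) 0 0 = th^-1 * (w *m y) 0 0.
  by rewrite -scalemxAl mxE.
have wv1 : (th^-1 *: w *m v) 0 0 = 1 by rewrite th1 mulVf.
have wJ1 : th^-1 *: w *m J = 0 by rewrite -scalemxAl wJ scaler0.
have ker1 (h : 'cV[R]_n) : J *m h = 0 -> (th^-1 *: w *m h) 0 0 = 0 -> h = 0.
  move=> Jh; rewrite th1 => /eqP; rewrite mulf_eq0 invr_eq0 (negbTE wv) => /eqP; exact: kerJ.
have T1' : (th^-1 *: w *m lin_lambda f N v) 0 0 != 0 by rewrite th1 mulf_neq0// invr_eq0.
have [T2|T2] := eqVneq ((w *m quad f N v v) 0 0) 0; last first.
  have [|dlt [b hb]] := transcritical_branch sf f0 Jv wJ1 wv1 ker1 T1'.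
    by rewrite th1 mulf_neq0// invr_eq0.
  by exists 1, dlt, b.
pose W2 : 'cV[R]_n := - (2 * kappa)^-1 *: S (quad f N v v).
have JW2 : J *m W2 = - 2^-1 *: quad f N v v.
  rewrite -scalemxAr JS// scalerA; congr (_ *: _).
  by field.
apply: (pitchfork_branch sf f0 Jv wJ1 wv1 ker1 T1' JW2).
rewrite th1 mulf_neq0 ?invr_eq0//; apply: contraNneq TK => K0.
rewrite T2 expr0n add0r sqrf_eq0; apply/eqP.
have -> : (kappa / 6) *: cubic f N v - 2^-1 *: quad f N v (S (quad f N v v)) =
    kappa *: (quad f N v W2 + 6^-1 *: cubic f N v).
  have -> : quad f N v W2 = - (2 * kappa)^-1 *: quad f N v (S (quad f N v v)).
    by apply/colP => i; rewrite !mxE zrowZ0 jet2Zr.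
  rewrite scalerDr !scalerA addrC; move: (quad f N v _) (cubic f N v) => q u.
  have -> : kappa * - (2 * kappa)^-1 = - 2^-1 by field.
  by rewrite scaleNr.
by rewrite -scalemxAr mxE K0 mulr0.
Qed.

Lemma witness_lin_lambda c h g tau (v : 'cV[R]_n) :
  lin_lambda (witness c h g tau) N v = v.
Proof.
apply/colP => i; rewrite mxE witness_jet2 zrow_r zrow_l !erowE eqxx eq_lrshift /slot unlift_none.
by rewrite /=; ring.
Qed.

Lemma witness_quad c h g tau (v v' : 'cV[R]_n) :
  quad (witness c h g tau) N v v' = g *: map2_mx *%R v v'.
Proof.
apply/colP => i; rewrite !mxE witness_jet2 !zrow_r !zrow_l /slot unlift_none.
by ring.
Qed.

Lemma witness_cubic c h g tau (v : 'cV[R]_n) i :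
  cubic (witness c h g tau) N v i 0 = tau * (\sum_p v (slot N p i) 0 * h 0 p) ^+ 3.
Proof.
rewrite mxE witness_jet3; congr (_ * _ ^+ _); apply: eq_bigr => p _.
by rewrite zrow_l.
Qed.

(** With g = 0 all second-order state terms vanish, so T2 is 0, [S] drops out and the cubic
    coefficient is a multiple of a weighted sum of cubes. *)
Lemma witness_branch_value (c h : 'rV[R]_k.+1) (v : 'cV[R]_n) (w : 'rV[R]_n) S (kappa : R) :
  kappa != 0 -> (w *m v) 0 0 != 0 ->
  \sum_i w 0 i * (\sum_p v (slot N p i) 0 * h 0 p) ^+ 3 != 0 ->
  branch_value (witness c h 0 1) v w S kappa != 0.
Proof.
move=> k0 wv C0; rewrite /branch_value witness_lin_lambda !witness_quad !scale0r scaler0 subr0.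
rewrite mulf_neq0// mulmx0 [in X in X ^+ 2 + _]mxE expr0n add0r sqrf_eq0 -scalemxAr mxE.
rewrite mulf_neq0//; first by rewrite mulf_neq0// invr_eq0 pnatr_eq0.
rewrite mxE; under eq_bigr do rewrite witness_cubic mul1r.
exact: C0.
Qed.

End Value.

Section OneCell.
Variable N : network k 1.

Lemma one_cell_jacobian (c : 'rV[R]_k.+1) : jacobian N c = (\sum_p c 0 p)%:M.
Proof. by apply/matrixP => i j; rewrite !ord1 -(jacobian_row_sum N c 0) big_ord1 mxE. Qed.

Definition one_cell_value (f : response R k) : R :=
  branch_value N f 1%:M 1%:M (fun=> 0) 1.

Lemma jp_one_cell : jet_poly (@jet_word k) one_cell_value.
Proof.
apply: (@jp_branch_value 1 N (fun=> 1%:M) (fun=> 1%:M) (fun=> fun=> 0) (fun=> 1));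
by intros; exact: jp_const.
Qed.

Lemma one_cell_branch f : smooth_on setT f -> (forall l : R, f (row_mx 0 l%:M) = 0) ->
  \sum_p first_derivatives f 0 p = 0 -> one_cell_value f != 0 ->
  exists e dlt b, half_branch f N e dlt b (fun x => x != 0).
Proof.
move=> sf f0 u0; apply: simple_branch => //.
- by rewrite one_cell_jacobian u0 raddf0 mul0mx.
- by rewrite one_cell_jacobian u0 raddf0 mulmx0.
- by rewrite mul1mx mxE eqxx oner_neq0.
- by move=> h _; rewrite mul1mx => h0; apply/colP => i; rewrite ord1 mxE.
- by move=> y; rewrite mul1mx mulmx0 => y0; apply/colP => i; rewrite ord1 !mxE y0 mulr0.
Qed.

Lemma one_cell_witness (c : 'rV[R]_k.+1) : one_cell_value (witness c (delta_mx 0 ord0) 0 1) != 0.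
Proof.
apply: witness_branch_value; rewrite ?oner_neq0//.
  by rewrite mul1mx mxE eqxx oner_neq0.
rewrite big_ord1 mxE eqxx mul1r expf_neq0// (bigD1 ord0)//= big1 ?addr0 => [|p p0].
  by rewrite !mxE !eqxx !mulr1 /slot unlift_none oner_neq0.
by rewrite [X in _ * X]mxE (negbTE p0) andbF mulr0.
Qed.

End OneCell.

Section TwoCells.
Variable N : network k 2.

Definition two_cell_eigenvalue (c : 'rV[R]_k.+1) : R :=
  jacobian N c 1 1 - jacobian N c 0 1.

Let ups (f : response R k) := \sum_p first_derivatives f 0 p.
Let J (f : response R k) := jacobian N (first_derivatives f).
(** When the second eigenvalue vanishes, [v] and [w] are null vectors and [w v] is the valency. The
    range then consists of the constant vectors, on which the Jacobian acts as the valency; hence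
    the form of [S]. *)
Let v (f : response R k) : 'cV[R]_2 := \col_i if i == 0 then - J f 0 1 else ups f - J f 0 1.
Let w : 'rV[R]_2 := \row_i if i == 0 then -1 else 1.
Let S (y : 'cV[R]_2) : 'cV[R]_2 := const_mx (y 0 0).

Definition two_cell_value (f : response R k) : R :=
  ups f * branch_value N f (v f) w S (ups f).

Let jp_ups : jet_poly (@jet_word k) ups.
Proof. by apply: jp_sum => p; exact: jp_first. Qed.

Lemma jp_two_cell : jet_poly (@jet_word k) two_cell_value.
Proof.
apply: jp_mul => //.
apply: (@jp_branch_value 2 N v (fun=> w) (fun=> S) ups) => //.
- move=> i; under eq_fun do rewrite mxE; case: (i == 0); last apply: jp_sub => //.
    by apply: jp_opp; exact: jp_jacobian.
  exact: jp_jacobian.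
- by move=> i; exact: jp_const.
- by move=> Y hY i; under eq_fun do rewrite mxE.
Qed.

Let sum2 (g : 'I_2 -> R) : \sum_i g i = g 0 + g 1.
Proof. by rewrite big_ord_recl big_ord1; congr (_ + g _); apply: val_inj. Qed.

Let case2 (i : 'I_2) : i = 0 \/ i = 1.
Proof. by case: i => [[|[|//]] p]; [left|right]; apply: val_inj. Qed.

Let wE (y : 'cV[R]_2) : (w *m y) 0 0 = y 1 0 - y 0 0.
Proof. by rewrite mxE sum2 !mxE /=; ring. Qed.

Lemma two_cell_column (c : 'rV[R]_k.+1) i : jacobian N c i 0 = \sum_p c 0 p - jacobian N c i 1.
Proof. by rewrite -(jacobian_row_sum N c i) sum2 addrK. Qed.

Let JE f (y : 'cV[R]_2) i : (J f *m y) i 0 = ups f * y 0 0 + J f i 1 * (y 1 0 - y 0 0).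
Proof. by rewrite mxE sum2 two_cell_column /ups -/(J f); ring. Qed.

Let wv f : (w *m v f) 0 0 = ups f.
Proof. by rewrite wE !mxE /=; ring. Qed.

Lemma two_cell_branch f : smooth_on setT f -> (forall l : R, f (row_mx 0 l%:M) = 0) ->
  two_cell_eigenvalue (first_derivatives f) = 0 -> two_cell_value f != 0 ->
  exists e dlt b, half_branch f N e dlt b (fun x => x != 0).
Proof.
move=> sf f0 mu0; rewrite mulf_eq0 negb_or => /andP[u0].
have J1 : J f 1 1 = J f 0 1 by apply/eqP; rewrite -subr_eq0; apply/eqP.
have Ji i : J f i 1 = J f 0 1 by case: (case2 i) => ->.
apply: simple_branch => //.
- by apply/colP => i; rewrite JE Ji !mxE /=; ring.
- apply/rowP => j; rewrite mxE sum2 !mxE /= -/(J f).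
  by case: (case2 j) => ->; rewrite ?two_cell_column -/(J f) J1; ring.
- by rewrite wv.
- move=> h Jh; rewrite wE => /eqP; rewrite subr_eq0 => /eqP h10.
  have := congr1 (fun y : 'cV[R]_2 => y 0 0) Jh; rewrite JE h10 subrr mulr0 addr0 mxE => /eqP.
  rewrite mulf_eq0 (negbTE u0) => /eqP h0.
  by apply/colP => i; rewrite mxE; case: (case2 i) => ->; rewrite ?h10 h0.
- move=> y; rewrite wE => /eqP; rewrite subr_eq0 => /eqP y10.
  by apply/colP => i; rewrite JE !mxE subrr mulr0 addr0; case: (case2 i) => ->; rewrite ?y10.
Qed.

Lemma two_cell_witness (c : 'rV[R]_k.+1) : \sum_p c 0 p != 0 ->
  two_cell_value (witness c (delta_mx 0 ord0) 0 1) != 0.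
Proof.
move=> u0; have hu : ups (witness c (delta_mx 0 ord0) 0 1) = \sum_p c 0 p.
  by apply: eq_bigr => p _; rewrite witness_first.
rewrite mulf_neq0 ?hu//; apply: witness_branch_value; rewrite ?wv ?hu//.
have key i : \sum_p v (witness c (delta_mx 0 ord0) 0 1) (slot N p i) 0 * (delta_mx 0 ord0 : 'rV[R]_k.+1) 0 p
    = v (witness c (delta_mx 0 ord0) 0 1) i 0.
  rewrite (bigD1 ord0)//= big1 ?addr0 => [|p p0].
    by rewrite [X in _ * X]mxE !eqxx mulr1 /slot unlift_none.
  by rewrite [X in _ * X]mxE (negbTE p0) andbF mulr0.
rewrite sum2 !key; set vv := v _.
have : vv 1 0 - vv 0 0 != 0 by rewrite -wE wv hu.
have -> : w 0 0 = -1 by rewrite mxE.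
have -> : w 0 1 = 1 by rewrite mxE.
move=> h; rewrite mulN1r mul1r addrC subr_eq0; apply: contraNneq h => /cube_inj->.
by rewrite subrr.
Qed.

End TwoCells.

End SimpleBranch.

(** * Nonvanishing of the cubic coefficient *)

Section Cubic.
Variables (R : realType) (k : nat) (N : network k 3).

Lemma cells_cover (x y z : 'I_3) : x != y -> x != z -> y != z ->
  forall i : 'I_3, [\/ i = x, i = y | i = z].
Proof.
case: x y z => [[|[|[|//]]] ?] [[|[|[|//]]] ?] [[|[|[|//]]] ?] // _ _ _ [[|[|[|//]]] ?];
by [apply: Or31; apply: val_inj|apply: Or32; apply: val_inj|apply: Or33; apply: val_inj].
Qed.

Lemma third_cell (x y : 'I_3) : x != y -> exists2 z, x != z & y != z.
Proof.
case: x y => [[|[|[|//]]] ?] [[|[|[|//]]] ?] // _;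
by [exists (inord 0); rewrite -val_eqE /= inordK|exists (inord 1); rewrite -val_eqE /= inordK
   |exists (inord 2); rewrite -val_eqE /= inordK].
Qed.

Lemma cells_sum (x y z : 'I_3) (g : 'I_3 -> R) : x != y -> x != z -> y != z ->
  \sum_i g i = g x + g y + g z.
Proof. by move=> xy xz yz; rewrite (sum3 xy xz yz (cells_cover xy xz yz)). Qed.

(* The cubic form cannot vanish on all combinations of [v] and its images by
   the input maps: a combination two of whose entries agree would be constant,
   and such combinations exist unless every input map is trivial. *)
Lemma cubic_nontrivial (v : 'cV[R]_3) (w : 'rV[R]_3) :
  \sum_i w 0 i = 0 -> (w *m v) 0 0 != 0 ->
  (forall h : 'rV[R]_k.+1, \sum_i w 0 i * (\sum_p v (slot N p i) 0 * h 0 p) ^+ 3 = 0) ->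
  forall p, (forall i, slot N p i = i) \/ (forall i j, slot N p i = slot N p j).
Proof.
move=> w1 wv0 C p.
have wv x y z : x != y -> x != z -> y != z -> w 0 x * v x 0 + w 0 y * v y 0 + w 0 z * v z 0 != 0.
  by move=> xy xz yz; move: wv0; rewrite mxE (cells_sum _ xy xz yz).
have ws x y z : x != y -> x != z -> y != z -> w 0 x + w 0 y + w 0 z = 0.
  by move=> xy xz yz; rewrite -(cells_sum _ xy xz yz).
(* Test vectors [h] supported on the slots 0 and p give the combinations of v with its pullback by
   the map of p. *)
have Cu (al be : R) x y z : x != y -> x != z -> y != z ->
    w 0 x * (al * v x 0 + be * v (slot N p x) 0) ^+ 3 +
    w 0 y * (al * v y 0 + be * v (slot N p y) 0) ^+ 3 +
    w 0 z * (al * v z 0 + be * v (slot N p z) 0) ^+ 3 = 0.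
  move=> xy xz yz; rewrite -(C (al *: 'e_ord0 + be *: 'e_p)) (cells_sum _ xy xz yz).
  suff E i : \sum_q v (slot N q i) 0 * (al *: 'e_ord0 + be *: 'e_p : 'rV[R]_k.+1) 0 q =
      al * v i 0 + be * v (slot N p i) 0 by rewrite !E.
  have pick (q : 'I_k.+1) : \sum_r v (slot N r i) 0 * ('e_q : 'rV[R]_k.+1) 0 r = v (slot N q i) 0.
    rewrite (bigD1 q)//= mxE !eqxx mulr1 big1 ?addr0// => r rq.
    by rewrite mxE (negbTE rq) andbF mulr0.
  have v0 : v i 0 = \sum_r v (slot N r i) 0 * ('e_ord0 : 'rV[R]_k.+1) 0 r.
    by rewrite pick /slot unlift_none.
  rewrite v0 -(pick p) !mulr_sumr -big_split; apply: eq_bigr => q _ /=.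
  have -> : (al *: 'e_ord0 + be *: 'e_p : 'rV[R]_k.+1) 0 q =
      al * ('e_ord0 : 'rV[R]_k.+1) 0 q + be * ('e_p : 'rV[R]_k.+1) 0 q by rewrite !mxE.
  by ring.
have C0 x y z : x != y -> x != z -> y != z ->
    w 0 x * v x 0 ^+ 3 + w 0 y * v y 0 ^+ 3 + w 0 z * v z 0 ^+ 3 = 0.
  by move=> xy xz yz; have := Cu 1 0 x y z xy xz yz; rewrite !mul1r !mul0r !addr0.
(* If v_x = v_y, then [w v] is w_z (v_z - v_x), while the cubic relation reads w_z (v_z^3 - v_x^3) =
   0; by injectivity of the cube the first product is 0 as well. *)
have vinj x y z : x != y -> x != z -> y != z -> v x 0 != v y 0.
  move=> xy xz yz; apply/eqP => vxy; have := wv x y z xy xz yz; have := C0 x y z xy xz yz.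
  have := ws x y z xy xz yz; rewrite vxy; move: (w 0 x) (w 0 y) (w 0 z) (v y 0) (v z 0).
  move=> a b c m n s0 h; rewrite (_ : a * m + b * m + c * n = c * (n - m)); last first.
    by rewrite (_ : a = - b - c); [ring|move: s0; lra].
  have /eqP : c * (n ^+ 3 - m ^+ 3) = 0.
    by rewrite -h (_ : a = - b - c); [ring|move: s0; lra].
  rewrite mulf_eq0 subr_eq0 => /orP[/eqP->|/eqP/cube_inj->]; first by rewrite mul0r eqxx.
  by rewrite subrr mulr0 eqxx.
have w0 x y z : x != y -> x != z -> y != z -> w 0 z != 0.
  move=> xy xz yz; apply/eqP => wz; have := wv x y z xy xz yz; have := C0 x y z xy xz yz.
  have := ws x y z xy xz yz; rewrite wz !mul0r !addr0.
  move: (w 0 x) (w 0 y) (v x 0) (v y 0) (vinj x y z xy xz yz) => a b m n mn s0 h.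
  have bE : b = - a by move: s0; lra.
  have /eqP : a * (m ^+ 3 - n ^+ 3) = 0 by rewrite -h bE; ring.
  rewrite mulf_eq0 subr_eq0 => /orP[/eqP a0|/eqP/cube_inj mn']; last by rewrite mn' eqxx in mn.
  by rewrite bE a0 oppr0 !mul0r addr0 eqxx.
(* A combination with two equal entries has all three equal. Below, coefficients are chosen so that
   two entries agree. *)
have stay al be x y z : x != y -> x != z -> y != z ->
    al * v x 0 + be * v (slot N p x) 0 = al * v y 0 + be * v (slot N p y) 0 ->
    al * v z 0 + be * v (slot N p z) 0 = al * v x 0 + be * v (slot N p x) 0.
  move=> xy xz yz e; have := Cu al be x y z xy xz yz; have := ws x y z xy xz yz.
  rewrite -e; move: (_ + _) (al * v z 0 + _) (w 0 x) (w 0 y) (w 0 z) (w0 x y z xy xz yz).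
  move=> m n a b c c0 s0 h.
  have /eqP : c * (n ^+ 3 - m ^+ 3) = 0.
    by rewrite -h (_ : a = - b - c); [ring|move: s0; lra].
  by rewrite mulf_eq0 (negbTE c0) subr_eq0 => /eqP/cube_inj.
have slot_inj x y : v x 0 = v y 0 -> x = y.
  move=> e; apply/eqP; apply: contraT => xy; have [z xz yz] := third_cell xy.
  by have := vinj x y z xy xz yz; rewrite e eqxx.
have [inj|] := boolP [forall x, forall y, (slot N p x == slot N p y) ==> (x == y)]; last first.
  move=> /forallPn[x /forallPn[y]]; rewrite negb_imply => /andP[/eqP e xy]; right.
  have [z xz yz] := third_cell xy.
  have := stay 0 1 x y z xy xz yz; rewrite !mul0r !add0r !mul1r e => /(_ erefl)/slot_inj ez.
  suff H i : slot N p i = slot N p y by move=> i j; rewrite !H.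
  by case: (cells_cover xy xz yz i) => ->.
have {}inj x y : slot N p x = slot N p y -> x = y.
  by move=> /eqP e; have /forallP/(_ x)/forallP/(_ y) := inj; rewrite e => /eqP.
have [/forallP id|/forallPn[x sx]] := boolP [forall x, slot N p x == x].
  by left => i; apply/eqP.
exfalso; set y := slot N p x in sx; have xy : x != y by rewrite eq_sym.
have [z xz yz] := third_cell xy; have cov := cells_cover xy xz yz.
have yz0 : v y 0 - v z 0 != 0.
  by rewrite subr_eq0; apply/eqP => /slot_inj e; rewrite e eqxx in yz.
have xy0 : v x 0 - v y 0 != 0.
  by rewrite subr_eq0; apply/eqP => /slot_inj e; rewrite e eqxx in xy.
have sy : slot N p y != y by apply/eqP => e; have := inj y x; rewrite e => /(_ erefl) e'; rewrite e' eqxx in xy.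
case: (cov (slot N p y)) => sy'; last 2 first.
- by rewrite sy' eqxx in sy.
(* Three-cycle: the coefficients equalize the entries at x and y; equality with the entry at z then
   makes a positive definite quadratic form in the differences of v vanish. *)
- have sz : slot N p z = x.
    case: (cov (slot N p z)) => // e.
      by have /inj e' : slot N p z = slot N p x by []; rewrite e' eqxx in xz.
    by have /inj e' := etrans e (esym sy'); rewrite e' eqxx in yz.
  have := stay (v y 0 - v z 0) (- (v x 0 - v y 0)) x y z xy xz yz.
  rewrite -/y sy' sz; move: (v x 0) (v y 0) (v z 0) yz0 xy0 => a b c h1 h2 h.
  have {}h : (b - c) * c + - (a - b) * a = (b - c) * a + - (a - b) * b by apply: h; ring.
  have sq : ((a - b) + (b - c) / 2) ^+ 2 + 3 / 4 * (b - c) ^+ 2 = 0.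
    transitivity (((b - c) * a + - (a - b) * b) - ((b - c) * c + - (a - b) * a)).
      by field.
    by rewrite h subrr.
  have := sqr_ge0 (a - b + (b - c) / 2).
  have : 0 < (b - c) ^+ 2 by rewrite lt_def sqr_ge0 sqrf_eq0 h1.
  by lra.
(* Transposition of x and y: the sum of v and its pullback puts v_z at the midpoint of v_x and v_y,
   their difference gives w_x = w_y, and both together give [w v] = 0. *)
have sz : slot N p z = z.
  case: (cov (slot N p z)) => // e.
    by have /inj e' := etrans e (esym sy'); rewrite e' eqxx in yz.
  by have /inj e' : slot N p z = slot N p x by []; rewrite e' eqxx in xz.
have := stay 1 1 x y z xy xz yz; have := Cu 1 (-1) x y z xy xz yz.
have := wv x y z xy xz yz; have := ws x y z xy xz yz.
rewrite -/y sy' sz; move: (w 0 x) (w 0 y) (w 0 z) (v x 0) (v y 0) (v z 0) xy0.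
move=> a b c x1 y1 z1 xy0 s0 n0 h1 h2.
have {}h2 : 1 * z1 + 1 * z1 = 1 * x1 + 1 * y1 by apply: h2; ring.
have z1E : z1 = (x1 + y1) / 2 by move: h2; lra.
have cE : c = - a - b by move: s0; lra.
have /eqP : (a - b) * (x1 - y1) ^+ 3 = 0 by rewrite -h1; ring.
rewrite mulf_eq0 expf_eq0 (negbTE xy0) orbF subr_eq0 => /eqP ab.
by move/eqP: n0; apply; rewrite z1E cE ab; field.
Qed.

End Cubic.

(** * Matrices with constant row sums *)

Section ReducedDeterminant.
Variable K : comNzRingType.
Implicit Type A : 'M[K]_3.

(** The two adjacent transpositions generate all orderings of the three cells. *)
Lemma cell_cases (x y z : 'I_3) (P : 'I_3 -> 'I_3 -> 'I_3 -> Prop) :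
  (forall x y z, P x y z -> P y x z) -> (forall x y z, P x y z -> P x z y) ->
  P 0 1 2 -> x != y -> x != z -> y != z -> P x y z.
Proof.
move=> h1 h2 P0 xy xz yz.
have := @cells_cover 0 1 2 isT isT isT => cov.
have P1 := h1 _ _ _ P0; have P2 := h2 _ _ _ P0; have P3 := h2 _ _ _ P1.
have P4 := h1 _ _ _ P2; have P5 := h2 _ _ _ P4.
by case: (cov x) xy xz => ->; case: (cov y) yz => ->; case: (cov z) => ->.
Qed.

Definition const_rows A (s : K) := forall i, A i 0 + A i 1 + A i 2 = s.

Lemma row_sum A s x y z i : const_rows A s -> x != y -> x != z -> y != z ->
  A i x + A i y + A i z = s.
Proof.
move=> As; apply: (@cell_cases x y z (fun x y z => A i x + A i y + A i z = s)) => //.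
  by move=> a b c <-; rewrite [A i a + _]addrC.
by move=> a b c <-; rewrite addrAC.
Qed.

(** The reduced matrices belong to one induced map modulo the diagonal, written in bases that depend
    on the ordering of the cells. *)
Lemma reduced_indep A s x y z : const_rows A s -> x != y -> x != z -> y != z ->
  reduced_det x y z A = reduced_det 0 1 2 A /\ reduced_trace x y z A = reduced_trace 0 1 2 A.
Proof.
move=> As xy xz yz.
pose P x y z := [/\ x != y, x != z & y != z] ->
  reduced_det x y z A = reduced_det 0 1 2 A /\ reduced_trace x y z A = reduced_trace 0 1 2 A.
suff : P x y z by apply.
apply: cell_cases => // {xy xz yz} {}x {}y {}z H [xy xz yz].
  have yx : x != y by rewrite eq_sym.
  have [<- <-] := H (And3 yx yz xz).
  have hx i : A i y = s - A i x - A i z by rewrite -(row_sum i As xy xz yz); ring.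
  by rewrite /reduced_det /reduced_trace !hx; split; ring.
have zy : y != z by rewrite eq_sym.
have [<- <-] := H (And3 xz xy zy).
by rewrite /reduced_det /reduced_trace; split; ring.
Qed.

Lemma det2 (A : 'M[K]_2) : \det A = A 0 0 * A 1 1 - A 0 1 * A 1 0.
Proof.
rewrite (expand_det_row _ ord0) !big_ord_recl big_ord0 /cofactor !det_mx11 !mxE.
have -> : lift ord0 ord0 = 1 :> 'I_2 by apply: val_inj.
have -> : lift 1 0 = 0 :> 'I_2 by apply: val_inj.
by rewrite /= expr0 expr1; ring.
Qed.

Lemma det3 A : \det A = A 0 0 * (A 1 1 * A 2 2 - A 1 2 * A 2 1)
  - A 0 1 * (A 1 0 * A 2 2 - A 1 2 * A 2 0) + A 0 2 * (A 1 0 * A 2 1 - A 1 1 * A 2 0).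
Proof.
pose g (i j : nat) := A (inord i) (inord j).
have AE i j : A i j = g i j by rewrite /g !inord_val.
have minor (i j : 'I_3) : \det (row' i (col' j A)) =
    A (lift i (0 : 'I_2)) (lift j (0 : 'I_2)) * A (lift i (1 : 'I_2)) (lift j (1 : 'I_2)) -
    A (lift i (0 : 'I_2)) (lift j (1 : 'I_2)) * A (lift i (1 : 'I_2)) (lift j (0 : 'I_2)).
  by have := det2 (row' i (col' j A)); rewrite !mxE.
rewrite (expand_det_row _ 0) !big_ord_recl big_ord0 /cofactor !minor.
rewrite !AE /= /bump /=.
by ring.
Qed.

Lemma det_const_rows A s : const_rows A s -> \det A = s * reduced_det 0 1 2 A.
Proof.
move=> As; have h i : A i 0 = s - A i 1 - A i 2 by rewrite -(As i); ring.
by rewrite det3 !h /reduced_det; ring.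
Qed.

Lemma trace_const_rows A s : const_rows A s -> \tr A = s + reduced_trace 0 1 2 A.
Proof.
move=> As; rewrite /mxtrace !big_ord_recl big_ord0 /reduced_trace.
have -> : lift ord0 (ord0 : 'I_2) = 1 :> 'I_3 by apply: val_inj.
have -> : lift ord0 (lift ord0 (ord0 : 'I_1)) = 2 :> 'I_3 by apply: val_inj.
by rewrite -(As 0); ring.
Qed.

End ReducedDeterminant.

Section ThreeCellValue.
Variables (R : realType) (k : nat) (N : network k 3).

Lemma jacobian_rows (c : 'rV[R]_k.+1) : const_rows (jacobian N c) (\sum_p c 0 p).
Proof. by move=> i; rewrite -(jacobian_row_sum N c i) (@cells_sum _ 0 1 2). Qed.

Let J (f : response R k) := jacobian N (first_derivatives f).
Let ups (f : response R k) := \sum_p first_derivatives f 0 p.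
Let tr f := reduced_trace 0 1 2 (J f).

Section Labelled.
Variables (a b c : 'I_3).
Hypotheses (ab : a != b) (ac : a != c) (bc : b != c).

(** [p], [q], [r], [s] are the entries of the reduced matrix. At determinant 0 its adjugate provides
    the null vectors [v] and [w], with [w v] = ups tr s. By the Cayley-Hamilton theorem the reduced
    matrix acts on its range as its trace, which gives the quasi-inverse [S] with factor ups tr; the
    entries at cell a come from the equation of cell a. *)
Let p f := J f b b - J f a b.
Let q f := J f b c - J f a c.
Let r f := J f c b - J f a b.
Let s f := J f c c - J f a c.
Let w f : 'rV[R]_3 := \row_i case3 a b (q f - s f) (s f) (- q f) i.
Let va f := - (J f a b * s f - J f a c * r f).
Let v f : 'cV[R]_3 := \col_i case3 a b (va f) (va f + ups f * s f) (va f - ups f * r f) i.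
Let Sa f (y : 'cV[R]_3) := tr f * y a 0 - (J f a b * (y b 0 - y a 0) + J f a c * (y c 0 - y a 0)).
Let S f (y : 'cV[R]_3) : 'cV[R]_3 := \col_i case3 a b (Sa f y)
  (Sa f y + ups f * (y b 0 - y a 0)) (Sa f y + ups f * (y c 0 - y a 0)) i.

Definition labelled_value f : R := s f * branch_value N f (v f) (w f) (S f) (ups f * tr f).

Let jJ i j : jet_poly (@jet_word k) (fun f => J f i j).
Proof. exact: jp_jacobian. Qed.
Let jups : jet_poly (@jet_word k) ups.
Proof. by apply: jp_sum => i; exact: jp_first. Qed.
Let jtr : jet_poly (@jet_word k) tr.
Proof. by apply: jp_add; apply: jp_sub. Qed.
Let js : jet_poly (@jet_word k) s.
Proof. exact: jp_sub. Qed.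

Let jcase (x y z : response R k -> R) i : jet_poly (@jet_word k) x ->
  jet_poly (@jet_word k) y -> jet_poly (@jet_word k) z ->
  jet_poly (@jet_word k) (fun f => case3 a b (x f) (y f) (z f) i).
Proof. by rewrite /case3; case: (i == a); case: (i == b). Qed.

Let jva : jet_poly (@jet_word k) va.
Proof. by apply: jp_opp; apply: jp_sub; apply: jp_mul => //; exact: jp_sub. Qed.

Lemma jp_labelled : jet_poly (@jet_word k) labelled_value.
Proof.
apply: jp_mul => //; apply: (@jp_branch_value _ _ 3 N v w S); last exact: jp_mul.
- move=> i; under eq_fun do rewrite mxE; apply: jcase => //.
    by apply: jp_add => //; exact: jp_mul.
  by apply: jp_sub => //; apply: jp_mul => //; exact: jp_sub.
- move=> i; under eq_fun do rewrite mxE; apply: jcase => //.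
    by apply: jp_sub => //; exact: jp_sub.
  by apply: jp_opp; exact: jp_sub.
- move=> Y hY i; have jSa : jet_poly (@jet_word k) (fun f => Sa f (Y f)).
    apply: jp_sub; first exact: jp_mul.
    by apply: jp_add; apply: jp_mul => //; exact: jp_sub.
  under eq_fun do rewrite mxE; apply: jcase => //; apply: jp_add => //; apply: jp_mul => //;
  exact: jp_sub.
Qed.

Let c3 (T : Type) (x y z : T) := case3E ab ac bc x y z.
Let cov := cells_cover ab ac bc.
Let tE f : tr f = p f + s f.
Proof. by rewrite /tr; have [_ <-] := reduced_indep (jacobian_rows (first_derivatives f)) ab ac bc. Qed.

Let J0 f i : J f i a = ups f - J f i b - J f i c.
Proof. by rewrite /ups -(row_sum i (jacobian_rows _) ab ac bc); rewrite -/(J f); ring. Qed.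

Let JE f (y : 'cV[R]_3) i : (J f *m y) i 0 =
  ups f * y a 0 + J f i b * (y b 0 - y a 0) + J f i c * (y c 0 - y a 0).
Proof. by rewrite mxE (cells_sum _ ab ac bc) J0; ring. Qed.

Let wE f (y : 'cV[R]_3) : (w f *m y) 0 0 = s f * (y b 0 - y a 0) - q f * (y c 0 - y a 0).
Proof.
rewrite mxE (cells_sum _ ab ac bc) !mxE.
by have [-> -> ->] := c3 (q f - s f) (s f) (- q f); ring.
Qed.

Let vE f : [/\ v f a 0 = va f, v f b 0 = va f + ups f * s f & v f c 0 = va f - ups f * r f].
Proof. by rewrite !mxE; have [-> -> ->] := c3 (va f) (va f + ups f * s f) (va f - ups f * r f). Qed.

Let wv f : reduced_det a b c (J f) = 0 -> (w f *m v f) 0 0 = ups f * tr f * s f.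
Proof.
move=> d0; rewrite wE tE; have [-> -> ->] := vE f.
have qr : q f * r f = p f * s f by move: d0; rewrite /reduced_det -/(p f) -/(q f) -/(r f) -/(s f); lra.
transitivity (ups f * (s f * s f + q f * r f)); [ring|rewrite qr; ring].
Qed.

Lemma labelled_branch f : smooth_on setT f -> (forall l : R, f (row_mx 0 l%:M) = 0) ->
  reduced_det a b c (J f) = 0 -> ups f * tr f != 0 -> labelled_value f != 0 ->
  exists e dlt br, half_branch f N e dlt br (fun x => x != 0).
Proof.
move=> sf f0 d0 ut; rewrite mulf_eq0 negb_or => /andP[s0].
have qr : q f * r f = p f * s f by move: d0; rewrite /reduced_det -/(p f) -/(q f) -/(r f) -/(s f); lra.
have /andP[u0 t0] : (ups f != 0) && (tr f != 0) by rewrite -negb_or -mulf_eq0.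
have Jb i : J f i b = J f a b + (J f i b - J f a b) by ring.
apply: simple_branch => //.
- apply/colP => i; rewrite JE [RHS]mxE; have [-> -> ->] := vE f.
  have -> : ups f * va f + J f i b * (va f + ups f * s f - va f) + J f i c * (va f - ups f * r f - va f) =
    ups f * ((J f i b - J f a b) * s f - (J f i c - J f a c) * r f) by rewrite /va; ring.
  case: (cov i) => ->; first by ring.
    by rewrite -/(p f) -/(q f) qr; ring.
  by rewrite -/(r f) -/(s f); ring.
- have wu g : \sum_i w f 0 i * (J f i g) = s f * (J f b g - J f a g) - q f * (J f c g - J f a g).
    rewrite (cells_sum _ ab ac bc) !mxE.
    by have [-> -> ->] := c3 (q f - s f) (s f) (- q f); ring.
  have wb : s f * p f - q f * r f = 0 by rewrite qr; ring.
  apply/rowP => g; rewrite !mxE wu; case: (cov g) => ->.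
  + rewrite !J0 -[RHS]oppr0 -wb /p /q /r /s; ring.
  + by rewrite -/(p f) -/(r f).
  + by rewrite -/(q f) -/(s f); ring.
- by rewrite wv// mulf_neq0.
- move=> h Jh; rewrite wE => wh.
  have hi i : (J f *m h) i 0 = 0 by rewrite Jh mxE.
  have e1 : p f * (h b 0 - h a 0) + q f * (h c 0 - h a 0) = 0.
    by rewrite -[RHS](subrr (0 : R)) -{1}(hi b) -(hi a) !JE /p /q; ring.
  have e2 : r f * (h b 0 - h a 0) + s f * (h c 0 - h a 0) = 0.
    by rewrite -[RHS](subrr (0 : R)) -{1}(hi c) -(hi a) !JE /r /s; ring.
  have /eqP : tr f * (h b 0 - h a 0) = 0.
    by rewrite tE -[RHS](addr0 0) -{1}e1 -wh; ring.
  rewrite mulf_eq0 (negbTE t0) => /eqP u1; move: e2; rewrite u1 mulr0 add0r => /eqP.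
  rewrite mulf_eq0 (negbTE s0) => /eqP u2.
  have := hi a; rewrite JE u1 u2 !mulr0 !addr0 => /eqP; rewrite mulf_eq0 (negbTE u0) => /eqP ha.
  apply/colP => i; rewrite mxE; move: u1 u2; rewrite ha !subr0 => hb hc.
  by case: (cov i) => ->.
- move=> y; rewrite wE => wy; apply/colP => i; rewrite JE [RHS]mxE !mxE.
  have [-> -> ->] := c3 (Sa f y) (Sa f y + ups f * (y b 0 - y a 0)) (Sa f y + ups f * (y c 0 - y a 0)).
  have e2 : p f * (y c 0 - y a 0) - r f * (y b 0 - y a 0) = 0.
    apply: (mulfI s0); rewrite mulr0; transitivity (q f * r f * (y c 0 - y a 0) - r f * (s f * (y b 0 - y a 0))).
      by rewrite qr; ring.
    transitivity (- r f * (s f * (y b 0 - y a 0) - q f * (y c 0 - y a 0))); first by ring.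
    by rewrite wy mulr0.
  have -> : ups f * Sa f y + J f i b * (Sa f y + ups f * (y b 0 - y a 0) - Sa f y) +
      J f i c * (Sa f y + ups f * (y c 0 - y a 0) - Sa f y) =
      ups f * (tr f * y a 0 + ((J f i b - J f a b) * (y b 0 - y a 0) + (J f i c - J f a c) * (y c 0 - y a 0))).
    by rewrite /Sa; ring.
  rewrite -mulrA; congr (_ * _); rewrite tE; case: (cov i) => ->; first by ring.
    rewrite -/(p f) -/(q f).
    have -> : q f * (y c 0 - y a 0) = s f * (y b 0 - y a 0) by move: wy; lra.
    by ring.
  rewrite -/(r f) -/(s f).
  have -> : r f * (y b 0 - y a 0) = p f * (y c 0 - y a 0) by move: e2; lra.
  by ring.
Qed.

(** If no [h] worked, the weighted sum of cubes would vanish for all [h], and [cubic_nontrivial]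
    would make every input map an identity or a constant. *)
Lemma labelled_witness (e : 'rV[R]_k.+1) : reduced_det a b c (jacobian N e) = 0 ->
  \sum_i e 0 i != 0 -> reduced_trace 0 1 2 (jacobian N e) != 0 ->
  jacobian N e c c - jacobian N e a c != 0 ->
  (exists p, ~ (forall i, slot N p i = i) /\ ~ (forall i j, slot N p i = slot N p j)) ->
  exists h, labelled_value (witness e h 0 1) != 0.
Proof.
move=> d0 u0 t0 s0 [p0 [np1 np2]].
pose f h := witness e h 0 1.
have fE h : first_derivatives (f h) = e by exact: witness_first.
have uE h : ups (f h) = \sum_i e 0 i by rewrite /ups fE.
have tE' h : tr (f h) = reduced_trace 0 1 2 (jacobian N e) by rewrite /tr /J fE.
have sE h : s (f h) = jacobian N e c c - jacobian N e a c by rewrite /s /J fE.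
have vE' h : v (f h) = v (f 0) by rewrite /v /va /ups /s /r /J !fE.
have wE' h : w (f h) = w (f 0) by rewrite /w /q /s /J !fE.
apply: contrapT => none.
have C (h : 'rV[R]_k.+1) : \sum_i w (f 0) 0 i * (\sum_p v (f 0) (slot N p i) 0 * h 0 p) ^+ 3 = 0.
  apply/eqP/negPn/negP => ne; apply: none; exists h.
  rewrite -/(f h) mulf_neq0 ?sE//; apply: witness_branch_value.
  - by rewrite uE tE' mulf_neq0.
  - by rewrite -/(f h) wv ?uE ?tE' ?sE /J ?fE// !mulf_neq0.
  - by rewrite -/(f h) vE' wE'.
have w1 : \sum_i w (f 0) 0 i = 0.
  rewrite (cells_sum _ ab ac bc) !mxE.
  by have [-> -> ->] := c3 (q (f 0) - s (f 0)) (s (f 0)) (- q (f 0)); ring.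
have wv0 : (w (f 0) *m v (f 0)) 0 0 != 0.
  by rewrite wv ?uE ?tE' ?sE /J ?fE// !mulf_neq0.
by case: (cubic_nontrivial w1 wv0 C p0).
Qed.

End Labelled.

(* One of the two diagonal entries of the adjugate of the reduced matrix does
   not vanish when its trace does not. *)
Definition three_cell_value (f : response R k) : R :=
  ups f * tr f * (labelled_value 0 1 2 f ^+ 2 + labelled_value 0 2 1 f ^+ 2).

Lemma jp_three_cell : jet_poly (@jet_word k) three_cell_value.
Proof.
apply: jp_mul; last by apply: jp_add; apply: jp_exp; exact: jp_labelled.
apply: jp_mul; first by apply: jp_sum => i; exact: jp_first.
by apply: jp_add; apply: jp_sub; exact: jp_jacobian.
Qed.

Lemma three_cell_branch f : smooth_on setT f -> (forall l : R, f (row_mx 0 l%:M) = 0) ->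
  reduced_det 0 1 2 (J f) = 0 -> three_cell_value f != 0 ->
  exists e dlt br, half_branch f N e dlt br (fun x => x != 0).
Proof.
move=> sf f0 d0; rewrite mulf_eq0 negb_or => /andP[ut].
have [h|h _] := eqVneq (labelled_value 0 1 2 f) 0; last exact: (@labelled_branch 0 1 2).
rewrite h expr0n add0r sqrf_eq0 => h'; apply: (@labelled_branch 0 2 1) => //.
by have [->] := reduced_indep (jacobian_rows (first_derivatives f)) (isT : (0 : 'I_3) != 2) (isT : (0 : 'I_3) != 1) (isT : (2 : 'I_3) != 1).
Qed.

Lemma three_cell_witness (e : 'rV[R]_k.+1) : reduced_det 0 1 2 (jacobian N e) = 0 ->
  \sum_i e 0 i != 0 -> reduced_trace 0 1 2 (jacobian N e) != 0 ->
  (exists p, ~ (forall i, slot N p i = i) /\ ~ (forall i j, slot N p i = slot N p j)) ->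
  exists h, three_cell_value (witness e h 0 1) != 0.
Proof.
move=> d0 u0 t0 np.
have ut h : ups (witness e h 0 1) * tr (witness e h 0 1) != 0.
  by rewrite /ups /tr /J witness_first mulf_neq0.
have sq (x y : R) : (x != 0) || (y != 0) -> x ^+ 2 + y ^+ 2 != 0.
  by rewrite paddr_eq0 ?sqr_ge0// !sqrf_eq0 -negb_and.
have [s0|s0] := eqVneq (jacobian N e 2 2 - jacobian N e 0 2) 0.
  have [||h hh] := @labelled_witness 0 2 1 isT isT isT e _ u0 t0 _ np.
  - by have [->] := reduced_indep (jacobian_rows e) (isT : (0 : 'I_3) != 2) (isT : (0 : 'I_3) != 1) (isT : (2 : 'I_3) != 1).
  - by move: t0; rewrite /reduced_trace s0 addr0.
  by exists h; apply: mulf_neq0; [exact: ut|apply: sq; apply/orP; right].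
have [h hh] := @labelled_witness 0 1 2 isT isT isT e d0 u0 t0 s0 np.
by exists h; apply: mulf_neq0; [exact: ut|apply: sq; apply/orP; left].
Qed.

End ThreeCellValue.

(** * Synchrony spaces and annotations *)

Section SynchronySpaces.
Variables (R : realType) (k : nat) (N : network k 3).
Implicit Types (x : 'cV[R]_3) (D E : {vspace 'cV[R]_3}).

Lemma mem_mxker n (A : 'M[R]_n) (x : 'cV[R]_n) : (x \in mxker A) = (A *m x == 0).
Proof. by rewrite memv_ker lfunE. Qed.

Definition pair_space (i j : 'I_3) : {vspace 'cV[R]_3} :=
  mxker (delta_mx i i - delta_mx i j).

Lemma mem_pair i j x : x \in pair_space i j <-> x i 0 = x j 0.
Proof.
have E r : ((delta_mx i i - delta_mx i j) *m x) r 0 = (r == i)%:R * (x i 0 - x j 0).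
  have dE (u v : 'I_3) : (delta_mx u v *m x) r 0 = (r == u)%:R * x v 0.
    rewrite mxE (bigD1 v)//= mxE eqxx andbT big1 ?addr0// => s sv.
    by rewrite mxE (negbTE sv) andbF mul0r.
  by rewrite mulmxBl mxE [X in _ + X]mxE !dE mulrBr.
rewrite mem_mxker; split=> [/eqP/colP/(_ i)|xij].
  by rewrite E eqxx mul1r mxE => /eqP; rewrite subr_eq0 => /eqP.
by apply/eqP/colP => r; rewrite E xij subrr mulr0 mxE.
Qed.

Lemma mem_diagonal x : x \in diagonal_space R <-> forall i j, x i 0 = x j 0.
Proof.
split=> [/vlineP[c ->] i j|h]; first by rewrite !mxE.
apply/vlineP; exists (x 0 0); apply/colP => i; rewrite !mxE mulr1; exact: h.
Qed.

Lemma mem_full x : x \in full_space R.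
Proof. exact: memvf. Qed.

Lemma space_eq D E : (forall x, x \in D <-> x \in E) -> D = E.
Proof. by move=> h; apply/vspaceP => x; apply/idP/idP => /h. Qed.

Lemma pair_sym i j : pair_space i j = pair_space j i.
Proof. by apply: space_eq => x; rewrite !mem_pair; split=> ->. Qed.

Lemma pair_cases (P : {vspace 'cV[R]_3} -> Prop) (a b c : 'I_3) : a != b -> a != c -> b != c ->
  P (pair_space a b) -> P (pair_space a c) -> P (pair_space b c) ->
  forall i j, i != j -> P (pair_space i j).
Proof.
move=> ab ac bc pab pac pbc i j; have cov := cells_cover ab ac bc.
case: (cov i) => ->; case: (cov j) => ->; rewrite ?eqxx; first [by []|by move=> _|by rewrite pair_sym].
Qed.

Definition indicator (i : 'I_3) : 'cV[R]_3 := \col_j (j == i)%:R.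

(** The indicator of a cell lies in the space of a pair exactly when the cell is not in the pair, so
    the space determines the third cell. *)
Lemma pair_space_inj i j i' j' : i != j -> i' != j' -> pair_space i j = pair_space i' j' ->
  (i = i' /\ j = j') \/ (i = j' /\ j = i').
Proof.
move=> ij ij' e.
have [z iz jz] := third_cell ij; have [z' iz' jz'] := third_cell ij'.
have zz : z = z'.
  have : indicator z \in pair_space i' j'.
    by rewrite -e; apply/mem_pair; rewrite !mxE (negbTE iz) (negbTE jz).
  move/mem_pair; rewrite !mxE; case: (cells_cover ij' iz' jz' z) => -> //;
  by rewrite eqxx ?(negbTE ij') ?[j' == i']eq_sym ?(negbTE ij') => /eqP; rewrite ?oner_eq0 // eq_sym oner_eq0.
case: (cells_cover ij iz jz i') => e1; case: (cells_cover ij iz jz j') => e2; subst;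
  do ?[by rewrite eqxx in ij'|by rewrite eqxx in iz'|by rewrite eqxx in jz'|by left|by right].
Qed.

Lemma pair_neq_diagonal i j : i != j -> pair_space i j != diagonal_space R.
Proof.
move=> ij; have [z iz jz] := third_cell ij; apply/eqP => e.
have : indicator z \in diagonal_space R.
  by rewrite -e; apply/mem_pair; rewrite !mxE (negbTE iz) (negbTE jz).
by move/mem_diagonal/(_ i z)/eqP; rewrite !mxE eqxx (negbTE iz) eq_sym oner_eq0.
Qed.

Lemma pair_neq_full i j : i != j -> pair_space i j != full_space R.
Proof.
move=> ij; apply/eqP => e; have : indicator i \in pair_space i j by rewrite e mem_full.
by move/mem_pair/eqP; rewrite !mxE eqxx [j == i]eq_sym (negbTE ij) oner_eq0.
Qed.

Lemma diagonal_neq_full : diagonal_space R != full_space R.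
Proof.
apply/eqP => e; have : indicator 0 \in diagonal_space R by rewrite e mem_full.
by move/mem_diagonal/(_ 0 1)/eqP; rewrite !mxE oner_eq0.
Qed.

Lemma diagonal_sub_pair i j : (diagonal_space R <= pair_space i j)%VS.
Proof. by apply/subvP => x /mem_diagonal h; apply/mem_pair. Qed.

Lemma pair_sub_diagonal i j : i != j -> ~~ (pair_space i j <= diagonal_space R)%VS.
Proof.
move=> ij; apply: contraNN (pair_neq_diagonal ij) => h.
apply/eqP/space_eq => x; split; first exact: (subvP h).
exact: (subvP (diagonal_sub_pair i j)).
Qed.

Lemma polydiagonal_cases D : polydiagonal D ->
  [\/ D = diagonal_space R, D = full_space R |
      exists i j, i != j /\ D = pair_space i j].
Proof.
move=> [e De].
pose q i j := e i j || e j i.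
have DE x : x \in D <-> [/\ q 0 1 -> x 0 0 = x 1 0, q 0 2 -> x 0 0 = x 2 0 & q 1 2 -> x 1 0 = x 2 0].
  rewrite De; split=> [h|[h01 h02 h12] i j eij].
    by split=> /orP[]/h.
  have := @cells_cover 0 1 2 isT isT isT => cov.
  case: (cov i) eij => ->; case: (cov j) => -> // eij; do ?[apply: h01|apply: h02|apply: h12|apply/esym; apply: h01|apply/esym; apply: h02|apply/esym; apply: h12];
  by rewrite /q eij ?orbT.
have diag x : x \in diagonal_space R <-> x 0 0 = x 1 0 /\ x 0 0 = x 2 0.
  rewrite mem_diagonal; split=> [h|[h1 h2] i j]; first by split; exact: h.
  have := @cells_cover 0 1 2 isT isT isT => cov.
  by case: (cov i) => ->; case: (cov j) => ->; congruence.
case q01 : (q 0 1) DE; case q02 : (q 0 2); case q12 : (q 1 2) => DE.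
- constructor 1; apply: space_eq => x; rewrite DE diag; split=> [[h1 h2 _]|[h1 h2]].
    by split; [exact: h1|exact: h2].
  by split=> // _; rewrite -h1.
- constructor 1; apply: space_eq => x; rewrite DE diag; split=> [[h1 h2 _]|[h1 h2]].
    by split; [exact: h1|exact: h2].
  by split.
- constructor 1; apply: space_eq => x; rewrite DE diag; split=> [[h1 _ h3]|[h1 h2]].
    by split; [exact: h1|rewrite h1// h3].
  by split=> // _; rewrite -h1.
2: constructor 1; apply: space_eq => x; rewrite DE diag; split=> [[_ h2 h3]|[h1 h2]].
2: by split; [rewrite h2// h3|exact: h2].
2: by split=> // _; rewrite -h1.
- by constructor 3; exists 0, 1; split=> //; apply: space_eq => x; rewrite DE mem_pair; split=> [[h1 _ _]|h1]; [exact: h1|split].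
- by constructor 3; exists 0, 2; split=> //; apply: space_eq => x; rewrite DE mem_pair; split=> [[_ h1 _]|h1]; [exact: h1|split].
- by constructor 3; exists 1, 2; split=> //; apply: space_eq => x; rewrite DE mem_pair; split=> [[_ _ h1]|h1]; [exact: h1|split].
- by constructor 2; apply: space_eq => x; rewrite DE; split=> // _; exact: mem_full.
Qed.

Lemma adjacency_mul l x i : (adjacency R N (lift ord0 l) *m x) i 0 = x (N l i) 0.
Proof.
rewrite mxE (bigD1 (N l i))//= mxE /slot liftK eqxx mul1r big1 ?addr0// => j ji.
by rewrite mxE /slot liftK eq_sym (negbTE ji) mul0r.
Qed.

Lemma synchrony_full : synchrony N (full_space R).
Proof.
split=> [|l x _]; last exact: mem_full.
by exists (fun _ _ => false) => x; split=> // _; exact: mem_full.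
Qed.

Lemma synchrony_diagonal : synchrony N (diagonal_space R).
Proof.
split=> [|l x /mem_diagonal h]; last by apply/mem_diagonal => i j; rewrite !adjacency_mul; exact: h.
exists (fun _ _ => true) => x; rewrite mem_diagonal; split=> h i j; last exact: h.
by move=> _; exact: h.
Qed.

(** Invariance need only be tested on the indicator of the third cell, which separates that cell
    from the pair. *)
Lemma synchrony_pair i j : i != j -> synchrony N (pair_space i j) <-> sync_pair N i j.
Proof.
move=> ij; split=> [[_ h] l|sp].
  have [z iz jz] := third_cell ij; have cov := cells_cover ij iz jz.
  have hz : indicator z \in pair_space i j by apply/mem_pair; rewrite !mxE (negbTE iz) (negbTE jz).
  move/(h l)/mem_pair: hz; rewrite !adjacency_mul !mxE.
  have zi : (i == z) = false by exact: negbTE. have zj : (j == z) = false by exact: negbTE.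
  case: (cov (N l i)) => ->; case: (cov (N l j)) => ->; rewrite ?eqxx ?zi ?zj;
  do ?[by left|by right; left|by right; right|by move/eqP; rewrite ?oner_eq0 // eq_sym oner_eq0].
split.
  exists (fun a b => (a == i) && (b == j)) => x; rewrite mem_pair.
  by split=> [h a b /andP[/eqP-> /eqP->]//|]; apply; rewrite !eqxx.
move=> l x /mem_pair h; apply/mem_pair; rewrite !adjacency_mul.
by case: (sp l) => [->|[[-> ->]|[-> ->]]].
Qed.

Lemma synchrony_cases D : synchrony N D ->
  [\/ D = diagonal_space R, D = full_space R |
      exists i j, [/\ i != j, sync_pair N i j & D = pair_space i j]].
Proof.
move=> sD; have [pD _] := sD.
have [->|->|[i [j [ij De]]]] := polydiagonal_cases pD; [by constructor 1|by constructor 2|].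
by constructor 3; exists i, j; split=> //; apply/synchrony_pair; rewrite // -De.
Qed.

Lemma sync_pair_sym i j : sync_pair N i j -> sync_pair N j i.
Proof. by move=> h l; case: (h l) => [->|[[-> ->]|[-> ->]]]; [left|right; left|right; right]. Qed.

End SynchronySpaces.

(** * The quotients on the diagonal, on a pair space and on the full space *)

Section Quotients.
Variables (R : realType) (k : nat) (N : network k 3).

Definition diagonal_quotient : network k 1 := fun _ _ => ord0.

Lemma diagonal_quotientP : quotient_network N (diagonal_space R) diagonal_quotient.
Proof.
exists (fun=> ord0); split=> //.
- by move=> a; exists 0; rewrite [a]ord1.
- by move=> x; rewrite mem_diagonal; split=> h i j => [_|]; apply: h.
Qed.

Section Pair.
Variables (a b c : 'I_3).
Hypotheses (ab : a != b) (ac : a != c) (bc : b != c) (sab : sync_pair N a b).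

Definition pair_class (i : 'I_3) : 'I_2 := if i == c then 1 else 0.
Definition pair_quotient : network k 2 :=
  fun l u => pair_class (N l (if u == 0 then a else c)).

Let ca : pair_class a = 0. Proof. by rewrite /pair_class (negbTE ac). Qed.
Let cb : pair_class b = 0. Proof. by rewrite /pair_class (negbTE bc). Qed.
Let cc : pair_class c = 1. Proof. by rewrite /pair_class eqxx. Qed.

Lemma pair_quotient_class l i : pair_quotient l (pair_class i) = pair_class (N l i).
Proof.
rewrite /pair_quotient; case: (cells_cover ab ac bc i) => ->; rewrite ?ca ?cb ?cc//=.
by case: (sab l) => [->|[[-> ->]|[-> ->]]]; rewrite ?ca ?cb.
Qed.

Lemma pair_class_onto u : exists i, pair_class i = u.
Proof.
case: u => [[|[|//]] p]; [exists a; rewrite ca|exists c; rewrite cc]; exact: val_inj.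
Qed.

Lemma pair_class_space (x : 'cV[R]_3) : x \in pair_space R a b <->
  forall i j, pair_class i = pair_class j -> x i 0 = x j 0.
Proof.
rewrite mem_pair; split=> [h i j|]; last by apply; rewrite ca cb.
by case: (cells_cover ab ac bc i) => ->; case: (cells_cover ab ac bc j) => ->; rewrite ?ca ?cb ?cc.
Qed.

Lemma pair_quotientP : quotient_network N (pair_space R a b) pair_quotient.
Proof.
exists pair_class; split; [exact: pair_class_onto|exact: pair_class_space|].
exact: pair_quotient_class.
Qed.

Definition pair_eigenvalue (e : 'rV[R]_k.+1) : R := jacobian N e c c - jacobian N e a c.

Lemma pair_quotient_slot p i : slot pair_quotient p (pair_class i) = pair_class (slot N p i).
Proof. by rewrite /slot; case: unliftP => // l _; exact: pair_quotient_class. Qed.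

Lemma jacobianE n (M : network k n) (e : 'rV[R]_k.+1) i j :
  jacobian M e i j = \sum_p e 0 p * (slot M p i == j)%:R.
Proof. by rewrite summxE; apply: eq_bigr => p _; rewrite !mxE. Qed.

Lemma pair_quotient_eigenvalue e : two_cell_eigenvalue pair_quotient e = pair_eigenvalue e.
Proof.
rewrite /two_cell_eigenvalue /pair_eigenvalue -ca -cc !jacobianE.
have h i : (pair_class i == pair_class c) = (i == c).
  by rewrite cc /pair_class; case: (i == c).
by congr (_ - _); apply: eq_bigr => p _; rewrite pair_quotient_slot h.
Qed.

(* The trace alone identifies the second eigenvalue of any quotient by the
   equality of the cells a and b. *)
Lemma pair_quotient_trace m (M : network k m) e : quotient_network N (pair_space R a b) M ->
  \tr (jacobian M e) = \sum_p e 0 p + pair_eigenvalue e.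
Proof.
move=> [g [g_surj gD gM]].
have gab : g a = g b.
  apply/eqP; apply: contraT => gn.
  have : (\col_i (g i == g a)%:R : 'cV[R]_3) \in pair_space R a b.
    by apply/gD => i j; rewrite !mxE => ->.
  by move/mem_pair/eqP; rewrite !mxE eqxx [g b == _]eq_sym (negbTE gn) oner_eq0.
have gac : g a != g c.
  apply/eqP => e'; have : indicator R c \in pair_space R a b.
    by apply/mem_pair; rewrite !mxE (negbTE ac) (negbTE bc).
  by move/gD/(_ a c e')/eqP; rewrite !mxE eqxx (negbTE ac) eq_sym oner_eq0.
have gcov u : u = g a \/ u = g c.
  have [i <-] := g_surj u; case: (cells_cover ab ac bc i) => ->; rewrite -?gab; by [left|right].
have gslot p i : slot M p (g i) = g (slot N p i) by rewrite /slot; case: unliftP => // l _; exact: gM.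
have sum_g (h : 'I_m -> R) : \sum_u h u = h (g a) + h (g c).
  rewrite (bigD1 (g a))//= (bigD1 (g c)) 1?eq_sym//= big1 ?addr0// => u /andP[ua uc].
  by case: (gcov u) ua uc => ->; rewrite eqxx.
rewrite /mxtrace sum_g /pair_eigenvalue !jacobianE -sumrB -!big_split; apply: eq_bigr => p _ /=.
rewrite !gslot.
have ga i : (g i == g a) = (i != c).
  case: (cells_cover ab ac bc i) => ->; rewrite -?gab ?eqxx ?ac ?bc//.
  by rewrite eq_sym (negbTE gac).
have gc i : (g i == g c) = (i == c).
  case: (cells_cover ab ac bc i) => ->; rewrite -?gab ?eqxx ?(negbTE gac) ?(negbTE ac) ?(negbTE bc)//.
by rewrite ga gc; case: (slot N p a == c); rewrite /=; ring.
Qed.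

End Pair.

Lemma full_quotient_self : quotient_network N (full_space R) N.
Proof.
exists id; split=> //; first by move=> a; exists a.
by move=> x; split=> [_ i j ->//|_]; exact: mem_full.
Qed.

(** An annotation may refer to any copy of the quotient. On the full space such a copy is a
    relabelling of the cells, under which conjugation invariants do not change. *)
Lemma full_quotient m (M : network k m) (e : 'rV[R]_k.+1) : quotient_network N (full_space R) M ->
  \tr (jacobian M e) = \tr (jacobian N e) /\ \det (jacobian M e) = \det (jacobian N e).
Proof.
move=> [g [g_surj gD gM]].
have g_inj : injective g.
  move=> i j gij; have /gD/(_ i j gij)/eqP := mem_full (indicator R j).
  by rewrite !mxE eqxx; apply: contraTeq => ij; rewrite (negbTE ij) eq_sym oner_eq0.
have m3 : m = 3%N.
  have [h gh] := choice g_surj.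
  rewrite -(card_ord m) -(card_ord 3); apply/esym/(@bij_eq_card _ _ g); exists h => [i|u]; last exact: gh.
  by apply: g_inj; exact: gh.
subst m; pose s := perm.perm g_inj.
have gslot p i : slot M p (g i) = g (slot N p i) by rewrite /slot; case: unliftP => // l _; exact: gM.
have JE : jacobian N e = row_perm s (col_perm s (jacobian M e)).
  apply/matrixP => i j; rewrite !mxE !perm.permE !jacobianE; apply: eq_bigr => p _.
  by rewrite gslot (inj_eq g_inj).
split.
  rewrite JE /mxtrace (reindex_inj g_inj); apply: eq_bigr => i _.
  by rewrite !mxE !perm.permE.
rewrite JE row_permE col_permE !det_mulmx !det_perm perm.odd_permV.
by rewrite mulrCA -signr_addb addbb expr0 mulr1.
Qed.

End Quotients.

(** * Polynomial functions and generic points *)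

Section GenericPoints.
Variables (R : realType) (d : nat).
Implicit Types (c : 'rV[R]_d) (phi psi : 'rV[R]_d -> R).

Definition poly_fun phi : Prop := exists p : mpoly d R, forall c, phi c = evalp p c.

Lemma pf_const x : poly_fun (fun=> x).
Proof. by exists (mpolyC _ x) => c; rewrite evalpC. Qed.

Lemma pf_coord i : poly_fun (fun c => c 0 i).
Proof. by exists (mpolyX R (mnm1 i)) => c; rewrite evalpX. Qed.

Lemma pf_add phi psi : poly_fun phi -> poly_fun psi -> poly_fun (fun c => phi c + psi c).
Proof. by move=> [p hp] [q hq]; exists (p + q) => c; rewrite evalpD hp hq. Qed.

Lemma pf_mul phi psi : poly_fun phi -> poly_fun psi -> poly_fun (fun c => phi c * psi c).
Proof. by move=> [p hp] [q hq]; exists (p * q) => c; rewrite evalpM hp hq. Qed.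

Lemma pf_sub phi psi : poly_fun phi -> poly_fun psi -> poly_fun (fun c => phi c - psi c).
Proof.
move=> hp /(pf_mul (pf_const (-1)))/(pf_add hp)[p h]; exists p => c.
by rewrite -h mulN1r.
Qed.

Lemma pf_sum n (F : 'I_n -> 'rV[R]_d -> R) :
  (forall i, poly_fun (F i)) -> poly_fun (fun c => \sum_i F i c).
Proof.
move=> hF; elim: (index_enum _) => [|i s ih].
  by under eq_fun do rewrite big_nil; exact: pf_const.
by under eq_fun do rewrite big_cons; exact: pf_add.
Qed.

Lemma pf_continuous phi : poly_fun phi -> continuous phi.
Proof.
move=> [p hp]; rewrite (_ : phi = evalp p); last by apply/funext.
by move=> c; apply: differentiable_continuous; exact: (smooth_differentiable [::] c (smooth_evalp p)).
Qed.

Lemma pf_generic phi : poly_fun phi -> (exists c, phi c != 0) ->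
  generic_point (fun c => phi c != 0).
Proof.
move=> [p hp] [c pc]; exists p => [|x]; last by rewrite hp.
by apply: contraNneq pc => p0; rewrite hp p0 /evalp meval0.
Qed.

Lemma generic_and (P Q : 'rV[R]_d -> Prop) : generic_point P -> generic_point Q ->
  generic_point (fun c => P c /\ Q c).
Proof.
move=> [p p0 hp] [q q0 hq]; exists (p * q); first exact: mulf_neq0.
by move=> c; rewrite evalpM mulf_eq0 negb_or => /andP[/hp ? /hq].
Qed.

Lemma generic_imp (P Q : 'rV[R]_d -> Prop) : (forall c, P c -> Q c) ->
  generic_point P -> generic_point Q.
Proof. by move=> PQ [p p0 hp]; exists p => // c /hp/PQ. Qed.

Lemma generic_near (P : 'rV[R]_d -> Prop) c e : generic_point P -> 0 < e ->
  exists2 x, `|x - c| < e & P x.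
Proof. by move=> [p p0 hp] e0; have [x xc /hp] := evalp_nonzero_near c p0 e0; exists x. Qed.

Lemma continuous_add phi psi : continuous phi -> continuous psi ->
  continuous (fun c => phi c + psi c).
Proof. by move=> cf cg c; apply: (@cvgD _ _ _ (nbhs c)); [exact: cf|exact: cg]. Qed.

Lemma continuous_sub phi psi : continuous phi -> continuous psi ->
  continuous (fun c => phi c - psi c).
Proof. by move=> cf cg c; apply: (@cvgB _ _ _ (nbhs c)); [exact: cf|exact: cg]. Qed.

Lemma continuous_mul phi psi : continuous phi -> continuous psi ->
  continuous (fun c => phi c * psi c).
Proof. by move=> cf cg c; apply: (@cvgM _ _ (nbhs c)); [exact: cf|exact: cg]. Qed.

(** Generic points are dense, so an equality of continuous functions extends from them to all
    points. *)
Lemma generic_eq phi psi : continuous phi -> continuous psi ->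
  generic_point (fun c => phi c = psi c) -> forall c, phi c = psi c.
Proof.
move=> cphi cpsi g c; apply/eqP; rewrite -subr_eq0; apply: contraT => ne.
have e0 : 0 < `|phi c - psi c| by rewrite normr_gt0.
have cb : (fun x => phi x - psi x) @ nbhs c --> phi c - psi c by apply: cvgB; [exact: cphi|exact: cpsi].
move/(@cvgrPdist_lt _ _ _ (nbhs c)): cb => /(_ _ e0)/nbhs_ballP[q /= q0 hq].
have [x xc px] := generic_near c g q0.
have /hq : ball c q x by rewrite -ball_normE /ball_ /= distrC.
by rewrite /= px subrr subr0 ltxx.
Qed.

End GenericPoints.

(** * Eigenvalues determined by an annotation *)

Section Annotations.
Variables (R : realType) (k : nat) (N : network k 3).
Implicit Types (e : 'rV[R]_k.+1) (mu : eigenfunction R k).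

Definition ups e : R := \sum_p e 0 p.
Definition red_trace e : R := reduced_trace 0 1 2 (jacobian N e).
Definition red_det e : R := reduced_det 0 1 2 (jacobian N e).

Lemma pf_ups : poly_fun ups.
Proof. by apply: pf_sum => p; exact: pf_coord. Qed.

Lemma pf_jacobian n (M : network k n) i j : poly_fun (fun e => jacobian M e i j).
Proof.
under eq_fun do rewrite jacobianE.
by apply: pf_sum => p; apply: pf_mul; [exact: pf_coord|exact: pf_const].
Qed.

Lemma pf_trace : poly_fun red_trace.
Proof. by apply: pf_add; apply: pf_sub; exact: pf_jacobian. Qed.

Lemma pf_det : poly_fun red_det.
Proof.
apply: pf_sub; apply: pf_mul; apply: pf_sub; exact: pf_jacobian.
Qed.

Lemma pf_pair a c : poly_fun (fun e => pair_eigenvalue N a c e).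
Proof. by apply: pf_sub; exact: pf_jacobian. Qed.

Lemma complexE (x : R[i]) (y z : R) : complex.Re x = y -> complex.Im x = z -> x = (y +i* z)%C.
Proof. by case: x => u v /= -> ->. Qed.

Lemma real_eigenfunction mu (phi : 'rV[R]_k.+1 -> R) : continuous_eigenfunction mu ->
  poly_fun phi -> generic_point (fun e => mu e = (phi e)%:C%C) ->
  forall e, mu e = (phi e)%:C%C.
Proof.
move=> [cRe cIm] /pf_continuous cphi g e; apply: complexE.
  apply: (generic_eq cRe cphi); apply: generic_imp g => {}e -> //.
have h := @generic_eq R _ (fun e => complex.Im (mu e)) (fun=> 0) cIm (@cst_continuous _ _ 0).
by apply: h; apply: (generic_imp _ g) => {}e ->.
Qed.

(** The trace is the valency plus [mu], which determines [mu] at generic points and then everywhere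
    by continuity. *)
Lemma annotated_pair a b c m (M : network k m) mu : a != b -> a != c -> b != c ->
  quotient_network N (pair_space R a b) M ->
  eigenvalue_annotation M [:: (@valency R k, false); (mu, false)] ->
  forall e, mu e = (pair_eigenvalue N a c e)%:C%C.
Proof.
move=> ab ac bc qM [cont gen].
apply: real_eigenfunction; [by apply: (cont (mu, false)); right; left|exact: pf_pair|].
apply: generic_imp gen => e [cp _].
have {}cp : char_poly (map_mx (real_complex R) (jacobian M e)) =
    \prod_(z <- [:: valency e; mu e]) ('X - z%:P).
  by rewrite cp !big_cons !big_nil !expr1.
have m2 : m = 2%N.
  by have := congr1 (fun p : {poly R[i]} => size p) cp; rewrite size_char_poly size_prod_XsubC => -[].
subst m; have := congr1 (fun p : {poly R[i]} => p`_1) cp.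
rewrite /= (@char_poly_trace _ 2)// (coefPn_prod_XsubC (ps := [:: valency e; mu e]))//.
move/oppr_inj; rewrite trace_map_mx (pair_quotient_trace ab ac bc e qM) !big_cons big_nil addr0.
by rewrite rmorphD /= => /addrI ->.
Qed.

(** Trace and determinant are compared with the annotated factorization. The determinant yields the
    product of the two eigenvalues only after multiplication by the valency, which is cancelled
    where it is nonzero; continuity does the rest. *)
Lemma annotated_full m (M : network k m) (s : annotation R k) mu1 mu2 :
  quotient_network N (full_space R) M -> eigenvalue_annotation M s ->
  continuous_eigenfunction mu1 -> continuous_eigenfunction mu2 ->
  (forall e, \prod_(x <- s) ('X - (x.1 e)%:P) ^+ (if x.2 then 2 else 1) =
     \prod_(z <- [:: valency e; mu1 e; mu2 e]) ('X - z%:P)) ->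
  (forall e, mu1 e + mu2 e = (red_trace e)%:C%C) /\
  ((exists e, ups e != 0) -> forall e, mu1 e * mu2 e = (red_det e)%:C%C).
Proof.
move=> qM [_ gen] c1 c2 sE.
have {}gen : generic_point (fun e => mu1 e + mu2 e = (red_trace e)%:C%C /\
    valency e * (mu1 e * mu2 e) = (ups e * red_det e)%:C%C).
  apply: generic_imp gen => e [cp _]; rewrite sE in cp.
  have m3 : m = 3%N.
    by have := congr1 (fun p : {poly R[i]} => size p) cp; rewrite size_char_poly size_prod_XsubC => -[].
  subst m; have [trM detM] := full_quotient e qM; split.
    have := congr1 (fun p : {poly R[i]} => p`_2) cp.
    rewrite /= (@char_poly_trace _ 3)// (coefPn_prod_XsubC (ps := [:: valency e; mu1 e; mu2 e]))//.
    move/oppr_inj; rewrite trace_map_mx trM (trace_const_rows (jacobian_rows N e)).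
    by rewrite !big_cons big_nil addr0 rmorphD /= => /addrI ->.
  have := congr1 (fun p : {poly R[i]} => p`_0) cp.
  rewrite /= char_poly_det coef0_prod_XsubC /= det_map_mx detM (det_const_rows (jacobian_rows N e)).
  rewrite !big_cons big_nil mulr1 => h; apply: (mulfI (_ : (-1) ^+ 3 != 0 :> R[i])).
    by rewrite expf_neq0// oppr_eq0 oner_eq0.
  by rewrite -h.
have [[cR1 cI1] [cR2 cI2]] := (c1, c2).
split.
  apply: (@real_eigenfunction (fun e => mu1 e + mu2 e) red_trace); last 1 first.
  - by apply: (generic_imp _ gen) => e [].
  - split.
      have -> : (fun e => complex.Re (mu1 e + mu2 e)) = (fun e => complex.Re (mu1 e) + complex.Re (mu2 e)).
        by apply/funext => x; rewrite raddfD.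
      exact: continuous_add.
    have -> : (fun e => complex.Im (mu1 e + mu2 e)) = (fun e => complex.Im (mu1 e) + complex.Im (mu2 e)).
      by apply/funext => x; rewrite raddfD.
    exact: continuous_add.
  - exact: pf_trace.
move=> u0 e.
have gu : generic_point (fun e => ups e != 0) by apply: pf_generic; [exact: pf_ups|].
have g : generic_point (fun e => mu1 e * mu2 e = (red_det e)%:C%C).
  apply: generic_imp (generic_and gen gu) => {}e [[_ h] ue].
  by apply: (mulfI (_ : valency e != 0)); [rewrite fmorph_eq0|rewrite h rmorphM].
have ReM (x y : R[i]) : complex.Re (x * y) = complex.Re x * complex.Re y - complex.Im x * complex.Im y.
  by case: x y => [? ?] [? ?].
have ImM (x y : R[i]) : complex.Im (x * y) = complex.Re x * complex.Im y + complex.Im x * complex.Re y.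
  by case: x y => [? ?] [? ?].
apply: (@real_eigenfunction (fun e => mu1 e * mu2 e) red_det) g e; last exact: pf_det.
split.
  have -> : (fun e => complex.Re (mu1 e * mu2 e)) =
      (fun e => complex.Re (mu1 e) * complex.Re (mu2 e) - complex.Im (mu1 e) * complex.Im (mu2 e)).
    by apply/funext => x; rewrite ReM.
  by apply: continuous_sub; exact: continuous_mul.
have -> : (fun e => complex.Im (mu1 e * mu2 e)) =
    (fun e => complex.Re (mu1 e) * complex.Im (mu2 e) + complex.Im (mu1 e) * complex.Re (mu2 e)).
  by apply/funext => x; rewrite ImM.
by apply: continuous_add; exact: continuous_mul.
Qed.

Lemma ups_neq0 : exists e, ups e != 0.
Proof.
exists 'e_ord0; rewrite /ups (bigD1 ord0)//= big1 ?addr0 ?mxE ?oner_neq0// => p p0.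
by rewrite mxE (negbTE p0) andbF.
Qed.

Lemma different_neq (mus : seq (eigenfunction R k)) i j : different mus ->
  (i < j < size mus)%N -> exists e, nth (@valency R k) mus i e != nth (@valency R k) mus j e.
Proof.
move=> dm /andP[ij js]; have [e _ ue] := generic_near 0 dm (@ltr01 R).
exists e; have /(uniqP 0) inj := ue.
have nE l : (l < size mus)%N -> nth 0 [seq mu e | mu <- mus] l = nth (@valency R k) mus l e.
  by move=> h; rewrite (nth_map (@valency R k)).
have is' := ltn_trans ij js.
apply/eqP; rewrite -!nE// => /inj; rewrite !inE size_map => /(_ is' js) ij'.
by rewrite ij' ltnn in ij.
Qed.

End Annotations.

(** * Generic synchronies *)

Section LinearProblem.
Variables (R : realType) (k : nat).
Local Notation response := (response R k).

Definition lin (al : 'I_k.+1 -> R) (e : 'rV[R]_k.+1) : R := \sum_p al p * e 0 p.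
Definition lin_mu al : eigenfunction R k := fun e => (lin al e)%:C%C.

Lemma lin_ups : valency (R := R) (k := k) = lin_mu (fun=> 1).
Proof. by apply/funext => e; congr (_%:C%C); apply: eq_bigr => p _; rewrite mul1r. Qed.

Lemma ups_lin (e : 'rV[R]_k.+1) : ups e = lin (fun=> 1) e.
Proof. by apply: eq_bigr => p _; rewrite mul1r. Qed.

Lemma lin_shift al e x : al ord0 = 1 -> lin al (e + x *: 'e_ord0) = lin al e + x.
Proof.
move=> a0; rewrite -[x in RHS]mul1r -a0 /lin.
have -> : al ord0 * x = \sum_p al p * (x *: 'e_ord0 : 'rV[R]_k.+1) 0 p.
  rewrite (bigD1 ord0)//= !mxE !eqxx mulr1 big1 ?addr0// => p p0.
  by rewrite !mxE (negbTE p0) andbF !mulr0.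
by rewrite -big_split; apply: eq_bigr => p _; rewrite [X in _ * X]mxE mulrDr.
Qed.

(** Adding to e_0 shifts both linear eigenvalues by the same amount, so the first can be moved to 0
    while their difference is kept. *)
Lemma lin_separate al be : al ord0 = 1 -> be ord0 = 1 -> (exists e, lin al e != lin be e) ->
  exists2 e, lin al e = 0 & lin be e != 0.
Proof.
move=> a0 b0 [e ne]; exists (e + - lin al e *: 'e_ord0); first by rewrite lin_shift// subrr.
by rewrite lin_shift// subr_eq0 eq_sym.
Qed.

Variable al : 'I_k.+1 -> R.
Hypothesis al0 : al ord0 = 1.
Local Notation V := (bifurcation_problem (lin_mu al)).

Lemma lin_problemP (f : response) : V f <-> [/\ smooth_on setT f,
  lin al (first_derivatives f) = 0 & forall l : R, f (row_mx 0 l%:M) = 0].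
Proof.
split=> [[sf mu0 _ f0]|[sf mu0 f0]]; first by split=> //; case: mu0.
split=> //; first by rewrite /lin_mu mu0.
by rewrite (_ : [set c | _] = setT) ?interiorT//; apply/seteqP; split.
Qed.

Lemma first_mix s (f g : response) : smooth_on setT f -> smooth_on setT g ->
  first_derivatives (mix s f g) =
  first_derivatives f + s *: (first_derivatives g - first_derivatives f).
Proof. by move=> sf sg; apply/rowP => p; rewrite !mxE pderiv_mix. Qed.

Lemma lin_convex : convex_problem V.
Proof.
split=> [f /lin_problemP[]//|f g s /lin_problemP[sf lf f0] /lin_problemP[sg lg g0]].
apply/lin_problemP; split; first exact: smooth_mix.
  have linD u v : lin al (u + v) = lin al u + lin al v.
    by rewrite /lin -big_split; apply: eq_bigr => p _; rewrite mxE mulrDr.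
  have linZ x u : lin al (x *: u) = x * lin al u.
    by rewrite /lin mulr_sumr; apply: eq_bigr => p _; rewrite mxE mulrCA.
  by rewrite first_mix// linD linZ linD -scaleN1r linZ lf lg; ring.
by move=> l; rewrite /mix f0 g0 subrr mulr0 addr0.
Qed.

Lemma lin_generic P : condition V P -> generically V P.
Proof.
apply: (@generic_linear _ _ _ (fun f => \sum_(p < k.+1) (if p == ord0 then 0 else - al p * first_derivatives f 0 p))).
  apply: jp_sum => p; case: eqVneq => [_|p0]; first exact: jp_const.
  by apply: jp_mul; [exact: jp_const|exact: free_first].
move=> f /lin_problemP[_ lf _].
have := lf; rewrite /lin (bigD1 ord0)//= al0 mul1r mxE => h.
rewrite [RHS](bigD1 ord0)//= add0r [RHS](eq_bigr (fun p => - (al p * first_derivatives f 0 p))); last first.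
  by move=> p /negbTE ->; rewrite mulNr.
by rewrite sumrN; move: h; move: (\sum_(i < _ | _) _) (pderiv _ f 0) => X Y; lra.
Qed.

Lemma lin_witness e h g tau : lin al e = 0 -> V (witness e h g tau).
Proof.
move=> le; apply/lin_problemP; split; [exact: smooth_witness| |exact: witness_trivial].
by rewrite witness_first.
Qed.

Lemma condition_jet Phi e h g tau : jet_poly (@jet_word k) Phi -> lin al e = 0 ->
  Phi (witness e h g tau) != 0 -> condition V (fun f => Phi f != 0).
Proof.
by move=> jP le ne; exists Phi; split=> //; exists (witness e h g tau) => //; exact: lin_witness.
Qed.

Lemma condition_poly (phi : 'rV[R]_k.+1 -> R) :
  jet_poly (@jet_word k) (fun f => phi (first_derivatives f)) ->
  (exists2 e, lin al e = 0 & phi e != 0) ->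
  condition V (fun f => phi (first_derivatives f) != 0).
Proof.
move=> jP [e le ne]; apply: (condition_jet (e := e) (h := 0) (g := 0) (tau := 0)) => //.
by rewrite witness_first.
Qed.

Lemma condition_lin be : be ord0 = 1 -> (exists e, lin al e != lin be e) ->
  condition V (fun f => lin be (first_derivatives f) != 0).
Proof.
move=> b0 ne; apply: condition_poly; last exact: lin_separate.
by apply: jp_sum => p; apply: jp_mul; [exact: jp_const|exact: jp_first].
Qed.

Lemma synchronies_from_condition (N : network k 3) C Ds :
  condition V (fun f => forall D, branch_with_synchrony N f D <-> D \in Ds) ->
  generic_synchronies_if N C (lin_mu al) Ds.
Proof. by move=> h _; apply: lin_generic; apply: condition_imp h => f _ h _. Qed.

End LinearProblem.

Section Dynamics.
Variables (R : realType) (k : nat) (N : network k 3) (f : response R k).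
Hypothesis sf : smooth_on setT f.
Hypothesis f0 : forall l : R, f (row_mx 0 l%:M) = 0.
Local Notation e := (first_derivatives f).
Local Notation "'near' P" := (near_zeros f N P) (at level 0).
Implicit Types D E : {vspace 'cV[R]_3}.

Lemma branch_synchrony D : branch_with_synchrony N f D -> synchrony N D.
Proof. by move=> [I [b [rI /(_ I (@subset_refl _ I) rI) [_ []]]]]. Qed.

Lemma diagonal_least E : synchrony N E -> (diagonal_space R <= E)%VS.
Proof.
move=> /synchrony_cases[->|->|[i [j [ij _ ->]]]]; [exact: subvv|exact: subvf|].
exact: diagonal_sub_pair.
Qed.

Lemma ups_diagonal_zero : ups e != 0 -> near (fun x => x \in diagonal_space R -> x = 0).
Proof.
move=> u0; have [cc [onto sp cN]] := diagonal_quotientP R N.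
apply: (quotient_zero sf f0 cN onto sp).
by rewrite one_cell_jacobian det_scalar1.
Qed.

Lemma diagonal_branch : ups e = 0 ->
  one_cell_value (@diagonal_quotient k) f != 0 -> branch_with_synchrony N f (diagonal_space R).
Proof.
move=> u0 v0; have [cc [onto sp cN]] := diagonal_quotientP R N.
have [e1 [dlt [b hb]]] := one_cell_branch sf f0 u0 v0.
apply: (half_branch_synchrony (inflate_branch cN hb)) => //; first exact: synchrony_diagonal.
exists 1 => // x l _ _ _ [y -> y0]; split.
- by apply: contraNneq y0 => yz; apply/eqP/(inflate_inj onto); rewrite yz inflate0.
- by apply/sp => i j ij; rewrite !mxE ij.
- by move=> E /diagonal_least.
Qed.

Section Pair.
Variables (a b c : 'I_3).
Hypotheses (ab : a != b) (ac : a != c) (bc : b != c) (sab : sync_pair N a b).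

Let cN := pair_quotient_class ab ac bc sab.
Let onto := pair_class_onto ac.
Let sp (x : 'cV[R]_3) := pair_class_space ab ac bc x.

Lemma two_cell_det (M : network k 2) (c' : 'rV[R]_k.+1) :
  \det (jacobian M c') = ups c' * two_cell_eigenvalue M c'.
Proof.
by rewrite det2 !two_cell_column -/(ups c') /two_cell_eigenvalue; ring.
Qed.

Lemma pair_space_zero : ups e != 0 -> pair_eigenvalue N a c e != 0 ->
  near (fun x => x \in pair_space R a b -> x = 0).
Proof.
move=> u0 m0; apply: (quotient_zero sf f0 cN onto sp).
by rewrite two_cell_det mulf_neq0// (pair_quotient_eigenvalue ab ac bc sab).
Qed.

(** The lifted branch of the two-cell quotient is nonzero. Any further equality of cells would put
    it on the diagonal, where a nonzero valency leaves only the zero 0 nearby. *)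
Lemma pair_branch : ups e != 0 -> pair_eigenvalue N a c e = 0 ->
  two_cell_value (pair_quotient N a c) f != 0 -> branch_with_synchrony N f (pair_space R a b).
Proof.
move=> u0 m0 v0.
have [|e1 [dlt [br hb]]] := two_cell_branch sf f0 _ v0; first by rewrite (pair_quotient_eigenvalue ab ac bc sab).
have [r r0 dz] := ups_diagonal_zero u0.
apply: (half_branch_synchrony (inflate_branch cN hb)) => //; first exact/synchrony_pair.
exists r => // x l hx hl Fx [y xy y0].
have x0 : x != 0.
  by apply: contraNneq y0 => x0; apply/eqP/(inflate_inj onto); rewrite -xy x0 inflate0.
have xp : x \in pair_space R a b by apply/sp => i j ij; rewrite xy !mxE ij.
split=> // E sE xE; case: (synchrony_cases sE) => [Ed|->|[i [j [ij _ Ep]]]]; last 2 first.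
- exact: subvf.
- have [same|diff] := eqVneq (pair_space R i j) (pair_space R a b); first by rewrite Ep same subvv.
  case/eqP: x0; apply: (dz x l) => //; apply/mem_diagonal.
  move: xE; rewrite Ep => /mem_pair xij; move/mem_pair: xp => xab.
  have cov := cells_cover ab ac bc.
  suff [xa xc] : x a 0 = x b 0 /\ x a 0 = x c 0.
    by have ex u : x u 0 = x a 0 by [case: (cov u) => ->]; move=> u v; rewrite !ex.
  split=> //; move: diff xij ij; case: (cov i) => ->; case: (cov j) => -> diff xij ij;
    first [by rewrite eqxx in ij|by rewrite eqxx in diff|by rewrite pair_sym eqxx in diff
          |by rewrite xij|by rewrite -xij|by rewrite xab xij|by rewrite xab -xij].
- by case/eqP: x0; apply: (dz x l) => //; rewrite -Ed.
Qed.

Lemma diagonal_excluded : ups e != 0 -> ~ branch_with_synchrony N f (diagonal_space R).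
Proof.
move=> u0 /branch_not_below/(_ (ups_diagonal_zero u0)).
by rewrite subvv.
Qed.

Lemma pair_excluded : ups e != 0 -> pair_eigenvalue N a c e != 0 ->
  ~ branch_with_synchrony N f (pair_space R a b).
Proof.
move=> u0 m0 /branch_not_below/(_ (pair_space_zero u0 m0)).
by rewrite subvv.
Qed.

Lemma pair_sub i j : i != j -> (pair_space R i j <= pair_space R a b)%VS ->
  pair_space R i j = pair_space R a b.
Proof.
move=> ij sub; have cov := cells_cover ab ac bc.
have [z iz jz] := third_cell ij.
have : indicator R z \in pair_space R a b.
  by apply: (subvP sub); apply/mem_pair; rewrite !mxE (negbTE iz) (negbTE jz).
move/mem_pair; rewrite !mxE => hz.
have zc : z = c.
  case: (cov z) hz => -> //; rewrite eqxx; first by rewrite [b == a]eq_sym (negbTE ab) => /eqP; rewrite oner_eq0.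
  by rewrite (negbTE ab) => /eqP; rewrite eq_sym oner_eq0.
move: iz jz ij; rewrite zc; case: (cov i) => ->; case: (cov j) => ->; rewrite ?eqxx// => _ _ _.
exact: pair_sym.
Qed.

(** The nonzero transverse eigenvalue confines nearby zeros to the pair space, and the nonzero
    valency excludes the diagonal. *)
Lemma pair_only D : ups e != 0 -> \sum_p transverse R N a b p * e 0 p != 0 ->
  branch_with_synchrony N f D -> D = pair_space R a b.
Proof.
move=> u0 s0 bD; have [r r0 H] := pair_zero sf f0 ab sab s0.
have sub : (D <= pair_space R a b)%VS.
  apply: (branch_below bD); first exact/synchrony_pair.
  by exists r => // x l hx hl Fx _; apply/mem_pair; exact: (H x l).
case: (synchrony_cases (branch_synchrony bD)) => [Ed|Ef|[i [j [ij _ Ep]]]].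
- by case: (diagonal_excluded u0); rewrite -Ed.
- case/eqP: (pair_neq_full R ab); apply: space_eq => x; split=> [_|_]; first exact: mem_full.
  by apply: (subvP sub); rewrite Ef mem_full.
- by rewrite Ep; apply: pair_sub => //; rewrite -Ep.
Qed.

(* The valency is the only critical eigenvalue of the quotient, whose zeros are
   therefore synchronous. *)
Lemma pair_into_diagonal : pair_eigenvalue N a c e != 0 ->
  ~ branch_with_synchrony N f (pair_space R a b).
Proof.
move=> m0 bD.
have s2 : sync_pair (pair_quotient N a c) 0 1.
  move=> l; case: (pair_quotient N a c l 0) => [[|[|//]] p]; case: (pair_quotient N a c l 1) => [[|[|//]] q];
  by [left; apply: val_inj|right; left; split; apply: val_inj|right; right; split; apply: val_inj].
have [|r r0 H] := @pair_zero _ _ _ sf f0 _ (pair_quotient N a c) 0 1 isT s2.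
  have -> : \sum_p transverse R (pair_quotient N a c) 0 1 p * e 0 p = pair_eigenvalue N a c e.
    have tE i : \sum_p e 0 p * (slot (pair_quotient N a c) p i == 0)%:R = ups e - jacobian (pair_quotient N a c) e i 1.
      by rewrite -two_cell_column jacobianE.
    transitivity (\sum_p e 0 p * (slot (pair_quotient N a c) p 0 == 0)%:R -
                  \sum_p e 0 p * (slot (pair_quotient N a c) p 1 == 0)%:R).
      by rewrite -sumrB; apply: eq_bigr => p _; rewrite /transverse; ring.
    rewrite !tE -(pair_quotient_eigenvalue ab ac bc sab) /two_cell_eigenvalue; ring.
  exact: m0.
have := pair_sub_diagonal R ab; rewrite (branch_below bD (synchrony_diagonal R N))//.
exists r => // x l hx hl Fx /sp/(inflateP onto)[y xy yx].
apply/mem_diagonal => i j; rewrite xy !mxE.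
have y01 : y 0 0 = y 1 0.
  apply: (H y l) => //; first exact: le_trans hx.
  by apply: (inflate_inj onto); rewrite -(inflate_admissible _ cN) -xy Fx inflate0.
have yc u : y u 0 = y 0 0.
  by case: u => [[|[|//]] p]; [|rewrite y01]; congr (y _ 0); exact: val_inj.
by rewrite !yc.
Qed.

End Pair.

Lemma diagonal_only D : red_det N e != 0 -> branch_with_synchrony N f D -> D = diagonal_space R.
Proof.
move=> d0 bD.
have [r r0 H] := @diagonal_zero _ _ _ sf f0 N 0 1 2 isT isT isT (@cells_cover 0 1 2 isT isT isT) d0.
have sub : (D <= diagonal_space R)%VS.
  apply: (branch_below bD); first exact: synchrony_diagonal.
  exists r => // x l hx hl Fx _; have [x1 x2] := H x l hx hl Fx.
  apply/mem_diagonal => i j; have := @cells_cover 0 1 2 isT isT isT => cov.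
  have ex u : x u 0 = x 0 0 by case: (cov u) => ->.
  by rewrite !ex.
apply: space_eq => x; split; first exact: (subvP sub).
exact: (subvP (diagonal_least (branch_synchrony bD))).
Qed.

End Dynamics.

Section GenericSynchronies.
Variables (R : realType) (k : nat) (N : network k 3).
Implicit Types D E : {vspace 'cV[R]_3}.

Lemma problem_smooth (mu : eigenfunction R k) f : bifurcation_problem mu f ->
  smooth_on setT f /\ (forall l : R, f (row_mx 0 l%:M) = 0).
Proof. by case. Qed.

Lemma jp_red_det : jet_poly (@jet_word k) (fun f : response R k => red_det N (first_derivatives f)).
Proof. by apply: jp_sub; apply: jp_mul; apply: jp_sub; exact: jp_jacobian. Qed.

Lemma mem1 (D E : {vspace 'cV[R]_3}) : (D \in [:: E]) = (D == E).
Proof. by rewrite inE. Qed.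

Lemma valency_generic : (exists2 e : 'rV[R]_k.+1, ups e = 0 & red_det N e != 0) ->
  generic_synchronies N (@valency R k) [:: diagonal_space R].
Proof.
move=> [e ue de]; rewrite lin_ups.
have ue' : lin (fun=> 1) e = 0 by rewrite -ups_lin.
apply: synchronies_from_condition => //.
have c1 : condition (bifurcation_problem (lin_mu (fun=> 1))) (fun f : response R k => one_cell_value (@diagonal_quotient k) f != 0).
  apply: (condition_jet _ ue' (one_cell_witness _ e)) => //; exact: jp_one_cell.
have c2 : condition (bifurcation_problem (lin_mu (fun=> 1))) (fun f : response R k => red_det N (first_derivatives f) != 0).
  by apply: (condition_poly (phi := red_det N)); [exact: jp_red_det|exists e].
apply: condition_imp (condition_and (lin_convex _) c1 c2) => f /lin_problemP[sf lf f0] [v0 d0] D.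
rewrite mem1; split=> [bD|/eqP->]; first by apply/eqP; exact: (diagonal_only sf f0 d0).
by apply: diagonal_branch => //; rewrite ups_lin.
Qed.

Section Pair.
Variables (a b c : 'I_3).
Hypotheses (ab : a != b) (ac : a != c) (bc : b != c) (sab : sync_pair N a b).

Definition pair_slot (p : 'I_k.+1) : R := (slot N p c == c)%:R - (slot N p a == c)%:R.

Lemma pair_lin e : pair_eigenvalue N a c e = lin pair_slot e.
Proof.
rewrite /pair_eigenvalue !jacobianE -sumrB; apply: eq_bigr => p _.
by rewrite /pair_slot; ring.
Qed.

Lemma pair_slot0 : pair_slot ord0 = 1.
Proof. by rewrite /pair_slot /slot unlift_none eqxx (negbTE ac) subr0. Qed.

Definition transverse_eigenvalue (e : 'rV[R]_k.+1) : R := lin (transverse R N a b) e.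

Lemma transverse0 : transverse R N a b ord0 = 1.
Proof. by rewrite /transverse /slot unlift_none eqxx eq_sym (negbTE ab) subr0. Qed.

Definition pair_mu : eigenfunction R k := fun e => (pair_eigenvalue N a c e)%:C%C.

Lemma pair_muE : pair_mu = lin_mu pair_slot.
Proof. by apply/funext => e; rewrite /pair_mu pair_lin. Qed.

Local Notation V := (bifurcation_problem (lin_mu pair_slot)).

Lemma pair_branch_condition : (exists e : 'rV[R]_k.+1, ups e != pair_eigenvalue N a c e) ->
  condition V (fun f => ups (first_derivatives f) != 0 /\
                        branch_with_synchrony N f (pair_space R a b)).
Proof.
move=> [e0 ne]; have ne' : exists e, lin pair_slot e != lin (fun=> 1) e.
  by exists e0; rewrite -pair_lin -ups_lin eq_sym.
have [e le ue] := lin_separate pair_slot0 (erefl 1) ne'; rewrite -ups_lin in ue.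
have c1 : condition V (fun f => two_cell_value (pair_quotient N a c) f != 0).
  by apply: (condition_jet _ le (two_cell_witness _ ue)); exact: jp_two_cell.
apply: condition_imp (condition_and (lin_convex _) (condition_lin pair_slot0 (erefl 1) ne') c1).
move=> f /lin_problemP[sf lf f0] [u0 v0]; rewrite -ups_lin in u0; split=> //.
by apply: (pair_branch sf f0 ab ac bc sab u0 _ v0); rewrite pair_lin.
Qed.

Lemma pair_generic : (exists e : 'rV[R]_k.+1, ups e != pair_eigenvalue N a c e) ->
  (exists e : 'rV[R]_k.+1, transverse_eigenvalue e != pair_eigenvalue N a c e) ->
  generic_synchronies N pair_mu [:: pair_space R a b].
Proof.
move=> ne1 [e ne2]; rewrite pair_muE; apply: synchronies_from_condition; first exact: pair_slot0.
have c2 : condition V (fun f => lin (transverse R N a b) (first_derivatives f) != 0).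
  by apply: condition_lin; [exact: pair_slot0|exact: transverse0|exists e; rewrite -pair_lin eq_sym].
apply: condition_imp (condition_and (lin_convex _) (pair_branch_condition ne1) c2).
move=> f /lin_problemP[sf lf f0] [[u0 br] s0] D.
rewrite mem1; split=> [bD|/eqP->//]; apply/eqP.
exact: (pair_only sf f0 ab ac bc sab u0).
Qed.

End Pair.

(* When the reduced determinant vanishes at e, the reduced trace and determinant
   at clear0 e are the coefficients of a quadratic equation for e_0. *)
Definition clear0 (e : 'rV[R]_k.+1) : 'rV[R]_k.+1 := \row_p if p == ord0 then 0 else e 0 p.

Lemma jacobian_clear0 e i j : jacobian N e i j = jacobian N (clear0 e) i j + e 0 ord0 * (i == j)%:R.
Proof.
rewrite !jacobianE (bigD1 ord0)//= [X in _ = X + _](bigD1 ord0)//= mxE eqxx mul0r add0r addrC.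
rewrite {2}/slot unlift_none; congr (_ + _); apply: eq_bigr => p /negbTE p0.
by rewrite mxE p0.
Qed.

Lemma red_det_clear0 e : red_det N e = e 0 ord0 ^+ 2 + red_trace N (clear0 e) * e 0 ord0 + red_det N (clear0 e).
Proof.
by rewrite /red_det /red_trace /reduced_det /reduced_trace !(jacobian_clear0 e) /=; ring.
Qed.

Lemma red_trace_clear0 e : red_trace N e = 2 * e 0 ord0 + red_trace N (clear0 e).
Proof. by rewrite /red_trace /reduced_trace !(jacobian_clear0 e) /=; ring. Qed.

Lemma free_jacobian i j :
  jet_poly (@free_word k) (fun f : response R k => jacobian N (clear0 (first_derivatives f)) i j).
Proof.
under eq_fun do rewrite jacobianE; apply: jp_sum => p; apply: jp_mul; last exact: jp_const.
under eq_fun do rewrite mxE; case: eqVneq => [_|p0]; [exact: jp_const|exact: free_first].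
Qed.

(** For a root of the reduced quadratic that lives on no proper quotient. The last hypothesis says
    that a pair space carries the other root, which equals the reduced trace because the critical
    root is 0; thus proper quotients are nonsingular once the valency and the reduced trace are
    nonzero. *)
Lemma three_cell_generic (mu : eigenfunction R k) C :
  (forall f, bifurcation_problem mu f -> red_det N (first_derivatives f) = 0) ->
  (exists e, [/\ mu e = 0, [set c | complex.Im (mu c) = 0]° e & [/\ ups e != 0,
     red_trace N e != 0 & ups e != red_trace N e]]) ->
  (exists p, ~ (forall i, slot N p i = i) /\ ~ (forall i j, slot N p i = slot N p j)) ->
  (forall a b c f, a != b -> a != c -> b != c -> sync_pair N a b ->
     bifurcation_problem mu f ->
     pair_eigenvalue N a c (first_derivatives f) = red_trace N (first_derivatives f)) ->
  generic_synchronies_if N C mu [:: full_space R].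
Proof.
move=> Vd [e [mue ie [ue te ute]]] np Vp _.
have de : red_det N e = 0.
  have h := @witness_problem R k mu e 0 0 0 mue ie.
  by have := Vd _ h; rewrite witness_first.
(* The conjugate point: it differs from [e] only in e_0, which is the other root of the same
   quadratic, and its reduced trace is the opposite one. *)
pose e' := e + - red_trace N e *: 'e_ord0.
have e'0 : e' 0 ord0 = e 0 ord0 - red_trace N e by rewrite !mxE !eqxx mulr1.
have e'p p : p != ord0 -> e' 0 p = e 0 p by move=> /negbTE p0; rewrite !mxE p0 andbF mulr0 addr0.
have ce : clear0 e' = clear0 e.
  by apply/rowP => p; rewrite [LHS]mxE [RHS]mxE; case: eqVneq => // /e'p.
have te' : red_trace N e' = - red_trace N e.
  by rewrite (red_trace_clear0 e') ce e'0 (red_trace_clear0 e); ring.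
have de' : red_det N e' = 0.
  by rewrite -[RHS]de (red_det_clear0 e') (red_det_clear0 e) ce e'0 (red_trace_clear0 e); ring.
have ue' : ups e' != 0.
  by rewrite ups_lin lin_shift// -ups_lin subr_eq0.
have [h hh] := three_cell_witness de ue te np.
have [h' hh'] : exists h', three_cell_value N (witness e' h' 0 1) != 0.
  by apply: three_cell_witness => //; rewrite -/(red_trace N e') te' oppr_eq0.
(* The directions [h] and [h'] serve one root each. Mixing them with the same s at both points keeps
   the first derivatives and gives one cubic term that is nondegenerate at both roots. *)
pose f1 := witness e h 0 1; pose f2 := witness e h' 0 1.
pose g1 := witness e' h 0 1; pose g2 := witness e' h' 0 1.
have [q hq] := jp_mix (@jp_three_cell R k N) (@smooth_witness R k e h 0 1) (@smooth_witness R k e h' 0 1).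
have [r hr] := jp_mix (@jp_three_cell R k N) (@smooth_witness R k e' h 0 1) (@smooth_witness R k e' h' 0 1).
have q0 : q != 0 by apply: contraNneq hh => q0; rewrite -(mix0 (witness e h 0 1) f2) hq q0 horner0.
have r0 : r != 0 by apply: contraNneq hh' => r0; rewrite -(mix1 g1 (witness e' h' 0 1)) hr r0 horner0.
have [s _] := poly_small_nonroot (mulf_neq0 q0 r0) (@ltr01 R).
rewrite hornerM mulf_eq0 negb_or -hq -hr => /andP[qs rs].
have fe x y u : first_derivatives (mix s (witness x y 0 1) (witness x u 0 1)) = x.
  by rewrite first_mix ?witness_first ?subrr ?scaler0 ?addr0//; exact: smooth_witness.
apply: (@generic_by_norm _ _ _ _ (fun f => red_trace N (clear0 (first_derivatives f)))
  (fun f => red_det N (clear0 (first_derivatives f))) (three_cell_value N)).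
- by apply: jp_add; apply: jp_sub; exact: free_jacobian.
- by apply: jp_sub; apply: jp_mul; apply: jp_sub; exact: free_jacobian.
- exact: jp_three_cell.
- by move=> f /Vd; rewrite (red_det_clear0 (first_derivatives f)) [first_derivatives f 0 ord0]mxE.
- exists (mix s f1 f2), (mix s g1 g2); split; [|exact: qs|exact: rs| |].
  + rewrite /f1 /f2; split; rewrite ?fe//; first by apply: smooth_mix; exact: smooth_witness.
    by move=> l; rewrite /mix !witness_trivial subrr mulr0 addr0.
  + have f0E x : pderiv (f0_word k) x 0 = first_derivatives x 0 ord0 by rewrite mxE.
    by rewrite /f1 /f2 /g1 /g2 !f0E !fe e'0 (red_trace_clear0 e); ring.
  + move=> w sw w0; rewrite /f1 /f2 /g1 /g2 !pderiv_mix; do ?exact: smooth_witness.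
    by rewrite /mix !(@witness_free _ _ e' e _ _ _ w).
move=> f Vf v0 _ D; have [sf f0] := problem_smooth Vf; have df := Vd f Vf.
have [u0 t0] : ups (first_derivatives f) != 0 /\ red_trace N (first_derivatives f) != 0.
  by move: v0; rewrite !mulf_eq0 !negb_or => /andP[/andP[]].
rewrite mem1; split=> [bD|/eqP->].
  case: (synchrony_cases (branch_synchrony bD)) => [Ed|->//|[i [j [ij sij Ep]]]].
    by have := bD; rewrite Ed => /(diagonal_excluded sf f0 u0).
  have [z iz jz] := third_cell ij; have := bD; rewrite Ep.
  by move/(pair_excluded sf f0 ij iz jz sij u0); rewrite (Vp i j z f)// => /(_ t0).
have [e1 [dlt [br hb]]] := three_cell_branch sf f0 df v0.
apply: (half_branch_synchrony hb (synchrony_full R N)).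
have excl E : synchrony N E -> E != full_space R -> near_zeros f N (fun x => x \in E -> x = 0).
  move=> sE nE; case: (synchrony_cases sE) => [->|Ef|[i [j [ij sij ->]]]].
  - exact: ups_diagonal_zero.
  - by rewrite Ef eqxx in nE.
  - have [z iz jz] := third_cell ij.
    by apply: (pair_space_zero sf f0 ij iz jz sij u0); rewrite (Vp i j z f).
(* The radius depends on [E], so the finitely many candidate spaces are treated one at a time and
   the radii are intersected afterwards. *)
have all E : near_zeros f N (fun x => x != 0 -> synchrony N E -> x \in E -> (full_space R <= E)%VS).
  have [->|nE] := eqVneq E (full_space R); first by exists 1 => // *; exact: subvv.
  have [sE|nsE] := pselect (synchrony N E); last by exists 1 => // x l _ _ _ _ /nsE.
  have [rr rr0 H] := excl E sE nE; exists rr => // x l hx hl Fx x0 _ xE.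
  by case/eqP: x0; exact: (H x l).
have := near_zeros_and (all (diagonal_space R)) (near_zeros_and (all (pair_space R 0 1))
  (near_zeros_and (all (pair_space R 0 2)) (all (pair_space R 1 2)))).
apply: near_zeros_imp => x [h1 [h2 [h3 h4]]] x0; split=> //; first exact: mem_full.
move=> E sE xE; case: (synchrony_cases sE) => [Ed|->|[i [j [ij sij Ep]]]].
- by rewrite Ed; apply: h1 => //; rewrite -Ed.
- exact: subvv.
- move: Ep; apply: (@pair_cases R (fun D => E = D -> (full_space R <= E)%VS) 0 1 2 isT isT isT) => // Ep;
  by rewrite Ep; first [apply: h2|apply: h3|apply: h4] => //; rewrite -Ep.
Qed.

End GenericSynchronies.

(** * Feedforward, chain and homogeneous networks *)

Section SpecialNetworks.
Variables (R : realType) (k : nat) (N : network k 3).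
Implicit Types D E : {vspace 'cV[R]_3}.
Local Notation "'first' f" := (first_derivatives f) (at level 10).

Definition one_pair_lattice (a b : 'I_3) : Prop := forall E, synchrony N E ->
  [\/ E = diagonal_space R, E = pair_space R a b | E = full_space R].

Lemma asynchronous_full a b (f : response R k) s dlt (br : R -> 'cV[R]_3) :
  one_pair_lattice a b -> half_branch f N s dlt br (fun x => x a 0 != x b 0) ->
  branch_with_synchrony N f (full_space R).
Proof.
move=> lat hb; apply: (half_branch_synchrony hb (synchrony_full R N)).
exists 1 => // x l _ _ _ xab; split; last 2 first.
- exact: mem_full.
- move=> E /lat[->|->|->]; last by move=> _; exact: subvv.
    by move/mem_diagonal/(_ a b)/eqP; rewrite (negbTE xab).
  by move/mem_pair/eqP; rewrite (negbTE xab).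
by apply: contraNneq xab => ->; rewrite !mxE.
Qed.

Lemma jet1_state (f : response R k) (u : 'I_k.+1 -> R) :
  jet1 f (row_mx (\row_p u p) 0) = lin u (first f).
Proof.
rewrite /jet1 big_split_ord /= big_ord1 row_mxEr mxE mul0r addr0.
by apply: eq_bigr => p _; rewrite row_mxEl !mxE.
Qed.

Lemma jp_const_jet2 (z z' : 'rV[R]_(k.+1 + 1)) : jet_poly (@jet_word k) (fun f : response R k => jet2 f z z').
Proof. by apply: (jp_jet2 (Y := fun=> z) (Z := fun=> z')) => a; exact: jp_const. Qed.

Lemma jp_const_jet1 (z : 'rV[R]_(k.+1 + 1)) : jet_poly (@jet_word k) (fun f : response R k => jet1 f z).
Proof. by apply: (jp_jet1 (Y := fun=> z)) => a; exact: jp_const. Qed.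

Local Notation state u := (row_mx (\row_(p < k.+1) u p) (0 : 'rV[R]_1) : 'rV[R]_(k.+1 + 1)).

Lemma state_l (u : 'I_k.+1 -> R) p : state u 0 (lshift 1 p) = u p.
Proof. by rewrite row_mxEl mxE. Qed.

Lemma state_r (u : 'I_k.+1 -> R) q : state u 0 (rshift k.+1 q) = 0.
Proof. by rewrite row_mxEr mxE. Qed.

Lemma witness_state c h g tau (u v : 'I_k.+1 -> R) :
  jet2 (witness c h g tau) (state u) (state v) = g * (u ord0 * v ord0).
Proof. by rewrite witness_jet2 !state_l !state_r; ring. Qed.

Lemma witness_time c h g tau (u : 'I_k.+1 -> R) :
  jet2 (witness c h g tau) (state u) (erow R k) = u ord0.
Proof. by rewrite witness_jet2 !state_l !state_r !erowE eqxx eq_lrshift /=; ring. Qed.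

Lemma witness_state1 c h g tau (u : 'I_k.+1 -> R) :
  jet1 (witness c h g tau) (state u) = lin u c.
Proof. by rewrite jet1_state witness_first. Qed.

Lemma lin_delta (u : 'I_k.+1 -> R) p : lin u 'e_p = u p.
Proof.
rewrite /lin (bigD1 p)//= mxE !eqxx mulr1 big1 ?addr0// => q qp.
by rewrite mxE (negbTE qp) andbF mulr0.
Qed.

Lemma lin0 (u : 'I_k.+1 -> R) : lin u 0 = 0.
Proof. by rewrite /lin big1// => p _; rewrite mxE mulr0. Qed.

Lemma zrow_eq (x : 'cV[R]_3) l i (u : 'I_k.+1 -> R) :
  (forall p, x (slot N p i) 0 = u p) -> zrow N x l i = state u + l *: erow R k.
Proof.
move=> xu; apply/rowP => j; rewrite [RHS]mxE [X in _ + X]mxE.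
case: (split_ordP j) => p ->; rewrite ?zrow_l ?zrow_r ?state_l ?state_r erowE.
  by rewrite eq_lrshift mulr0 addr0.
by rewrite [p]ord1 eqxx mulr1 add0r.
Qed.

Lemma stateD (u v : 'I_k.+1 -> R) : state u + state v = state (fun p => u p + v p).
Proof.
by rewrite add_row_mx addr0; congr row_mx; apply/rowP => p; rewrite !mxE.
Qed.

Lemma stateZ x (u : 'I_k.+1 -> R) : x *: state u = state (fun p => x * u p).
Proof.
by rewrite scale_row_mx scaler0; congr row_mx; apply/rowP => p; rewrite !mxE.
Qed.

Section Feedforward.
Variables (a b c : 'I_3).
Hypotheses (ab : a != b) (ac : a != c) (bc : b != c).
Hypotheses (na : forall p, slot N p a = a) (nb : forall p, slot N p b = b).

(** Cells a and b receive input from themselves only, so the valency becomes critical for each of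
    them separately. The pair space has no branch of its own because its second eigenvalue is not
    critical. *)
Lemma feedforward_generic : one_pair_lattice a b ->
  (exists e : 'rV[R]_k.+1, ups e != pair_eigenvalue N a c e) ->
  generic_synchronies N (@valency R k) [:: diagonal_space R; full_space R].
Proof.
move=> lat [e0 ne]; rewrite lin_ups; apply: synchronies_from_condition => //.
have sab : sync_pair N a b.
  move=> l; right; left; have := na (lift ord0 l); have := nb (lift ord0 l).
  by rewrite /slot liftK.
set V := bifurcation_problem _.
pose u1 : 'I_k.+1 -> R := fun=> 1.
have l0 : lin (fun=> 1) (0 : 'rV[R]_k.+1) = 0 by exact: lin0.
have c1 : condition V (fun f : response R k => one_cell_value (@diagonal_quotient k) f != 0).
  by apply: (condition_jet _ l0 (one_cell_witness _ 0)); exact: jp_one_cell.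
have c2 : condition V (fun f : response R k => jet2 f (state u1) (state u1) != 0).
  apply: (condition_jet (e := 0) (h := 0) (g := 1) (tau := 0)) => //; first exact: jp_const_jet2.
  by rewrite witness_state !mulr1 oner_neq0.
have c3 : condition V (fun f : response R k => jet2 f (state u1) (erow R k) != 0).
  apply: (condition_jet (e := 0) (h := 0) (g := 1) (tau := 0)) => //; first exact: jp_const_jet2.
  by rewrite witness_time oner_neq0.
have c4 : condition V (fun f : response R k => lin (pair_slot R N a c) (first f) != 0).
  apply: condition_lin => //; first exact: pair_slot0.
  by exists e0; rewrite -pair_lin -ups_lin.
apply: condition_imp (condition_and (lin_convex _) c1 (condition_and (lin_convex _) c2
  (condition_and (lin_convex _) c3 c4))) => f /lin_problemP[sf lf f0] [v0 [q0 [t0 m0]]] D.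
have uf : ups (first f) = 0 by rewrite ups_lin.
rewrite !inE; split=> [bD|/orP[]/eqP->].
- case: (lat _ (branch_synchrony bD)) => [->|Ep|->]; rewrite ?eqxx ?orbT//.
  have := bD; rewrite Ep => /(pair_into_diagonal sf f0 ab ac bc sab).
  by rewrite pair_lin => /(_ m0).
- exact: diagonal_branch.
pose ind (i : 'I_3) p : R := (slot N p c == i)%:R.
have [|||||||dlt [br hb]] := @feedforward_branch R k f sf f0 N a b c ab ac bc (cells_cover ab ac bc)
    (state u1) (state (ind c)) (state (ind a)) (state (ind b)).
- move=> x l; rewrite (@zrow_eq x l a (fun p => x a 0 * u1 p)) ?stateZ// => p.
  by rewrite na mulr1.
- move=> x l; rewrite (@zrow_eq x l b (fun p => x b 0 * u1 p)) ?stateZ// => p.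
  by rewrite nb mulr1.
- move=> x l; rewrite !stateZ !stateD; apply: zrow_eq => p; rewrite /ind.
  have ba : (b == a) = false by rewrite eq_sym (negbTE ab).
  have ca : (c == a) = false by rewrite eq_sym (negbTE ac).
  have cb : (c == b) = false by rewrite eq_sym (negbTE bc).
  by case: (cells_cover ab ac bc (slot N p c)) => ->; rewrite eqxx ?(negbTE ab) ?(negbTE ac) ?(negbTE bc) ?ba ?ca ?cb /=; ring.
- by rewrite jet1_state.
- exact: q0.
- exact: t0.
- rewrite jet1_state; suff -> : lin (ind c) (first f) = lin (pair_slot R N a c) (first f) by [].
  by apply: eq_bigr => p _; rewrite /pair_slot na (negbTE ac) subr0.
exact: (asynchronous_full lat hb).
Qed.

End Feedforward.

Section Chain.
Variables (a b c : 'I_3).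
Hypotheses (ab : a != b) (ac : a != c) (bc : b != c).
Hypothesis slots : forall p,
  [\/ forall i, slot N p i = i, forall i j, slot N p i = slot N p j,
      [/\ slot N p a = a, slot N p b = a & slot N p c = b]
    | [/\ slot N p a = b, slot N p b = b & slot N p c = a]].
Hypothesis chain : exists p, slot N p a = slot N p b /\ slot N p c != slot N p a.

(** [eta] is the coefficient of the critical eigenvalue; [chi] is 1 or -1 on the two kinds of chain
    maps and 0 on identities and constants; [kb] and [kc] tell whether cell a receives from b or
    from c. *)
Let eta p : R := (slot N p c == c)%:R - (slot N p a == c)%:R.
Let chi p : R := (slot N p c == b)%:R * (slot N p a == a)%:R - (slot N p c == a)%:R * (slot N p a == b)%:R.
Let kb p : R := (slot N p a == b)%:R.
Let kc p : R := (slot N p a == c)%:R.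
Let u1 : 'I_k.+1 -> R := fun=> 1.

Let ba : (b == a) = false. Proof. by rewrite eq_sym (negbTE ab). Qed.
Let ca : (c == a) = false. Proof. by rewrite eq_sym (negbTE ac). Qed.
Let cb : (c == b) = false. Proof. by rewrite eq_sym (negbTE bc). Qed.
Let ab' := negbTE ab. Let ac' := negbTE ac. Let bc' := negbTE bc.
Let cov := cells_cover ab ac bc.

Let eta0 : eta ord0 = 1.
Proof. by rewrite /eta /slot unlift_none eqxx ac' subr0. Qed.

Let za (x : 'cV[R]_3) l : zrow N x l a = x a 0 *: state u1 + (x b 0 - x a 0) *: state kb
  + (x c 0 - x a 0) *: state kc + l *: erow R k.
Proof.
rewrite !stateZ !stateD; apply: zrow_eq => p; rewrite /u1 /kb /kc.
by case: (cov (slot N p a)) => ->; rewrite ?eqxx ?ab' ?ac' ?bc' ?ba ?ca ?cb /=; ring.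
Qed.

Let zdiff (x : 'cV[R]_3) l i (v : 'I_k.+1 -> R) :
  (forall p, x (slot N p i) 0 = x (slot N p a) 0 + v p) -> zrow N x l i = zrow N x l a + state v.
Proof.
move=> h; rewrite (@zrow_eq x l a (fun p => x (slot N p a) 0))// addrAC stateD.
exact: zrow_eq.
Qed.

Let zb (x : 'cV[R]_3) l : zrow N x l b = zrow N x l a + (x b 0 - x a 0) *: state eta.
Proof.
rewrite stateZ; apply: zdiff => p; rewrite /eta.
case: (slots p) => [h|h|[h1 h2 h3]|[h1 h2 h3]].
- by rewrite !h eqxx ac' /=; ring.
- by rewrite (h b a) (h c a) subrr mulr0 addr0.
- by rewrite h1 h2 h3 bc' ac' /=; ring.
- by rewrite h1 h2 h3 bc' ac' /=; ring.
Qed.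

Let zc (x : 'cV[R]_3) l : zrow N x l c =
  zrow N x l a + (x c 0 - x a 0) *: state eta + (x b 0 - x a 0) *: state chi.
Proof.
rewrite !stateZ -addrA stateD; apply: zdiff => p; rewrite /eta /chi.
case: (slots p) => [h|h|[h1 h2 h3]|[h1 h2 h3]].
- by rewrite !h eqxx ac' ca cb ab' /=; ring.
- rewrite (h c a); case: (cov (slot N p a)) => ->; rewrite ?eqxx ?ab' ?ac' ?bc' ?ba ?ca ?cb /=; ring.
- by rewrite h1 h3 ?eqxx ?ab' ?ac' ?bc' ?ba /=; ring.
- by rewrite h1 h3 ?eqxx ?ab' ?ac' ?bc' ?ba /=; ring.
Qed.

Lemma chain_generic C : sync_pair N a b -> one_pair_lattice a b ->
  (exists e : 'rV[R]_k.+1, ups e != pair_eigenvalue N a c e) ->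
  generic_synchronies_if N C (@pair_mu R k N a c) [:: pair_space R a b; full_space R].
Proof.
move=> sab lat ne; rewrite pair_muE; apply: synchronies_from_condition; first exact: pair_slot0.
set V := bifurcation_problem _.
have c1 := pair_branch_condition ab ac bc sab ne; rewrite -/V in c1.
have lE : pair_slot R N a c = eta by [].
have [p0 [pab pca]] := chain.
have [nid ncst] : ~ (forall i, slot N p0 i = i) /\ ~ (forall i j, slot N p0 i = slot N p0 j).
  split=> h; first by have := ab; rewrite -[a](h a) -[b](h b) pab eqxx.
  by rewrite (h c a) eqxx in pca.
have chp0 : chi p0 = 1 /\ kb p0 = 0 \/ chi p0 = -1 /\ kb p0 = 1.
  case: (slots p0) => [/nid//|/ncst//|[h1 h2 h3]|[h1 h2 h3]]; [left|right].
    by rewrite /chi /kb h1 h3 !eqxx ?ab' ?ba /=; split=> //; ring.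
  by rewrite /chi /kb h1 h3 !eqxx ?ab' ?ba /=; split=> //; ring.
have ep0 : eta p0 = 0.
  case: (slots p0) => [/nid//|/ncst//|[h1 h2 h3]|[h1 h2 h3]];
  by rewrite /eta h1 h3 ?ac' ?bc' subrr.
have le0 : lin (pair_slot R N a c) ('e_p0 : 'rV[R]_k.+1) = 0 by rewrite lE lin_delta.
have l0 : lin (pair_slot R N a c) (0 : 'rV[R]_k.+1) = 0 by exact: lin0.
have c2 : condition V (fun f : response R k => jet1 f (state chi) != 0).
  apply: (condition_jet (e := 'e_p0) (h := 0) (g := 1) (tau := 0)) => //; first exact: jp_const_jet1.
  by rewrite witness_state1 lin_delta; case: chp0 => -[-> _]; rewrite ?oppr_eq0 oner_neq0.
have c3 : condition V (fun f : response R k => jet2 f (erow R k) (state eta) != 0).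
  apply: (condition_jet (e := 0) (h := 0) (g := 1) (tau := 0)) => //; first exact: jp_const_jet2.
  by rewrite (jet2C _ _ (@smooth_witness R k _ _ _ _)) witness_time eta0 oner_neq0.
have c4 : condition V (fun f : response R k => jet2 f (state eta) (state eta) != 0).
  apply: (condition_jet (e := 0) (h := 0) (g := 1) (tau := 0)) => //; first exact: jp_const_jet2.
  by rewrite witness_state eta0 !mulr1 oner_neq0.
have kb0 : kb ord0 = 0 by rewrite /kb /slot unlift_none ab'.
have kc0 : kc ord0 = 0 by rewrite /kc /slot unlift_none ac'.
(* The requirements of the branch lemmas stand inside the existential statement, so that dummy
   values serve where they fail and a single new polynomial is needed. *)
have c5 : condition V (fun f : response R k => exists s dlt br,
    ups (first f) != 0 -> jet1 f (state chi) != 0 -> jet2 f (erow R k) (state eta) != 0 ->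
    jet2 f (state eta) (state eta) != 0 ->
    half_branch f N s dlt br (fun x : 'cV[R]_3 => x a 0 != x b 0)).
  have [/existsP[p1 /eqP p1c]|/existsPn noc] := boolP [exists p, slot N p a == c].
    have c6 : condition V (fun f : response R k => jet2 f (state kc) (state eta) * jet1 f (state u1)
        - jet1 f (state kc) * jet2 f (state u1) (state eta) != 0).
      apply: (condition_jet (e := 'e_p1) (h := 0) (g := 1) (tau := 0)).
      - by apply: jp_sub; apply: jp_mul; do ?exact: jp_const_jet2; exact: jp_const_jet1.
      - rewrite lE lin_delta /eta p1c eqxx.
        case: (slots p1) => [h|h|[h1 _ _]|[h1 _ _]].
        + by move: ac; rewrite -p1c h eqxx.
        + by rewrite (h c a) p1c eqxx subrr.
        + by move: ac; rewrite -p1c h1 eqxx.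
        + by move: bc; rewrite -p1c h1 eqxx.
      rewrite !witness_state !witness_state1 !lin_delta kc0 eta0 /kc p1c eqxx /u1.
      by rewrite !mul1r !mul0r sub0r oppr_eq0 oner_neq0.
    apply: condition_imp c6 => f /lin_problemP[sf lf f0] H.
    have [u0|u0] := pselect (ups (first f) != 0); last by exists 0, 0, (fun=> 0) => /u0.
    have [n0|n0] := pselect (jet1 f (state chi) != 0); last by exists 0, 0, (fun=> 0) => _ /n0.
    have [m0|m0] := pselect (jet2 f (erow R k) (state eta) != 0); last by exists 0, 0, (fun=> 0) => _ _ /m0.
    have [q0|q0] := pselect (jet2 f (state eta) (state eta) != 0); last by exists 0, 0, (fun=> 0) => _ _ _ /q0.
    have [||dlt [br hb]] := @chain_branch_open R k f sf f0 N a b c ab ac bc cov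
      (state u1) (state eta) (state chi) (state kb) (state kc) za zb zc _ _ n0 m0 q0 H.
    - by rewrite jet1_state -lE.
    - by rewrite jet1_state -ups_lin.
    by exists 1, dlt, br.
  have kcz : state kc = 0.
    rewrite (_ : \row_(p < k.+1) kc p = 0) ?row_mx0//; apply/rowP => p.
    by rewrite !mxE /kc (negbTE (noc p)).
  have c6 : condition V (fun f : response R k => (jet2 f (state kb) (state eta) + 2^-1 * jet2 f (state eta) (state eta))
      * jet1 f (state u1) - jet1 f (state kb) * jet2 f (state u1) (state eta) != 0).
    apply: (condition_jet (e := 'e_p0) (h := 0) (g := 1) (tau := 0)) => //.
      apply: jp_sub; apply: jp_mul; do ?exact: jp_const_jet2; do ?exact: jp_const_jet1.
      by apply: jp_add; [|apply: jp_mul; first exact: jp_const]; exact: jp_const_jet2.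
    rewrite !witness_state !witness_state1 !lin_delta kb0 eta0 /u1.
    (* At this witness the expression is 1/2 - [kb p0], hence 1/2 or -1/2. *)
    by case: chp0 => -[_ ->]; apply/eqP; lra.
  apply: condition_imp c6 => f /lin_problemP[sf lf f0] H.
  have [u0|u0] := pselect (ups (first f) != 0); last by exists 0, 0, (fun=> 0) => /u0.
  have [n0|n0] := pselect (jet1 f (state chi) != 0); last by exists 0, 0, (fun=> 0) => _ /n0.
  have [m0|m0] := pselect (jet2 f (erow R k) (state eta) != 0); last by exists 0, 0, (fun=> 0) => _ _ /m0.
  have [q0|q0] := pselect (jet2 f (state eta) (state eta) != 0); last by exists 0, 0, (fun=> 0) => _ _ _ /q0.
  have [||s [dlt [br hb]]] := @chain_branch_closed R k f sf f0 N a b c ab ac bc cov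
    (state u1) (state eta) (state chi) (state kb) (state kc) za zb zc _ _ n0 m0 q0 kcz H.
  - by rewrite jet1_state -lE.
  - by rewrite jet1_state -ups_lin.
  by exists s, dlt, br.
have cvx := lin_convex (pair_slot R N a c).
apply: condition_imp (condition_and cvx c1 (condition_and cvx c2
  (condition_and cvx c3 (condition_and cvx c4 c5)))).
move=> f /lin_problemP[sf lf f0] [[u0 bp] [n0 [m0 [q0 [s [dlt [br hb]]]]]]] D.
rewrite !inE; split=> [bD|/orP[]/eqP->//].
  case: (lat _ (branch_synchrony bD)) => [Ed|->|->]; rewrite ?eqxx ?orbT//.
  by have := bD; rewrite Ed => /(diagonal_excluded sf f0 u0).
exact: (asynchronous_full lat (hb u0 n0 m0 q0)).
Qed.

End Chain.

Lemma differentiable_neq0 d (G : 'rV[R]_d -> R) : differentiable G 0 -> G 0 != 0 ->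
  exists2 r : R, 0 < r & forall z, `|z| <= r -> G z != 0.
Proof.
move=> /differentiable_continuous cG G0; move/(@cvgrPdist_lt _ _ _ (nbhs (0 : 'rV[R]_d))): cG.
have n0 : 0 < `|G 0| by rewrite normr_gt0.
move=> /(_ _ n0) /nbhs_ballP[q /= q1 hq]; exists (q / 2); first by rewrite divr_gt0.
move=> z hz; apply: contraTneq (hq z _) => [->|]; first by rewrite subr0 ltxx.
rewrite -ball_normE /= sub0r normrN; apply: le_lt_trans hz _; lra.
Qed.

Lemma derive_neq0 (h : R -> R) (m : R) : is_derive (0 : R) (1 : R) h m -> h 0 = 0 -> m != 0 ->
  exists2 r : R, 0 < r & forall l, 0 < `|l| <= r -> h l != 0.
Proof.
move=> dh h0 m0; have dv : 'D_1 h 0 = m by exact: (@derive_val _ _ _ _ _ _ _ dh).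
have : derivable h 0 1 by exact: (@ex_derive _ _ _ _ _ _ _ dh).
move=> /cvg_ex[/= m' cm]; have mm : m' = m by rewrite -dv; apply/esym; exact: cvg_lim cm.
have n0 : 0 < `|m| by rewrite normr_gt0.
move: cm; rewrite mm => /cvgrPdist_lt/(_ _ n0)/nbhs_ballP[q /= q0 hq].
exists (q / 2); first by rewrite divr_gt0.
move=> l /andP[l0 lq]; apply/eqP => hl.
have := hq l; rewrite /ball /= sub0r normrN => /(_ _ _).
have lq' : `|l| < q by apply: le_lt_trans lq _; lra.
have l0' : l != 0 by rewrite -normr_gt0.
by move=> /(_ lq' l0'); rewrite addr0 [l *: 1]mulr1 hl h0 subrr scaler0 subr0 ltxx.
Qed.

Section HomogeneousNetwork.
Hypothesis id_or_const : forall p, (forall i, slot N p i = i) \/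
  (forall i j, slot N p i = slot N p j).

Definition fixs (p : 'I_k.+1) : R := [forall i, slot N p i == i]%:R.

Lemma homogeneous_slot p (i j : 'I_3) : i != j ->
  (slot N p j == j)%:R - (slot N p i == j)%:R = fixs p.
Proof.
move=> ij; rewrite /fixs; case: (id_or_const p) => h.
  by have -> : [forall i, slot N p i == i]; [apply/forallP => q; rewrite h|rewrite !h eqxx (negbTE ij) subr0].
rewrite (h i j) subrr; case: forallP => // hp.
have := ij; rewrite -(eqP (hp i)) -(eqP (hp j)) (h i j) eqxx //.
Qed.

Lemma homogeneous_pair_slot i j : i != j -> pair_slot R N i j = fixs.
Proof. by move=> ij; apply/funext => p; exact: homogeneous_slot. Qed.

Lemma fixs0 : fixs ord0 = 1.
Proof.
by rewrite /fixs; have -> : [forall i, slot N ord0 i == i] by apply/forallP => i; rewrite /slot unlift_none.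
Qed.

Lemma homogeneous_sync i j : sync_pair N i j.
Proof.
move=> l; case: (id_or_const (lift ord0 l)) => h.
  by right; left; have := h i; have := h j; rewrite /slot liftK.
by left; have := h i j; rewrite /slot liftK.
Qed.

(** Constant inputs vanish modulo the diagonal and identities act as scalars, so the double
    eigenvalue is [lin fixs e]. *)
Lemma homogeneous_det (e : 'rV[R]_k.+1) : \det (jacobian N e) = ups e * lin fixs e ^+ 2.
Proof.
have diff i j q : jacobian N e i q - jacobian N e j q = \sum_p e 0 p * ((slot N p i == q)%:R - (slot N p j == q)%:R).
  by rewrite !jacobianE -sumrB; apply: eq_bigr => p _; rewrite mulrBr.
have same q : q != 0 -> jacobian N e q q - jacobian N e 0 q = lin fixs e.
  move=> q0; rewrite diff; apply: eq_bigr => p _; rewrite homogeneous_slot 1?eq_sym// mulrC//.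
have zero : jacobian N e 1 2 - jacobian N e 0 2 = 0.
  rewrite diff big1// => p _; case: (id_or_const p) => h; last by rewrite (h 1 0) subrr mulr0.
  by rewrite !h /= subrr mulr0.
rewrite (det_const_rows (jacobian_rows N e)) -/(ups e) /reduced_det zero !same//.
by rewrite mul0r subr0 expr2.
Qed.

(** Each pair quotient contributes a branch. For the converse, the double eigenvalue passes through
    0 with nonzero speed along the trivial solutions, so the Jacobian is regular at small nonzero
    parameters, as [homogeneous_branch] demands. *)
Lemma homogeneous_generic C Ds :
  (forall D, D \in Ds <-> exists i j, i != j /\ D = pair_space R i j) ->
  (exists e : 'rV[R]_k.+1, ups e != lin fixs e) ->
  generic_synchronies_if N C (lin_mu fixs) Ds.
Proof.
move=> DsE ne; apply: synchronies_from_condition; first exact: fixs0.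
set V := bifurcation_problem _; have cvx := lin_convex fixs.
have fixE : fixed_slots R N = state fixs by [].
have cp i j z : i != j -> i != z -> j != z -> condition V (fun f =>
    ups (first f) != 0 /\ branch_with_synchrony N f (pair_space R i j)).
  move=> ij iz jz; have := @pair_branch_condition R k N i j z ij iz jz (homogeneous_sync i j).
  rewrite (homogeneous_pair_slot iz); apply.
  by have [e he] := ne; exists e; rewrite pair_lin (homogeneous_pair_slot iz).
have l0 : lin fixs (0 : 'rV[R]_k.+1) = 0 by exact: lin0.
have c1 : condition V (fun f : response R k => jet2 f (state fixs) (state fixs) != 0).
  apply: (condition_jet (e := 0) (h := 0) (g := 1) (tau := 0)) => //; first exact: jp_const_jet2.
  by rewrite witness_state fixs0 !mulr1 oner_neq0.
have c2 : condition V (fun f : response R k => jet2 f (erow R k) (state fixs) != 0).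
  apply: (condition_jet (e := 0) (h := 0) (g := 1) (tau := 0)) => //; first exact: jp_const_jet2.
  by rewrite (jet2C _ _ (@smooth_witness R k _ _ _ _)) witness_time fixs0 oner_neq0.
have c3 := condition_and cvx (cp 0 1 2 isT isT isT)
  (condition_and cvx (cp 0 2 1 isT isT isT) (cp 1 2 0 isT isT isT)).
apply: condition_imp (condition_and cvx c3 (condition_and cvx c1 c2)).
move=> f /lin_problemP[sf lf f0] [[[u0 b01] [[_ b02] [_ b12]]] [q0 m0]] D.
rewrite DsE; split=> [bD|[i [j [ij ->]]]]; last first.
  exact: (@pair_cases R (fun D => branch_with_synchrony N f D) 0 1 2 isT isT isT).
have detJ : exists2 r : R, 0 < r & forall l, 0 < `|l| <= r ->
    \det (jacobian N (derivatives_at f l)) != 0.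
  pose G (w : 'I_k.+1 -> R) (z : 'rV[R]_(k.+1 + 1)) := \sum_p w p * pderiv [:: lshift 1 p] f z.
  have GE w l : G w (l *: erow R k) = lin w (derivatives_at f l).
    by apply: eq_bigr => p _; rewrite mxE.
  have dG w z : differentiable (G w) z.
    apply: differentiable_fsum => p; apply: differentiable_fmul; first exact: differentiable_cst.
    exact: smooth_differentiable.
  have [|r1 r10 H1] := differentiable_neq0 (dG (fun=> 1) 0).
    by rewrite -(scale0r (erow R k)) GE derivatives_at0 -ups_lin.
  (* The speed of the critical eigenvalue in the parameter is a mixed second derivative of f. *)
  have dh : is_derive (0 : R) (1 : R) (fun t => G fixs (0 + t *: erow R k)) (jet2 f (erow R k) (state fixs)).
    have := is_derive_line (z := 0) (v := erow R k) (t := 0) (dG fixs (0 + 0 *: erow R k)).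
    suff -> : 'D_(erow R k) (G fixs) (0 + 0 *: erow R k) = jet2 f (erow R k) (state fixs) by [].
    have dsum : is_derive (0 : 'rV[R]_(k.+1 + 1)) (erow R k) (G fixs)
        (\sum_p fixs p * \sum_a erow R k 0 a * pderiv [:: a; lshift 1 p] f 0).
      apply: is_derive_fsum => p.
      have dq : is_derive (0 : 'rV[R]_(k.+1 + 1)) (erow R k) (pderiv [:: lshift 1 p] f)
          (\sum_a erow R k 0 a * pderiv [:: a; lshift 1 p] f 0).
        apply: DeriveDef; first by apply: diff_derivable; exact: smooth_differentiable.
        by rewrite derive_coord//; exact: smooth_differentiable.
      have := is_derive_fmul (is_derive_cst (fixs p) (0 : 'rV[R]_(k.+1 + 1)) (erow R k)) dq.
      by rewrite mulr0 addr0.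
    rewrite scale0r addr0 (@derive_val _ _ _ _ _ _ _ dsum) /jet2 exchange_big big_split_ord /=.
    rewrite big_ord1 [X in _ = _ + X]big1 ?addr0 => [|a _]; last by rewrite state_r mulr0 mul0r.
    apply: eq_bigr => p _; rewrite mulr_sumr; apply: eq_bigr => a _.
    by rewrite state_l mulrA [fixs p * _]mulrC.
  have [||r2 r20 H2] := derive_neq0 dh.
  - by rewrite add0r GE derivatives_at0.
  - exact: m0.
  have E0 : 0 < `|erow R k| + 1 by rewrite ltr_wpDl.
  exists (Order.min (r1 / (`|erow R k| + 1)) r2); first by rewrite lt_min r20 divr_gt0.
  move=> l /andP[l1]; rewrite le_min => /andP[l2 l3].
  rewrite homogeneous_det mulf_neq0//.
    rewrite ups_lin -GE; apply: H1; rewrite normrZ; move: l2; rewrite ler_pdivlMr//.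
    by apply: le_trans; apply: ler_wpM2l => //; rewrite lerDl.
  by rewrite expf_neq0// -GE -[_ *: _]add0r; apply: H2; rewrite l1 l3.
have diag : near_zeros f N (fun x => x 0 0 = x 1 0 -> x 0 0 = x 2 0 -> x = 0).
  have dz : near_zeros f N (fun x => x \in diagonal_space R -> x = 0) by exact: ups_diagonal_zero.
  apply: (near_zeros_imp _ dz) => x H x1 x2; apply: H.
  apply/mem_diagonal => i j; have := @cells_cover 0 1 2 isT isT isT => cov.
  have ex u : x u 0 = x 0 0 by case: (cov u) => ->.
  by rewrite !ex.
have [i [j [ij H]]] := homogeneous_branch sf f0 id_or_const q0 detJ diag bD.
have [z iz jz] := third_cell ij; have sij := homogeneous_sync i j.
have sub := H (pair_space R i j) ((synchrony_pair R N ij).2 sij) (mem_pair i j).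
case: (synchrony_cases (branch_synchrony bD)) => [Ed|Ef|[i' [j' [ij' _ Ep]]]].
- by have := bD; rewrite Ed => /(diagonal_excluded sf f0 u0).
- case/eqP: (pair_neq_full R ij); apply: space_eq => x; split=> [_|_]; first exact: mem_full.
  by apply: (subvP sub); rewrite Ef mem_full.
- by exists i', j'.
Qed.

End HomogeneousNetwork.

End SpecialNetworks.

(** * Dynamics with a synchronous pair *)

Section Consequences.
Variables (R : realType) (k : nat) (N : network k 3).
Implicit Types (D E : {vspace 'cV[R]_3}) (e : 'rV[R]_k.+1).

Lemma sync_slot p a b : sync_pair N a b ->
  [\/ slot N p a = slot N p b, slot N p a = a /\ slot N p b = b | slot N p a = b /\ slot N p b = a].
Proof.
move=> sab; rewrite /slot; case: unliftP => [l _|_]; last by constructor 2.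
by case: (sab l) => [h|[h|h]]; [constructor 1|constructor 2|constructor 3].
Qed.

Section OnePair.
Variables (a b c : 'I_3).
Hypotheses (ab : a != b) (ac : a != c) (bc : b != c) (sab : sync_pair N a b).

Let ba : (b == a) = false. Proof. by rewrite eq_sym (negbTE ab). Qed.

(** The rows of a and b agree in column c, so the reduced matrix is triangular. *)
Lemma sync_reduced e : red_trace N e = pair_eigenvalue N a c e + transverse_eigenvalue N a b e /\
  red_det N e = pair_eigenvalue N a c e * transverse_eigenvalue N a b e.
Proof.
have [dE tE] := reduced_indep (jacobian_rows N e) ab ac bc.
have Jbc : jacobian N e b c = jacobian N e a c.
  rewrite !jacobianE; apply: eq_bigr => p _; congr (_ * _%:R).
  by case: (sync_slot p sab) => [->|[-> ->]|[-> ->]]; rewrite ?(negbTE ac) ?(negbTE bc).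
have Jbb : jacobian N e b b - jacobian N e a b = transverse_eigenvalue N a b e.
  rewrite !jacobianE -sumrB; apply: eq_bigr => p _; rewrite /transverse -mulrBr mulrC.
  by case: (sync_slot p sab) => [->|[-> ->]|[-> ->]]; rewrite ?eqxx ?(negbTE ab) ?ba ?subrr ?subr0.
rewrite /red_trace /red_det -dE -tE /reduced_trace /reduced_det Jbc subrr mul0r subr0 Jbb.
by rewrite -/(pair_eigenvalue N a c e); split; ring.
Qed.

(** At the basis vector of a slot the valency is 1, whereas the transverse coefficient is 0, 1 or -1
    according to whether the pair is collapsed, fixed or swapped. *)
Lemma transverse_one : (forall e, transverse_eigenvalue N a b e = ups e) ->
  forall p, slot N p a = a /\ slot N p b = b.
Proof.
move=> h p; have := h 'e_p; rewrite ups_lin /transverse_eigenvalue !lin_delta /transverse.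
case: (sync_slot p sab) => [->|//|[-> ->]]; first by rewrite subrr => /eqP; rewrite eq_sym oner_eq0.
by rewrite eqxx ba sub0r => /eqP; rewrite eq_sym -subr_eq0 opprK -mulr2n pnatr_eq0.
Qed.

(** At each basis vector both sides are integers between -1 and 1; running through the images of the
    three cells leaves four shapes. *)
Lemma transverse_chain : (forall e, transverse_eigenvalue N a b e = pair_eigenvalue N a c e) ->
  forall p, [\/ forall i, slot N p i = i, forall i j, slot N p i = slot N p j,
      [/\ slot N p a = a, slot N p b = a & slot N p c = b]
    | [/\ slot N p a = b, slot N p b = b & slot N p c = a]].
Proof.
move=> h p; have := h 'e_p; rewrite pair_lin /transverse_eigenvalue !lin_delta /transverse /pair_slot.
have cov := cells_cover ab ac bc.
have id_case : slot N p a = a -> slot N p b = b -> slot N p c = c -> forall i, slot N p i = i.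
  by move=> h1 h2 h3 i; case: (cov i) => ->.
have const_case : slot N p a = slot N p b -> slot N p c = slot N p b -> forall i j, slot N p i = slot N p j.
  by move=> h1 h2 i j; case: (cov i) => ->; case: (cov j) => ->; congruence.
case: (sync_slot p sab) => [e1|[e1 e2]|[e1 e2]].
- rewrite e1 subrr => /esym/eqP; rewrite subr_eq0 eqr_nat => /eqP hc.
  case: (cov (slot N p b)) => e2; case: (cov (slot N p c)) => e3;
    move: hc; rewrite e2 e3 ?eqxx ?(negbTE ac) ?(negbTE bc) // => _.
  + by constructor 2; apply: const_case; congruence.
  + by constructor 3; split; congruence.
  + by constructor 4; split; congruence.
  + by constructor 2; apply: const_case; congruence.
  + by constructor 2; apply: const_case; congruence.
- rewrite e1 e2 eqxx ba (negbTE ac) !subr0; case: (cov (slot N p c)) => e3; rewrite e3 ?eqxx;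
  rewrite ?(negbTE ac) ?(negbTE bc) => /eqP; rewrite ?oner_eq0// => _.
  by constructor 1; exact: id_case.
- rewrite e1 e2 eqxx ba (negbTE bc) sub0r subr0; case: (slot N p c == c) => /eqP.
    by rewrite eq_sym -subr_eq0 opprK -mulr2n pnatr_eq0.
  by rewrite oppr_eq0 oner_eq0.
Qed.

End OnePair.

(** No two cells can be swapped, because the third cell would be incompatible with one of them. Then
    a cell that is moved forces every other cell to the same image. *)
Lemma all_sync_trivial : (forall a b, a != b -> sync_pair N a b) ->
  forall p, (forall i, slot N p i = i) \/ (forall i j, slot N p i = slot N p j).
Proof.
move=> sync p.
have noswap a b : a != b -> slot N p a = b -> slot N p b = a -> False.
  move=> ab e1 e2; have [z az bz] := third_cell ab.
  case: (sync_slot p (sync a z az)) => [h|[h _]|[h _]].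
  - have := sync_slot p (sync b z bz); rewrite -h e1 e2 => -[/esym/eqP|[/eqP]|[/eqP]].
    + by rewrite eq_sym (negbTE ab).
    + by rewrite (negbTE ab).
    + by rewrite (negbTE az).
  - by move: ab; rewrite -e1 h eqxx.
  - by move: bz; rewrite -e1 h eqxx.
have dich a b : a != b -> slot N p a = slot N p b \/ (slot N p a = a /\ slot N p b = b).
  by move=> ab; case: (sync_slot p (sync a b ab)) => [|h|[h1 h2]]; [left|right|case: (noswap a b)].
have [/forallP h|/forallPn[i hi]] := boolP [forall i, slot N p i == i]; first by left => i; apply/eqP.
right; suff h j : slot N p j = slot N p i by move=> j j'; rewrite !h.
have [->//|ji] := eqVneq j i; case: (dich j i ji) => // -[_ e]; by rewrite e eqxx in hi.
Qed.

Lemma nontrivial_slot a b : a != b -> ~ sync_pair N a b ->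
  exists p, ~ (forall i, slot N p i = i) /\ ~ (forall i j, slot N p i = slot N p j).
Proof.
move=> ab nsab; apply: contrapT => none; apply: nsab => l.
have [h|h] : (forall i, slot N (lift ord0 l) i = i) \/ (forall i j, slot N (lift ord0 l) i = slot N (lift ord0 l) j).
  apply: contrapT => /not_orP[h1 h2]; apply: none; exists (lift ord0 l); split=> //.
- by right; left; have := h a; have := h b; rewrite /slot liftK.
- by left; have := h a b; rewrite /slot liftK.
Qed.

(** The expression is the reduced characteristic polynomial at the valency. It is invariant under
    shifts of e_0, and once the valency is moved to 0 it is the reduced determinant. *)
Lemma valency_from_chi : (exists e, ups e ^+ 2 - ups e * red_trace N e + red_det N e != 0) ->
  generic_synchronies N (@valency R k) [:: diagonal_space R].
Proof.
move=> [e ne]; apply: valency_generic; exists (e + - ups e *: 'e_ord0).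
  by rewrite ups_lin lin_shift// -ups_lin subrr.
have ce : clear0 (e + - ups e *: 'e_ord0) = clear0 e.
  apply/rowP => p; rewrite [LHS]mxE [RHS]mxE; case: eqVneq => // /negbTE p0.
  by rewrite !mxE p0 andbF mulr0 addr0.
have e0E : (e + - ups e *: 'e_ord0) 0 ord0 = e 0 ord0 - ups e by rewrite !mxE !eqxx mulr1.
apply: contraNneq ne => h; apply/eqP; rewrite -h (red_det_clear0 _ (e + _)) ce e0E.
by rewrite (red_det_clear0 N e) (red_trace_clear0 N e); ring.
Qed.

Lemma real_inj (x y : R) : (x%:C)%C = (y%:C)%C -> x = y.
Proof. by case. Qed.

Section Lattice.
Variable L : seq ({vspace 'cV[R]_3} * annotation R k).
Hypothesis lat : annotated_synchrony_lattice N L.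

Lemma lattice_pair D mu : List.In (D, [:: plain (@valency R k); plain mu]) L ->
  D != diagonal_space R -> D != full_space R -> synchrony N D ->
  exists a b c, [/\ a != b, a != c, b != c, sync_pair N a b &
    D = pair_space R a b /\ mu = @pair_mu R k N a c].
Proof.
move=> DL nd nf /synchrony_cases[Ed|Ef|[a [b [ab sab Ep]]]].
- by rewrite Ed eqxx in nd.
- by rewrite Ef eqxx in nf.
have [c ac bc] := third_cell ab.
exists a, b, c; split=> //; split=> //; apply/funext => e.
have [_ _ /(_ _ DL)[m [M [qM aM]]]] := lat.
by rewrite Ep in qM; exact: (annotated_pair ab ac bc qM aM).
Qed.

Lemma lattice_full (s : annotation R k) mu1 mu2 : List.In (full_space R, s) L ->
  (forall x, List.In x s -> continuous_eigenfunction x.1) ->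
  (exists b1, List.In (mu1, b1) s) -> (exists b2, List.In (mu2, b2) s) ->
  (forall e, \prod_(x <- s) ('X - (x.1 e)%:P) ^+ (if x.2 then 2 else 1) =
     \prod_(z <- [:: valency e; mu1 e; mu2 e]) ('X - z%:P)) ->
  (forall e, mu1 e + mu2 e = (red_trace N e)%:C%C) /\
  (forall e, mu1 e * mu2 e = (red_det N e)%:C%C).
Proof.
move=> sL cs [b1 i1] [b2 i2] sE.
have [_ _ /(_ _ sL)[m [M [qM aM]]]] := lat.
have [h1 h2] := annotated_full qM aM (cs _ i1) (cs _ i2) sE.
by split=> //; apply: h2; exact: ups_neq0.
Qed.

Lemma lattice_continuous D s : List.In (D, s) L ->
  forall x, List.In x s -> continuous_eigenfunction x.1.
Proof. by move=> sL; have [_ _ /(_ _ sL)[m [M [_ []]]]] := lat. Qed.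

End Lattice.

Lemma one_pair_facts (D1 : {vspace 'cV[R]_3}) s0 s1 s2 :
  annotated_synchrony_lattice N [:: (diagonal_space R, s0); (D1, s1); (full_space R, s2)] ->
  [/\ D1 != diagonal_space R, D1 != full_space R, synchrony N D1 &
    forall E, synchrony N E -> [\/ E = diagonal_space R, E = D1 | E = full_space R]].
Proof.
move=> lat; have [u sync _] := lat.
have [h1 h2] : D1 != diagonal_space R /\ D1 != full_space R.
  by move: u; rewrite /= !inE negb_or => /and3P[/andP[]]; rewrite eq_sym => -> _ ->.
split=> //; first by apply/sync; rewrite !inE eqxx orbT.
move=> E /sync; rewrite !inE => /or3P[]/eqP->; by [constructor 1|constructor 2|constructor 3].
Qed.

Lemma one_pair_unsync a b c (D1 := pair_space R a b) : a != b -> a != c -> b != c ->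
  (forall E, synchrony N E -> [\/ E = diagonal_space R, E = D1 | E = full_space R]) ->
  ~ sync_pair N a c.
Proof.
move=> ab ac bc lat sac.
case: (lat _ ((synchrony_pair R N ac).2 sac)) => h.
- by have := pair_neq_diagonal R ac; rewrite h eqxx.
- case: (pair_space_inj ac ab h) => [[_ cb]|[ab' _]]; first by rewrite cb eqxx in bc.
  by rewrite ab' eqxx in ab.
- by have := pair_neq_full R ac; rewrite h eqxx.
Qed.

Lemma different2 (mu : eigenfunction R k) (phi : 'rV[R]_k.+1 -> R) :
  different [:: @valency R k; mu] -> (forall e, mu e = (phi e)%:C%C) ->
  exists e, ups e != phi e.
Proof.
move=> d mE; have [e] := @different_neq R k _ 0 1 d isT.
by rewrite /= mE => h; exists e; apply: contraNneq h => <-.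
Qed.

Lemma type_a_dynamics D1 mu : @type_a R k N D1 mu ->
  generic_synchronies N (@valency R k) [:: diagonal_space R; full_space R] /\
  generic_synchronies N mu [:: D1].
Proof.
move=> [dif lat]; have [nd nf sD one] := one_pair_facts lat.
have [a [b [c [ab ac bc sab [ED Emu]]]]] := lattice_pair lat (or_intror (or_introl erefl)) nd nf sD.
have muE e : mu e = (pair_eigenvalue N a c e)%:C%C by rewrite Emu.
have ne := different2 dif muE.
have [] := lattice_full (mu1 := @valency R k) (mu2 := mu) lat (or_intror (or_intror (or_introl erefl))).
- by apply: (lattice_continuous lat (D := full_space R)); right; right; left.
- by exists false; left.
- by exists false; right; right; left.
- by move=> e; rewrite !big_cons !big_nil !expr1.
move=> trE _.
(* The full trace contains the valency twice and the eigenvalue of the pair quotient once. *)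
have tv e : transverse_eigenvalue N a b e = ups e.
  have := trE e; rewrite muE -[valency e]/((ups e)%:C%C) -rmorphD => /real_inj.
  by rewrite (sync_reduced ab ac bc sab e).1; lra.
have sl := transverse_one ab sab tv.
split.
  apply: (feedforward_generic ab ac bc (fun p => (sl p).1) (fun p => (sl p).2)) => //.
  by move=> E /one; rewrite -ED.
rewrite ED Emu; apply: pair_generic => //; have [e he] := ne; exists e; by rewrite tv.
Qed.

Lemma type_c_dynamics D1 mu C : @type_c R k N D1 mu ->
  generic_synchronies N (@valency R k) [:: diagonal_space R] /\
  generic_synchronies_if N C mu [:: D1; full_space R].
Proof.
move=> [dif lat]; have [nd nf sD one] := one_pair_facts lat.
have [a [b [c [ab ac bc sab [ED Emu]]]]] := lattice_pair lat (or_intror (or_introl erefl)) nd nf sD.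
have muE e : mu e = (pair_eigenvalue N a c e)%:C%C by rewrite Emu.
have ne := different2 dif muE.
have [] := lattice_full (mu1 := mu) (mu2 := mu) lat (or_intror (or_intror (or_introl erefl))).
- by apply: (lattice_continuous lat (D := full_space R)); right; right; left.
- by exists true; right; left.
- by exists true; right; left.
- by move=> e; rewrite !big_cons !big_nil !mulr1 expr1 expr2.
move=> trE _.
have tv e : transverse_eigenvalue N a b e = pair_eigenvalue N a c e.
  have := trE e; rewrite muE -rmorphD => /real_inj.
  by rewrite (sync_reduced ab ac bc sab e).1; lra.
split.
  apply: valency_from_chi; have [e he] := ne; exists e.
  have [-> ->] := sync_reduced ab ac bc sab e; rewrite tv.
  have -> : forall x y : R, x ^+ 2 - x * (y + y) + y * y = (x - y) ^+ 2 by move=> x y; ring.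
  by rewrite expf_neq0// subr_eq0.
have sl := transverse_chain ab ac bc sab tv.
rewrite ED in one; have nsync := one_pair_unsync ab ac bc one.
have ch : exists p, slot N p a = slot N p b /\ slot N p c != slot N p a.
  have [p [nid ncst]] := nontrivial_slot ac nsync.
  exists p; case: (sl p) => [/nid//|/ncst//|[-> -> ->]|[-> -> ->]]; split=> //.
  by rewrite eq_sym.
rewrite ED Emu; apply: (chain_generic ab ac bc sl ch) => //.
Qed.

Lemma type_f_dynamics D1 mu1 mu2 : @type_f R k N D1 mu1 mu2 ->
  [/\ generic_synchronies N (@valency R k) [:: diagonal_space R],
      generic_synchronies N mu1 [:: D1] & generic_synchronies N mu2 [:: full_space R]].
Proof.
move=> [dif lat]; have [nd nf sD one] := one_pair_facts lat.
have [a [b [c [ab ac bc sab [ED Emu]]]]] := lattice_pair lat (or_intror (or_introl erefl)) nd nf sD.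
have mu1E e : mu1 e = (pair_eigenvalue N a c e)%:C%C by rewrite Emu.
have [] := lattice_full (mu1 := mu1) (mu2 := mu2) lat (or_intror (or_intror (or_introl erefl))).
- by apply: (lattice_continuous lat (D := full_space R)); right; right; left.
- by exists false; right; left.
- by exists false; right; right; left.
- by move=> e; rewrite !big_cons !big_nil !expr1.
move=> trE _.
have mu2E e : mu2 e = (transverse_eigenvalue N a b e)%:C%C.
  apply: (addrI (mu1 e)); rewrite trE mu1E -rmorphD; congr (_%:C%C).
  by rewrite (sync_reduced ab ac bc sab e).1.
have [e [d1 d2 d3]] : exists e, [/\ ups e != pair_eigenvalue N a c e,
    ups e != transverse_eigenvalue N a b e & pair_eigenvalue N a c e != transverse_eigenvalue N a b e].
  have [e _ ue] := generic_near 0 dif (@ltr01 R); exists e.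
  move: ue; rewrite /= mu1E mu2E !inE negb_or => /and3P[/andP[h1 h2] h3 _].
  by split; [apply: contraNneq h1 => h|apply: contraNneq h2 => h|apply: contraNneq h3 => h];
    rewrite /valency -/(ups e) h.
rewrite ED in one.
have mu2L : mu2 = lin_mu (transverse R N a b) by apply/funext => x; rewrite mu2E.
split.
- apply: valency_from_chi; exists e; have [-> ->] := sync_reduced ab ac bc sab e.
  have -> : forall x y z : R, x ^+ 2 - x * (y + z) + y * z = (x - y) * (x - z) by move=> x y z; ring.
  by rewrite mulf_neq0// subr_eq0.
- by rewrite ED Emu; apply: pair_generic => //; exists e => //; rewrite eq_sym.
have det0 f : bifurcation_problem mu2 f -> transverse_eigenvalue N a b (first_derivatives f) = 0.
  by rewrite mu2L => /lin_problemP[].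
apply: three_cell_generic.
- by move=> f /det0 h; rewrite (sync_reduced ab ac bc sab _).2 h mulr0.
- exists (e + - transverse_eigenvalue N a b e *: 'e_ord0).
  have t0 : transverse_eigenvalue N a b (e + - transverse_eigenvalue N a b e *: 'e_ord0) = 0.
    by rewrite /transverse_eigenvalue lin_shift ?subrr//; exact: transverse0.
  split; first by rewrite mu2E t0.
    by rewrite mu2L (_ : [set c | _] = setT) ?interiorT//; apply/seteqP; split.
  have [-> _] := sync_reduced ab ac bc sab (e + - transverse_eigenvalue N a b e *: 'e_ord0).
  rewrite t0 addr0 ups_lin pair_lin !lin_shift ?(pair_slot0 R N ac)// -ups_lin -pair_lin.
  split; rewrite ?subr_eq0//.
  by rewrite (inj_eq (addIr _)).
- exact: (nontrivial_slot ac (one_pair_unsync ab ac bc one)).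
- move=> a' b' c' f ab' ac' bc' sab' /det0 t0.
  rewrite (sync_reduced ab ac bc sab _).1 t0 addr0.
  have cov := cells_cover ab ac bc.
  (* The eigenvalue of the pair quotient does not depend on which of the two cells represents the
     pair. *)
  have pb : pair_eigenvalue N b c (first_derivatives f) = pair_eigenvalue N a c (first_derivatives f).
    congr (_ - _); rewrite !jacobianE; apply: eq_bigr => p _; congr (_ * _%:R).
    by case: (sync_slot p sab) => [->|[-> ->]|[-> ->]]; rewrite ?(negbTE ac) ?(negbTE bc).
  case: (one _ ((synchrony_pair R N ab').2 sab')) => h.
  + by have := pair_neq_diagonal R ab'; rewrite h eqxx.
  + case: (pair_space_inj ab' ab h) => -[ea eb]; move: ab' ac' bc'; rewrite ea eb;
    case: (cov c') => ->; rewrite ?eqxx// => _ _ _; by rewrite ?eqxx.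
  + by have := pair_neq_full R ab'; rewrite h eqxx.
Qed.

Lemma type_b_dynamics D1 D2 D3 mu C : @type_b R k N D1 D2 D3 mu ->
  generic_synchronies N (@valency R k) [:: diagonal_space R] /\
  generic_synchronies_if N C mu [:: D1; D2; D3].
Proof.
move=> [dif lat]; have [u sync _] := lat.
have [u3 n3] : uniq [:: D1; D2; D3] /\ forall D, D \in [:: D1; D2; D3] -> D != diagonal_space R /\ D != full_space R.
  have : uniq (diagonal_space R :: rcons [:: D1; D2; D3] (full_space R)) by exact: u.
  rewrite cons_uniq rcons_uniq => /and3P[q1 q2 ->]; split=> // D DD; split.
    by apply: contraNneq q1 => <-; rewrite mem_rcons inE DD orbT.
  by apply: contraNneq q2 => <-.
have DsE D : D \in [:: D1; D2; D3] <-> [/\ synchrony N D, D != diagonal_space R & D != full_space R].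
  split=> [DD|[sD nd nf]].
    have [h1 h2] := n3 D DD; split=> //; apply: (sync D).2; move: DD; rewrite !inE => /or3P[]->; by rewrite ?orbT.
  by have := (sync D).1 sD; rewrite /= !inE (negbTE nd) (negbTE nf) /= orbF.
have pairD D : D \in [:: D1; D2; D3] -> exists i j, [/\ i != j, sync_pair N i j & D = pair_space R i j].
  by move/DsE => [/synchrony_cases[->|->|//]]; rewrite eqxx.
have sync_all a b : a != b -> sync_pair N a b.
  move=> ab; apply: contrapT => nsab.
  have [z az bz] := third_cell ab.
  (* Without the pair a, b only two pair spaces would remain for three distinct members of the
     lattice. *)
  pose Ps := [:: pair_space R a z; pair_space R b z].
  have sub : {subset [:: D1; D2; D3] <= Ps}.
    move=> D /pairD[i [j [ij sij ->]]]; rewrite !inE; have cov := cells_cover ab az bz.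
    move: ij sij; case: (cov i) => ->; case: (cov j) => ->; rewrite ?eqxx ?orbT// => _ sij.
    - by case: nsab; apply: sync_pair_sym.
    - by rewrite pair_sym eqxx.
    - by rewrite [pair_space R z b]pair_sym eqxx orbT.
  by have := uniq_leq_size u3 sub.
have triv := all_sync_trivial sync_all.
have in1 : D1 \in [:: D1; D2; D3] by rewrite inE eqxx.
have [sD nd nf] := (DsE D1).1 in1.
have [a [b [c [ab ac bc sab [ED Emu]]]]] := lattice_pair lat (or_intror (or_introl erefl)) nd nf sD.
have muL : mu = lin_mu (fixs R N) by rewrite Emu pair_muE homogeneous_pair_slot.
have ne : exists e : 'rV[R]_k.+1, ups e != lin (fixs R N) e.
  by apply: (different2 dif) => e; rewrite muL.
split.
  apply: valency_from_chi; have [e he] := ne; exists e.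
  have [-> ->] := sync_reduced ab ac bc sab e.
  have -> : pair_eigenvalue N a c e = lin (fixs R N) e by rewrite pair_lin homogeneous_pair_slot.
  have -> : transverse_eigenvalue N a b e = lin (fixs R N) e.
    apply: eq_bigr => p _; congr (_ * _); rewrite /transverse; apply: homogeneous_slot => //.
    by rewrite eq_sym.
  have -> : forall x y : R, x ^+ 2 - x * (y + y) + y * y = (x - y) ^+ 2 by move=> x y; ring.
  by rewrite expf_neq0// subr_eq0.
rewrite muL; apply: homogeneous_generic => //.
move=> D; split=> [/pairD[i [j [ij _ ->]]]|[i [j [ij ->]]]]; first by exists i, j.
apply/DsE; split; [|exact: pair_neq_diagonal|exact: pair_neq_full].
by apply/synchrony_pair => //; exact: sync_all.
Qed.

Lemma type_e_dynamics D1 D2 mu1 mu2 : @type_e R k N D1 D2 mu1 mu2 ->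
  [/\ generic_synchronies N (@valency R k) [:: diagonal_space R],
      generic_synchronies N mu1 [:: D1] & generic_synchronies N mu2 [:: D2]].
Proof.
move=> [dif lat]; have [u sync _] := lat.
have [[nd1 nf1 sD1] [nd2 nf2 sD2]] : [/\ D1 != diagonal_space R, D1 != full_space R & synchrony N D1] /\
    [/\ D2 != diagonal_space R, D2 != full_space R & synchrony N D2].
  have : uniq (diagonal_space R :: rcons [:: D1; D2] (full_space R)) by exact: u.
  rewrite cons_uniq rcons_uniq mem_rcons !inE !negb_or => /and4P[/and3P[_ n1 n2] /andP[m1 m2] _ _].
  by split; split; rewrite // 1?eq_sym//; apply: (sync _).2; rewrite !inE eqxx ?orbT.
have [a [b [c [ab ac bc sab [ED1 Emu1]]]]] := lattice_pair lat (or_intror (or_introl erefl)) nd1 nf1 sD1.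
have [a' [b' [c' [ab' ac' bc' sab' [ED2 Emu2]]]]] := lattice_pair lat (or_intror (or_intror (or_introl erefl))) nd2 nf2 sD2.
have mu1E e : mu1 e = (pair_eigenvalue N a c e)%:C%C by rewrite Emu1.
have mu2E e : mu2 e = (pair_eigenvalue N a' c' e)%:C%C by rewrite Emu2.
have [] := lattice_full (mu1 := mu1) (mu2 := mu2) lat (or_intror (or_intror (or_intror (or_introl erefl)))).
- by apply: (lattice_continuous lat (D := full_space R)); right; right; right; left.
- by exists false; right; left.
- by exists false; right; right; left.
- by move=> e; rewrite !big_cons !big_nil !expr1.
move=> trE _.
have trR e : pair_eigenvalue N a c e + pair_eigenvalue N a' c' e = red_trace N e.
  by apply: real_inj; rewrite rmorphD -trE mu1E mu2E.
(* By the trace identity, the eigenvalue transverse to one pair space is the one carried by the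
   other. *)
have t1 e : transverse_eigenvalue N a b e = pair_eigenvalue N a' c' e.
  by have := trR e; rewrite (sync_reduced ab ac bc sab e).1; lra.
have t2 e : transverse_eigenvalue N a' b' e = pair_eigenvalue N a c e.
  by have := trR e; rewrite (sync_reduced ab' ac' bc' sab' e).1; lra.
have [e [d1 d2 d3]] : exists e, [/\ ups e != pair_eigenvalue N a c e,
    ups e != pair_eigenvalue N a' c' e & pair_eigenvalue N a c e != pair_eigenvalue N a' c' e].
  have [e _ ue] := generic_near 0 dif (@ltr01 R); exists e.
  move: ue; rewrite /= mu1E mu2E !inE negb_or => /and3P[/andP[h1 h2] h3 _].
  by split; [apply: contraNneq h1 => h|apply: contraNneq h2 => h|apply: contraNneq h3 => h];
    rewrite /valency -/(ups e) h.
split.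
- apply: valency_from_chi; exists e; have [-> ->] := sync_reduced ab ac bc sab e; rewrite t1.
  have -> : forall x y z : R, x ^+ 2 - x * (y + z) + y * z = (x - y) * (x - z) by move=> x y z; ring.
  by rewrite mulf_neq0// subr_eq0.
- by rewrite ED1 Emu1; apply: pair_generic => //; exists e => //; rewrite t1 eq_sym.
- by rewrite ED2 Emu2; apply: pair_generic => //; exists e => //; rewrite t2.
Qed.

End Consequences.

(** * Connectivity and discriminants *)

(* Self-maps of the three cells as lists of values, for which the discriminant
   of the characteristic polynomial modulo the diagonal can be computed. *)
Definition indicator_entry (s : seq nat) (i j : nat) : int := (nth 0%N s i == j)%:Z.
Definition discriminant_entries (K : pzRingType) (m : nat -> nat -> K) : K :=
  (m 1%N 1%N - m 0%N 1%N - (m 2%N 2%N - m 0%N 2%N)) ^+ 2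
  + 4 * ((m 1%N 2%N - m 0%N 2%N) * (m 2%N 1%N - m 0%N 1%N)).
Definition cell_maps : seq (seq nat) :=
  [seq x :: s | x <- iota 0 3, s <- [seq [:: y; z] | y <- iota 0 3, z <- iota 0 3]].
Definition sync_code (s : seq nat) (a b : nat) : bool :=
  [|| nth 0 s a == nth 0 s b, (nth 0 s a == a) && (nth 0 s b == b)
    | (nth 0 s a == b) && (nth 0 s b == a)]%N.

(** A synchronous pair concerns all input types, so one pair must serve every admissible map [t];
    the check therefore fixes the pair before [t] varies. *)
Lemma common_sync_code : all (fun s =>
  [|| s == [:: 0; 1; 2], constant s,
      discriminant_entries (indicator_entry s) != 0%R
    | has (fun ab => all (fun t =>
        (discriminant_entries (indicator_entry t) == 0%R) ==>
        (discriminant_entries (fun i j => (indicator_entry s i j + indicator_entry t i j)%R) == 0%R) ==>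
        sync_code t ab.1 ab.2) cell_maps)
      [:: (0, 1); (0, 2); (1, 2)]])%N cell_maps.
Proof. by vm_compute. Qed.

Section Classification.
Variables (R : realType) (k : nat) (N : network k 3).
Implicit Types (D E : {vspace 'cV[R]_3}) (e : 'rV[R]_k.+1).

Let code p : seq nat := [:: slot N p 0 : nat; slot N p 1 : nat; slot N p 2 : nat].

Let nth_code p (i : 'I_3) : nth 0%N (code p) i = slot N p i.
Proof. by case: (@cells_cover 0 1 2 isT isT isT i) => ->. Qed.

Let code_maps p : code p \in cell_maps.
Proof.
have io (i : 'I_3) : (i : nat) \in iota 0 3 by rewrite mem_iota ltn_ord.
exact: allpairs_f (io _) (allpairs_f _ (io _) (io _)).
Qed.

Let disc e : R := red_trace N e ^+ 2 - 4 * red_det N e.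

Let disc_int e (m : nat -> nat -> int) : (forall i j : 'I_3, jacobian N e i j = (m i j)%:~R) ->
  disc e = (discriminant_entries m)%:~R.
Proof.
move=> h; rewrite /disc /red_trace /red_det /reduced_trace /reduced_det !h /discriminant_entries /=.
by rewrite rmorphD rmorphXn !rmorphM !rmorphB /= -!rmorphB; ring.
Qed.

Lemma jacobian_delta p (i j : 'I_3) : jacobian N ('e_p : 'rV[R]_k.+1) i j = (slot N p i == j)%:R.
Proof.
by rewrite jacobianE (bigD1 p)//= big1 ?addr0 ?mxE ?eqxx ?mul1r// => q qp; rewrite mxE (negbTE qp) andbF mul0r.
Qed.

Let jacobianD (e e' : 'rV[R]_k.+1) i j : jacobian N (e + e') i j = jacobian N e i j + jacobian N e' i j.
Proof. by rewrite !jacobianE -big_split; apply: eq_bigr => p _ /=; rewrite mxE mulrDl. Qed.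

Let code_entry p (i j : 'I_3) : (slot N p i == j)%:R = (indicator_entry (code p) i j)%:~R :> R.
Proof. by rewrite /indicator_entry nth_code -val_eqE pmulrn. Qed.

(* A map with a double eigenvalue modulo the diagonal is the identity, constant
   or a chain, and the sum of two chains has distinct eigenvalues unless they
   have a synchronous pair in common.  The discriminant is a quadratic form, so
   that this check over pairs of maps suffices. *)
Lemma discriminant_neq0 : (forall a b, a != b -> ~ sync_pair N a b) ->
  exists e, red_trace N e ^+ 2 - 4 * red_det N e != 0.
Proof.
move=> nosync; apply: contrapT => none.
have disc0 e : disc e = 0 by apply/eqP; apply: contraT => h; case: none; exists e.
have [p [nid ncst]] := @nontrivial_slot k N 0 1 isT (nosync 0 1 isT).
have dp q : discriminant_entries (indicator_entry (code q)) = 0.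
  apply/eqP; rewrite -(intr_eq0 R) -(@disc_int ('e_q)) ?disc0// => i j.
  by rewrite jacobian_delta code_entry.
have dpq q : discriminant_entries (fun i j => indicator_entry (code p) i j + indicator_entry (code q) i j) = 0.
  apply/eqP; rewrite -(intr_eq0 R) -(@disc_int ('e_p + 'e_q)) ?disc0// => i j.
  by rewrite jacobianD !jacobian_delta !code_entry rmorphD.
have := allP common_sync_code _ (code_maps p) => /or4P[/eqP[h0 h1 h2]|cst|/eqP[]|/hasP[[a b] ab /allP h]].
- by apply: nid => i; apply: val_inj; case: (@cells_cover 0 1 2 isT isT isT i) => ->.
- have [h1 h2] : slot N p 1 = slot N p 0 :> nat /\ slot N p 2 = slot N p 0 :> nat.
    by move: cst; rewrite /= andbT => /andP[/eqP ? /eqP ?].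
  have h i : slot N p i = slot N p 0 by apply: val_inj; case: (@cells_cover 0 1 2 isT isT isT i) => ->.
  by apply: ncst => i j; rewrite !h.
- exact: dp.
have syn q : sync_code (code q) a b.
  by have /implyP/(_ _)/implyP := h _ (code_maps q); apply; apply/eqP; [exact: dp|exact: dpq].
have [i [j [ij ai bj]]] : exists i j : 'I_3, [/\ i != j, a = i & b = j].
  by move: ab; rewrite !inE => /or3P[]/eqP[-> ->]; [exists 0, 1|exists 0, 2|exists 1, 2].
apply: (nosync i j ij) => l; have := syn (lift ord0 l).
rewrite /sync_code ai bj !nth_code /slot liftK.
case/or3P => [/eqP h1|/andP[/eqP h1 /eqP h2]|/andP[/eqP h1 /eqP h2]];
  by [left; exact: val_inj|right; left; split; exact: val_inj|right; right; split; exact: val_inj].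
Qed.

Lemma sync_pairP i j : sync_pair N i j <->
  forall l, [|| N l i == N l j, (N l i == i) && (N l j == j) | (N l i == j) && (N l j == i)].
Proof.
split=> h l; first by case: (h l) => [->|[[-> ->]|[-> ->]]]; rewrite !eqxx ?orbT.
by have /or3P[/eqP|/andP[/eqP ? /eqP ?]|/andP[/eqP ? /eqP ?]] := h l; auto.
Qed.

Lemma isolated_cell c : (forall l i, (N l i == c) = (i == c)) -> ~ connected_network N.
Proof.
move=> iso conn; have [j jc] : exists j, j != c by exists (if c == 0 then 1 else 0); case: (eqVneq c 0) => [->|] //; rewrite eq_sym.
have : fingraph.closed (fun a b => [exists l, (N l a == b) || (N l b == a)]) (pred1 c).
  move=> x y /existsP[l /orP[]/eqP <-]; by rewrite !inE iso.
by move=> /closed_connect/(_ _ _ (conn j c)); rewrite !inE eqxx (negbTE jc).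
Qed.

(** Equality at every basis vector would make all input maps fix c and keep a and b away from it,
    which isolates c. *)
Lemma pair_not_valency a b c : connected_network N -> a != b -> a != c -> b != c -> sync_pair N a b ->
  exists e : 'rV[R]_k.+1, ups e != pair_eigenvalue N a c e.
Proof.
move=> conn ab ac bc sab; apply: contrapT => none.
apply: (isolated_cell (c := c)) conn => l i.
have h : pair_slot R N a c (lift ord0 l) = 1.
  rewrite -lin_delta -pair_lin; transitivity (ups ('e_(lift ord0 l) : 'rV[R]_k.+1)).
    by apply/eqP; rewrite eq_sym; apply: contraT => h; case: none; exists 'e_(lift ord0 l).
  by rewrite ups_lin lin_delta.
have [h1 h2] : N l c = c /\ N l a != c.
  move: h; rewrite /pair_slot /slot liftK; case: eqP => [->|_]; case: eqP => //= _ /eqP.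
  - by rewrite subrr eq_sym oner_eq0.
  - by rewrite sub0r eq_sym -subr_eq0 opprK -mulr2n pnatr_eq0.
  - by rewrite subr0 eq_sym oner_eq0.
have h3 : N l b != c by case: (sab l) => [<-//|[[_ ->]|[_ ->]]].
case: (cells_cover ab ac bc i) => ->; rewrite ?h1 ?eqxx ?(negbTE h2) ?(negbTE h3) ?(negbTE ac) ?(negbTE bc)//.
Qed.

Lemma pair_eigenvalues_differ x y z : x != y -> x != z -> y != z ->
  sync_pair N x y -> sync_pair N x z -> ~ sync_pair N y z ->
  exists e : 'rV[R]_k.+1, pair_eigenvalue N x z e != pair_eigenvalue N x y e.
Proof.
move=> xy xz yz /sync_pairP sxy /sync_pairP sxz nyz; apply: contrapT => none.
apply: nyz; apply/sync_pairP => l.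
(* The coefficients of one input type, compared in the natural numbers without subtraction, so that
   running through all images decides the claim. *)
have : ((N l z == z) + (N l x == y) == (N l y == y) + (N l x == z))%N.
  rewrite -(eqr_nat R) !natrD.
  have : pair_slot R N x z (lift ord0 l) = pair_slot R N x y (lift ord0 l).
    rewrite -!lin_delta -!pair_lin.
    by apply/eqP; apply: contraT => h; case: none; exists 'e_(lift ord0 l).
  by rewrite /pair_slot /slot liftK => h; apply/eqP; lra.
have zx : (z == x) = false by rewrite eq_sym (negbTE xz).
have yx : (y == x) = false by rewrite eq_sym (negbTE xy).
have zy : (z == y) = false by rewrite eq_sym (negbTE yz).
move: (sxy l) (sxz l).
case: (cells_cover xy xz yz (N l x)) => ->; case: (cells_cover xy xz yz (N l y)) => ->;
case: (cells_cover xy xz yz (N l z)) => ->;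
by rewrite ?eqxx ?(negbTE xy) ?(negbTE xz) ?(negbTE yz) ?zx ?yx ?zy.
Qed.

(* At e = (1, ..., 1) the value is the sum of the weights of the spanning trees
   of the input graph (matrix-tree theorem); if there is none, there are two
   cells without inputs or an isolated cell. *)
Lemma chi_neq0 : connected_network N -> (forall a b, a != b -> ~ sync_pair N a b) ->
  exists e, ups e ^+ 2 - ups e * red_trace N e + red_det N e != 0.
Proof.
move=> conn nosync; pose e : 'rV[R]_k.+1 := const_mx 1; exists e.
pose J := jacobian N e; pose b x y := [exists l, N l x == y].
have J_ge0 x y : 0 <= J x y.
  by rewrite /J jacobianE; apply: sumr_ge0 => p _; rewrite mxE mul1r ler0n.
have J_gt0 x y : b x y -> 0 < J x y.
  move=> /existsP[l /eqP h]; rewrite lt0r J_ge0 andbT /J jacobianE psumr_neq0; last first.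
    by move=> p _; rewrite mxE mul1r ler0n.
  by apply/hasP; exists (lift ord0 l); rewrite ?mem_index_enum//= mxE mul1r /slot liftK h eqxx ltr01.
have row i : J i 0 + J i 1 + J i 2 = ups e by rewrite /J (jacobian_rows N e i).
(* The row sums eliminate the diagonal entries; the nine products are the nine rooted spanning trees
   on three cells. *)
have chiE : ups e ^+ 2 - ups e * red_trace N e + red_det N e =
    J 1 0 * J 2 0 + J 1 0 * J 2 1 + J 1 0 * J 0 2 + J 1 2 * J 2 0 + J 1 2 * J 0 2
    + J 0 1 * J 2 0 + J 0 1 * J 2 1 + J 1 2 * J 0 1 + J 0 2 * J 2 1.
  have h1 : J 1 1 = ups e - J 1 0 - J 1 2 by rewrite -(row 1); ring.
  have h2 : J 2 2 = ups e - J 2 0 - J 2 1 by rewrite -(row 2); ring.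
  by rewrite /red_trace /red_det /reduced_trace /reduced_det -/J h1 h2; ring.
have no_sink x y : x != y -> (forall z, z != x -> ~~ b x z) -> (forall z, z != y -> ~~ b y z) -> False.
  move=> xy hx hy; apply: (nosync x y xy) => l; right; left.
  have stay u : (forall z, z != u -> ~~ b u z) -> N l u = u.
    by move=> h; apply/eqP; apply: contraT => /h/existsP[]; exists l.
  by split; exact: stay.
have no_iso x : (forall z, z != x -> ~~ b x z && ~~ b z x) -> False.
  move=> h; apply: (@isolated_cell x) conn => l i; have [->|ix] := eqVneq i x.
    by apply: contraT => /h/andP[/existsP[]]; exists l.
  by apply/negbTE; have /andP[_] := h i ix; apply: contra => hi; apply/existsP; exists l.
have np x y x' y' : J x y * J x' y' == 0 -> ~~ (b x y && b x' y').
  by move=> /eqP h; apply/negP => /andP[/J_gt0 u /J_gt0 v]; have := mulr_gt0 u v; rewrite h ltxx.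
(* All terms are nonnegative, so a zero sum would mean that every spanning tree misses an edge. *)
rewrite chiE; apply/negP; rewrite !paddr_eq0 ?(addr_ge0, mulr_ge0)// -!andbA.
move=> /and5P[f1 f2 f3 f4 /and5P[f5 f6 f7 f8 f9]].
have sink x y z : x != y -> x != z -> y != z -> ~~ [&& ~~ b x y, ~~ b x z, ~~ b y x & ~~ b y z].
  move=> xy xz yz; apply/negP => /and4P[h1 h2 h3 h4]; have covx := cells_cover xy xz yz.
  by apply: (no_sink x y xy) => u; case: (covx u) => ->; rewrite ?eqxx.
have iso x y z : x != y -> x != z -> y != z -> ~~ [&& ~~ b x y, ~~ b x z, ~~ b y x & ~~ b z x].
  move=> xy xz yz; apply/negP => /and4P[h1 h2 h3 h4]; have covx := cells_cover xy xz yz.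
  by apply: (no_iso x) => u; case: (covx u) => ->; rewrite ?eqxx// ?h1 ?h2 ?h3 ?h4.
move: (np _ _ _ _ f1) (np _ _ _ _ f2) (np _ _ _ _ f3) (np _ _ _ _ f4) (np _ _ _ _ f5)
  (np _ _ _ _ f6) (np _ _ _ _ f7) (np _ _ _ _ f8) (np _ _ _ _ f9) (sink 0 1 2 isT isT isT) (sink 0 2 1 isT isT isT)
  (sink 1 2 0 isT isT isT) (iso 0 1 2 isT isT isT) (iso 1 0 2 isT isT isT) (iso 2 0 1 isT isT isT).
case: (b 1 0) => /=; case: (b 0 2) => //=; case: (b 1 2) => //=; case: (b 0 1) => //=;
by case: (b 2 0) => //=; case: (b 2 1).
Qed.

End Classification.

(** * Spectra of the quotients *)

Section Spectrum.
Variables (K : fieldType) (n : nat) (A : 'M[K]_n).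

Lemma rank_eigenspace a : \rank (eigenspace A^T a) = (n - \rank (A - a%:M)%R)%N.
Proof. by rewrite mxrank_ker -(mxrank_tr (A - _)) linearB /= tr_scalar_mx. Qed.

Lemma rank_eigenspace_gt0 a : root (char_poly A) a -> (0 < \rank (eigenspace A^T a))%N.
Proof.
by rewrite -eigenvalue_root_char rank_eigenspace -mxrank_ker lt0n mxrank_eq0.
Qed.

Lemma sum_count_undup (s : seq K) : (\sum_(z <- undup s) count_mem z s = size s)%N.
Proof.
under eq_bigr do rewrite -sum1_count big_mkcond.
rewrite exchange_big -sum1_size big_seq [RHS]big_seq; apply: eq_bigr => y ys.
transitivity (count_mem y (undup s)); last by rewrite count_uniq_mem ?undup_uniq// mem_undup ys.
by rewrite -big_mkcond sum1_count; apply: eq_count => z; rewrite /= eq_sym.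
Qed.

(* The eigenspaces are independent, so their dimensions cannot exceed the
   multiplicities without summing to more than the size of the matrix. *)
Lemma semisimple_spectrum (s : seq K) : char_poly A = \prod_(z <- s) ('X - z%:P) ->
  {in s, forall z, (count_mem z s <= \rank (eigenspace A^T z))%N} ->
  {in s, forall z, mup z (char_poly A) = \rank (eigenspace A^T z)}.
Proof.
move=> cp low z zs; rewrite cp mu_prod_XsubC; apply/eqP; rewrite eqn_leq low//=.
have sn : size s = n.
  by have := size_char_poly A; rewrite cp size_prod_XsubC => -[].
pose u := undup s; pose a_ (i : 'I_(size u)) := nth 0 u i.
have inj : {in predT &, injective a_}.
  move=> i j _ _ /eqP; rewrite nth_uniq ?ltn_ord ?undup_uniq// => /eqP; exact: val_inj.
have /mxdirectP/= rk := mxdirect_sum_eigenspace A^T inj.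
have tot : (\sum_(y <- u) \rank (eigenspace A^T y) <= \sum_(y <- u) count_mem y s)%N.
  rewrite sum_count_undup sn (big_nth 0) big_mkord -rk; exact: rank_leq_row.
have zu : z \in u by rewrite mem_undup.
move: tot; rewrite !(bigD1_seq z)//= ?undup_uniq// => tot.
rewrite -(leq_add2r (\sum_(y <- u | y != z) count_mem y s)); apply: leq_trans tot.
rewrite leq_add2l big_seq_cond [X in (_ <= X)%N]big_seq_cond.
by apply: leq_sum => y /andP[yu _]; apply: low; rewrite -mem_undup.
Qed.

Lemma distinct_spectrum (s : seq K) : char_poly A = \prod_(z <- s) ('X - z%:P) -> uniq s ->
  {in s, forall z, mup z (char_poly A) = \rank (eigenspace A^T z)}.
Proof.
move=> cp us; apply: semisimple_spectrum => // z zs.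
by rewrite count_uniq_mem// zs; apply: rank_eigenspace_gt0; rewrite cp root_prod_XsubC.
Qed.

Lemma rank1_minor (B : 'M[K]_n) i j i' j' : (\rank B <= 1)%N -> B i j * B i' j' = B i j' * B i' j.
Proof.
rewrite -{2 3 4 5}(mulmx_base B); move: (col_base B) (row_base B); case: (\rank B) => [|[|//]] C D _.
  by rewrite !mxE !big_ord0 !mul0r.
by rewrite !mxE !big_ord1; ring.
Qed.

End Spectrum.

Section SpectrumThree.
Variable K : fieldType.
Implicit Types (A : 'M[K]_3) (s : K).

Lemma char_poly_rows A s m1 m2 : const_rows A s -> m1 + m2 = reduced_trace 0 1 2 A ->
  m1 * m2 = reduced_det 0 1 2 A -> char_poly A = \prod_(z <- [:: s; m1; m2]) ('X - z%:P).
Proof.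
move=> As h1 h2; rewrite /char_poly (@det_const_rows _ (char_poly_mx A) ('X - s%:P)); last first.
  move=> i; rewrite -(As i) !mxE !rmorphD /=.
  by case: (@cells_cover 0 1 2 isT isT isT i) => -> /=; rewrite mulr1n !mulr0n; ring.
rewrite !big_cons big_nil mulr1 /reduced_det !mxE /= !mulr1n !mulr0n.
have e1 : m1%:P + m2%:P = (A 1 1)%:P - (A 0 1)%:P + ((A 2 2)%:P - (A 0 2)%:P) :> {poly K}.
  by rewrite -!polyCB -!polyCD h1.
have e2 : m1%:P * m2%:P = ((A 1 1)%:P - (A 0 1)%:P) * ((A 2 2)%:P - (A 0 2)%:P)
   - ((A 1 2)%:P - (A 0 2)%:P) * ((A 2 1)%:P - (A 0 1)%:P) :> {poly K}.
  by rewrite -polyCM h2 /reduced_det !(polyCB, polyCM).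
have -> : ('X - m1%:P) * ('X - m2%:P) = 'X * 'X - (m1%:P + m2%:P) * 'X + m1%:P * m2%:P :> {poly K} by ring.
by rewrite e1 e2; ring.
Qed.

Lemma rank1_reduced_det A : (\rank A <= 1)%N -> reduced_det 0 1 2 A = 0.
Proof.
move=> rk; have h := rank1_minor _ _ _ _ rk; rewrite /reduced_det.
have := h 1 1 2 2; have := h 1 1 0 2; have := h 0 1 2 2 => h1 h2 h3.
have -> : forall p q r t x y : K, (p - x) * (q - y) - (r - y) * (t - x) =
   (p * q - r * t) - (p * y - r * x) - (x * q - y * t) by move=> *; ring.
by rewrite h1 h2 h3; ring.
Qed.

(** Rank one makes the rows proportional, and equal nonzero row sums make the factor 1. *)
Lemma rank1_const_rows A s i i' j : (\rank A <= 1)%N -> const_rows A s -> s != 0 -> A i j = A i' j.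
Proof.
move=> rk As s0; apply: (mulIf s0); rewrite -{1}(As i') -(As i) !mulrDr.
have h := rank1_minor _ _ _ _ rk.
by rewrite (h i j i' 0) (h i j i' 1) (h i j i' 2); ring.
Qed.

Lemma const_rows_shift A s x : const_rows A s -> const_rows (A - x%:M) (s - x).
Proof.
move=> As i; rewrite -(As i) !mxE.
by case: (@cells_cover 0 1 2 isT isT isT i) => -> /=; rewrite mulr1n !mulr0n; ring.
Qed.

Lemma reduced_det_shift A x : reduced_det 0 1 2 (A - x%:M) =
  x ^+ 2 - x * reduced_trace 0 1 2 A + reduced_det 0 1 2 A.
Proof. by rewrite /reduced_det /reduced_trace !mxE /= !mulr1n !mulr0n; ring. Qed.

End SpectrumThree.

Section Annotations.
Variables (R : realType) (k : nat) (N : network k 3).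
Implicit Types (e : 'rV[R]_k.+1) (mu : eigenfunction R k).

Let cJ n (M : network k n) e := map_mx (real_complex R) (jacobian M e).

Lemma real_continuous_eigenfunction (phi : 'rV[R]_k.+1 -> R) : continuous phi ->
  continuous_eigenfunction (fun e => (phi e)%:C%C).
Proof. by move=> c; split=> //; exact: (@cst_continuous _ _ (0 : R)). Qed.

Lemma valency_continuous : continuous_eigenfunction (@valency R k).
Proof. by apply: (@real_continuous_eigenfunction (@ups R k)); apply: pf_continuous; exact: pf_ups. Qed.

Lemma pair_mu_continuous a c : continuous_eigenfunction (@pair_mu R k N a c).
Proof. by apply: real_continuous_eigenfunction; apply: pf_continuous; exact: pf_pair. Qed.

Lemma plain_annotation n (M : network k n) (mus : seq (eigenfunction R k)) :
  (forall mu, List.In mu mus -> continuous_eigenfunction mu) ->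
  generic_point (fun e => char_poly (cJ M e) = \prod_(z <- [seq mu e | mu <- mus]) ('X - z%:P) /\
    {in [seq mu e | mu <- mus], forall z, mup z (char_poly (cJ M e)) = \rank (eigenspace (cJ M e)^T z)}) ->
  eigenvalue_annotation M [seq plain mu | mu <- mus].
Proof.
move=> cont gen; split=> [x /List.in_map_iff[mu [<- /cont]]//|].
apply: generic_imp gen => e [cp mupE]; split.
  by rewrite -/(cJ M e) cp !big_map; apply: eq_bigr => mu _; rewrite expr1.
move=> x /List.in_map_iff[mu [<- inmu]] /=; rewrite addn0; apply: mupE.
elim: mus inmu {cont cp} => //= nu mus IH [->|/IH]; first by rewrite inE eqxx.
by rewrite inE => ->; rewrite orbT.
Qed.

Lemma distinct_annotation n (M : network k n) (mus : seq (eigenfunction R k)) : different mus ->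
  (forall mu, List.In mu mus -> continuous_eigenfunction mu) ->
  (forall e, char_poly (cJ M e) = \prod_(z <- [seq mu e | mu <- mus]) ('X - z%:P)) ->
  eigenvalue_annotation M [seq plain mu | mu <- mus].
Proof.
move=> dif cont cp; apply: plain_annotation => //; apply: generic_imp dif => e u.
by split=> //; exact: distinct_spectrum.
Qed.

Lemma diagonal_annotation : eigenvalue_annotation (@diagonal_quotient k) [:: plain (@valency R k)].
Proof.
apply: (@distinct_annotation _ _ [:: @valency R k]).
- by exists 1; rewrite ?oner_neq0.
- by move=> mu [<-|//]; exact: valency_continuous.
move=> e; rewrite /= big_cons big_nil mulr1 /char_poly det_mx11 !mxE eqxx mulr1n.
by rewrite -[valency e]/((ups e)%:C%C) /ups -(jacobian_row_sum (@diagonal_quotient k) e 0) big_ord1.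
Qed.

Lemma different_pair (phi psi : 'rV[R]_k.+1 -> R) : poly_fun phi -> poly_fun psi ->
  (exists e, phi e != psi e) ->
  generic_point (fun e => phi e != psi e).
Proof.
move=> p1 p2 [e he]; apply: generic_imp (pf_generic (pf_sub p1 p2) _); last first.
  by exists e; rewrite subr_eq0.
by move=> e'; rewrite subr_eq0.
Qed.

Lemma different_real2 (phi : 'rV[R]_k.+1 -> R) : poly_fun phi -> (exists e, ups e != phi e) ->
  different [:: @valency R k; fun e => (phi e)%:C%C].
Proof.
move=> p1 /(different_pair (pf_ups R k) p1); apply: generic_imp => e ne /=.
by rewrite inE andbT; apply: contra ne => /eqP/real_inj/eqP.
Qed.

Lemma different_real3 (phi psi : 'rV[R]_k.+1 -> R) : poly_fun phi -> poly_fun psi ->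
  (exists e, ups e != phi e) -> (exists e, ups e != psi e) -> (exists e, phi e != psi e) ->
  different [:: @valency R k; fun e => (phi e)%:C%C; fun e => (psi e)%:C%C].
Proof.
move=> p1 p2 /(different_pair (pf_ups R k) p1) g1 /(different_pair (pf_ups R k) p2) g2.
move=> /(different_pair p1 p2) g3; apply: generic_imp (generic_and g1 (generic_and g2 g3)).
move=> e [n1 [n2 n3]] /=; rewrite !inE negb_or !andbT -andbA.
by apply/and3P; split; [apply: contra n1|apply: contra n2|apply: contra n3] => /eqP/real_inj/eqP.
Qed.

Lemma pair_annotation a b c : a != b -> a != c -> b != c -> sync_pair N a b ->
  (exists e : 'rV[R]_k.+1, ups e != pair_eigenvalue N a c e) ->
  eigenvalue_annotation (pair_quotient N a c) [:: plain (@valency R k); plain (@pair_mu R k N a c)].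
Proof.
move=> ab ac bc sab ne.
apply: (@distinct_annotation _ _ [:: @valency R k; @pair_mu R k N a c]).
- by apply: different_real2 => //; exact: pf_pair.
- by move=> mu [<-|[<-|//]]; [exact: valency_continuous|exact: pair_mu_continuous].
move=> e; rewrite /= !big_cons big_nil mulr1 /char_poly det2 !mxE /= !mulr1n !mulr0n.
rewrite /pair_mu -(pair_quotient_eigenvalue ab ac bc sab) /two_cell_eigenvalue.
rewrite -[valency e]/((ups e)%:C%C).
set M := pair_quotient N a c; have row i : ups e = jacobian M e i 0 + jacobian M e i 1.
  rewrite /ups -(jacobian_row_sum M e i) !big_ord_recl big_ord0 addr0; congr (_ + jacobian M e i _).
  exact: val_inj.
have e0 : jacobian M e 0 0 = ups e - jacobian M e 0 1 by rewrite (row 0) addrK.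
have e1 : jacobian M e 1 0 = ups e - jacobian M e 1 1 by rewrite (row 1) addrK.
by rewrite e0 e1 !rmorphB /=; ring.
Qed.

Section Full.
Variables mu1 mu2 : eigenfunction R k.
Hypotheses (sumE : forall e, mu1 e + mu2 e = (red_trace N e)%:C%C)
  (prodE : forall e, mu1 e * mu2 e = (red_det N e)%:C%C).

Let rows e : const_rows (cJ N e) (valency e).
Proof.
by move=> i; rewrite !mxE -!rmorphD /= (jacobian_rows N e i).
Qed.

Lemma full_char_poly e : char_poly (cJ N e) = \prod_(z <- [:: valency e; mu1 e; mu2 e]) ('X - z%:P).
Proof.
apply: char_poly_rows => //.
  by rewrite sumE /red_trace /reduced_trace !mxE -!rmorphB -rmorphD.
by rewrite prodE /red_det /reduced_det !mxE -!rmorphB -!rmorphM -rmorphB.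
Qed.

Lemma full_annotation : different [:: @valency R k; mu1; mu2] ->
  continuous_eigenfunction mu1 -> continuous_eigenfunction mu2 ->
  eigenvalue_annotation N [:: plain (@valency R k); plain mu1; plain mu2].
Proof.
move=> dif c1 c2; apply: (@distinct_annotation _ _ [:: @valency R k; mu1; mu2]) => //.
  by move=> mu [<-|[<-|[<-|//]]] //; exact: valency_continuous.
exact: full_char_poly.
Qed.

End Full.

Let semisimple e (s : seq R[i]) : char_poly (cJ N e) = \prod_(z <- s) ('X - z%:P) ->
  {in s, forall z, (count_mem z s <= \rank (eigenspace (cJ N e)^T z))%N} ->
  {in s, forall z, mup z (char_poly (cJ N e)) = \rank (eigenspace (cJ N e)^T z)}.
Proof. exact: semisimple_spectrum. Qed.

Let rank_two e z (u : 'cV[R[i]]_3) (v : 'rV[R[i]]_3) : cJ N e - z%:M = u *m v ->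
  (2 <= \rank (eigenspace (cJ N e)^T z))%N.
Proof.
move=> E; rewrite rank_eigenspace E; have := mxrankM_maxl u v; have := rank_leq_col u.
by case: (\rank u) => [|[|//]] _; case: (\rank _) => [|[|//]].
Qed.

Lemma double_valency_annotation a b c (mu := @pair_mu R k N a c) : a != b -> a != c -> b != c ->
  sync_pair N a b -> (forall p, slot N p a = a /\ slot N p b = b) ->
  (exists e, ups e != pair_eigenvalue N a c e) ->
  eigenvalue_annotation N [:: plain (@valency R k); plain (@valency R k); plain mu].
Proof.
move=> ab ac bc sab sl ne.
have tv e : transverse_eigenvalue N a b e = ups e.
  rewrite ups_lin; apply: eq_bigr => p _; congr (_ * _); rewrite /transverse.
  by have [-> ->] := sl p; rewrite eqxx eq_sym (negbTE ab) subr0.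
apply: (@plain_annotation _ _ [:: @valency R k; @valency R k; mu]).
  by move=> x [<-|[<-|[<-|//]]]; [exact: valency_continuous|exact: valency_continuous|exact: pair_mu_continuous].
have dif := different_real2 (@pf_pair R k N a c) ne; apply: generic_imp dif => e /= u.
have vm : valency e != mu e by move: u; rewrite inE andbT.
have cp : char_poly (cJ N e) = \prod_(z <- [:: valency e; valency e; mu e]) ('X - z%:P).
  apply: (@full_char_poly (@valency R k) mu) => {u vm} e; rewrite -[valency e]/((ups e)%:C%C) /mu /pair_mu.
    by rewrite -rmorphD (sync_reduced ab ac bc sab e).1 tv addrC.
  by rewrite -rmorphM (sync_reduced ab ac bc sab e).2 tv mulrC.
have r2 : (2 <= \rank (eigenspace (cJ N e)^T (valency e)))%N.
  (* Rows a and b of the shifted Jacobian are 0, so it is a column times its row c. *)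
  apply: (rank_two (u := \col_i (i == c)%:R) (v := row c (cJ N e - (valency e)%:M))).
  apply/matrixP => i j; rewrite [RHS]mxE big_ord1 !mxE.
  have fixed x : (forall p, slot N p x = x) -> (x == c) = false ->
      (jacobian N e x j)%:C%C - valency e *+ (x == j) = (x == c)%:R * ((jacobian N e c j)%:C%C - valency e *+ (c == j)).
    move=> h ->; rewrite mul0r jacobianE; under eq_bigr do rewrite h.
    by rewrite -mulr_suml rmorphM rmorph_nat mulr_natr subrr.
  case: (cells_cover ab ac bc i) => ->; last by rewrite eqxx mul1r.
    by apply: fixed; [move=> p; exact: (sl p).1|exact: negbTE].
  by apply: fixed; [move=> p; exact: (sl p).2|exact: negbTE].
split; [exact: cp|apply: semisimple; [exact: cp|]] => z; rewrite !inE => /or3P[]/eqP->.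
- rewrite /= !eqxx eq_sym (negbTE vm).
  exact: r2.
- by rewrite /= !eqxx eq_sym (negbTE vm); exact: r2.
by rewrite /= !eqxx (negbTE vm); apply: rank_eigenspace_gt0; rewrite cp root_prod_XsubC !inE eqxx !orbT.
Qed.

Lemma homogeneous_annotation (mu := lin_mu (fixs R N)) :
  (forall p, (forall i, slot N p i = i) \/ (forall i j, slot N p i = slot N p j)) ->
  (exists e : 'rV[R]_k.+1, ups e != lin (fixs R N) e) ->
  eigenvalue_annotation N [:: plain (@valency R k); plain mu; plain mu].
Proof.
move=> triv ne.
have pE i j e : i != j -> pair_eigenvalue N i j e = lin (fixs R N) e.
  by move=> ij; rewrite pair_lin homogeneous_pair_slot.
have tE e : transverse_eigenvalue N 0 1 e = lin (fixs R N) e.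
  by apply: eq_bigr => p _; congr (_ * _); rewrite /transverse; exact: homogeneous_slot.
have sE e := @sync_reduced R k N 0 1 2 isT isT isT (homogeneous_sync triv 0 1) e.
apply: (@plain_annotation _ _ [:: @valency R k; mu; mu]).
  have cmu : continuous_eigenfunction mu.
    apply: real_continuous_eigenfunction; apply: pf_continuous.
    rewrite (_ : lin (fixs R N) = fun e => pair_eigenvalue N 0 1 e); first exact: pf_pair.
    by apply/funext => e; rewrite pE.
  by move=> x [<-|[<-|[<-|//]]] //; exact: valency_continuous.
have pfl : poly_fun (lin (fixs R N)).
  by rewrite (_ : lin _ = fun e => pair_eigenvalue N 0 1 e); [exact: pf_pair|apply/funext => e; rewrite pE].
have dif := different_real2 pfl ne; apply: generic_imp dif => e /= u.
have vm : valency e != mu e by move: u; rewrite inE andbT.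
have cp : char_poly (cJ N e) = \prod_(z <- [:: valency e; mu e; mu e]) ('X - z%:P).
  apply: (@full_char_poly mu mu) => {u vm} e.
    by rewrite -rmorphD (sE e).1 tE pE.
  by rewrite -rmorphM (sE e).2 tE pE.
have r2 : (2 <= \rank (eigenspace (cJ N e)^T (mu e)))%N.
  (* All rows of the shifted Jacobian are equal. *)
  apply: (rank_two (u := const_mx 1) (v := row 0 (cJ N e - (mu e)%:M))).
  apply/matrixP => i j; rewrite [RHS]mxE big_ord1 !mxE mul1r -[mu e]/((lin (fixs R N) e)%:C%C).
  suff h : jacobian N e i j - lin (fixs R N) e * (i == j)%:R = jacobian N e 0 j - lin (fixs R N) e * (0 == j)%:R.
    by have := congr1 (real_complex R) h; rewrite !rmorphB !rmorphM !rmorph_nat !mulr_natr.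
  apply/eqP; rewrite -subr_eq0; apply/eqP.
  have -> : forall x y z t : R, x - y - (z - t) = (x - z) - (y - t) by move=> *; ring.
  rewrite -mulrBr !jacobianE -sumrB mulr_suml -sumrB big1// => p _.
  rewrite /fixs; case: (triv p) => h.
    rewrite !h (introT forallP _); last by move=> x; rewrite h.
    by rewrite -mulrBr mul1r subrr.
  rewrite (h i 0) subrr (_ : [forall x, _] = false); first by rewrite !mul0r subr0.
  apply/negbTE/forallPn; have [h0|h0] := eqVneq (slot N p 0) 0; last by exists 0.
  by exists 1; rewrite (h 1 0) h0.
split; [exact: cp|apply: semisimple; [exact: cp|]] => z; rewrite !inE => /or3P[]/eqP->.
- by rewrite /= !eqxx eq_sym (negbTE vm); apply: rank_eigenspace_gt0; rewrite cp root_prod_XsubC !inE eqxx.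
- by rewrite /= !eqxx (negbTE vm).
- by rewrite /= !eqxx (negbTE vm).
Qed.

(** Both eigenspaces must be lines, so no shifted Jacobian may have rank at most 1. At the valency
    this would make the reduced determinant of the shift, (ups - mu)^2, vanish; at [mu] it would
    make the rows equal, against the entries in column b. *)
Lemma chain_annotation a b c (mu := @pair_mu R k N a c) : a != b -> a != c -> b != c ->
  sync_pair N a b -> (forall e, transverse_eigenvalue N a b e = pair_eigenvalue N a c e) ->
  (exists e, jacobian N e c b != jacobian N e a b) ->
  (exists e, ups e != pair_eigenvalue N a c e) ->
  eigenvalue_annotation N [:: plain (@valency R k); star mu].
Proof.
move=> ab ac bc sab tv nd ne.
have dif := different_real2 (@pf_pair R k N a c) ne.
have gnd := different_pair (@pf_jacobian R k 3 N c b) (@pf_jacobian R k 3 N a b) nd.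
have cp e : char_poly (cJ N e) = \prod_(z <- [:: valency e; mu e; mu e]) ('X - z%:P).
  apply: (@full_char_poly mu mu) => {}e.
    by rewrite -rmorphD (sync_reduced ab ac bc sab e).1 tv.
  by rewrite -rmorphM (sync_reduced ab ac bc sab e).2 tv.
split=> [x [<-|[<-|//]]|]; [exact: valency_continuous|exact: pair_mu_continuous|].
apply: generic_imp (generic_and dif gnd) => e [/= u nJ].
have vm : valency e != mu e by move: u; rewrite inE andbT.
have crows : const_rows (cJ N e) (valency e) by move=> i; rewrite !mxE -!rmorphD (jacobian_rows N e i).
split; first by rewrite -/(cJ N e) cp !big_cons !big_nil !mulr1 expr1 expr2.
have one z : root (char_poly (cJ N e)) z -> ~~ (\rank (cJ N e - z%:M)%R <= 1)%N ->
    \rank (eigenspace (cJ N e)^T z) = 1%N.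
  move=> rz; rewrite -ltnNge => r2; have := rank_eigenspace_gt0 rz.
  by rewrite rank_eigenspace; move: r2; case: (\rank _) => [|[|[|r]]].
have rt z : root (char_poly (cJ N e)) z = (z \in [:: valency e; mu e; mu e]) by rewrite cp root_prod_XsubC.
have r1 : \rank (eigenspace (cJ N e)^T (valency e)) = 1%N.
  apply: one; first by rewrite rt inE eqxx.
  apply/negP => /rank1_reduced_det; rewrite reduced_det_shift => h.
  have [trC detC] : reduced_trace 0 1 2 (cJ N e) = mu e + mu e /\ reduced_det 0 1 2 (cJ N e) = mu e * mu e.
    rewrite /mu /pair_mu -rmorphD -rmorphM /reduced_trace /reduced_det !mxE -!rmorphB -?rmorphM -?rmorphD -?rmorphB.
    by have [] := sync_reduced ab ac bc sab e; rewrite tv /red_trace /red_det => <- <-.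
  move: h; rewrite trC detC => h; case/negP: vm; rewrite -subr_eq0 -sqrf_eq0 -h; apply/eqP; ring.
have r2 : \rank (eigenspace (cJ N e)^T (mu e)) = 1%N.
  apply: one; first by rewrite rt !inE eqxx !orbT.
  apply/negP => rk; have := rank1_const_rows c a b rk (const_rows_shift (mu e) crows).
  rewrite subr_eq0 => /(_ vm); rewrite !mxE (negbTE ab) eq_sym (negbTE bc) !mulr0n !subr0 => /real_inj/eqP.
  by rewrite (negbTE nJ).
have m1 : mup (valency e) (char_poly (cJ N e)) = 1%N.
  by rewrite cp mu_prod_XsubC /= eqxx eq_sym (negbTE vm).
have m2 : mup (mu e) (char_poly (cJ N e)) = 2%N.
  by rewrite cp mu_prod_XsubC /= !eqxx (negbTE vm).
move=> x [<-|[<-|//]].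
  exact: (etrans m1 (esym (congr1 (fun r => r + false)%N r1))).
exact: (etrans m2 (esym (congr1 (fun r => r + true)%N r2))).
Qed.

End Annotations.

(** * Dynamics without synchronous pairs *)

Section Unsynchronized.
Variables (R : realType) (k : nat) (N : network k 3).
Implicit Types (D E : {vspace 'cV[R]_3}) (e : 'rV[R]_k.+1) (mu : eigenfunction R k).

Lemma red_shift e x : red_trace N (e + x *: 'e_ord0) = red_trace N e + 2 * x /\
  red_det N (e + x *: 'e_ord0) = red_det N e + red_trace N e * x + x ^+ 2.
Proof.
have ce : clear0 (e + x *: 'e_ord0) = clear0 e.
  apply/rowP => p; rewrite [LHS]mxE [RHS]mxE; case: eqVneq => // /negbTE p0.
  by rewrite !mxE p0 andbF mulr0 addr0.
have e0E : (e + x *: 'e_ord0) 0 ord0 = e 0 ord0 + x by rewrite !mxE !eqxx mulr1.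
rewrite (red_trace_clear0 _ (e + _)) (red_trace_clear0 _ e) (red_det_clear0 _ (e + _)) (red_det_clear0 _ e).
by rewrite ce e0E; split; ring.
Qed.

Section Roots.
Variables mu mu' : eigenfunction R k.
Hypotheses (sumE : forall e, mu e + mu' e = (red_trace N e)%:C%C)
  (prodE : forall e, mu e * mu' e = (red_det N e)%:C%C).
Hypothesis cmu : continuous_eigenfunction mu.

(* Along e_0 the two roots keep their distance, so the continuous root mu
   cannot jump from one to the other. *)
Lemma root_shift e x : mu e != mu' e -> complex.Im (mu e) = 0 ->
  mu (e + x *: 'e_ord0) = mu e + (x%:C)%C.
Proof.
move=> ne im0; pose m := complex.Re (mu e).
have muE : mu e = (m%:C)%C by rewrite /m; case: (mu e) im0 => u v /= ->.
(* Removing the midpoint of the two roots leaves half their difference up to sign, which does not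
   depend on y. *)
pose t := red_trace N e; pose phi y : R[i] := mu (e + y *: 'e_ord0) - ((y + t / 2)%:C)%C.
pose r := m - t / 2.
have mu'E : mu' e = ((t - m)%:C)%C by apply: (addrI (mu e)); rewrite sumE muE -rmorphD -/t; congr (_%:C)%C; ring.
have r0 : r != 0.
  apply: contraNneq ne => h; rewrite muE mu'E; apply/eqP; congr (_%:C)%C.
  by move: h; rewrite /r; lra.
have dE : red_det N e = m * (t - m).
  by apply: real_inj; rewrite -prodE muE mu'E rmorphM.
have phiE y : phi y = (r%:C)%C \/ phi y = ((- r)%:C)%C.
  have [h1 h2] := red_shift e y.
  have q : (mu (e + y *: 'e_ord0)) * ((red_trace N (e + y *: 'e_ord0))%:C%C - mu (e + y *: 'e_ord0)) =
      (red_det N (e + y *: 'e_ord0))%:C%C by rewrite -sumE addrAC subrr add0r prodE.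
  have : phi y ^+ 2 == (r%:C)%C ^+ 2.
    have gen (h' y' m' : R) (z : R[i]) :
        z * (((h' + h' + (y' + y'))%:C)%C - z) = ((m' * (h' + h' - m') + (h' + h') * y' + y' * y')%:C)%C ->
        (z - ((y' + h')%:C)%C) ^+ 2 = ((m' - h')%:C)%C ^+ 2.
      rewrite !(rmorphD, rmorphB, rmorphM, rmorphN) /=.
      move: (h'%:C)%C (y'%:C)%C (m'%:C)%C => H Y M q'.
      have -> : (z - (Y + H)) ^+ 2 = (Y + H) ^+ 2 - z * (H + H + (Y + Y) - z) by ring.
      by rewrite q'; ring.
    apply/eqP; apply: gen; rewrite -splitr -mulr2n -mulr_natl -h1 q h2 dE -/t -expr2.
    by [].
  by rewrite eqf_sqr => /orP[]/eqP->; [left|right; rewrite rmorphN].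
have cphi : continuous (fun y => complex.Re (phi y)).
  have -> : (fun y => complex.Re (phi y)) =
      (fun y => complex.Re (mu (e + y *: 'e_ord0)) - (y + t / 2)).
    by apply/funext => y; rewrite /phi raddfB.
  move=> y; apply: cvgB; last by apply: cvgD; [exact: cvg_id|exact: cvg_cst].
  have cl : continuous (fun y : R => e + y *: 'e_ord0).
    by move=> z; apply: (@cvgD _ _ _ (nbhs z)); [exact: cvg_cst|apply: cvgZr_tmp; exact: cvg_id].
  exact: (continuous_comp (cl y) (cmu.1 _)).
have phi0 : phi 0 = (r%:C)%C by rewrite /phi scale0r addr0 muE add0r -rmorphB.
have phix : phi x = (r%:C)%C.
  case: (phiE x) => // px; exfalso.
  (* A jump to the other root would give a zero in between, while [phi] takes only the nonzero
     values r and - r. *)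
  have : exists y, complex.Re (phi y) = 0.
    have zero a b : a <= b -> Num.min (complex.Re (phi a)) (complex.Re (phi b)) <= 0 <=
        Num.max (complex.Re (phi a)) (complex.Re (phi b)) -> exists y, complex.Re (phi y) = 0.
      move=> ab h; have cw : {within `[a, b], continuous (fun y => complex.Re (phi y))}.
        exact: continuous_subspaceT.
      by have [y _ hy] := IVT ab cw h; exists y.
    have [x0|x0] := leP 0 x; [apply: (zero 0 x x0)|apply: (zero x 0 (ltW x0))];
      rewrite phi0 px /= ge_min le_max; apply/andP; split; apply/orP;
      have [r1|r1] := leP 0 r; by [left; lra|right; lra].
  by move=> [y]; case: (phiE y) => -> /= /eqP; rewrite ?oppr_eq0 (negbTE r0).
have := phix; rewrite /phi => /eqP; rewrite subr_eq => /eqP ->.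
by rewrite muE -!rmorphD; congr (_%:C)%C; rewrite /r; ring.
Qed.

Hypothesis dif : different [:: @valency R k; mu; mu'].
Hypothesis nosync : forall a b, a != b -> ~ sync_pair N a b.

(** [mu] is known only as a continuous root. Near the jet of a given member of the problem a generic
    point with real [mu] is picked, where all eigenvalues differ, and e_0 is then shifted by - mu.
    The interior condition keeps [mu] real near both points, and [root_shift] identifies its value
    after the shift. *)
Lemma unsync_generic : generic_synchronies N mu [:: full_space R].
Proof.
move=> ne; have [f [_ mu0 int0 _]] := ne; move: ne.
set c := first_derivatives f in mu0 int0.
apply: three_cell_generic; last 1 first.
- by move=> a b c' g ab _ _ sab; case: (nosync ab).
- move=> g [_ h _ _]; apply: real_inj.
  by rewrite -prodE h mul0r.
- have /nbhs_interior := (int0 : nbhs c [set x | complex.Im (mu x) = 0]).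
  move=> /nbhs_ballP[rho /= rho0 sub].
  (* One half of the radius pays for the move to a generic point, the other for the shift of e_0. *)
  have rho2 : 0 < rho / 2 by rewrite divr_gt0.
  have : nbhs c [set x | `|complex.Re (mu x)| < rho / 2].
    have /(_ _ _ rho2) := (@cvgrPdist_lt _ _ _ (nbhs c) _ _ _).1 (cmu.1 c).
    by rewrite mu0; apply: filterS => x /=; rewrite sub0r normrN.
  move=> /nbhs_ballP[d /= d0 small].
  have d2 : 0 < Num.min (rho / 2) d by rewrite lt_min rho2.
  have [c' near /= u] := generic_near c dif d2; move: near; rewrite lt_min => /andP[near1 near2].
  have [n1 n2 n3] : [/\ valency c' != mu c', valency c' != mu' c' & mu c' != mu' c'].
    by move: u; rewrite !inE negb_or !andbT => /andP[/andP[]].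
  have im0 : complex.Im (mu c') = 0.
    have hb : ball c rho c'.
      rewrite -ball_normE /= distrC; apply: lt_le_trans near1 _.
      by rewrite ler_pdivrMr// ler_peMr ?ler1n// ltW.
    exact: (@interior_subset _ [set x | complex.Im (mu x) = 0] c' (sub c' hb)).
  have sm : `|complex.Re (mu c')| < rho / 2 by apply: (small c'); rewrite -ball_normE /= distrC.
  pose x := complex.Re (mu c'); have muE : mu c' = (x%:C)%C by rewrite /x; case: (mu c') im0 => p q /= ->.
  have mu'E : mu' c' = ((red_trace N c' - x)%:C)%C.
    by apply: (addrI (mu c')); rewrite sumE muE -rmorphD; congr (_%:C)%C; ring.
  exists (c' + - x *: 'e_ord0); split.
  - by rewrite root_shift// muE -rmorphD subrr.
  - apply: (sub (c' + - x *: 'e_ord0)); rewrite -ball_normE /= distrC addrAC.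
    apply: le_lt_trans (ler_normD _ _) _; rewrite [ltRHS]splitr; apply: ltr_leD near1 _.
    rewrite normrZ normrN; apply: le_trans (ltW sm); rewrite -[leRHS]mulr1.
    apply: ler_wpM2l; first exact: normr_ge0.
    by apply: mx_norm_le => // i j; rewrite mxE; case: (_ && _); rewrite ?normr1 ?normr0.
  rewrite ups_lin lin_shift// -ups_lin (red_shift c' (- x)).1.
  have m1 : ups c' != x by apply: contra n1 => /eqP h; rewrite muE -h.
  have m2 : ups c' != red_trace N c' - x by apply: contra n2 => /eqP h; rewrite mu'E -h.
  have m3 : x != red_trace N c' - x by apply: contra n3 => /eqP h; rewrite muE mu'E -h.
  split; [by rewrite subr_eq0|apply: contra m3 => /eqP h; apply/eqP; lra
    |apply: contra m2 => /eqP h; apply/eqP; lra].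
- exact: (@nontrivial_slot k N 0 1 isT (@nosync 0 1 isT)).
Qed.

End Roots.

(** For conjugate nonreal values the reduced determinant is the squared modulus of [mu2], so a
    singular Jacobian means valency 0; a branch makes the Jacobian singular by [isolated_zero]. *)
Lemma only_valency mu1 mu2 :
  (forall e, mu1 e * mu2 e = (red_det N e)%:C%C) -> only_valency_bifurcates N mu1 mu2.
Proof.
move=> prodE f sf f0 c conj im0 sing.
have dJ : \det (jacobian N c) = 0.
  case: sing => // -[D bD]; apply/eqP; apply: contraT => dJ.
  have := branch_not_below bD (E := full_space R); rewrite subvf => /(_ _)/negP[]//.
  rewrite /c -derivatives_at0 in dJ; have [r r0 h] := isolated_zero sf f0 dJ.
  by exists r => // x l hx hl F0 _; apply: (h x l) => //; rewrite subr0.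
move: dJ; rewrite (det_const_rows (jacobian_rows N c)) -/(red_det N c) => /eqP.
rewrite mulf_eq0 => /orP[/eqP u0|/eqP d0].
  by rewrite lin_ups; apply/lin_problemP => //; split=> //; rewrite -ups_lin.
have : mu1 c * mu2 c == 0 by rewrite prodE d0.
rewrite mulf_eq0 conj; case: (mu2 c) im0 => u v /= /eqP v0.
by case/orP => /eqP[_ h]; case: v0; rewrite ?h// -[v]opprK h oppr0.
Qed.

Lemma type_g_dynamics mu1 mu2 : @type_g R k N mu1 mu2 ->
  [/\ generic_synchronies N (@valency R k) [:: diagonal_space R],
      only_valency_bifurcates N mu1 mu2,
      generic_synchronies N mu1 [:: full_space R] &
      generic_synchronies N mu2 [:: full_space R]].
Proof.
move=> [dif lat]; have [_ sync _] := lat.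
have nosync a b : a != b -> ~ sync_pair N a b.
  move=> ab /(synchrony_pair R N ab)/sync; rewrite !inE.
  by rewrite (negbTE (pair_neq_diagonal R ab)) (negbTE (pair_neq_full R ab)).
have cont := lattice_continuous lat (or_intror (or_introl erefl)).
have [] := lattice_full (mu1 := mu1) (mu2 := mu2) lat (or_intror (or_introl erefl)).
- exact: cont.
- by exists false; right; left.
- by exists false; right; right; left.
- by move=> e; rewrite !big_cons !big_nil !expr1.
move=> trE detE.
have c1 : continuous_eigenfunction mu1 by apply: (cont (mu1, false)); right; left.
have c2 : continuous_eigenfunction mu2 by apply: (cont (mu2, false)); right; right; left.
split.
- have [e _ ue] := generic_near 0 dif (@ltr01 R).
  apply: valency_from_chi; exists e; apply/eqP => h.
  have : (valency e - mu1 e) * (valency e - mu2 e) == 0.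
    have := congr1 (real_complex R) h.
    rewrite rmorphD rmorphB expr2 !rmorphM /= -trE -detE -[(ups e)%:C%C]/(valency e) rmorph0 => <-.
    by apply/eqP; ring.
  move: ue; rewrite /= !inE negb_or mulf_eq0 !subr_eq0 => /and3P[/andP[/negbTE -> /negbTE ->] _ _].
  by [].
- exact: only_valency.
- exact: (unsync_generic trE detE).
apply: (unsync_generic (mu' := mu1)) => //.
- by move=> e; rewrite addrC.
- by move=> e; rewrite mulrC.
apply: generic_imp dif => e /=; rewrite !inE !negb_or !andbT => /andP[/andP[h1 h2] h3].
by rewrite h1 h2 eq_sym h3.
Qed.

Lemma type_d_impossible mu : ~ @type_d R k N mu.
Proof.
move=> [dif lat]; have [_ sync _] := lat.
have nosync a b : a != b -> ~ sync_pair N a b.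
  move=> ab /(synchrony_pair R N ab)/sync; rewrite !inE.
  by rewrite (negbTE (pair_neq_diagonal R ab)) (negbTE (pair_neq_full R ab)).
have [] := lattice_full (mu1 := mu) (mu2 := mu) lat (or_intror (or_introl erefl)).
- by apply: (lattice_continuous lat (D := full_space R)); right; left.
- by exists true; right; left.
- by exists true; right; left.
- by move=> e; rewrite !big_cons !big_nil !mulr1 expr1 expr2.
move=> trE detE; have [e /eqP[]] := discriminant_neq0 R nosync; apply: real_inj.
by rewrite expr2 rmorphB !rmorphM /= -trE -detE rmorph_nat; ring.
Qed.

End Unsynchronized.

(** * The seven lattice types *)

Section LatticeTypes.
Variables (R : realType) (k : nat) (N : network k 3).
Hypothesis conn : connected_network N.
Implicit Types (D E : {vspace 'cV[R]_3}) (e : 'rV[R]_k.+1) (mu : eigenfunction R k).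

Let labelled (Ds : {vspace 'cV[R]_3} * annotation R k) : Prop :=
  exists (m : nat) (M : network k m), quotient_network N Ds.1 M /\ eigenvalue_annotation M Ds.2.

Let labelled_diagonal : labelled (diagonal_space R, [:: plain (@valency R k)]).
Proof. by exists 1%N, (@diagonal_quotient k); split; [exact: diagonal_quotientP|exact: diagonal_annotation]. Qed.

Let labelled_full s : eigenvalue_annotation N s -> labelled (full_space R, s).
Proof. by move=> h; exists 3, N; split; first exact: full_quotient_self. Qed.

Let labelled_pair a b c : a != b -> a != c -> b != c -> sync_pair N a b ->
  labelled (pair_space R a b, [:: plain (@valency R k); plain (@pair_mu R k N a c)]).
Proof.
move=> ab ac bc sab; exists 2%N, (pair_quotient N a c); split; first exact: pair_quotientP.
exact: (pair_annotation ab ac bc sab (pair_not_valency R conn ab ac bc sab)).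
Qed.

Section OnePair.
Variables (a b c : 'I_3).
Hypotheses (ab : a != b) (ac : a != c) (bc : b != c) (sab : sync_pair N a b).
Hypotheses (nac : ~ sync_pair N a c) (nbc : ~ sync_pair N b c).

Let one_lattice s : eigenvalue_annotation N s ->
  annotated_synchrony_lattice N [:: (diagonal_space R, [:: plain (@valency R k)]);
    (pair_space R a b, [:: plain (@valency R k); plain (@pair_mu R k N a c)]); (full_space R, s)].
Proof.
move=> sN; split.
- rewrite /= !inE negb_or diagonal_neq_full (eq_sym (diagonal_space R)) pair_neq_diagonal//.
  by rewrite pair_neq_full.
- move=> D; rewrite !inE; split; last first.
    case/or3P => /eqP->; [exact: synchrony_diagonal|exact/(synchrony_pair R N ab)|exact: synchrony_full].
  case/synchrony_cases => [->|->|[i [j [ij sij ->]]]]; rewrite ?eqxx ?orbT//.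
  suff -> : pair_space R i j = pair_space R a b by rewrite eqxx orbT.
  have cov := cells_cover ab ac bc.
  case: (cov i) ij sij => ->; case: (cov j) => ->; rewrite ?eqxx// => _ sij.
  + by rewrite pair_sym.
  + by case: nac; exact: sync_pair_sym.
  + by case: nbc; exact: sync_pair_sym.
by move=> Ds [<-|[<-|[<-|//]]]; [exact: labelled_diagonal|exact: labelled_pair|exact: labelled_full].
Qed.

(** The transverse eigenvalue of the pair is identically the valency, identically the eigenvalue of
    the quotient, or generically different from both; this decides between (a), (c) and (f). *)
Lemma one_pair_type : (exists D1 mu, @type_a R k N D1 mu) \/ (exists D1 mu, @type_c R k N D1 mu) \/
  (exists D1 mu1 mu2, @type_f R k N D1 mu1 mu2).
Proof.
have ne := pair_not_valency R conn ab ac bc sab.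
have dif : different [:: @valency R k; @pair_mu R k N a c].
  by apply: (@different_real2 R k (fun e => pair_eigenvalue N a c e)) => //; exact: pf_pair.
have [ta|nta] := pselect (forall e, transverse_eigenvalue (R := R) N a b e = ups e).
  left; exists (pair_space R a b), (@pair_mu R k N a c); split=> //; apply: one_lattice.
  by apply: double_valency_annotation bc sab _ ne => //; exact: transverse_one.
have [tc|ntc] := pselect (forall e, transverse_eigenvalue (R := R) N a b e = pair_eigenvalue N a c e).
  right; left; exists (pair_space R a b), (@pair_mu R k N a c); split=> //; apply: one_lattice.
  apply: (chain_annotation ab ac bc sab tc _ ne).
  have [p [nid ncst]] := nontrivial_slot ac nac; exists 'e_p; rewrite !jacobian_delta.
  case: (transverse_chain ab ac bc sab tc p) => [/nid//|/ncst//|[-> _ ->]|[-> _ ->]].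
    by rewrite eqxx (negbTE ab) oner_eq0.
  by rewrite eqxx (negbTE ab) eq_sym oner_eq0.
right; right; exists (pair_space R a b), (@pair_mu R k N a c), (lin_mu (transverse R N a b)).
have pt : poly_fun (fun e => transverse_eigenvalue (R := R) N a b e).
  by apply: pf_sum => p; apply: pf_mul; [exact: pf_const|exact: pf_coord].
have d3 : different [:: @valency R k; @pair_mu R k N a c; lin_mu (transverse R N a b)].
  apply: (@different_real3 R k (fun e => pair_eigenvalue N a c e) (fun e => transverse_eigenvalue N a b e)) => //.
  - exact: pf_pair.
  - apply: contrapT => h; apply: nta => e; apply/eqP; apply: contraT => h'.
    by case: h; exists e; rewrite eq_sym.
  - apply: contrapT => h; apply: ntc => e; apply/eqP; apply: contraT => h'.
    by case: h; exists e; rewrite eq_sym.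
split=> //; apply: one_lattice; apply: full_annotation => //.
- by move=> e; rewrite -rmorphD (sync_reduced ab ac bc sab e).1.
- by move=> e; rewrite -rmorphM (sync_reduced ab ac bc sab e).2.
- exact: pair_mu_continuous.
- by apply: real_continuous_eigenfunction; apply: pf_continuous.
Qed.

End OnePair.

Lemma two_pair_type x y z : x != y -> x != z -> y != z -> sync_pair N x y -> sync_pair N x z ->
  ~ sync_pair N y z -> exists D1 D2 mu1 mu2, @type_e R k N D1 D2 mu1 mu2.
Proof.
move=> xy xz yz sxy sxz nyz; have zy : z != y by rewrite eq_sym.
exists (pair_space R x y), (pair_space R x z), (@pair_mu R k N x z), (@pair_mu R k N x y).
have d3 : different [:: @valency R k; @pair_mu R k N x z; @pair_mu R k N x y].
  apply: (@different_real3 R k (fun e => pair_eigenvalue N x z e) (fun e => pair_eigenvalue N x y e)).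
  - exact: pf_pair.
  - exact: pf_pair.
  - exact: (pair_not_valency R conn xy xz yz sxy).
  - exact: (pair_not_valency R conn xz xy zy sxz).
  - exact: (pair_eigenvalues_differ R xy xz yz sxy sxz nyz).
(* The right-hand side is the eigenvalue of the quotient by the other pair x, z, in which y is the
   single cell. *)
have tE e : transverse_eigenvalue N x y e = pair_eigenvalue N x y e.
  have [_ tr] := reduced_indep (jacobian_rows N e) xy xz yz.
  have := (sync_reduced xy xz yz sxy e).1; rewrite /red_trace -tr /reduced_trace /pair_eigenvalue.
  by rewrite [LHS]addrC => /addrI ->.
split=> //; split.
- have nz : pair_space R x y != pair_space R x z.
    apply/eqP => /(pair_space_inj xy xz) [[_ h]|[h _]]; first by rewrite h eqxx in yz.
    by rewrite h eqxx in xz.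
  have [d1 d2] := (pair_neq_diagonal R xy, pair_neq_diagonal R xz).
  have [f1 f2] := (pair_neq_full R xy, pair_neq_full R xz).
  move: nz d1 d2 f1 f2; move: (pair_space R x y) (pair_space R x z) => D1 D2 nz d1 d2 f1 f2.
  by rewrite /= !inE !negb_or diagonal_neq_full ![diagonal_space R == _]eq_sym d1 d2 nz f1 f2.
- move=> D; rewrite !inE; split; last first.
    case/or4P => /eqP->; [exact: synchrony_diagonal|exact/(synchrony_pair R N xy)|exact/(synchrony_pair R N xz)|exact: synchrony_full].
  case/synchrony_cases => [->|->|[i [j [ij sij ->]]]]; rewrite ?eqxx ?orbT//.
  have cov := cells_cover xy xz yz.
  case: (cov i) ij sij => ->; case: (cov j) => ->; rewrite ?eqxx ?orbT// => _ sij.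
  + by rewrite pair_sym eqxx orbT.
  + by rewrite [pair_space R z x]pair_sym eqxx !orbT.
  + by case: nyz; exact: sync_pair_sym.
move=> Ds [<-|[<-|[<-|[<-|//]]]]; [exact: labelled_diagonal|exact: labelled_pair|exact: labelled_pair|].
apply: labelled_full; apply: full_annotation => //.
- by move=> e; rewrite -rmorphD (sync_reduced xy xz yz sxy e).1 tE.
- by move=> e; rewrite -rmorphM (sync_reduced xy xz yz sxy e).2 tE.
- exact: pair_mu_continuous.
- exact: pair_mu_continuous.
Qed.

Lemma three_pair_type : (forall a b, a != b -> sync_pair N a b) ->
  exists D1 D2 D3 mu, @type_b R k N D1 D2 D3 mu.
Proof.
move=> sync; have triv := all_sync_trivial sync.
exists (pair_space R 0 1), (pair_space R 0 2), (pair_space R 1 2), (lin_mu (fixs R N)).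
have pE (i j : 'I_3) : i != j -> @pair_mu R k N i j = lin_mu (fixs R N).
  by move=> ij; rewrite pair_muE homogeneous_pair_slot.
have ne : exists e : 'rV[R]_k.+1, ups e != lin (fixs R N) e.
  have [e he] := pair_not_valency R conn (isT : 0 != 1 :> 'I_3) (isT : 0 != 2 :> 'I_3) (isT : 1 != 2 :> 'I_3) (sync 0 1 isT).
  by exists e; move: he; rewrite pair_lin homogeneous_pair_slot.
have lp (i j l : 'I_3) : i != j -> i != l -> j != l ->
    labelled (pair_space R i j, [:: plain (@valency R k); plain (lin_mu (fixs R N))]).
  by move=> ij il jl; rewrite -(pE i l il); apply: labelled_pair => //; exact: sync.
split.
  apply: (@different_real2 R k (lin (fixs R N))) => //.
  by apply: pf_sum => p; apply: pf_mul; [exact: pf_const|exact: pf_coord].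
split.
- have nz (i j i' j' : 'I_3) : i != j -> i' != j' -> (i, j) != (i', j') -> (i, j) != (j', i') ->
      pair_space R i j != pair_space R i' j'.
    move=> ij ij' h1 h2; apply/eqP => /(pair_space_inj ij ij') [[h h']|[h h']].
      by rewrite h h' eqxx in h1.
    by rewrite h h' eqxx in h2.
  have U (p q r : {vspace 'cV[R]_3}) : [/\ p != diagonal_space R, q != diagonal_space R & r != diagonal_space R] ->
      [/\ p != full_space R, q != full_space R & r != full_space R] -> [/\ p != q, p != r & q != r] ->
      uniq [:: diagonal_space R; p; q; r; full_space R].
    move=> [d1 d2 d3] [f1 f2 f3] [e1 e2 e3]; rewrite /= !inE !negb_or diagonal_neq_full.
    by rewrite ![diagonal_space R == _]eq_sym d1 d2 d3 f1 f2 f3 e1 e2 e3.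
  apply: U; split; first [exact: pair_neq_diagonal|exact: pair_neq_full|exact: nz].
- move=> D; rewrite !inE; split; last first.
    case/or4P => [/eqP->|/eqP->|/eqP->|/orP[]/eqP->];
      [exact: synchrony_diagonal|by apply/(@synchrony_pair R k N 0 1 isT); exact: sync
      |by apply/(@synchrony_pair R k N 0 2 isT); exact: sync
      |by apply/(@synchrony_pair R k N 1 2 isT); exact: sync|exact: synchrony_full].
  case/synchrony_cases => [->|->|[i [j [ij sij ->]]]]; rewrite ?eqxx ?orbT//.
  pose Q D := [|| D == diagonal_space R, D == pair_space R 0 1, D == pair_space R 0 2,
    D == pair_space R 1 2 | D == full_space R].
  by apply: (@pair_cases R Q 0 1 2 isT isT isT) => //; rewrite /Q eqxx !orbT.
move=> Ds [<-|[<-|[<-|[<-|[<-|//]]]]].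
- exact: labelled_diagonal.
- exact: (@lp 0 1 2).
- exact: (@lp 0 2 1).
- exact: (@lp 1 2 0).
by apply: labelled_full; exact: homogeneous_annotation.
Qed.

Lemma no_pair_type : (forall a b, a != b -> ~ sync_pair N a b) ->
  exists mu1 mu2, @type_g R k N mu1 mu2.
Proof.
move=> nosync.
pose dsc (e : 'rV[R]_k.+1) : R := red_trace N e ^+ 2 - 4 * red_det N e.
(* [Num.sqrt] is 0 on negative numbers, so one of [s] and [s'] always vanishes. The same formulas
   then cover real and conjugate roots and stay continuous where the discriminant changes sign. *)
pose s (e : 'rV[R]_k.+1) : R := Num.sqrt (dsc e); pose s' (e : 'rV[R]_k.+1) : R := Num.sqrt (- dsc e).
pose mu1 : eigenfunction R k := fun e => ((red_trace N e + s e) / 2 +i* (s' e / 2))%C.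
pose mu2 : eigenfunction R k := fun e => ((red_trace N e - s e) / 2 +i* (- s' e / 2))%C.
have sumE e : mu1 e + mu2 e = (red_trace N e)%:C%C.
  by rewrite /mu1 /mu2; apply/eqP; rewrite eq_complex /=; apply/andP; split; apply/eqP; field.
have ss0 e : s e * s' e = 0.
  rewrite /s /s'; have [h|h] := leP 0 (dsc e).
    by rewrite (@ler0_sqrtr _ (- dsc e)) ?mulr0// oppr_le0.
  by rewrite (ler0_sqrtr (ltW h)) mul0r.
have ss e : s e ^+ 2 - s' e ^+ 2 = dsc e.
  rewrite /s /s'; have [h|h] := leP 0 (dsc e).
    by rewrite (@ler0_sqrtr _ (- dsc e)) ?oppr_le0// sqr_sqrtr//; ring.
  by rewrite (ler0_sqrtr (ltW h)) sqr_sqrtr ?oppr_ge0 ?(ltW h)//; ring.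
have prodE e : mu1 e * mu2 e = (red_det N e)%:C%C.
  have h1 := ss0 e; have := ss e; rewrite /dsc => h2.
  rewrite /mu1 /mu2; apply/eqP; rewrite eq_complex /=; apply/andP; split; apply/eqP.
    have -> : red_det N e = (red_trace N e ^+ 2 - (s e ^+ 2 - s' e ^+ 2)) / 4 by rewrite h2; field.
    by field.
  by rewrite -(mulr0 (- 2^-1)) -h1; field.
have cr : continuous (@red_trace R k N) by apply: pf_continuous; exact: pf_trace.
have cdsc : continuous dsc.
  apply: pf_continuous; apply: pf_sub; first by apply: pf_mul; exact: pf_trace.
  by apply: pf_mul; [exact: pf_const|exact: pf_det].
have cN (phi : 'rV[R]_k.+1 -> R) : continuous phi -> continuous (fun e => - phi e).
  by move=> h e; apply: (@cvgN _ _ _ (nbhs e)); exact: h.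
have cs : continuous s by move=> e; apply: (continuous_comp (cdsc e)); exact: sqrt_continuous.
have cs' : continuous s'.
  move=> e; apply: (@continuous_comp _ _ _ (fun e => - dsc e) Num.sqrt); last exact: sqrt_continuous.
  exact: (cN _ cdsc e).
have half (phi : 'rV[R]_k.+1 -> R) : continuous phi -> continuous (fun e => phi e / 2).
  by move=> h; apply: continuous_mul => //; exact: (@cst_continuous _ _ (2^-1 : R)).
have c1 : continuous_eigenfunction mu1 by split; apply: half => //; exact: continuous_add.
have c2 : continuous_eigenfunction mu2.
  split; apply: half; first exact: continuous_sub.
  exact: cN.
have dif : different [:: @valency R k; mu1; mu2].
  have pchi : poly_fun (fun e : 'rV[R]_k.+1 => ups e ^+ 2 - ups e * red_trace N e + red_det N e).
    have pu := pf_ups R k; have pt := @pf_trace R k N; have pd := @pf_det R k N.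
    exact: pf_add (pf_sub (pf_mul pu pu) (pf_mul pu pt)) pd.
  have g1 := pf_generic pchi (chi_neq0 R conn nosync).
  have pd : poly_fun dsc.
    apply: pf_sub; first by apply: pf_mul; exact: pf_trace.
    by apply: pf_mul; [exact: pf_const|exact: pf_det].
  have g2 := pf_generic pd (discriminant_neq0 R nosync).
  apply: generic_imp (generic_and g1 g2) => e [h1 h2] /=; rewrite !inE negb_or andbT.
  have chiE : ((ups e ^+ 2 - ups e * red_trace N e + red_det N e)%:C)%C =
      (valency e - mu1 e) * (valency e - mu2 e).
    by rewrite expr2 rmorphD rmorphB !rmorphM /= -sumE -prodE -[(ups e)%:C%C]/(valency e); ring.
  have dscE : ((dsc e)%:C)%C = (mu1 e - mu2 e) ^+ 2.
    by rewrite /dsc expr2 rmorphB !rmorphM rmorph_nat /= -sumE -prodE; ring.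
  have real0 (x : R) : x != 0 -> (x%:C)%C != 0.
    by apply: contra => /eqP/(@real_inj R x 0) ->.
  move: (real0 _ h1) (real0 _ h2); rewrite chiE dscE mulf_eq0 expf_eq0 /= !subr_eq0.
  by rewrite negb_or => /andP[-> ->] ->.
exists mu1, mu2; split=> //; split.
- by rewrite /= !inE diagonal_neq_full.
- move=> D; rewrite !inE; split; last first.
    by case/orP => /eqP->; [exact: synchrony_diagonal|exact: synchrony_full].
  by case/synchrony_cases => [->|->|[i [j [ij /(nosync _ _ ij)]]]]; rewrite ?eqxx ?orbT.
move=> Ds [<-|[<-|//]]; first exact: labelled_diagonal.
by apply: labelled_full; exact: full_annotation.
Qed.

Lemma lattice_type : ((exists D1 mu, @type_a R k N D1 mu) \/
   (exists D1 D2 D3 mu, @type_b R k N D1 D2 D3 mu) \/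
   (exists D1 mu, @type_c R k N D1 mu) \/
   (exists mu, @type_d R k N mu) \/
   (exists D1 D2 mu1 mu2, @type_e R k N D1 D2 mu1 mu2) \/
   (exists D1 mu1 mu2, @type_f R k N D1 mu1 mu2) \/
   (exists mu1 mu2, @type_g R k N mu1 mu2)).
Proof.
have [all|/existsNP[y /existsNP[z /not_implyP[yz nyz]]]] := pselect (forall a b, a != b -> sync_pair N a b).
  by right; left; exact: three_pair_type.
have [x yx zx] := third_cell yz.
have xy : x != y by rewrite eq_sym.
have xz : x != z by rewrite eq_sym.
have zy : z != y by rewrite eq_sym.
have nzy : ~ sync_pair N z y by move/sync_pair_sym.
have [sxy|nxy] := pselect (sync_pair N x y); have [sxz|nxz] := pselect (sync_pair N x z).
- by right; right; right; right; left; exact: (two_pair_type xy xz yz).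
- by have := one_pair_type xy xz yz sxy nxz nyz; tauto.
- by have := one_pair_type xz xy zy sxz nxy nzy; tauto.
do 6!right; apply: no_pair_type => a b ab; have cov := cells_cover xy xz yz.
by case: (cov a) ab => ->; case: (cov b) => ->; rewrite ?eqxx// => _ // /sync_pair_sym.
Qed.

End LatticeTypes.

Theorem theorem4p6 (R : realType) (k : nat) (N : network k 3)
    (hN : connected_network N) :
  (* the lattice is of one of the seven types *)
  ((exists D1 mu, @type_a R k N D1 mu) \/
   (exists D1 D2 D3 mu, @type_b R k N D1 D2 D3 mu) \/
   (exists D1 mu, @type_c R k N D1 mu) \/
   (exists mu, @type_d R k N mu) \/
   (exists D1 D2 mu1 mu2, @type_e R k N D1 D2 mu1 mu2) \/
   (exists D1 mu1 mu2, @type_f R k N D1 mu1 mu2) \/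
   (exists mu1 mu2, @type_g R k N mu1 mu2)) /\
  (* (a) *)
  (forall D1 mu, @type_a R k N D1 mu ->
     generic_synchronies N (@valency R k) [:: diagonal_space R; full_space R] /\
     generic_synchronies N mu [:: D1]) /\
  (* (b) *)
  (forall D1 D2 D3 mu, @type_b R k N D1 D2 D3 mu ->
     generic_synchronies N (@valency R k) [:: diagonal_space R] /\
     generic_synchronies_if N (assumptions_A N 2) mu [:: D1; D2; D3]) /\
  (* (c) *)
  (forall D1 mu, @type_c R k N D1 mu ->
     generic_synchronies N (@valency R k) [:: diagonal_space R] /\
     generic_synchronies_if N (condition_B N D1) mu [:: D1; full_space R]) /\
  (* (d) *)
  (forall mu, @type_d R k N mu ->
     generic_synchronies N (@valency R k) [:: diagonal_space R] /\
     generic_synchronies N mu [:: full_space R]) /\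
  (* (e) *)
  (forall D1 D2 mu1 mu2, @type_e R k N D1 D2 mu1 mu2 ->
     [/\ generic_synchronies N (@valency R k) [:: diagonal_space R],
         generic_synchronies N mu1 [:: D1]
       & generic_synchronies N mu2 [:: D2]]) /\
  (* (f) *)
  (forall D1 mu1 mu2, @type_f R k N D1 mu1 mu2 ->
     [/\ generic_synchronies N (@valency R k) [:: diagonal_space R],
         generic_synchronies N mu1 [:: D1]
       & generic_synchronies N mu2 [:: full_space R]]) /\
  (* (g) *)
  (forall mu1 mu2, @type_g R k N mu1 mu2 ->
     [/\ generic_synchronies N (@valency R k) [:: diagonal_space R],
         only_valency_bifurcates N mu1 mu2,
         generic_synchronies N mu1 [:: full_space R]
       & generic_synchronies N mu2 [:: full_space R]]).
Proof.
split; first exact: lattice_type.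
split; first exact: type_a_dynamics.
split; first by move=> D1 D2 D3 mu; exact: type_b_dynamics.
split; first by move=> D1 mu; exact: type_c_dynamics.
split; first by move=> mu /type_d_impossible.
split; first exact: type_e_dynamics.
split; first exact: type_f_dynamics.
exact: type_g_dynamics.
Qed.
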